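(* Let $K\neq0$ and let $(\mathcal M,\rho)$ be a semimetric space such that $\operatorname{diam}(\mathcal M)\le\pi/(2\sqrt K)$ when $K>0$. Then $(\mathcal M,\rho)$ is a complete $\Re_K$ domain (with $\operatorname{diam}(\mathcal M)\le\pi/(2\sqrt K)$ when $K>0$) if and only if: (a) $(\mathcal M,\rho)$ is weakly convex; (b) each Cauchy sequence in $(\mathcal M,\rho)$ has a limit; (c) $(\mathcal M,\rho)$ satisfies the one-sided four point $\operatorname{cosq}_K$ condition.
   Context: A semimetric space is a set with a distance $\rho$ that is symmetric, nonnegative and satisfies $\rho(P,Q)=0$ iff $P=Q$ (no triangle inequality assumed); Cauchy sequences, limits and diameter are defined as for metric spaces. It is weakly convex if for all $A,B\in\mathcal M$ there is $\lambda\in(0,1)$ such that for every $\varepsilon>0$ there is $C_\varepsilon\in\mathcal M$ with $|\rho(A,C_\varepsilon)-\lambda\rho(A,B)|<\varepsilon$ and $|\rho(B,C_\varepsilon)-(1-\lambda)\rho(A,B)|<\varepsilon$. Let $\kappa=\sqrt{|K|}$. For $A\neq P$, $B\neq Q$ in $\mathcal M$ (with $\rho(A,P),\rho(B,Q),\rho(A,B)<\pi/\sqrt K$ if $K>0$), put $x=\rho(A,P)$, $y=\rho(B,Q)$, $a=\rho(A,B)$, $b=\rho(P,Q)$, $d=\rho(P,B)$, $f=\rho(A,Q)$; for $K>0$ $$\operatorname{cosq}_K(\overrightarrow{AP},\overrightarrow{BQ})=\frac{\cos\kappa b+\cos\kappa x\cos\kappa y}{\sin\kappa x\sin\kappa y}-\frac{(\cos\kappa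 x+\cos\kappa d)(\cos\kappa y+\cos\kappa f)}{(1+\cos\kappa a)\sin\kappa x\sin\kappa y},$$ and for $K<0$ $$\operatorname{cosq}_K(\overrightarrow{AP},\overrightarrow{BQ})=\frac{(\cosh\kappa x+\cosh\kappa d)(\cosh\kappa y+\cosh\kappa f)}{(1+\cosh\kappa a)\sinh\kappa x\sinh\kappa y}-\frac{\cosh\kappa b+\cosh\kappa x\cosh\kappa y}{\sinh\kappa x\sinh\kappa y}.$$ Upper/lower four point $\operatorname{cosq}_K$ condition: $\operatorname{cosq}_K\le1$ / $\ge-1$ for all such quadruples; one-sided: at least one holds. $\Re_K$ domain: a metric space in which any two points are joined by a shortest (curve of length equal to their distance), in which (if $K>0$) every geodesic triangle (three distinct points with three pairwise joining shortests) has perimeter $<2\pi/\sqrt K$, and in which every geodesic triangle $ABC$ satisfies: the sum of the upper angles between its sides at the three vertices is at most $\angle_KBAC+\angle_KABC+\angle_KACB$. Here $\angle_K BAC$ is the angle at the vertex corresponding to $A$ of a triangle with the same side lengths in the model plane $\mathbb S_K$ (open hemisphere of radius $1/\sqrt K$ if $K>0$, hyperbolic plane of curvature $K$ if $K<0$, Euclidean plane if $K=0$), and the upper angle between shortests $\mathcal L,\mathcal N$ from $O$ is $\limsup\angle_0XOY$ as $X\to O$ in $\mathcal L\setminus\{O\}$, $Y\to O$ in $\mathcal N\setminus\{O\}$. A complete $\Re_K$ domain is one that is complete as a metric space. *)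

(* Defs.v *)
From Stdlib Require Import Reals Ratan Lra.
Open Scope R_scope.

Section Defs.
Context {M : Type} (rho : M -> M -> R).

Definition semimetric : Prop :=
  (forall P Q, rho P Q = rho Q P) /\
  (forall P Q, 0 <= rho P Q) /\
  (forall P Q, rho P Q = 0 <-> P = Q).

Definition triangle_ineq : Prop :=
  forall P Q S, rho P S <= rho P Q + rho Q S.

Definition diam_le (D : R) : Prop := forall P Q, rho P Q <= D.

Definition is_cauchy (x : nat -> M) : Prop :=
  forall eps, 0 < eps -> exists N, forall m n, (N <= m)%nat -> (N <= n)%nat ->
    rho (x m) (x n) < eps.

Definition is_limit (x : nat -> M) (L : M) : Prop :=
  forall eps, 0 < eps -> exists N, forall n, (N <= n)%nat -> rho (x n) L < eps.

Definition cauchy_complete : Prop :=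
  forall x, is_cauchy x -> exists L, is_limit x L.

Definition weakly_convex : Prop :=
  forall A B, exists lam, 0 < lam < 1 /\
    forall eps, 0 < eps -> exists C,
      Rabs (rho A C - lam * rho A B) < eps /\
      Rabs (rho B C - (1 - lam) * rho A B) < eps.

Definition kap (K : R) : R := sqrt (Rabs K).

Definition cosq (K : R) (A P B Q : M) : R :=
  let k := kap K in
  let x := rho A P in let y := rho B Q in let a := rho A B in
  let b := rho P Q in let d := rho P B in let f := rho A Q in
  if Rlt_dec 0 K then
    (cos (k*b) + cos (k*x) * cos (k*y)) / (sin (k*x) * sin (k*y))
    - (cos (k*x) + cos (k*d)) * (cos (k*y) + cos (k*f))
        / ((1 + cos (k*a)) * sin (k*x) * sin (k*y))
  else
    (cosh (k*x) + cosh (k*d)) * (cosh (k*y) + cosh (k*f))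
        / ((1 + cosh (k*a)) * sinh (k*x) * sinh (k*y))
    - (cosh (k*b) + cosh (k*x) * cosh (k*y)) / (sinh (k*x) * sinh (k*y)).

Definition cosq_admissible (K : R) (A P B Q : M) : Prop :=
  A <> P /\ B <> Q /\
  (0 < K -> rho A P < PI / sqrt K /\ rho B Q < PI / sqrt K /\ rho A B < PI / sqrt K).

Definition upper_cosq_cond (K : R) : Prop :=
  forall A P B Q, cosq_admissible K A P B Q -> cosq K A P B Q <= 1.

Definition lower_cosq_cond (K : R) : Prop :=
  forall A P B Q, cosq_admissible K A P B Q -> -1 <= cosq K A P B Q.

Definition one_sided_cosq_cond (K : R) : Prop :=
  upper_cosq_cond K \/ lower_cosq_cond K.

Definition in01 (t : R) : Prop := 0 <= t <= 1.

Definition curve (g : R -> M) : Prop :=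
  forall t, in01 t -> forall eps, 0 < eps -> exists del, 0 < del /\
    forall s, in01 s -> Rabs (s - t) < del -> rho (g s) (g t) < eps.

Fixpoint poly_sum (g : R -> M) (t : nat -> R) (n : nat) : R :=
  match n with
  | O => 0
  | S m => poly_sum g t m + rho (g (t m)) (g (t (S m)))
  end.

Definition partition_sums (g : R -> M) (s : R) : Prop :=
  exists (n : nat) (t : nat -> R), t O = 0 /\ t n = 1 /\
    (forall i, (i < n)%nat -> t i <= t (S i)) /\ s = poly_sum g t n.

Definition curve_length (g : R -> M) (L : R) : Prop := is_lub (partition_sums g) L.

Definition shortest (g : R -> M) (A B : M) : Prop :=
  curve g /\ g 0 = A /\ g 1 = B /\ curve_length g (rho A B).

Definition image (g : R -> M) (X : M) : Prop := exists t, in01 t /\ X = g t.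

(** angle at the vertex with adjacent sides b, c and opposite side a,
    in the model plane S_K *)
Definition model_angle (K a b c : R) : R :=
  let k := kap K in
  if Rlt_dec 0 K then
    acos ((cos (k*a) - cos (k*b) * cos (k*c)) / (sin (k*b) * sin (k*c)))
  else if Rlt_dec K 0 then
    acos ((cosh (k*b) * cosh (k*c) - cosh (k*a)) / (sinh (k*b) * sinh (k*c)))
  else
    acos ((b*b + c*c - a*a) / (2 * b * c)).

Definition comp_angle (K : R) (B A C : M) : R :=
  model_angle K (rho B C) (rho A B) (rho A C).

Definition is_glb (E : R -> Prop) (m : R) : Prop :=
  (forall x, E x -> m <= x) /\ (forall b, (forall x, E x -> b <= x) -> b <= m).

Definition near_angles (O : M) (S1 S2 : M -> Prop) (del : R) (v : R) : Prop :=
  exists X Y, S1 X /\ S2 Y /\ X <> O /\ Y <> O /\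
    rho O X < del /\ rho O Y < del /\ v = comp_angle 0 X O Y.

(** theta = limsup of angle_0 X O Y as X -> O in S1\{O}, Y -> O in S2\{O},
    i.e. theta = inf_{del>0} sup { angle_0 XOY : X, Y within del of O } *)
Definition upper_angle (O : M) (S1 S2 : M -> Prop) (theta : R) : Prop :=
  is_glb (fun s => exists del, 0 < del /\ is_lub (near_angles O S1 S2 del) s) theta.

Definition geodesic_triangle (A B C : M) (gAB gBC gCA : R -> M) : Prop :=
  A <> B /\ B <> C /\ C <> A /\
  shortest gAB A B /\ shortest gBC B C /\ shortest gCA C A.

Definition RK_domain (K : R) : Prop :=
  triangle_ineq /\
  (forall A B, exists g, shortest g A B) /\
  (0 < K -> forall A B C gAB gBC gCA, geodesic_triangle A B C gAB gBC gCA ->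
     rho A B + rho B C + rho C A < 2 * PI / sqrt K) /\
  (forall A B C gAB gBC gCA, geodesic_triangle A B C gAB gBC gCA ->
     forall thA thB thC,
       upper_angle A (image gAB) (image gCA) thA ->
       upper_angle B (image gAB) (image gBC) thB ->
       upper_angle C (image gBC) (image gCA) thC ->
       thA + thB + thC <= comp_angle K B A C + comp_angle K A B C + comp_angle K A C B).

Definition complete_RK_domain (K : R) : Prop := RK_domain K /\ cauchy_complete.

End Defs.

(* Main.v *)
(** Rescaling the metric reduces everything to curvature [K = 1] or [K = -1]. Both directions pass
    through the inequality of CAT(K) comparison: along a geodesic [e] of length [l] from [A] to [B],
    the function [h x = cs (d P (e x))] dominates (is dominated by, if [K < 0]) the solution of
    [h'' + K h = 0] with the same boundary values.

    From the cosq condition to this inequality. Weak convexity and completeness give geodesics. For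
    two geodesics issuing from a point, apply the four-point condition to the corners of a small
    rectangle of parameters: for one well chosen ratio of the sides, the second order terms bound
    the mixed difference of the cosine [psi (s, t)] of the model angle. Subdividing an arbitrary
    rectangle into such small ones makes the mixed difference nonpositive (up to a harmless error if
    [K < 0]). Hence the model angles at a point of a geodesic add up to at least [pi] up to second
    order, which says that [h] is a subsolution, and a maximum principle applies. The comparison
    inequality makes [psi] antitone, so upper angles are at most the model angles.

    From an [Re_K] domain to the inequality. If an upper angle exceeded the model angle at [O] of a
    hinge [O X Y], the bound on the angle sum would leave the angle at [X] or at [Y] smaller than
    its model angle by a fixed amount. By the first variation, moving that vertex towards [O] then
    decreases the model angle at [O] at a definite logarithmic rate, and this descent cannot end.
    So upper angles are at most the model angles; adjacent ones add up to at least [pi], and the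
    inequality follows. It implies the lower cosq condition by estimating [d P Q] through the best
    point [N] of the geodesic [A B]. *)

Require Import Defs.
From Stdlib Require Import Reals Ratan.
From Stdlib Require Import Arith ZArith Lra Lia Psatz ClassicalEpsilon.
Open Scope R_scope.

(** * Sequences and trigonometry *)

(** The distance is only Lipschitz along geodesics, so mixed differences over rectangles stand in
    for a second derivative of [psi], and limit slopes come from compactness. Both four-point
    conditions lead to the same limit inequality [2 * L + sg b * (X - cs s0)^2 <= 0], where
    [X - cs s0] measures how far [psi] is from being stationary in [t]. For [K > 0] the square has
    the favourable sign. For [K < 0] it does not, and a bootstrap is required: a crude Lipschitz
    bound on the slope gives a bounded density of the mixed difference, hence a variation of [psi]
    in [t] at rate [O(u)]; inserted again, this makes the square so small near the origin that [psi]
    is nonincreasing up to [O(u^2)], which the maximum principle tolerates. *)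

Lemma Rabs_le_inv (x a : R) : Rabs x <= a -> - a <= x <= a.
Proof. unfold Rabs; destruct (Rcase_abs x); lra. Qed.

Lemma Rabs_lb (x : R) : - x <= Rabs x.
Proof. unfold Rabs; destruct (Rcase_abs x); lra. Qed.

Lemma cv_const (c : R) : Un_cv (fun _ => c) c.
Proof. intros e He; exists O; intros; unfold Rdist; rewrite Rminus_diag, Rabs_R0; lra. Qed.

Lemma cv_eq (u : nat -> R) (l l' : R) : Un_cv u l -> l = l' -> Un_cv u l'.
Proof. now intros H <-. Qed.

Lemma cv_ext (u v : nat -> R) (l : R) : (forall n, u n = v n) -> Un_cv u l -> Un_cv v l.
Proof.
  intros E H e He; destruct (H e He) as [N HN]; exists N; intros n Hn.
  rewrite <- E; auto.
Qed.

Lemma cv_opp (u : nat -> R) (l : R) : Un_cv u l -> Un_cv (fun n => - u n) (- l).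
Proof. apply CV_opp. Qed.

Lemma cv_cont (f : R -> R) (u : nat -> R) (l : R) :
  continuity f -> Un_cv u l -> Un_cv (fun n => f (u n)) (f l).
Proof. intros Hf H; exact (continuity_seq f u l (Hf l) H). Qed.

Lemma cv_inv (u : nat -> R) (l : R) : Un_cv u l -> l <> 0 -> Un_cv (fun n => / u n) (/ l).
Proof.
  intros H Hl; apply (continuity_seq (fun x => / x)); auto.
  apply (continuity_pt_inv (fun x => x) l); auto.
  apply derivable_continuous_pt, derivable_pt_id.
Qed.

Lemma cv_div (u v : nat -> R) (l m : R) :
  Un_cv u l -> Un_cv v m -> m <> 0 -> Un_cv (fun n => u n / v n) (l / m).
Proof. intros; apply CV_mult; auto; apply cv_inv; auto. Qed.

Lemma cv_pow (u : nat -> R) (l : R) (k : nat) : Un_cv u l -> Un_cv (fun n => u n ^ k) (l ^ k).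
Proof. intros H; induction k; simpl; [apply cv_const | apply CV_mult; auto]. Qed.

Lemma cv_squeeze (u v : nat -> R) (l : R) :
  (forall n, Rabs (u n - l) <= v n) -> Un_cv v 0 -> Un_cv u l.
Proof.
  intros H Hv e He; destruct (Hv e He) as [N HN]; exists N; intros n Hn.
  specialize (HN n Hn); specialize (H n); unfold Rdist in *.
  rewrite Rminus_0_r in HN; pose proof (Rle_abs (v n)); lra.
Qed.

Lemma cv_le_ev (u v : nat -> R) (l m : R) (N : nat) :
  (forall n, (N <= n)%nat -> u n <= v n) -> Un_cv u l -> Un_cv v m -> l <= m.
Proof.
  intros H Hu Hv; apply Rnot_lt_le; intros Hlt.
  destruct (Hu ((l - m) / 2)) as [N1 H1]; [lra|].
  destruct (Hv ((l - m) / 2)) as [N2 H2]; [lra|].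
  set (n := (N + N1 + N2)%nat).
  specialize (H1 n ltac:(unfold n; lia)); specialize (H2 n ltac:(unfold n; lia)).
  specialize (H n ltac:(unfold n; lia)).
  unfold Rdist in *; apply Rabs_def2 in H1; apply Rabs_def2 in H2; lra.
Qed.

Lemma cv_le (u v : nat -> R) (l m : R) :
  (forall n, u n <= v n) -> Un_cv u l -> Un_cv v m -> l <= m.
Proof. intros H; apply (cv_le_ev u v l m 0); auto. Qed.

Lemma cv_abs_le (u v : nat -> R) (l m : R) :
  (forall n, Rabs (u n) <= v n) -> Un_cv u l -> Un_cv v m -> Rabs l <= m.
Proof.
  intros H Hu Hv; apply Rabs_le; split.
  - apply (cv_le (fun n => - v n) u); auto using cv_opp.
    intros n; specialize (H n); pose proof (Rabs_lb (u n)); lra.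
  - apply (cv_le u v); auto; intros n; specialize (H n); pose proof (Rle_abs (u n)); lra.
Qed.

Lemma cv_ev_gt (u : nat -> R) (l c : R) :
  Un_cv u l -> c < l -> exists N, forall n, (N <= n)%nat -> c < u n.
Proof.
  intros H Hc; destruct (H (l - c)) as [N HN]; [lra|]; exists N; intros n Hn.
  specialize (HN n Hn); unfold Rdist in HN; apply Rabs_def2 in HN; lra.
Qed.

Lemma cv_ev_lt (u : nat -> R) (l c : R) :
  Un_cv u l -> l < c -> exists N, forall n, (N <= n)%nat -> u n < c.
Proof.
  intros H Hc; destruct (H (c - l)) as [N HN]; [lra|]; exists N; intros n Hn.
  specialize (HN n Hn); unfold Rdist in HN; apply Rabs_def2 in HN; lra.
Qed.

(** Subsequences are encoded by [n <= phi n] instead of monotonicity: this suffices for convergence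
    and is stable under composition. *)
Lemma cv_sub (u : nat -> R) (l : R) (phi : nat -> nat) :
  (forall n, (n <= phi n)%nat) -> Un_cv u l -> Un_cv (fun n => u (phi n)) l.
Proof.
  intros Hp H e He; destruct (H e He) as [N HN]; exists N; intros n Hn.
  apply HN; specialize (Hp n); lia.
Qed.

Lemma cv_inv_nat : Un_cv (fun n => / INR (S n)) 0.
Proof.
  intros e He; destruct (archimed_cor1 e He) as [N [HN HN0]]; exists N; intros n Hn.
  unfold Rdist; rewrite Rminus_0_r, Rabs_right.
  - apply Rle_lt_trans with (/ INR N); auto.
    apply Rinv_le_contravar; [apply lt_0_INR; lia | apply le_INR; lia].
  - apply Rle_ge, Rlt_le, Rinv_0_lt_compat, lt_0_INR; lia.
Qed.

Lemma inv_nat_pos (n : nat) : 0 < / INR (S n).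
Proof. apply Rinv_0_lt_compat, lt_0_INR; lia. Qed.

(* The limit is the supremum of the levels exceeded by infinitely many terms. *)
Lemma bolzano_weierstrass (u : nat -> R) (B : R) :
  (forall n, Rabs (u n) <= B) ->
  exists phi l, (forall n, (n <= phi n)%nat) /\ Un_cv (fun n => u (phi n)) l.
Proof.
  intros HB.
  set (E := fun x => forall N, exists n, (N <= n)%nat /\ x <= u n).
  assert (HE : exists l, is_lub E l).
  { destruct (completeness E) as [l Hl].
    - exists B; intros x Hx; destruct (Hx O) as [n [_ Hn]].
      specialize (HB n); pose proof (Rle_abs (u n)); lra.
    - exists (- B); intros N; exists N; split; [lia|].
      specialize (HB N); pose proof (Rabs_lb (u N)); lra.
    - now exists l. }
  destruct HE as [l [Hub Hleast]].
  assert (Hex : forall N, exists n, (N <= n)%nat /\ Rabs (u n - l) <= / INR (S N)).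
  { intros N; pose proof (inv_nat_pos N) as Hp; set (e := / INR (S N)) in *.
    assert (H1 : ~ E (l + e)) by (intros H; specialize (Hub _ H); lra).
    assert (H2 : exists x, E x /\ l - e < x).
    { apply NNPP; intros H; assert (l <= l - e); [|lra].
      apply Hleast; intros x Hx; apply Rnot_lt_le; intros Hlt; apply H; now exists x. }
    apply not_all_ex_not in H1; destruct H1 as [N1 H1].
    destruct H2 as [x [Hx Hxl]]; destruct (Hx (N + N1)%nat) as [n [Hn Hn2]].
    exists n; split; [lia|].
    assert (u n < l + e).
    { apply Rnot_le_lt; intros Hle; apply H1; exists n; split; [lia|auto]. }
    apply Rabs_le; lra. }
  destruct (choice _ Hex) as [phi Hphi]; exists phi, l; split; [apply Hphi|].
  apply cv_squeeze with (fun n => / INR (S n)); [apply Hphi | apply cv_inv_nat].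
Qed.

(* The curvature, normalised to 1 ([b = true]) or -1, with the matching cosine and sine. *)
Definition sg (b : bool) : R := if b then 1 else -1.
Definition cs (b : bool) (x : R) : R := if b then cos x else cosh x.
Definition sn (b : bool) (x : R) : R := if b then sin x else sinh x.

Section Trig.
Variable b : bool.
Notation σ := (sg b).
Notation c := (cs b).
Notation s := (sn b).

Lemma sg_sq : σ * σ = 1.
Proof. destruct b; simpl; lra. Qed.

Lemma sg_cases : σ = 1 \/ σ = -1.
Proof. destruct b; simpl; auto. Qed.

Lemma cs_add (x y : R) : c (x + y) = c x * c y - σ * (s x * s y).
Proof.
  destruct b; simpl; [rewrite cos_plus; ring|].
  unfold cosh, sinh; rewrite Ropp_plus_distr, !exp_plus; field.
Qed.

Lemma sn_add (x y : R) : s (x + y) = s x * c y + c x * s y.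
Proof.
  destruct b; simpl; [rewrite sin_plus; ring|].
  unfold cosh, sinh; rewrite Ropp_plus_distr, !exp_plus; field.
Qed.

Lemma cs_neg (x : R) : c (- x) = c x.
Proof.
  destruct b; simpl; [apply cos_neg|].
  unfold cosh; rewrite Ropp_involutive; field.
Qed.

Lemma sn_neg (x : R) : s (- x) = - s x.
Proof.
  destruct b; simpl; [apply sin_neg|].
  unfold sinh; rewrite Ropp_involutive; field.
Qed.

Lemma cs_sub (x y : R) : c (x - y) = c x * c y + σ * (s x * s y).
Proof. unfold Rminus; rewrite cs_add, cs_neg, sn_neg; ring. Qed.

Lemma sn_sub (x y : R) : s (x - y) = s x * c y - c x * s y.
Proof. unfold Rminus; rewrite sn_add, cs_neg, sn_neg; ring. Qed.

Lemma cs_0 : c 0 = 1.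
Proof. destruct b; simpl; [apply cos_0 | apply cosh_0]. Qed.

Lemma sn_0 : s 0 = 0.
Proof. destruct b; simpl; [apply sin_0 | apply sinh_0]. Qed.

Lemma pyth (x : R) : c x * c x + σ * (s x * s x) = 1.
Proof. rewrite <- cs_sub, Rminus_diag; apply cs_0. Qed.

Lemma sn_sq (x : R) : s x * s x = σ * (1 - c x * c x).
Proof. pose proof (pyth x); destruct sg_cases as [E|E]; rewrite E in *; lra. Qed.

Lemma cs_sum (x y : R) : c x + c y = 2 * c ((x + y) / 2) * c ((x - y) / 2).
Proof.
  replace (c x) with (c ((x + y) / 2 + (x - y) / 2)) by (f_equal; field).
  replace (c y) with (c ((x + y) / 2 - (x - y) / 2)) by (f_equal; field).
  rewrite cs_add, cs_sub; ring.
Qed.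

Lemma cs_diff (x y : R) : c y - c x = σ * (2 * s ((x + y) / 2) * s ((x - y) / 2)).
Proof.
  replace (c x) with (c ((x + y) / 2 + (x - y) / 2)) by (f_equal; field).
  replace (c y) with (c ((x + y) / 2 - (x - y) / 2)) by (f_equal; field).
  rewrite cs_add, cs_sub; ring.
Qed.

Lemma cs_double (x : R) : 1 + c x = 2 * (c (x / 2) * c (x / 2)).
Proof. rewrite <- cs_0, Rplus_comm, cs_sum; rewrite Rplus_0_r, Rminus_0_r; ring. Qed.

Lemma cs_double' (x : R) : 1 - c x = σ * (2 * (s (x / 2) * s (x / 2))).
Proof.
  rewrite <- cs_0 at 1; rewrite cs_diff, Rplus_0_r, Rminus_0_r; ring.
Qed.

Lemma derivable_cs (x : R) : derivable_pt_lim c x (- σ * s x).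
Proof.
  unfold cs, sn, sg; destruct b.
  - replace (- (1) * sin x) with (- sin x) by ring; apply derivable_pt_lim_cos.
  - replace (- (-1) * sinh x) with (sinh x) by ring; apply derivable_pt_lim_cosh.
Qed.

Lemma derivable_sn (x : R) : derivable_pt_lim s x (c x).
Proof.
  unfold cs, sn; destruct b; [apply derivable_pt_lim_sin | apply derivable_pt_lim_sinh].
Qed.

Lemma cont_cs : continuity c.
Proof. intros x; apply derivable_continuous_pt; eexists; apply derivable_cs. Qed.

Lemma cont_sn : continuity s.
Proof. intros x; apply derivable_continuous_pt; eexists; apply derivable_sn. Qed.

Lemma cosh_ge_1 (x : R) : 1 <= cosh x.
Proof.
  unfold cosh; rewrite exp_Ropp; pose proof (exp_pos x).
  assert (exp x * / exp x = 1) by (apply Rinv_r; lra).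
  assert (0 < / exp x) by (apply Rinv_0_lt_compat; lra).
  assert (0 <= (exp x - 1) * (exp x - 1) * / exp x) by (apply Rmult_le_pos; [apply Rle_0_sqr | lra]).
  replace ((exp x - 1) * (exp x - 1) * / exp x) with (exp x - 2 + / exp x) in * by (field; lra).
  lra.
Qed.

Lemma sn_pos (x : R) : 0 < x -> (b = true -> x < PI) -> 0 < s x.
Proof.
  intros H H1; unfold sn; destruct b; [apply sin_gt_0; auto|].
  rewrite <- sinh_0; apply sinh_lt; auto.
Qed.

Lemma sn_nonneg (x : R) : 0 <= x -> (b = true -> x <= PI) -> 0 <= s x.
Proof.
  intros H H1; destruct (Req_dec x 0) as [->|]; [rewrite sn_0; lra|].
  unfold sn; destruct b; [apply sin_ge_0; auto|].
  rewrite <- sinh_0; apply Rlt_le, sinh_lt; lra.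
Qed.

Lemma cs_pos (x : R) : (b = true -> - (PI / 2) < x < PI / 2) -> 0 < c x.
Proof.
  intros H; unfold cs; destruct b; [apply cos_gt_0; apply H; auto|].
  pose proof (cosh_ge_1 x); lra.
Qed.

Lemma cs_nonneg (x : R) : (b = true -> - (PI / 2) <= x <= PI / 2) -> 0 <= c x.
Proof.
  intros H; unfold cs; destruct b; [apply cos_ge_0; apply H; auto|].
  pose proof (cosh_ge_1 x); lra.
Qed.

Lemma sg_cs_le_1 (x : R) : σ * c x <= σ.
Proof.
  unfold sg, cs; destruct b; [pose proof (COS_bound x) | pose proof (cosh_ge_1 x)]; lra.
Qed.

(** By [cs_diff] a difference of cosines is a product of two sines. The factor [σ] gives [cos] and
    [cosh] the same monotonicity, so that one argument serves both signs of the curvature. *)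
Lemma cs_anti_lt (x y : R) : 0 <= x < y -> (b = true -> y <= PI) -> σ * c y < σ * c x.
Proof.
  intros Hxy H; pose proof PI_RGT_0.
  assert (Hd : 0 < σ * (c x - c y)); [|lra].
  replace (c x - c y) with (σ * (2 * s ((y + x) / 2) * s ((y - x) / 2)))
    by (symmetry; apply cs_diff).
  rewrite <- Rmult_assoc, sg_sq, Rmult_1_l.
  apply Rmult_lt_0_compat; [apply Rmult_lt_0_compat; [lra|]|]; apply sn_pos; try lra;
    intros E; specialize (H E); lra.
Qed.

Lemma cs_anti_le (x y : R) : 0 <= x <= y -> (b = true -> y <= PI) -> σ * c y <= σ * c x.
Proof.
  intros Hxy H; destruct (Req_dec x y) as [->|]; [lra|].
  apply Rlt_le, cs_anti_lt; auto; lra.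
Qed.

Lemma cs_anti_inv (x y : R) :
  0 <= x -> 0 <= y -> (b = true -> y <= PI) -> σ * c x <= σ * c y -> y <= x.
Proof.
  intros Hx Hy H Hc; apply Rnot_lt_le; intros Hlt.
  pose proof (cs_anti_lt x y ltac:(lra) H); lra.
Qed.

Lemma cosh_mono (x y : R) : Rabs x <= y -> cosh x <= cosh y.
Proof.
  assert (H : forall u v, 0 <= u <= v -> cosh u <= cosh v).
  { intros u v Huv; destruct (Req_dec u v) as [->|]; [lra|].
    destruct (MVT_cor2 cosh sinh u v) as [w [Hw Hw2]];
      [lra | intros; apply derivable_pt_lim_cosh |].
    assert (0 < sinh w) by (rewrite <- sinh_0; apply sinh_lt; lra); nra. }
  intros Hxy; replace (cosh x) with (cosh (Rabs x)).
  - apply H; split; [apply Rabs_pos | auto].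
  - unfold Rabs; destruct (Rcase_abs x); auto.
    unfold cosh; rewrite Ropp_involutive; field.
Qed.

Lemma sinh_lt_cosh (x : R) : Rabs (sinh x) <= cosh x.
Proof.
  unfold sinh, cosh; pose proof (exp_pos x); pose proof (exp_pos (- x)).
  apply Rabs_le; lra.
Qed.

Lemma cs_bound (x y : R) : Rabs x <= y -> Rabs (c x) <= cosh y.
Proof.
  intros H; unfold cs; destruct b.
  - pose proof (COS_bound x); pose proof (cosh_ge_1 y); apply Rabs_le; lra.
  - pose proof (cosh_ge_1 x); rewrite Rabs_right; [apply cosh_mono; auto | lra].
Qed.

Lemma sn_bound (x y : R) : Rabs x <= y -> Rabs (s x) <= cosh y.
Proof.
  intros H; unfold sn; destruct b.
  - pose proof (SIN_bound x); pose proof (cosh_ge_1 y); apply Rabs_le; lra.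
  - eapply Rle_trans; [apply sinh_lt_cosh | apply cosh_mono; auto].
Qed.

Lemma mvt_lipschitz (f f' : R -> R) (B L : R) :
  (forall x, derivable_pt_lim f x (f' x)) -> (forall x, Rabs x <= B -> Rabs (f' x) <= L) ->
  forall x y, Rabs x <= B -> Rabs y <= B -> Rabs (f x - f y) <= L * Rabs (x - y).
Proof.
  intros Hd HL x y Hx Hy.
  destruct (MVT_abs f f' y x) as [z [-> Hz]]; [auto|].
  apply Rmult_le_compat_r; [apply Rabs_pos | apply HL].
  revert Hz; unfold Rmin, Rmax; destruct (Rle_dec y x); intros Hz;
    apply Rabs_le;
    pose proof (Rle_abs x); pose proof (Rle_abs y); pose proof (Rabs_lb x);
    pose proof (Rabs_lb y); lra.
Qed.

Lemma cs_lipschitz (x y B : R) :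
  Rabs x <= B -> Rabs y <= B -> Rabs (c x - c y) <= cosh B * Rabs (x - y).
Proof.
  apply (mvt_lipschitz c (fun z => - σ * s z)); [apply derivable_cs|].
  intros z Hz; replace (Rabs (- σ * s z)) with (Rabs (s z)); [apply sn_bound; auto|].
  rewrite Rabs_mult; replace (Rabs (- σ)) with 1; [ring|].
  rewrite Rabs_Ropp; destruct sg_cases as [->| ->]; unfold Rabs;
    destruct (Rcase_abs _); lra.
Qed.

Lemma sn_lipschitz (x y B : R) :
  Rabs x <= B -> Rabs y <= B -> Rabs (s x - s y) <= cosh B * Rabs (x - y).
Proof.
  apply (mvt_lipschitz s c); [apply derivable_sn|].
  intros z Hz; apply cs_bound; auto.
Qed.

Lemma sn_small (x B : R) : Rabs x <= B -> Rabs (s x) <= cosh B * Rabs x.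
Proof.
  intros H; pose proof (sn_lipschitz x 0 B H) as H1.
  rewrite sn_0, !Rminus_0_r in H1; apply H1; rewrite Rabs_R0.
  pose proof (Rabs_pos x); lra.
Qed.

Lemma cs_small (x B : R) : Rabs x <= B -> Rabs (1 - c x) <= cosh B * cosh B * (x * x).
Proof.
  intros H; rewrite cs_double'.
  assert (Hx : Rabs (x / 2) <= B).
  { unfold Rdiv; rewrite Rabs_mult, (Rabs_right (/ 2)); pose proof (Rabs_pos x); lra. }
  pose proof (sn_small _ _ Hx) as H1.
  replace (Rabs (σ * (2 * (s (x / 2) * s (x / 2))))) with (2 * (Rabs (s (x / 2)) * Rabs (s (x / 2)))).
  - assert (E : Rabs (x / 2) * Rabs (x / 2) = x * x / 4).
    { rewrite <- Rabs_mult, Rabs_right; [field | nra]. }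
    pose proof (Rabs_pos (s (x / 2))); pose proof (Rabs_pos (x / 2)); pose proof (cosh_ge_1 B).
    assert (Rabs (s (x / 2)) * Rabs (s (x / 2))
            <= (cosh B * Rabs (x / 2)) * (cosh B * Rabs (x / 2)))
      by (apply Rmult_le_compat; auto).
    replace ((cosh B * Rabs (x / 2)) * (cosh B * Rabs (x / 2)))
      with (cosh B * cosh B * (x * x / 4)) in H4 by (rewrite <- E; ring).
    assert (0 <= cosh B * cosh B * (x * x)) by (apply Rmult_le_pos; nra); lra.
  - rewrite !Rabs_mult, (Rabs_right 2) by lra.
    replace (Rabs σ) with 1; [ring|].
    destruct sg_cases as [->| ->]; unfold Rabs; destruct (Rcase_abs _); lra.
Qed.

Lemma cv_cs (u : nat -> R) (l : R) : Un_cv u l -> Un_cv (fun n => c (u n)) (c l).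
Proof. apply cv_cont, cont_cs. Qed.

Lemma cv_sn (u : nat -> R) (l : R) : Un_cv u l -> Un_cv (fun n => s (u n)) (s l).
Proof. apply cv_cont, cont_sn. Qed.

Lemma cv_sn_ratio (u : nat -> R) :
  (forall n, u n <> 0) -> Un_cv u 0 -> Un_cv (fun n => s (u n) / u n) 1.
Proof.
  intros Hn H e He.
  pose proof (derivable_sn 0) as Hd; rewrite cs_0 in Hd.
  destruct (Hd e He) as [del Hdel].
  destruct (H del (cond_pos del)) as [N HN]; exists N; intros n Hn2.
  specialize (HN n Hn2); unfold Rdist in *; rewrite Rminus_0_r in HN.
  specialize (Hdel (u n) (Hn n) HN).
  rewrite Rplus_0_l, sn_0, Rminus_0_r in Hdel; auto.
Qed.

End Trig.

(* Leaves the nonvanishing of denominators as goals. *)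
Ltac cv :=
  first
  [ eassumption
  | lazymatch goal with
    | |- Un_cv (fun n => @?u n + @?v n) _ => eapply CV_plus; cv
    | |- Un_cv (fun n => @?u n - @?v n) _ => eapply CV_minus; cv
    | |- Un_cv (fun n => @?u n * @?v n) _ => eapply CV_mult; cv
    | |- Un_cv (fun n => @?u n / @?v n) _ => eapply cv_div; [cv | cv | idtac]
    | |- Un_cv (fun n => - @?u n) _ => eapply cv_opp; cv
    | |- Un_cv (fun n => (@?u n) ^ ?k) _ => eapply cv_pow; cv
    | |- Un_cv (fun n => cs _ (@?u n)) _ => eapply cv_cs; cv
    | |- Un_cv (fun n => sn _ (@?u n)) _ => eapply cv_sn; cv
    | |- Un_cv (fun n => / @?u n) _ => eapply cv_inv; [cv | idtac]
    | _ => try apply cv_const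
    end ].

(** * The four-point condition on small rectangles *)

Section Local.
Variable b : bool.
Notation σ := (sg b).
Notation c := (cs b).
Notation s := (sn b).

(* The four-point condition for the corners of a small rectangle of parameters: [p], [q], [u], [v]
   are the values of [cs d] at the corners (-,-), (+,+), (+,-), (-,+), and [A], [B] are [cs] of the
   two sides. *)
Definition upper_corners (A B p q u v : R) : Prop :=
  exists x y, p = c x /\ q = c y /\ σ * ((1 + A) * (B + c (x + y))) <= σ * ((p + u) * (q + v)).

Definition lower_corners (A B p q u v : R) : Prop :=
  exists x y, q = c x /\ p = c y /\ σ * ((q + B) * (p + A)) <= σ * ((1 + u) * (v + c (x - y))).

(** Only the cosines [p], [q] of the distances [x], [y] are to remain. The product [sn x * sn y]
    hidden in [cs (x + y)] is removed by AM-GM with weights [1 + m] and [1 - m], which leaves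
    squares of sines; [m] stays free, to be matched to the geometry later. *)
Lemma upper_corners_quadratic (i j p q u v m : R) :
  upper_corners (c (2 * i)) (c (2 * j)) p q u v -> -1 < m < 1 ->
  σ * (c i * c i * ((((p + q) / 2 - m * ((q - p) / 2))) * ((p + q) / 2 - m * ((q - p) / 2))
       - σ * (s j * s j) - m * m * (c j * c j)))
  <= σ * ((1 - m * m) * ((p + u) / 2 * ((q + v) / 2))).
Proof.
  intros [x [y [Hp [Hq H]]]] Hm.
  replace (c (2 * i)) with (2 * (c i * c i) - 1) in H.
  2:{ pose proof (cs_double b (2 * i)) as E; replace (2 * i / 2) with i in E by field; lra. }
  replace (c (2 * j)) with (1 - σ * (2 * (s j * s j))) in H.
  2:{ pose proof (cs_double' b (2 * j)) as E; replace (2 * j / 2) with j in E by field; lra. }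
  rewrite cs_add, <- Hp, <- Hq in H.
  pose proof (sn_sq b x) as Ex; pose proof (sn_sq b y) as Ey; rewrite <- Hp in Ex; rewrite <- Hq in Ey.
  pose proof (pyth b j) as Ej.
  assert (Hs : 0 <= (1 + m) * (1 + m) * (s x * s x) + (1 - m) * (1 - m) * (s y * s y)
               - 2 * (1 - m * m) * (s x * s y)).
  { pose proof (Rle_0_sqr ((1 + m) * s x - (1 - m) * s y)) as Hs; unfold Rsqr in Hs; nra. }
  assert (Hm2 : 0 <= 1 - m * m) by nra.
  apply (Rmult_le_compat_r (1 - m * m)) in H; [|auto].
  assert (Hc2 : 0 <= c i * c i) by apply Rle_0_sqr.
  pose proof (Rmult_le_pos _ _ Hc2 Hs) as HP.
  revert H HP; rewrite Ex, Ey; clear Hs.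
  set (XY := s x * s y); set (ci2 := c i * c i).
  replace (c j * c j) with (1 - σ * (s j * s j)) by lra.
  set (sj2 := s j * s j); intros H HP.
  destruct (sg_cases b) as [E|E]; rewrite E in *; lra.
Qed.

(** Given are the mean [C * C'] and, up to sign, the half difference [S * D]; wanted is
    [σ * cs (x - y) = σ - 2 * D^2]. The denominator [Z] exceeds [S^2] by [C^2 * D^2], so
    [D^2 >= (S * D)^2 / Z], with a loss of fourth order in [D]. *)
Lemma lower_corners_bound (x y p q : R) :
  q = c x -> p = c y -> 0 < σ * (1 - (p + q) / 2 * ((p + q) / 2)) ->
  σ * c (x - y) <= σ - 2 * ((q - p) / 2 * ((q - p) / 2)) / (σ * (1 - (p + q) / 2 * ((p + q) / 2))).
Proof.
  intros Hq Hp Hz.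
  set (D := s ((x - y) / 2)); set (S := s ((x + y) / 2)).
  set (C := c ((x + y) / 2)); set (C' := c ((x - y) / 2)).
  assert (E1 : (p + q) / 2 = C * C').
  { rewrite Hp, Hq, Rplus_comm; unfold C, C'; rewrite (cs_sum b x y); field. }
  assert (E2 : (q - p) / 2 = - σ * (S * D)).
  { rewrite Hp, Hq; unfold S, D; pose proof (cs_diff b x y); lra. }
  assert (E3 : σ * c (x - y) = σ - 2 * (D * D)).
  { pose proof (cs_double' b (x - y)) as E; fold D in E; pose proof (sg_sq b).
    destruct (sg_cases b) as [E0|E0]; rewrite E0 in *; lra. }
  rewrite E3; rewrite E1 in *; rewrite E2.
  set (Z := σ * (1 - C * C' * (C * C'))) in *.
  assert (E4 : Z - S * S = C * C * (D * D)).
  { unfold Z, S, D; rewrite !sn_sq; fold C C'; ring. }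
  assert (H : 2 * (- σ * (S * D) * (- σ * (S * D))) / Z <= 2 * (D * D)); [|lra].
  apply (Rmult_le_reg_r Z); [auto|].
  replace (2 * (- σ * (S * D) * (- σ * (S * D))) / Z * Z)
    with ((σ * σ) * (2 * (S * S) * (D * D))) by (field; lra).
  rewrite sg_sq.
  pose proof (Rle_0_sqr (C * D * D)); unfold Rsqr in *; nra.
Qed.

Section Limit.
Variables (sq tq i j p q u v l : nat -> R) (s0 t0 F X1 L : R).
(* Centre and half sides of the rectangles are [sq], [tq] and [i], [j]. [slope_s] approximates
   [cs t0 F - sn t0 (dF/dt)], and [mixed_form - 1] is, up to a positive factor, [sg b] times the mixed
   difference of the cosine of the model angle. *)
Definition slope_s (n : nat) : R :=
  c (tq n) * ((p n + q n + u n + v n) / 4) / (c (i n) * c (j n))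
  - s (tq n) * ((q n + v n - p n - u n) / 4) / (c (i n) * s (j n)).
Definition slope_t (n : nat) : R :=
  c (sq n) * ((p n + q n + u n + v n) / 4) / (c (i n) * c (j n))
  - s (sq n) * ((q n + u n - p n - v n) / 4) / (s (i n) * c (j n)).
Definition mixed_form (n : nat) : R :=
  (s (sq n + i n) * s (tq n + j n) * p n + s (sq n - i n) * s (tq n - j n) * q n
   - s (sq n + i n) * s (tq n - j n) * v n - s (sq n - i n) * s (tq n + j n) * u n)
  / (s (2 * i n) * s (2 * j n)).

Hypothesis Hs : Un_cv sq s0.
Hypothesis Ht : Un_cv tq t0.
Hypothesis Hi : Un_cv i 0.
Hypothesis Hj : Un_cv j 0.
Hypothesis Hi0 : forall n, 0 < i n <= 1.
Hypothesis Hj0 : forall n, 0 < j n <= 1.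
Hypothesis Hp : Un_cv p F.
Hypothesis Hq : Un_cv q F.
Hypothesis Hu : Un_cv u F.
Hypothesis Hv : Un_cv v F.
Hypothesis Hs0 : 0 < s s0.
Hypothesis Ht0 : 0 < s t0.
Hypothesis Hsn : forall n, 0 < s (sq n).
Hypothesis Htn : forall n, 0 < s (tq n).
Hypothesis HX : Un_cv slope_s X1.
Hypothesis Hl : Un_cv l L.
Hypothesis Hlo : forall n, l n <= σ * (mixed_form n - 1).

Lemma small_trig (x : R) : 0 < x <= 1 -> 0 < s x /\ 0 < c x /\ 0 < s (2 * x).
Proof.
  intros H; pose proof PI2_1.
  split; [|split]; [apply sn_pos | apply cs_pos | apply sn_pos]; intros; lra.
Qed.

(** The addition formulas split the form exactly into the mixed difference, the two first
    differences and the mean of the corner values; no Taylor remainder arises for the distance,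
    which is merely Lipschitz. *)
Lemma mixed_form_expand (n : nat) :
  mixed_form n = s (sq n) * s (tq n) * ((p n + q n - u n - v n) / 4) / (s (i n) * s (j n))
         - s (sq n) * c (tq n) * ((q n + u n - p n - v n) / 4) / (s (i n) * c (j n))
         - c (sq n) * s (tq n) * ((q n + v n - p n - u n) / 4) / (c (i n) * s (j n))
         + c (sq n) * c (tq n) * ((p n + q n + u n + v n) / 4) / (c (i n) * c (j n)).
Proof.
  unfold mixed_form; destruct (small_trig _ (Hi0 n)) as [A1 [A2 A3]].
  destruct (small_trig _ (Hj0 n)) as [B1 [B2 B3]].
  assert (D : forall x, s (2 * x) = 2 * s x * c x)
    by (intros x; replace (2 * x) with (x + x) by ring; rewrite sn_add; ring).
  rewrite !D, !sn_add, !sn_sub; field; repeat split; lra.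
Qed.

Lemma ratio_cv (r : R) : Un_cv (fun n => i n / j n) r ->
  Un_cv (fun n => s (i n) / s (j n)) r.
Proof.
  intros Hr.
  apply cv_ext with (fun n => (s (i n) / i n) * (i n / j n) / (s (j n) / j n)).
  - intros n; destruct (small_trig _ (Hj0 n)) as [B1 _].
    pose proof (Hi0 n); pose proof (Hj0 n); field; lra.
  - eapply cv_eq.
    + apply cv_div; [apply CV_mult; [apply cv_sn_ratio | apply Hr] | apply cv_sn_ratio |]; auto;
        try (intros n; pose proof (Hi0 n); pose proof (Hj0 n); lra); lra.
    + field.
Qed.

(* The ratio of the sides is the one for which the second order terms of the four-point condition
   complete a square. *)
Lemma local_upper :
  (forall n, upper_corners (c (2 * i n)) (c (2 * j n)) (p n) (q n) (u n) (v n)) -> 0 < F ->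
  Un_cv (fun n => i n / j n) (s s0 / (F * s t0)) -> 2 * L + σ * ((X1 - c s0) * (X1 - c s0)) <= 0.
Proof.
  intros HU HF Hr; apply ratio_cv in Hr.
  (* The weight is [m = tan j / tan t] (hyperbolic tangents for [σ = -1]), so that [1 + m] and
     [1 - m] are proportional to [sn (t + j)] and [sn (t - j)]. The small parameter is [g]: [sn i]
     and [sn j] are [g] times convergent factors, and the second order terms are divided by
     [g^2]. *)
  set (g := fun n => s (j n) / (c (j n) * s (tq n))).
  set (m := fun n => g n * c (tq n)).
  set (eps := fun n => (s (i n) / s (j n)) * (c (j n) * s (tq n))).
  set (f0 := fun n => (p n + q n + u n + v n) / 4).
  set (ft := fun n => (q n + v n - p n - u n) / 4).
  (* The mixed difference and the first difference in [s] enter only through this combination, which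
     is of order [g^2] by [E1]. *)
  set (e := fun n => (p n + q n - u n - v n) / 4 - m n * ((q n + u n - p n - v n) / 4)).
  assert (Hg : Un_cv g 0).
  { eapply cv_eq; [unfold g; cv|]; rewrite ?cs_0, ?sn_0; [lra|field; lra]. }
  assert (Hm : Un_cv m 0) by (eapply cv_eq; [unfold m; cv | ring]).
  assert (Heps : Un_cv eps (s s0 / F)).
  { eapply cv_eq; [unfold eps; cv|]; rewrite ?cs_0; field; lra. }
  assert (Hf0 : Un_cv f0 F) by (eapply cv_eq; [unfold f0; cv; lra | field]).
  assert (Hft : Un_cv ft 0) by (eapply cv_eq; [unfold ft; cv; lra | field]).
  assert (He : Un_cv e 0) by (eapply cv_eq; [unfold e; cv; lra | field]).
  destruct (cv_ev_lt m 0 1 Hm ltac:(lra)) as [N1 HN1].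
  destruct (cv_ev_gt m 0 (-1) Hm ltac:(lra)) as [N2 HN2].
  assert (HE : Un_cv (fun n => 2 * f0 n + e n - 2 * m n * ft n) (2 * F))
    by (eapply cv_eq; [cv | ring]).
  destruct (cv_ev_gt _ _ 0 HE ltac:(lra)) as [N3 HN3].
  assert (Key : forall n, (N1 + N2 + N3 <= n)%nat ->
    eps n * c (j n) / s (sq n) * (l n + σ * (1 - c (sq n) * slope_s n))
      * (2 * f0 n + e n - 2 * m n * ft n)
    <= σ * (c (j n) * c (j n) * (1 - c (i n) * c (i n) * (slope_s n * slope_s n)))
       + eps n * eps n * ((f0 n + (e n - m n * ft n)) * (f0 n + (e n - m n * ft n)))
       - s (i n) * s (i n) * (c (j n) * c (j n))).
  { intros n Hn; specialize (HN1 n ltac:(lia)); specialize (HN2 n ltac:(lia));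
      specialize (HN3 n ltac:(lia)).
    destruct (small_trig _ (Hi0 n)) as [A1 [A2 A3]].
    destruct (small_trig _ (Hj0 n)) as [B1 [B2 B3]].
    pose proof (Hsn n) as S1; pose proof (Htn n) as T1.
    assert (G0 : 0 < g n)
      by (unfold g; apply Rdiv_lt_0_compat; [lra | apply Rmult_lt_0_compat; lra]).
    assert (E1 : e n = g n * g n * (eps n * c (j n) / s (sq n) * (mixed_form n - c (sq n) * slope_s n))).
    { rewrite mixed_form_expand; unfold e, m, eps, g, slope_s; field; repeat split; lra. }
    assert (E2 : m n * f0 n - ft n = g n * c (i n) * c (j n) * slope_s n).
    { unfold m, g, f0, ft, slope_s; field; repeat split; lra. }
    assert (E3 : s (i n) = g n * eps n) by (unfold g, eps; field; lra).
    assert (E4 : σ * (s (j n) * s (j n)) + m n * m n * (c (j n) * c (j n))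
                 = g n * g n * (c (j n) * c (j n))).
    { pose proof (pyth b (tq n)) as P.
      replace (g n * g n * (c (j n) * c (j n)))
        with (g n * g n * (c (j n) * c (j n)) * (c (tq n) * c (tq n) + σ * (s (tq n) * s (tq n))))
        by (rewrite P; ring).
      unfold m, g; field; lra. }
    pose proof (upper_corners_quadratic _ _ _ _ _ _ (m n) (HU n) ltac:(lra)) as HQ.
    replace ((p n + q n) / 2 - m n * ((q n - p n) / 2)) with (f0 n + (e n - m n * ft n)) in HQ
      by (unfold f0, e, ft; field).
    replace ((p n + u n) / 2 * ((q n + v n) / 2)) with (f0 n * f0 n - ft n * ft n) in HQ
      by (unfold f0, ft; field).
    assert (HQ2 : σ * (e n * (2 * f0 n + e n - 2 * m n * ft n))
      <= σ * (g n * g n * (c (j n) * c (j n)) - (m n * f0 n - ft n) * (m n * f0 n - ft n))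
         + s (i n) * s (i n) * ((f0 n + (e n - m n * ft n)) * (f0 n + (e n - m n * ft n)))
         - s (i n) * s (i n) * (g n * g n * (c (j n) * c (j n)))).
    { rewrite <- E4; pose proof (pyth b (i n)) as P.
      replace (c (i n) * c (i n)) with (1 - σ * (s (i n) * s (i n))) in HQ by lra.
      destruct (sg_cases b) as [E|E]; rewrite E in *; lra. }
    rewrite E2, E3 in HQ2; rewrite E1 in HQ2 at 1.
    assert (Hlo' := Hlo n).
    assert (HQ3 : σ * (eps n * c (j n) / s (sq n) * (mixed_form n - c (sq n) * slope_s n)
                   * (2 * f0 n + e n - 2 * m n * ft n))
      <= σ * (c (j n) * c (j n) * (1 - c (i n) * c (i n) * (slope_s n * slope_s n)))
       + eps n * eps n * ((f0 n + (e n - m n * ft n)) * (f0 n + (e n - m n * ft n)))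
       - s (i n) * s (i n) * (c (j n) * c (j n))).
    { apply (Rmult_le_reg_l (g n * g n)); [apply Rmult_lt_0_compat; auto|].
      rewrite E3; eapply Rle_trans; [|eapply Rle_trans; [exact HQ2|]]; right; ring. }
    eapply Rle_trans; [|exact HQ3].
    replace (σ * (eps n * c (j n) / s (sq n) * (mixed_form n - c (sq n) * slope_s n)
                   * (2 * f0 n + e n - 2 * m n * ft n)))
      with (eps n * c (j n) / s (sq n) * (σ * (mixed_form n - c (sq n) * slope_s n))
                   * (2 * f0 n + e n - 2 * m n * ft n)) by ring.
    apply Rmult_le_compat_r; [lra|].
    apply Rmult_le_compat_l; [|lra].
    assert (0 < eps n) by (unfold eps; repeat apply Rmult_lt_0_compat; auto;
                            apply Rinv_0_lt_compat; auto).
    apply Rlt_le, Rdiv_lt_0_compat; [apply Rmult_lt_0_compat|]; auto. }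
  assert (H := cv_le_ev _ _ (s s0 / F * 1 / s s0 * (L + σ * (1 - c s0 * X1)) * (2 * F))
     (σ * (1 * (1 - 1 * (X1 * X1))) + s s0 / F * (s s0 / F) * ((F + 0) * (F + 0)) - 0) _ Key).
  lapply H; [clear H; intros H | eapply cv_eq; [cv; lra | rewrite ?cs_0; reflexivity]].
  lapply H; [clear H; intros H | eapply cv_eq; [cv; lra | rewrite ?cs_0, ?sn_0; ring]].
  replace (s s0 / F * 1 / s s0 * (L + σ * (1 - c s0 * X1)) * (2 * F))
    with (2 * L + 2 * (σ * (1 - c s0 * X1))) in H by (field; lra).
  replace (s s0 / F * (s s0 / F) * ((F + 0) * (F + 0))) with (s s0 * s s0) in H by (field; lra).
  rewrite sn_sq in H; lra.
Qed.

(** With this ratio the half sides are asymptotically proportional to [sn s0] and [sn t0]. Here both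
    slopes enter; after multiplication by [σ * (1 - F)] their terms combine into the claim and one
    perfect square. *)
Lemma local_lower (Y1 : R) :
  (forall n, lower_corners (c (2 * i n)) (c (2 * j n)) (p n) (q n) (u n) (v n)) -> 0 < 1 + F ->
  0 < σ * (1 - F * F) -> Un_cv slope_t Y1 ->
  Un_cv (fun n => i n / j n) (s s0 / s t0) -> 2 * L + σ * ((X1 - c s0) * (X1 - c s0)) <= 0.
Proof.
  intros HL HF HG HY Hr; apply ratio_cv in Hr.
  set (g := fun n => s (j n) / (c (j n) * s (tq n))).
  set (eps := fun n => (s (i n) / s (j n)) * (c (j n) * s (tq n))).
  set (f0 := fun n => (p n + q n + u n + v n) / 4).
  set (A := fun n => (c (sq n) * (f0 n / c (i n)) - c (j n) * slope_t n) / s (sq n)).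
  set (B := fun n => (c (tq n) * (f0 n / c (j n)) - c (i n) * slope_s n) / s (tq n)).
  assert (Heps : Un_cv eps (s s0)).
  { eapply cv_eq; [unfold eps; cv|]; rewrite ?cs_0; field; lra. }
  assert (Hf0 : Un_cv f0 F) by (eapply cv_eq; [unfold f0; cv; lra | field]).
  assert (HA : Un_cv A ((c s0 * F - Y1) / s s0)).
  { eapply cv_eq; [unfold A; cv|]; rewrite ?cs_0; try lra; field; lra. }
  assert (HB : Un_cv B ((c t0 * F - X1) / s t0)).
  { eapply cv_eq; [unfold B; cv|]; rewrite ?cs_0; try lra; field; lra. }
  set (z := fun n => (p n + q n) / 2).
  assert (Hz : Un_cv z F) by (eapply cv_eq; [unfold z; cv; lra | field]).
  set (fs := fun n => eps n * A n); set (ft := fun n => c (j n) * s (tq n) * B n).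
  set (sj := fun n => c (j n) * s (tq n)).
  assert (HZ : Un_cv (fun n => σ * (1 - z n * z n)) (σ * (1 - F * F)))
    by cv.
  destruct (cv_ev_gt _ _ 0 HZ HG) as [N1 HN1].
  assert (H1f : Un_cv (fun n => 1 + f0 n) (1 + F)) by cv.
  destruct (cv_ev_gt _ _ 0 H1f HF) as [N2 HN2].
  assert (H1u : Un_cv (fun n => 1 + u n) (1 + F)) by cv.
  destruct (cv_ev_gt _ _ 0 H1u HF) as [N3 HN3].
  set (R1 := fun n => c (tq n) * (s (sq n) * A n) / c (j n)
                      + c (sq n) * (s (tq n) * B n) / c (i n)
                      - c (sq n) * c (tq n) * f0 n / (c (i n) * c (j n))).
  assert (Key : forall n, (N1 + N2 + N3 <= n)%nat ->
    4 * (1 + f0 n) * (eps n * c (j n) / s (sq n)) * (l n + σ * (1 + R1 n))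
    <= σ * (4 * fs n * ft n)
       - 2 * ((fs n + ft n) * (fs n + ft n)) * (1 + u n) / (σ * (1 - z n * z n))
       + 2 * (1 + z n) * (eps n * eps n + sj n * sj n)
       - 2 * (g n * (fs n + ft n)) * (sj n * sj n - eps n * eps n)
       - 4 * σ * (eps n * eps n * (s (j n) * s (j n)))).
  { intros n Hn; specialize (HN1 n ltac:(lia)); specialize (HN2 n ltac:(lia));
      specialize (HN3 n ltac:(lia)); cbv beta in HN1.
    destruct (small_trig _ (Hi0 n)) as [A1 [A2 A3]].
    destruct (small_trig _ (Hj0 n)) as [B1 [B2 B3]].
    pose proof (Hsn n) as S1; pose proof (Htn n) as T1.
    assert (G0 : 0 < g n)
      by (unfold g; apply Rdiv_lt_0_compat; [lra | apply Rmult_lt_0_compat; lra]).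
    assert (Ei : s (i n) = g n * eps n) by (unfold g, eps; field; lra).
    assert (Ej : s (j n) = g n * sj n) by (unfold g, sj; field; lra).
    assert (Es : (q n + u n - p n - v n) / 4 = g n * fs n).
    { unfold fs, g, eps, A, f0, slope_t; field; repeat split; lra. }
    assert (Et : (q n + v n - p n - u n) / 4 = g n * ft n).
    { unfold ft, g, B, f0, slope_s; field; repeat split; lra. }
    assert (Est : (p n + q n - u n - v n) / 4
                  = g n * g n * (eps n * c (j n) / s (sq n)) * (mixed_form n + R1 n)).
    { rewrite mixed_form_expand; unfold R1, A, B, f0, slope_s, slope_t, eps, g; field; repeat split; lra. }
    destruct (HL n) as [x [y [Hqx [Hpy HLn]]]].
    pose proof (lower_corners_bound x y (p n) (q n) Hqx Hpy) as Hb; fold (z n) in Hb.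
    specialize (Hb HN1).
    replace (c (2 * i n)) with (1 - σ * (2 * (s (i n) * s (i n)))) in HLn.
    2:{ pose proof (cs_double' b (2 * i n)) as E; replace (2 * i n / 2) with (i n) in E by field; lra. }
    replace (c (2 * j n)) with (1 - σ * (2 * (s (j n) * s (j n)))) in HLn.
    2:{ pose proof (cs_double' b (2 * j n)) as E; replace (2 * j n / 2) with (j n) in E by field; lra. }
    assert (HLn2 : σ * ((q n + (1 - σ * (2 * (s (j n) * s (j n)))))
                        * (p n + (1 - σ * (2 * (s (i n) * s (i n))))))
       <= (1 + u n) * (σ * v n + (σ - 2 * ((q n - p n) / 2 * ((q n - p n) / 2)) / (σ * (1 - z n * z n))))).
    { eapply Rle_trans; [exact HLn|].
      replace (σ * ((1 + u n) * (v n + c (x - y)))) with ((1 + u n) * (σ * v n + σ * c (x - y))) by ring.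
      apply Rmult_le_compat_l; lra. }
    clear HLn Hb.
    replace ((q n - p n) / 2 * ((q n - p n) / 2))
      with (g n * g n * ((fs n + ft n) * (fs n + ft n))) in HLn2.
    2:{ replace ((q n - p n) / 2) with (g n * fs n + g n * ft n) by (rewrite <- Es, <- Et; field); ring. }
    set (Z := σ * (1 - z n * z n)) in *.
    set (Q := (fs n + ft n) * (fs n + ft n)) in *.
    replace ((1 + u n) * (σ * v n + (σ - 2 * (g n * g n * Q) / Z)))
      with (σ * ((1 + u n) * (1 + v n)) - g n * g n * (2 * Q * (1 + u n) / Z)) in HLn2 by (field; lra).
    set (V := 2 * Q * (1 + u n) / Z) in *.
    set (fst := (p n + q n - u n - v n) / 4) in *.
    assert (Hu' : u n = f0 n + g n * fs n - g n * ft n - fst)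
      by (unfold fst, f0; rewrite <- Es, <- Et; field).
    assert (Hv' : v n = f0 n - g n * fs n + g n * ft n - fst)
      by (unfold fst, f0; rewrite <- Es, <- Et; field).
    assert (Hq' : q n = z n + g n * (fs n + ft n))
      by (unfold z; rewrite Rmult_plus_distr_l, <- Es, <- Et; field).
    assert (Hp' : p n = z n - g n * (fs n + ft n))
      by (unfold z; rewrite Rmult_plus_distr_l, <- Es, <- Et; field).
    assert (Hz' : z n = f0 n + fst) by (unfold z, fst, f0; field).
    assert (HLn3 : 4 * (σ * fst) * (1 + f0 n)
      <= g n * g n * (σ * (4 * fs n * ft n) - V + 2 * (1 + z n) * (eps n * eps n + sj n * sj n)
       - 2 * (g n * (fs n + ft n)) * (sj n * sj n - eps n * eps n)
       - 4 * σ * (eps n * eps n * (g n * sj n * (g n * sj n))))).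
    { rewrite Ei, Ej in HLn2.
      assert (Pos : 0 <= g n * g n * V) by
       (unfold V, Q; apply Rmult_le_pos; [nra|]; apply Rlt_le in HN3;
        apply Rmult_le_pos; [apply Rmult_le_pos; [|lra]; pose proof (Rle_0_sqr (fs n + ft n)); unfold Rsqr in *; lra | apply Rlt_le, Rinv_0_lt_compat; auto]).
      clear - HLn2 Hu' Hv' Hq' Hp' Hz'.
      assert (E : (1 + u n) * (1 + v n)
        = (1 + f0 n - fst) * (1 + f0 n - fst) - (g n * fs n - g n * ft n) * (g n * fs n - g n * ft n))
        by (rewrite Hu', Hv'; ring).
      rewrite E, Hq', Hp', Hz' in HLn2; rewrite Hz'; clear E Hu' Hv' Hq' Hp' Hz'.
      destruct (sg_cases b) as [E|E]; rewrite E in *; lra. }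
    rewrite Ej; apply (Rmult_le_reg_l (g n * g n)); [apply Rmult_lt_0_compat; auto|].
    eapply Rle_trans; [|exact HLn3]; rewrite Est.
    replace (4 * (σ * (g n * g n * (eps n * c (j n) / s (sq n)) * (mixed_form n + R1 n))) * (1 + f0 n))
      with (g n * g n * (4 * (1 + f0 n) * (eps n * c (j n) / s (sq n)) * (σ * (mixed_form n + R1 n)))) by ring.
    apply Rmult_le_compat_l; [nra|].
    apply Rmult_le_compat_l; [|pose proof (Hlo n); lra].
    assert (0 < eps n) by (unfold eps; repeat apply Rmult_lt_0_compat; auto;
                            apply Rinv_0_lt_compat; auto).
    apply Rmult_le_pos; [lra|].
    apply Rlt_le, Rdiv_lt_0_compat; [apply Rmult_lt_0_compat|]; auto. }
  assert (Hg : Un_cv g 0).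
  { eapply cv_eq; [unfold g; cv|]; rewrite ?cs_0, ?sn_0; [lra|field; lra]. }
  assert (Hsj : Un_cv sj (s t0)) by (eapply cv_eq; [unfold sj; cv | rewrite ?cs_0; ring]).
  assert (Hfs : Un_cv fs (c s0 * F - Y1)) by (eapply cv_eq; [unfold fs; cv | field; lra]).
  assert (Hft : Un_cv ft (c t0 * F - X1))
    by (eapply cv_eq; [unfold ft; cv | rewrite ?cs_0; field; lra]).
  assert (HR1 : Un_cv R1 (c t0 * (c s0 * F - Y1) + c s0 * (c t0 * F - X1) - c s0 * c t0 * F)).
  { eapply cv_eq; [unfold R1; cv; rewrite ?cs_0; lra | rewrite ?cs_0; field; lra]. }
  assert (H := cv_le_ev _ _
     (4 * (1 + F) * (s s0 * 1 / s s0) * (L + σ * (1 + (c t0 * (c s0 * F - Y1) + c s0 * (c t0 * F - X1) - c s0 * c t0 * F))))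
     (σ * (4 * (c s0 * F - Y1) * (c t0 * F - X1))
      - 2 * ((c s0 * F - Y1 + (c t0 * F - X1)) * (c s0 * F - Y1 + (c t0 * F - X1))) * (1 + F) / (σ * (1 - F * F))
      + 2 * (1 + F) * (s s0 * s s0 + s t0 * s t0)) _ Key).
  lapply H; [clear H; intros H | eapply cv_eq; [cv; lra | rewrite ?cs_0; reflexivity]].
  lapply H; [clear H; intros H | eapply cv_eq; [cv; lra | rewrite ?sn_0; ring]].
  rewrite !sn_sq in H.
  replace (s s0 * 1 / s s0) with 1 in H by (field; lra).
  assert (Hs1F : 0 < σ * (1 - F)).
  { replace (σ * (1 - F * F)) with (σ * (1 - F) * (1 + F)) in HG by ring.
    apply (Rmult_lt_reg_r (1 + F)); [auto | lra]. }
  set (E1 := c s0 * F - Y1) in *; set (E2 := c t0 * F - X1) in *.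
  replace (2 * ((E1 + E2) * (E1 + E2)) * (1 + F) / (σ * (1 - F * F)))
    with (2 * ((E1 + E2) * (E1 + E2)) / (σ * (1 - F))) in H.
  2:{ pose proof (sg_cases b); field; repeat split; try lra.
      - intro E; rewrite E in HG; lra.
      - intro E; rewrite E in Hs1F; lra. }
  apply (Rmult_le_compat_r (σ * (1 - F))) in H; [|lra].
  remember (σ * (1 - F)) as cc eqn:Ecc.
  set (P1 := L + σ * _) in H.
  match type of H with _ <= (?a - ?bb / ?cc + ?d) * ?cc =>
    replace ((a - bb / cc + d) * cc) with ((a + d) * cc - bb) in H by (field; lra) end.
  subst cc.
  unfold P1 in H; clear P1 Key HX HY HL Hlo.
  apply Rnot_lt_le; intros Hc.
  assert (Hfin : 0 < (2 * L + σ * ((X1 - c s0) * (X1 - c s0))) * (σ * (1 - F * F)))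
    by (apply Rmult_lt_0_compat; auto).
  (* [H] says that twice the left side of the claim times [σ * (1 - F * F)], plus twice this square,
     is at most 0. *)
  pose proof (Rle_0_sqr (Y1 - c t0 + F * (X1 - c s0))) as Hsq; unfold Rsqr in Hsq.
  unfold E1, E2 in *; clear E1 E2.
  destruct (sg_cases b) as [E|E]; rewrite E in *; nra.
Qed.

End Limit.
End Local.

(** * Localisation of a positive mixed difference *)

Section Rectangles.
Variable chi : R -> R -> R.
Definition mixed (a a' b b' : R) : R := chi a b + chi a' b' - chi a b' - chi a' b.

Lemma increment_positive (f : R -> R) (a w : R) (n : nat) :
  f a < f (a + INR n * w) -> exists k, (k < n)%nat /\ f (a + INR k * w) < f (a + INR (S k) * w).
Proof.
  induction n as [|n IH]; intros H.
  - simpl in H; rewrite Rmult_0_l, Rplus_0_r in H; lra.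
  - destruct (Rlt_dec (f (a + INR n * w)) (f (a + INR (S n) * w))) as [H1|H1].
    + exists n; split; [lia | auto].
    + destruct IH as [k [Hk Hk2]]; [lra|]; exists k; split; [lia | auto].
Qed.

Lemma mixed_split (a b w h : R) (m n : nat) :
  0 < mixed a (a + INR m * w) b (b + INR n * h) ->
  exists k l, (k < m)%nat /\ (l < n)%nat /\
    0 < mixed (a + INR k * w) (a + INR (S k) * w) (b + INR l * h) (b + INR (S l) * h).
Proof.
  unfold mixed; intros H.
  destruct (increment_positive (fun x => chi x (b + INR n * h) - chi x b) a w m) as [k [Hk Hk2]];
    [cbv beta; lra|]; cbv beta in Hk2.
  destruct (increment_positive
    (fun y => chi (a + INR (S k) * w) y - chi (a + INR k * w) y) b h n) as [l [Hl Hl2]];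
    [cbv beta; lra|]; cbv beta in Hl2.
  exists k, l; repeat split; auto; lra.
Qed.

Variables a0 a0' b0 b0' : R.
Hypothesis Ha : a0 < a0'.
Hypothesis Hb : b0 < b0'.
Hypothesis Hpos : 0 < mixed a0 a0' b0 b0'.

Definition quarter (q : R * R) (w h : R) : R * R :=
  let (a, b) := q in
  if Rlt_dec 0 (mixed a (a + w) b (b + h)) then (a, b)
  else if Rlt_dec 0 (mixed (a + w) (a + w + w) b (b + h)) then (a + w, b)
  else if Rlt_dec 0 (mixed a (a + w) (b + h) (b + h + h)) then (a, b + h)
  else (a + w, b + h).

Fixpoint corner (n : nat) : R * R :=
  match n with
  | O => (a0, b0)
  | S m => quarter (corner m) ((a0' - a0) / 2 ^ S m) ((b0' - b0) / 2 ^ S m)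
  end.

Lemma corner_spec (n : nat) :
  let w := (a0' - a0) / 2 ^ n in let h := (b0' - b0) / 2 ^ n in
  0 < mixed (fst (corner n)) (fst (corner n) + w) (snd (corner n)) (snd (corner n) + h) /\
  a0 <= fst (corner n) /\ fst (corner n) + w <= a0' /\
  b0 <= snd (corner n) /\ snd (corner n) + h <= b0'.
Proof.
  induction n as [|n IH].
  - simpl; unfold Rdiv; rewrite Rinv_1, !Rmult_1_r.
    replace (a0 + (a0' - a0)) with a0' by ring; replace (b0 + (b0' - b0)) with b0' by ring.
    repeat split; auto; lra.
  - cbv zeta in *.
    change (corner (S n)) with
      (quarter (corner n) ((a0' - a0) / 2 ^ S n) ((b0' - b0) / 2 ^ S n)).
    assert (H2 : 0 < 2 ^ n) by (apply pow_lt; lra).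
    replace ((a0' - a0) / 2 ^ n) with ((a0' - a0) / 2 ^ S n + (a0' - a0) / 2 ^ S n) in IH
      by (simpl; field; lra).
    replace ((b0' - b0) / 2 ^ n) with ((b0' - b0) / 2 ^ S n + (b0' - b0) / 2 ^ S n) in IH
      by (simpl; field; lra).
    assert (Hw : 0 < (a0' - a0) / 2 ^ S n)
      by (apply Rdiv_lt_0_compat; [lra | apply pow_lt; lra]).
    assert (Hh : 0 < (b0' - b0) / 2 ^ S n)
      by (apply Rdiv_lt_0_compat; [lra | apply pow_lt; lra]).
    set (w := (a0' - a0) / 2 ^ S n) in *; set (h := (b0' - b0) / 2 ^ S n) in *.
    destruct (corner n) as [a b]; unfold quarter; cbn [fst snd] in *.
    rewrite <- !Rplus_assoc in IH.
    destruct (Rlt_dec 0 (mixed a (a + w) b (b + h))); cbn [fst snd]; [repeat split; lra|].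
    destruct (Rlt_dec 0 (mixed (a + w) (a + w + w) b (b + h))); cbn [fst snd]; [repeat split; lra|].
    destruct (Rlt_dec 0 (mixed a (a + w) (b + h) (b + h + h))); cbn [fst snd]; [repeat split; lra|].
    (* The four quarters add up to the whole, so the last one is positive when the others are
       not. *)
    cbn [fst snd]; unfold mixed in *; repeat split; lra.
Qed.

Lemma corner_mono (n : nat) :
  fst (corner n) <= fst (corner (S n)) /\ snd (corner n) <= snd (corner (S n)).
Proof.
  change (corner (S n)) with
    (quarter (corner n) ((a0' - a0) / 2 ^ S n) ((b0' - b0) / 2 ^ S n)).
  assert (Hw : 0 < (a0' - a0) / 2 ^ S n) by (apply Rdiv_lt_0_compat; [lra | apply pow_lt; lra]).
  assert (Hh : 0 < (b0' - b0) / 2 ^ S n) by (apply Rdiv_lt_0_compat; [lra | apply pow_lt; lra]).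
  destruct (corner n) as [a b]; unfold quarter.
  destruct (Rlt_dec _ _); [simpl; lra|]; destruct (Rlt_dec _ _); [cbn [fst snd]; lra|].
  destruct (Rlt_dec _ _); cbn [fst snd]; lra.
Qed.

Lemma cv_half_pow (x : R) : Un_cv (fun n => x / 2 ^ n) 0.
Proof.
  eapply cv_eq; [eapply CV_mult; [apply cv_const|]|].
  - apply cv_ext with (fun n => (/ 2) ^ n); [intros n; rewrite pow_inv; auto|].
    intros e He; destruct (pow_lt_1_zero (/ 2)) with (y := e) as [N HN]; auto.
    + rewrite Rabs_right; lra.
    + exists N; intros n Hn; unfold Rdist; rewrite Rminus_0_r; auto.
  - ring.
Qed.

(* Quartering the rectangle keeps a positive quarter, hence localises the positivity at a point;
   the last rectangle is cut into a grid chosen to achieve the aspect ratio [rho]. *)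
Lemma mixed_localise :
  exists s0 t0, a0 <= s0 <= a0' /\ b0 <= t0 <= b0' /\
  forall rho eta, 0 < rho -> 0 < eta ->
  exists s t i j, a0 <= s - i /\ s + i <= a0' /\ b0 <= t - j /\ t + j <= b0' /\
    0 < i < eta /\ 0 < j < eta /\ Rabs (s - s0) < eta /\ Rabs (t - t0) < eta /\
    Rabs (i / j - rho) < eta /\ 0 < mixed (s - i) (s + i) (t - j) (t + j).
Proof.
  assert (Hga : Un_growing (fun n => fst (corner n))) by (intros n; apply corner_mono).
  assert (Hgb : Un_growing (fun n => snd (corner n))) by (intros n; apply corner_mono).
  assert (Hw : forall n, 0 < (a0' - a0) / 2 ^ n)
    by (intros n; apply Rdiv_lt_0_compat; [lra | apply pow_lt; lra]).
  assert (Hh : forall n, 0 < (b0' - b0) / 2 ^ n)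
    by (intros n; apply Rdiv_lt_0_compat; [lra | apply pow_lt; lra]).
  destruct (growing_cv _ Hga) as [s0 Hs0].
  { exists a0'; intros x [n ->]; pose proof (corner_spec n) as H; simpl in H; specialize (Hw n); lra. }
  destruct (growing_cv _ Hgb) as [t0 Ht0].
  { exists b0'; intros x [n ->]; pose proof (corner_spec n) as H; simpl in H; specialize (Hh n); lra. }
  exists s0, t0; split; [|split].
  - pose proof (growing_ineq _ _ Hga Hs0 O) as H; simpl in H; split; [auto|].
    apply (cv_le (fun n => fst (corner n)) (fun _ => a0')); auto using cv_const.
    intros n; pose proof (corner_spec n) as H1; simpl in H1; specialize (Hw n); lra.
  - pose proof (growing_ineq _ _ Hgb Ht0 O) as H; simpl in H; split; [auto|].
    apply (cv_le (fun n => snd (corner n)) (fun _ => b0')); auto using cv_const.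
    intros n; pose proof (corner_spec n) as H1; simpl in H1; specialize (Hh n); lra.
  - intros rho eta Hrho Heta.
    destruct (Hs0 (eta / 2)) as [N1 HN1]; [lra|]; destruct (Ht0 (eta / 2)) as [N2 HN2]; [lra|].
    destruct (cv_ev_lt _ _ (eta / 2) (cv_half_pow (a0' - a0))) as [N3 HN3]; [lra|].
    destruct (cv_ev_lt _ _ (eta / 2) (cv_half_pow (b0' - b0))) as [N4 HN4]; [lra|].
    set (N := (N1 + N2 + N3 + N4)%nat).
    specialize (HN1 N ltac:(unfold N; lia)); specialize (HN2 N ltac:(unfold N; lia)).
    specialize (HN3 N ltac:(unfold N; lia)); specialize (HN4 N ltac:(unfold N; lia)).
    pose proof (corner_spec N) as HC; cbv zeta in HC.
    specialize (Hw N); specialize (Hh N).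
    set (w := (a0' - a0) / 2 ^ N) in *; set (h := (b0' - b0) / 2 ^ N) in *.
    set (a := fst (corner N)) in *; set (b := snd (corner N)) in *.
    (* The cells of an [m] by [n] grid have ratio [(w / m) / (h / n)], which is [rho] for
       [n = r * m]. Rounding [n] up costs at most [w / (h * m)], which the choice of [m] makes
       smaller than [eta]. *)
    set (r := rho * h / w).
    assert (Hr : 0 < r) by (unfold r; apply Rdiv_lt_0_compat; [nra | auto]).
    destruct (archimed_cor1 (Rmin (eta * h / w) r)) as [m [Hm Hm0]].
    { apply Rmin_pos; auto; apply Rdiv_lt_0_compat; [nra | auto]. }
    assert (Hm1 : / INR m < eta * h / w) by (eapply Rlt_le_trans; [exact Hm | apply Rmin_l]).
    assert (HmP : 0 < INR m) by (apply lt_0_INR; lia).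
    destruct (archimed (r * INR m)) as [Hup1 Hup2].
    assert (HupP : 0 < IZR (up (r * INR m))) by nra.
    apply lt_IZR in HupP.
    set (n := Z.to_nat (up (r * INR m))).
    assert (HnE : INR n = IZR (up (r * INR m))).
    { unfold n; rewrite INR_IZR_INZ, Z2Nat.id; auto; lia. }
    rewrite <- HnE in *.
    assert (HnP : 0 < INR n) by nra.
    destruct (mixed_split a b (w / INR m) (h / INR n) m n) as [k [l [Hk [Hl Hp]]]].
    { replace (INR m * (w / INR m)) with w by (field; lra).
      replace (INR n * (h / INR n)) with h by (field; lra); apply HC. }
    set (i := w / INR m / 2); set (j := h / INR n / 2).
    assert (Hi : 0 < i) by (unfold i; do 2 (apply Rdiv_lt_0_compat; [|lra]); auto).
    assert (Hj : 0 < j) by (unfold j; do 2 (apply Rdiv_lt_0_compat; [|lra]); auto).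
    assert (HwE : w = 2 * i * INR m) by (unfold i; field; lra).
    assert (HhE : h = 2 * j * INR n) by (unfold j; field; lra).
    assert (Hm1' : 1 <= INR m) by (change 1 with (INR 1); apply le_INR; lia).
    assert (Hn1' : 1 <= INR n).
    { change 1 with (INR 1); apply le_INR; destruct n; [simpl in HnP; lra | lia]. }
    assert (Hk1 : 0 <= INR k /\ INR k + 1 <= INR m).
    { split; [apply pos_INR|]; rewrite <- S_INR; apply le_INR; lia. }
    assert (Hl1 : 0 <= INR l /\ INR l + 1 <= INR n).
    { split; [apply pos_INR|]; rewrite <- S_INR; apply le_INR; lia. }
    rewrite !S_INR in Hp.
    replace (w / INR m) with (2 * i) in Hp by (unfold i; field; lra).
    replace (h / INR n) with (2 * j) in Hp by (unfold j; field; lra).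
    exists (a + (2 * INR k + 1) * i), (b + (2 * INR l + 1) * j), i, j.
    unfold Rdist in *; apply Rabs_def2 in HN1; apply Rabs_def2 in HN2.
    assert (B1 : 0 <= (2 * INR k + 1) * i <= w /\ 2 * INR k * i >= 0 /\ 2 * (INR k + 1) * i <= w)
      by (rewrite HwE; repeat split; nra).
    assert (B2 : 0 <= (2 * INR l + 1) * j <= h /\ 2 * INR l * j >= 0 /\ 2 * (INR l + 1) * j <= h)
      by (rewrite HhE; repeat split; nra).
    assert (i <= w) by nra; assert (j <= h) by nra.
    repeat split; try lra.
    + apply Rabs_def1; lra.
    + apply Rabs_def1; lra.
    + replace (i / j - rho) with (w / h * ((INR n - r * INR m) / INR m))
        by (unfold i, j, r; field; lra).
      assert (H1 : 0 <= (INR n - r * INR m) / INR m <= / INR m).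
      { split; [apply Rlt_le, Rdiv_lt_0_compat; lra|].
        unfold Rdiv; rewrite <- (Rmult_1_l (/ INR m)) at 2.
        apply Rmult_le_compat_r; [apply Rlt_le, Rinv_0_lt_compat; auto | lra]. }
      assert (Hwh : 0 < w / h) by (apply Rdiv_lt_0_compat; auto).
      rewrite Rabs_right by (apply Rle_ge, Rmult_le_pos; lra).
      apply Rle_lt_trans with (w / h * / INR m); [apply Rmult_le_compat_l; lra|].
      apply Rlt_le_trans with (w / h * (eta * h / w)); [apply Rmult_lt_compat_l; auto|].
      right; field; lra.
    + replace (a + (2 * INR k + 1) * i - i) with (a + INR k * (2 * i)) by ring.
      replace (a + (2 * INR k + 1) * i + i) with (a + (INR k + 1) * (2 * i)) by ring.
      replace (b + (2 * INR l + 1) * j - j) with (b + INR l * (2 * j)) by ring.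
      replace (b + (2 * INR l + 1) * j + j) with (b + (INR l + 1) * (2 * j)) by ring.
      exact Hp.
Qed.

End Rectangles.

(** * Geodesics *)

Definition geo {M : Type} (d : M -> M -> R) (e : R -> M) (l : R) : Prop :=
  forall u v, 0 <= u <= l -> 0 <= v <= l -> d (e u) (e v) = Rabs (u - v).

(* The cosq conditions cleared of denominators, after rescaling to [K = 1] or [-1]; in the cases
   [A = P] and [B = Q], where cosq is undefined, they hold with equality. *)
Definition upper4 (b : bool) {M : Type} (d : M -> M -> R) : Prop := forall A P B Q,
  sg b * ((1 + cs b (d A B)) * (cs b (d P Q) + cs b (d A P + d B Q)))
  <= sg b * ((cs b (d A P) + cs b (d P B)) * (cs b (d B Q) + cs b (d A Q))).

Definition lower4 (b : bool) {M : Type} (d : M -> M -> R) : Prop := forall A P B Q,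
  sg b * ((cs b (d A P) + cs b (d P B)) * (cs b (d B Q) + cs b (d A Q)))
  <= sg b * ((1 + cs b (d A B)) * (cs b (d P Q) + cs b (d A P - d B Q))).

Lemma mul_cancel (b : bool) (k x y : R) : 0 < k -> sg b * (k * x) <= sg b * (k * y) -> sg b * x <= sg b * y.
Proof. intros Hk H; apply (Rmult_le_reg_l k); [auto | lra]. Qed.

Section Space.
Variables (b : bool) (M : Type) (d : M -> M -> R).
Notation σ := (sg b).
Notation c := (cs b).
Notation s := (sn b).
Hypothesis Hd : semimetric d.
Hypothesis Hdiam : b = true -> diam_le d (PI / 2).
Hypothesis H4 : upper4 b d \/ lower4 b d.

Lemma d_sym (x y : M) : d x y = d y x.
Proof. apply Hd. Qed.

Lemma d_pos (x y : M) : 0 <= d x y.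
Proof. apply Hd. Qed.

Lemma d_eq (x y : M) : d x y = 0 -> x = y.
Proof. apply Hd. Qed.

Lemma d_refl (x : M) : d x x = 0.
Proof. now apply Hd. Qed.

Lemma d_le (x y : M) : b = true -> d x y <= PI / 2.
Proof. intros E; now apply Hdiam. Qed.

Lemma c_nonneg (x y : M) : 0 <= c (d x y).
Proof.
  apply cs_nonneg; intros E; pose proof (d_le x y E); pose proof (d_pos x y);
    pose proof PI_RGT_0; lra.
Qed.

Lemma c_abs (x : R) : c (Rabs x) = c x.
Proof. unfold Rabs; destruct (Rcase_abs x); [apply cs_neg | auto]. Qed.

(** Quadruples with a repeated point suffice: [A P B P] for the upper and [A P P B] for the lower
    condition compare [d A B] with the difference of the distances to [P]. In the upper case one
    divides by the square of [cs] at half the sum of these distances; it is 0 only if both are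
    [pi / 2], and then they are equal. *)
Lemma triangle_of_4point : triangle_ineq d.
Proof.
  assert (H : forall A B P, Rabs (d A P - d B P) <= d A B).
  { intros A B P; pose proof (d_pos A P); pose proof (d_pos B P); pose proof (d_pos A B).
    pose proof PI_RGT_0 as HPI.
    assert (Hab : b = true -> Rabs (d A P - d B P) <= PI).
    { intros E; pose proof (d_le A P E); pose proof (d_le B P E); apply Rabs_le; lra. }
    assert (Hok : b = true -> d A B <= PI)
      by (intros E; pose proof (d_le A B E); lra).
    destruct H4 as [HU|HL].
    - destruct (classic (b = true /\ d A P + d B P = PI)) as [[E1 E2]|E0].
      { pose proof (d_le A P E1); pose proof (d_le B P E1).
        replace (d A P - d B P) with 0 by lra; rewrite Rabs_R0; auto. }
      apply (cs_anti_inv b); auto using Rabs_pos.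
      rewrite c_abs; specialize (HU A P B P).
      rewrite d_refl, cs_0, (d_sym P B) in HU.
      rewrite (Rplus_comm (c (d B P))), (cs_double b (_ + _)), (cs_sum b (d A P) (d B P)) in HU.
      assert (E : c (d A P - d B P)
         = 2 * (c ((d A P - d B P) / 2) * c ((d A P - d B P) / 2)) - 1)
        by (pose proof (cs_double b (d A P - d B P)); lra).
      rewrite E; set (C := c ((d A P + d B P) / 2)) in *; set (C' := c ((d A P - d B P) / 2)) in *.
      assert (HC : 0 < C).
      { apply cs_pos; intros Eb; pose proof (d_le A P Eb); pose proof (d_le B P Eb).
        assert (d A P + d B P <> PI) by (intros E3; apply E0; auto); lra. }
      assert (σ * (1 + c (d A B)) <= σ * (2 * (C' * C'))); [|lra].
      apply (mul_cancel b (2 * (C * C))); [nra|]; lra.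
    - specialize (HL A P P B); rewrite d_refl, cs_0, (d_sym P B) in HL.
      apply (cs_anti_inv b); auto using Rabs_pos.
      rewrite c_abs; assert (HC : 0 < 1 + c (d A P)) by (pose proof (c_nonneg A P); lra).
      assert (σ * (c (d B P) + c (d A B)) <= σ * (c (d B P) + c (d A P - d B P))); [|lra].
      apply (mul_cancel b (1 + c (d A P))); lra. }
  intros P Q S; specialize (H P Q S); pose proof (Rle_abs (d P S - d Q S)); lra.
Qed.

Definition btw (A B : M) (u : R) (C : M) : Prop := d A C = u /\ d C B = d A B - u.

(** In the quadruples [A D C B] (upper) and [C A D B] (lower) only [d C D] is unknown, and for
    points on a line both conditions are equalities. The case [u = v] is the uniqueness of the point
    at a given parameter. *)
Lemma btw_dist_le (A B C D : M) (u v : R) :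
  0 <= u <= v -> v <= d A B -> btw A B u C -> btw A B v D -> d C D <= v - u.
Proof.
  intros Huv Hv [HC1 HC2] [HD1 HD2].
  pose proof PI_RGT_0 as HPI; pose proof (d_le A B) as Hl.
  destruct (Req_dec u 0) as [E|Hu].
  { rewrite E in HC1; apply d_eq in HC1; subst C; lra. }
  destruct (Req_dec v (d A B)) as [E|Hv2].
  { replace (d A B - v) with 0 in HD2 by lra; apply d_eq in HD2; subst D; lra. }
  assert (Hok : b = true -> d C D <= PI) by (intros E; pose proof (d_le C D E); lra).
  apply (cs_anti_inv b); auto using d_pos; try lra.
  set (l := d A B) in *.
  destruct H4 as [HU|HL].
  - specialize (HU A D C B); fold l in HU.
    rewrite HC1, HC2, HD1, HD2, (d_sym D C) in HU.
    rewrite (cs_double b u), (cs_sum b (l - v)), (Rplus_comm (c (l - u))), (cs_sum b l (l - u)) in HU.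
    replace ((l - v + (v + (l - u))) / 2) with (l - u / 2) in HU by field.
    replace ((l - v - (v + (l - u))) / 2) with (- (v - u / 2)) in HU by field.
    replace ((l + (l - u)) / 2) with (l - u / 2) in HU by field.
    replace ((l - (l - u)) / 2) with (u / 2) in HU by field.
    rewrite cs_neg in HU.
    assert (E : c (v - u) = 2 * c (v - u / 2) * c (u / 2) - c v).
    { pose proof (cs_sum b v (v - u)) as E.
      replace ((v + (v - u)) / 2) with (v - u / 2) in E by field.
      replace ((v - (v - u)) / 2) with (u / 2) in E by field; lra. }
    assert (H1 : 0 < c (l - u / 2)) by (apply cs_pos; intros Eb; specialize (Hl Eb); lra).
    assert (H2 : 0 < c (u / 2)) by (apply cs_pos; intros Eb; specialize (Hl Eb); lra).
    rewrite E; assert (σ * (2 * c (v - u / 2) * c (u / 2)) <= σ * (c v + c (d C D))); [|lra].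
    apply (mul_cancel b (2 * c (l - u / 2) * c (u / 2))); [|lra].
    repeat apply Rmult_lt_0_compat; lra.
  - specialize (HL C A D B); fold l in HL.
    rewrite (d_sym C A), HC1, HC2, HD1, HD2 in HL.
    rewrite (cs_sum b u v), (cs_sum b (l - v)), (cs_sum b l (u - (l - v))) in HL.
    replace ((l - v + (l - u)) / 2) with (l - (u + v) / 2) in HL by field.
    replace ((l - v - (l - u)) / 2) with ((u - v) / 2) in HL by field.
    replace ((l + (u - (l - v))) / 2) with ((u + v) / 2) in HL by field.
    replace ((l - (u - (l - v))) / 2) with (l - (u + v) / 2) in HL by field.
    assert (E : 1 + c (v - u) = 2 * (c ((u - v) / 2) * c ((u - v) / 2))).
    { rewrite cs_double; replace ((v - u) / 2) with (- ((u - v) / 2)) by field.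
      now rewrite cs_neg. }
    assert (H1 : 0 < c (l - (u + v) / 2)) by (apply cs_pos; intros Eb; specialize (Hl Eb); lra).
    assert (H2 : 0 < c ((u + v) / 2)) by (apply cs_pos; intros Eb; specialize (Hl Eb); lra).
    assert (σ * (1 + c (v - u)) <= σ * (1 + c (d C D))); [|lra].
    rewrite E; apply (mul_cancel b (2 * c (l - (u + v) / 2) * c ((u + v) / 2))); [|lra].
    repeat apply Rmult_lt_0_compat; lra.
Qed.

Lemma btw_dist (A B C D : M) (u v : R) :
  0 <= u <= v -> v <= d A B -> btw A B u C -> btw A B v D -> d C D = v - u.
Proof.
  intros Huv Hv HC HD; apply Rle_antisym; [apply (btw_dist_le A B); auto|].
  pose proof (triangle_of_4point A C D); destruct HC as [HC _]; destruct HD as [HD _]; lra.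
Qed.

Lemma cs_to_one (u : nat -> R) (v : nat -> R) :
  (forall n, 0 <= u n) -> (b = true -> forall n, u n <= PI / 2) ->
  (forall n, v n <= σ * c (u n)) -> Un_cv v σ -> Un_cv u 0.
Proof.
  intros Hu Hu2 Hv Hl e He; pose proof PI2_1.
  assert (He2 : 0 < Rmin e 1) by (apply Rmin_pos; lra).
  pose proof (Rmin_l e 1); pose proof (Rmin_r e 1).
  destruct (cv_ev_gt v σ (σ * c (Rmin e 1)) Hl) as [N HN].
  { pose proof (cs_anti_lt b 0 (Rmin e 1)) as H2; rewrite cs_0, Rmult_1_r in H2.
    apply H2; intros; lra. }
  exists N; intros n Hn; specialize (HN n Hn); unfold Rdist; rewrite Rminus_0_r, Rabs_right
    by (apply Rle_ge; auto).
  specialize (Hv n); apply Rnot_le_lt; intros Hle.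
  pose proof (cs_anti_le b (Rmin e 1) (u n) ltac:(lra)) as H3.
  lapply H3; [lra | intros E; specialize (Hu2 E n); lra].
Qed.

(** The limit form of the uniqueness in [btw_dist_le], with the same quadruples, since weak
    convexity yields only approximate points. The four-point bound forces the cosine of the distance
    to tend to 1. *)
Lemma approx_btw_close (A B : M) (C D : nat -> M) (u : R) :
  0 < u < d A B ->
  Un_cv (fun n => d A (C n)) u -> Un_cv (fun n => d (C n) B) (d A B - u) ->
  Un_cv (fun n => d A (D n)) u -> Un_cv (fun n => d (D n) B) (d A B - u) ->
  Un_cv (fun n => d (C n) (D n)) 0.
Proof.
  intros Hu HC1 HC2 HD1 HD2; set (l := d A B) in *.
  pose proof PI_RGT_0 as HPI; pose proof (d_le A B) as Hl; fold l in Hl.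
  destruct H4 as [HU|HL].
  - assert (P1 : 0 < c (l - u)) by (apply cs_pos; intros Eb; specialize (Hl Eb); lra).
    assert (P2 : 0 <= c l) by (apply c_nonneg).
    apply cv_ext with (fun n => d (C n) (D n)); [auto|].
    assert (Hden : Un_cv (fun n => c (d (C n) B) + c l) (c (l - u) + c l)) by cv.
    destruct (cv_ev_gt _ _ 0 Hden ltac:(lra)) as [N HN].
    (* The shift by [N] reaches the range where the denominator is positive. *)
    assert (HS : Un_cv (fun n => d (C (n + N)%nat) (D (n + N)%nat)) 0).
    { apply cs_to_one with (fun n => σ * ((1 + c (d A (C (n + N)%nat))) * (c (d (D (n + N)%nat) B)
          + c (d A (D (n + N)%nat) + d (C (n + N)%nat) B)) / (c (d (C (n + N)%nat) B) + c l)
          - c (d A (D (n + N)%nat)))).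
      - intros; apply d_pos.
      - intros E n; apply d_le; auto.
      - intros n; specialize (HN (n + N)%nat ltac:(lia)); cbv beta in HN.
        specialize (HU A (D (n + N)%nat) (C (n + N)%nat) B); fold l in HU.
        rewrite (d_sym (D _) (C _)) in HU.
        apply (mul_cancel b (c (d (C (n + N)%nat) B) + c l)); [auto|].
        match goal with |- ?x <= _ => eapply Rle_trans with (r2 := _) end; [right|].
        2:{ apply (Rplus_le_compat_r (- (σ * (c (d A (D (n + N)%nat)) * (c (d (C (n + N)%nat) B) + c l))))) in HU.
            eapply Rle_trans; [exact HU | right; ring]. }
        field; lra.
      - pose proof (cv_sub _ _ (fun n => n + N)%nat (fun n => Nat.le_add_r n N) HC1).
        pose proof (cv_sub _ _ (fun n => n + N)%nat (fun n => Nat.le_add_r n N) HC2).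
        pose proof (cv_sub _ _ (fun n => n + N)%nat (fun n => Nat.le_add_r n N) HD1).
        pose proof (cv_sub _ _ (fun n => n + N)%nat (fun n => Nat.le_add_r n N) HD2).
        eapply cv_eq; [cv; lra|].
        replace (u + (l - u)) with l by ring; field; lra. }
    intros e He; destruct (HS e He) as [N2 HN2]; exists (N + N2)%nat; intros n Hn.
    specialize (HN2 (n - N)%nat ltac:(lia)); replace (n - N + N)%nat with n in HN2 by lia; auto.
  - assert (P0 : 0 < c l + c (u - (l - u))).
    { assert (0 < c (u - (l - u))) by (apply cs_pos; intros Eb; specialize (Hl Eb); lra).
      pose proof (c_nonneg A B); fold l in H0; lra. }
    assert (Hden : Un_cv (fun n => c l + c (d A (C n) - d (D n) B)) (c l + c (u - (l - u)))) by cv.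
    destruct (cv_ev_gt _ _ 0 Hden P0) as [N HN].
    assert (HS : Un_cv (fun n => d (C (n + N)%nat) (D (n + N)%nat)) 0).
    { apply cs_to_one with (fun n => σ * ((c (d A (C (n + N)%nat)) + c (d A (D (n + N)%nat)))
          * (c (d (D (n + N)%nat) B) + c (d (C (n + N)%nat) B))
            / (c l + c (d A (C (n + N)%nat) - d (D (n + N)%nat) B)) - 1)).
      - intros; apply d_pos.
      - intros E n; apply d_le; auto.
      - intros n; specialize (HN (n + N)%nat ltac:(lia)); cbv beta in HN.
        specialize (HL (C (n + N)%nat) A (D (n + N)%nat) B); fold l in HL.
        rewrite (d_sym (C _) A) in HL.
        set (den := c l + c (d A (C (n + N)%nat) - d (D (n + N)%nat) B)) in *.
        apply (mul_cancel b den); [auto|].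
        match goal with |- ?x <= _ => eapply Rle_trans with (r2 := _) end; [right|].
        2:{ apply (Rplus_le_compat_r (- (σ * den))) in HL.
            eapply Rle_trans; [exact HL | right; ring]. }
        field; lra.
      - pose proof (cv_sub _ _ (fun n => n + N)%nat (fun n => Nat.le_add_r n N) HC1).
        pose proof (cv_sub _ _ (fun n => n + N)%nat (fun n => Nat.le_add_r n N) HC2).
        pose proof (cv_sub _ _ (fun n => n + N)%nat (fun n => Nat.le_add_r n N) HD1).
        pose proof (cv_sub _ _ (fun n => n + N)%nat (fun n => Nat.le_add_r n N) HD2).
        eapply cv_eq; [cv; lra|].
        replace (c l + c (u - (l - u))) with (2 * c u * c (l - u)) in *.
        { field; split; intros E; rewrite E in P0; lra. }
        { rewrite (cs_sum b l); replace ((l + (u - (l - u))) / 2) with u by field.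
          replace ((l - (u - (l - u))) / 2) with (l - u) by field; auto. } }
    intros e He; destruct (HS e He) as [N2 HN2]; exists (N + N2)%nat; intros n Hn.
    specialize (HN2 (n - N)%nat ltac:(lia)); replace (n - N + N)%nat with n in HN2 by lia; auto.
Qed.

Hypothesis Hcc : cauchy_complete d.

Definition approx_btw (A B : M) (u : R) : Prop :=
  forall eps, 0 < eps -> exists C, Rabs (d A C - u) < eps /\ Rabs (d C B - (d A B - u)) < eps.

Lemma limit_dist (A L : M) (C : nat -> M) (u : R) :
  is_limit d C L -> Un_cv (fun n => d A (C n)) u -> d A L = u.
Proof.
  intros HL HC; apply (UL_sequence (fun n => d A (C n))); auto.
  intros e He; destruct (HL e He) as [N HN]; exists N; intros n Hn; specialize (HN n Hn).
  pose proof (triangle_of_4point A (C n) L); pose proof (triangle_of_4point A L (C n)).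
  rewrite (d_sym L (C n)) in *; unfold Rdist; apply Rabs_def1; lra.
Qed.

(** Any two sequences of approximate points come together by [approx_btw_close]; applied to pairs of
    far apart terms of a single sequence, this gives the Cauchy property. *)
Lemma btw_of_approx (A B : M) (u : R) :
  0 < u < d A B -> approx_btw A B u -> exists C, btw A B u C.
Proof.
  intros Hu HA.
  assert (Hex : forall n, exists C, Rabs (d A C - u) < / INR (S n)
                            /\ Rabs (d C B - (d A B - u)) < / INR (S n))
    by (intros n; apply HA, inv_nat_pos).
  destruct (choice _ Hex) as [C HC].
  assert (H1 : Un_cv (fun n => d A (C n)) u).
  { apply cv_squeeze with (fun n => / INR (S n)); [|apply cv_inv_nat].
    intros n; apply Rlt_le, HC. }
  assert (H2 : Un_cv (fun n => d (C n) B) (d A B - u)).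
  { apply cv_squeeze with (fun n => / INR (S n)); [|apply cv_inv_nat].
    intros n; apply Rlt_le, HC. }
  assert (HCau : is_cauchy d C).
  { apply NNPP; intros HN; apply not_all_ex_not in HN; destruct HN as [e HN].
    apply imply_to_and in HN; destruct HN as [He HN].
    assert (Hmn : forall N, exists p : nat * nat,
               (N <= fst p)%nat /\ (N <= snd p)%nat /\ e <= d (C (fst p)) (C (snd p))).
    { intros N; apply NNPP; intros Hno; apply HN; exists N; intros m n Hm Hn.
      apply Rnot_le_lt; intros Hle; apply Hno; exists (m, n); auto. }
    destruct (choice _ Hmn) as [p Hp].
    assert (Hz : Un_cv (fun n => d (C (fst (p n))) (C (snd (p n)))) 0).
    { apply (approx_btw_close A B (fun n => C (fst (p n))) (fun n => C (snd (p n))) u); auto.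
      - apply (cv_sub (fun n => d A (C n)) u (fun n => fst (p n))); auto; apply Hp.
      - apply (cv_sub (fun n => d (C n) B) _ (fun n => fst (p n))); auto; apply Hp.
      - apply (cv_sub (fun n => d A (C n)) u (fun n => snd (p n))); auto; apply Hp.
      - apply (cv_sub (fun n => d (C n) B) _ (fun n => snd (p n))); auto; apply Hp. }
    pose proof (cv_le (fun _ => e) _ e 0 (fun n => proj2 (proj2 (Hp n))) (cv_const e) Hz); lra. }
  destruct (Hcc C HCau) as [L HL]; exists L; split.
  - eapply limit_dist; eauto.
  - rewrite d_sym; apply (limit_dist B L C); auto.
    apply cv_ext with (fun n => d (C n) B); auto; intros; apply d_sym.
Qed.

Lemma btw_0 (A B : M) : btw A B 0 A.
Proof. split; [apply d_refl | ring]. Qed.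

Lemma btw_end (A B : M) : btw A B (d A B) B.
Proof. split; [auto | rewrite d_refl; ring]. Qed.

Lemma btw_swap (A B C : M) (u : R) : btw A B u C -> btw B A (d A B - u) C.
Proof.
  intros [H1 H2]; split; [rewrite d_sym; auto|].
  rewrite d_sym, (d_sym B A), H1; ring.
Qed.

(** The attained parameters form a closed set by [btw_of_approx], so their supremum is attained. *)
Lemma btw_largest_below (A B : M) (t : R) : 0 <= t < d A B ->
  exists u C, 0 <= u <= t /\ btw A B u C /\
    forall v D, 0 <= v <= t -> btw A B v D -> v <= u.
Proof.
  intros Ht; set (E := fun u => 0 <= u <= t /\ exists C, btw A B u C).
  destruct (completeness E) as [u [Hub Hl]].
  { exists t; intros x [Hx _]; lra. }
  { exists 0; split; [lra|]; exists A; apply btw_0. }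
  assert (Hu0 : 0 <= u) by (apply Hub; split; [lra|]; exists A; apply btw_0).
  assert (Hut : u <= t) by (apply Hl; intros x [Hx _]; lra).
  assert (HC : exists C, btw A B u C).
  { destruct (Req_dec u 0) as [->|Hu]; [exists A; apply btw_0|].
    apply btw_of_approx; [lra|]; intros e He.
    assert (Hx : exists x, E x /\ u - e < x).
    { apply NNPP; intros Hno; assert (u <= u - e); [|lra].
      apply Hl; intros x Hx; apply Rnot_lt_le; intros Hlt; apply Hno; eauto. }
    destruct Hx as [x [[Hx1 [C [HC1 HC2]]] Hx2]].
    assert (x <= u) by (apply Hub; split; auto; exists C; split; auto).
    exists C; rewrite HC1, HC2; split; apply Rabs_def1; lra. }
  destruct HC as [C HC]; exists u, C; repeat split; auto; try apply HC.
  intros v D Hv HD; apply Hub; split; eauto.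
Qed.

Hypothesis Hwc : weakly_convex d.

(** The ratio in weak convexity depends on the pair of points, which rules out plain bisection.
    Instead, if [t] is not attained, the attained parameters nearest to it on both sides bound a
    gap, and weak convexity of the corresponding points puts a point into this gap. *)
Lemma btw_exists (A B : M) (t : R) : 0 <= t <= d A B -> exists C, btw A B t C.
Proof.
  intros Ht; destruct (Req_dec t 0) as [->|Ht0]; [exists A; apply btw_0|].
  destruct (Req_dec t (d A B)) as [->|Htl]; [exists B; apply btw_end|].
  destruct (btw_largest_below A B t) as [u [C [Hu [HC HCm]]]]; [lra|].
  (* The largest attained parameter counted from [B] is the least one above [t] counted from [A]. *)
  destruct (btw_largest_below B A (d A B - t)) as [w [D [Hw [HD HDm]]]];
    [rewrite (d_sym B A); lra|].
  apply btw_swap in HD; rewrite (d_sym B A) in HD; set (v := d A B - w) in *.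
  destruct (Req_dec u t) as [<-|Hut]; [eauto|].
  destruct (Req_dec v t) as [<-|Hvt]; [eauto|].
  exfalso; assert (Hvt2 : t < v) by (unfold v in *; lra).
  pose proof (btw_dist A B C D u v ltac:(lra) ltac:(unfold v; lra) HC HD) as HCD.
  destruct (Hwc C D) as [lam [Hlam Hap]]; rewrite HCD in Hap.
  set (x := u + lam * (v - u)).
  assert (Hx : u < x < v) by (unfold x; split; nra).
  destruct HC as [HC1 HC2]; destruct HD as [HD1 HD2].
  assert (HxE : exists X, btw A B x X).
  { apply btw_of_approx; [unfold v in *; lra|]; intros e He.
    destruct (Hap e He) as [X [HX1 HX2]]; exists X.
    apply Rabs_def2 in HX1; apply Rabs_def2 in HX2.
    pose proof (triangle_of_4point A C X); pose proof (triangle_of_4point X D B).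
    pose proof (triangle_of_4point A X B); rewrite (d_sym X D) in *.
    unfold x; split; apply Rabs_def1; lra. }
  destruct HxE as [X HX]; destruct (Rle_dec x t) as [Hxt|Hxt].
  - pose proof (HCm x X ltac:(lra) HX); lra.
  - apply btw_swap in HX; pose proof (HDm (d A B - x) X ltac:(unfold v in *; lra) HX).
    unfold v in *; lra.
Qed.

(** The points are chosen independently for each parameter; [btw_dist] makes every such choice
    isometric. *)
Lemma geo_exists (A B : M) : exists e, geo d e (d A B) /\ e 0 = A /\ e (d A B) = B.
Proof.
  assert (Hex : forall u, exists C, 0 <= u <= d A B -> btw A B u C).
  { intros u; destruct (classic (0 <= u <= d A B)) as [H|H].
    - destruct (btw_exists A B u H) as [C HC]; eauto.
    - exists A; tauto. }
  destruct (choice _ Hex) as [e He]; exists e; pose proof (d_pos A B); split; [|split].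
  - intros u v Hu Hv; destruct (Rle_dec u v) as [Huv|Huv].
    + rewrite (btw_dist A B (e u) (e v) u v), Rabs_minus_sym, Rabs_right; auto; lra.
    + rewrite d_sym, (btw_dist A B (e v) (e u) v u), Rabs_right; auto; lra.
  - symmetry; apply d_eq, (He 0); lra.
  - apply d_eq; destruct (He (d A B)) as [_ E]; lra.
Qed.

Lemma geo_btw (e : R -> M) (l u : R) : 0 <= u <= l -> geo d e l -> btw (e 0) (e l) u (e u).
Proof.
  intros Hu He; split; [|]; rewrite !He; try lra.
  - rewrite Rabs_minus_sym, Rminus_0_r, Rabs_right; lra.
  - rewrite !Rabs_left1; lra.
Qed.

Lemma geo_unique (e e' : R -> M) (l : R) : geo d e l -> geo d e' l -> e 0 = e' 0 -> e l = e' l ->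
  forall u, 0 <= u <= l -> e u = e' u.
Proof.
  intros He He' E0 El u Hu; apply d_eq, Rle_antisym; [|apply d_pos].
  rewrite <- (Rminus_diag u).
  apply (btw_dist_le (e 0) (e l)); [lra| |apply geo_btw; auto|rewrite E0, El; apply geo_btw; auto].
  rewrite He, Rabs_left1; lra.
Qed.

End Space.

(** * Model angles along two geodesics *)

Lemma sn_half (b : bool) (x : R) : 0 <= x <= 1 -> x / 2 <= sn b x.
Proof.
  intros Hx; destruct (Req_dec x 0) as [->|Hx0]; [rewrite sn_0; lra|].
  destruct (MVT_cor2 (sn b) (cs b) 0 x) as [z [Hz Hz2]];
    [lra | intros; apply derivable_sn|].
  rewrite sn_0, !Rminus_0_r in Hz; rewrite Hz.
  assert (1 / 2 <= cs b z); [|nra].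
  unfold cs; destruct b; [|pose proof (cosh_ge_1 z); lra].
  rewrite <- cos_PI3; apply cos_decr_1; pose proof PI2_3_2; pose proof PI2_1; try lra.
Qed.

Lemma sq_le_of_abs (x u : R) : Rabs x <= u -> x * x <= u * u.
Proof. unfold Rabs; destruct (Rcase_abs x); nra. Qed.

Lemma sn_add_half (b : bool) (x y : R) :
  (cs b x + cs b y) * sn b (x + y) = (1 + cs b (x + y)) * (sn b x + sn b y).
Proof.
  rewrite cs_add, sn_add; pose proof (pyth b x) as E1; pose proof (pyth b y) as E2.
  assert (F1 : sg b * (sn b x * sn b x) = 1 - cs b x * cs b x) by lra.
  assert (F2 : sg b * (sn b y * sn b y) = 1 - cs b y * cs b y) by lra.
  transitivity ((cs b x * cs b y + 1) * (sn b x + sn b y)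
    - sn b y * (sg b * (sn b x * sn b x)) - sn b x * (sg b * (sn b y * sn b y))); [|ring].
  rewrite F1, F2; ring.
Qed.

Lemma cs_mul_half (b : bool) (x y : R) :
  (1 + cs b (x - y)) * (1 + cs b (x + y)) = (cs b x + cs b y) * (cs b x + cs b y).
Proof.
  rewrite cs_add, cs_sub; pose proof (pyth b x) as E1; pose proof (pyth b y) as E2.
  assert (F1 : sn b x * sn b x = sg b * (1 - cs b x * cs b x)) by apply sn_sq.
  assert (F2 : sn b y * sn b y = sg b * (1 - cs b y * cs b y)) by apply sn_sq.
  transitivity ((1 + cs b x * cs b y) * (1 + cs b x * cs b y)
    - (sg b * sg b) * ((sn b x * sn b x) * (sn b y * sn b y))); [ring|].
  rewrite F1, F2, sg_sq.
  transitivity ((1 + cs b x * cs b y) * (1 + cs b x * cs b y)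
    - (sg b * sg b) * ((1 - cs b x * cs b x) * (1 - cs b y * cs b y))); [ring|].
  rewrite sg_sq; ring.
Qed.

Section Distance.
Variables (M : Type) (d : M -> M -> R).
Hypothesis Hd : semimetric d.
Hypothesis Htri : triangle_ineq d.
Notation dsym := (d_sym M d Hd).

Lemma dist_lip (x y z : M) : Rabs (d x y - d x z) <= d y z.
Proof.
  pose proof (Htri x y z); pose proof (Htri x z y); rewrite (dsym z y) in *.
  apply Rabs_le; lra.
Qed.

Lemma cv_hinge (e1 e2 : R -> M) (l1 l2 : R) (xn yn : nat -> R) (x y : R) :
  geo d e1 l1 -> geo d e2 l2 -> Un_cv xn x -> Un_cv yn y -> 0 <= x <= l1 -> 0 <= y <= l2 ->
  (forall n, 0 <= xn n <= l1) -> (forall n, 0 <= yn n <= l2) ->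
  Un_cv (fun n => d (e1 (xn n)) (e2 (yn n))) (d (e1 x) (e2 y)).
Proof.
  intros He1 He2 Hx Hy Bx By Bxn Byn.
  apply cv_squeeze with (fun n => Rabs (xn n - x) + Rabs (yn n - y)).
  - intros n; rewrite <- (He1 (xn n) x), <- (He2 (yn n) y); auto.
    pose proof (Htri (e1 (xn n)) (e1 x) (e2 (yn n))); pose proof (Htri (e1 x) (e2 y) (e2 (yn n))).
    pose proof (Htri (e1 x) (e1 (xn n)) (e2 y)); pose proof (Htri (e1 (xn n)) (e2 (yn n)) (e2 y)).
    rewrite (dsym (e1 x) (e1 (xn n))), (dsym (e2 y) (e2 (yn n))) in *; apply Rabs_le; lra.
  - assert (Z : forall u l, Un_cv u l -> Un_cv (fun n => Rabs (u n - l)) 0).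
    { intros u l H eps He; destruct (H eps He) as [N HN]; exists N; intros n Hn; specialize (HN n Hn).
      unfold Rdist in *; rewrite Rminus_0_r, Rabs_Rabsolu; auto. }
    eapply cv_eq; [apply CV_plus; apply Z; eauto | ring].
Qed.

Lemma geo_0 (e : R -> M) (l u : R) : geo d e l -> 0 <= u <= l -> d (e 0) (e u) = u.
Proof. intros He Hu; rewrite He, Rabs_left1; lra. Qed.

Lemma hinge_bounds (e1 e2 : R -> M) (l1 l2 s t : R) : geo d e1 l1 -> geo d e2 l2 -> e1 0 = e2 0 ->
  0 <= s <= l1 -> 0 <= t <= l2 -> Rabs (s - t) <= d (e1 s) (e2 t) <= s + t.
Proof.
  intros He1 He2 E Hs Ht.
  pose proof (geo_0 e1 l1 s He1 Hs) as D1; pose proof (geo_0 e2 l2 t He2 Ht) as D2.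
  rewrite E in D1; pose proof (Htri (e1 s) (e2 0) (e2 t)); pose proof (Htri (e2 0) (e1 s) (e2 t)).
  pose proof (Htri (e2 0) (e2 t) (e1 s)); rewrite (dsym (e1 s) (e2 0)) in *.
  rewrite (dsym (e2 t) (e1 s)) in *; split; [apply Rabs_le|]; lra.
Qed.

End Distance.

Section Space.
Variables (b : bool) (M : Type) (d : M -> M -> R).
Notation σ := (sg b).
Notation c := (cs b).
Notation s := (sn b).
Hypothesis Hd : semimetric d.
Hypothesis Hdiam : b = true -> diam_le d (PI / 2).
Hypothesis H4 : upper4 b d \/ lower4 b d.

Notation dsym := (d_sym M d Hd).
Notation dpos := (d_pos M d Hd).
Notation tri := (triangle_of_4point b M d Hd Hdiam H4).
Notation dlip := (dist_lip M d Hd tri).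

Lemma geo_len (e : R -> M) (l : R) : geo d e l -> 0 <= l -> b = true -> l <= PI / 2.
Proof.
  intros He Hl E; pose proof (d_le b M d Hdiam (e 0) (e l) E) as H.
  rewrite He, Rabs_left1 in H by lra; lra.
Qed.

Lemma geo_sn_pos (e : R -> M) (l u : R) : geo d e l -> 0 < u <= l -> 0 < s u.
Proof.
  intros He Hu; pose proof PI_RGT_0; apply sn_pos; [lra|]; intros E.
  pose proof (geo_len e l He ltac:(lra) E); lra.
Qed.

Section TwoGeodesics.
Variables (e1 e2 : R -> M) (l1 l2 : R).
Hypothesis He1 : geo d e1 l1.
Hypothesis He2 : geo d e2 l2.
Hypothesis HO : e1 0 = e2 0.

(** The law of cosines of the model plane, solved for the angle at the common origin. *)
Definition cos_angle (u t : R) : R := σ * (c (d (e1 u) (e2 t)) - c u * c t) / (s u * s t).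

(** Three of the four points lie on [e2], at 0, [t] and [r], so the four-point condition relates
    [d (e1 u) (e2 t)] to [d (e1 u) (e2 r)]. Since [eta = r - d (e1 u) (e2 r)] is at most [u] in
    absolute value, [1 - cs u] and [1 - cs eta] are quadratic errors. *)
Lemma distance_first_order (t r : R) : 0 < t < r -> r <= l2 -> exists C, 0 <= C /\
  forall u, 0 < u <= 1 -> u <= l1 ->
    σ * c t + s t * s (r - d (e1 u) (e2 r)) - C * (u * u) <= σ * c (d (e1 u) (e2 t)).
Proof.
  intros Htr Hr.
  assert (Hl2 : b = true -> r <= PI / 2)
    by (intros E; pose proof (geo_len e2 l2 He2 ltac:(lra) E); lra).
  pose proof PI_RGT_0 as HPI.
  set (Q := cosh 1 * cosh 1).
  assert (HQ : 0 <= Q) by (unfold Q; pose proof (cosh_ge_1 1); nra).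
  assert (Hx : forall u, 0 < u <= 1 -> u <= l1 ->
    Rabs (1 - c u) <= Q * (u * u) /\ Rabs (1 - c (r - d (e1 u) (e2 r))) <= Q * (u * u)).
  { intros u Hu Hul; split; [apply cs_small; rewrite Rabs_right; lra|].
    assert (Heta : Rabs (r - d (e1 u) (e2 r)) <= u).
    { pose proof (dlip (e2 r) (e1 0) (e1 u)) as H.
      rewrite (geo_0 M d e1 l1), HO, (dsym (e2 r) (e2 0)), (geo_0 M d e2 l2), (dsym (e2 r)) in H; auto; lra. }
    eapply Rle_trans; [apply (cs_small b _ 1); lra|].
    fold Q; apply Rmult_le_compat_l; [auto|].
    apply sq_le_of_abs; auto. }
  (* Both conditions lead to this shape, with a positive weight [w] and coefficients [k1], [k2] of
     the two quadratic errors. *)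
  assert (Hfin : forall w k1 k2 (v' : R -> R), 0 < w ->
    (forall u, 0 < u <= 1 -> u <= l1 ->
      σ * (w * (c t + σ * (s t * s (r - d (e1 u) (e2 r)))) - k1 * (1 - c u)
           - k2 * (1 - c (r - d (e1 u) (e2 r)))) <= σ * (w * v' u)) ->
    exists C, 0 <= C /\ forall u, 0 < u <= 1 -> u <= l1 ->
      σ * c t + s t * s (r - d (e1 u) (e2 r)) - C * (u * u) <= σ * v' u).
  { intros w k1 k2 v' Hw H; exists ((Rabs k1 + Rabs k2) * Q / w); split.
    { pose proof (Rabs_pos k1); pose proof (Rabs_pos k2).
      apply Rmult_le_pos; [nra | apply Rlt_le, Rinv_0_lt_compat; auto]. }
    intros u Hu Hul; specialize (H u Hu Hul); destruct (Hx u Hu Hul) as [Hx1 Hx2].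
    apply (Rmult_le_reg_l w); [auto|].
    set (eta := r - d (e1 u) (e2 r)) in *.
    assert (B : forall k x, Rabs x <= Q * (u * u) -> - (Rabs k * (Q * (u * u))) <= - (σ * (k * x))).
    { intros k x Hkx.
      assert (Rabs (σ * (k * x)) <= Rabs k * (Q * (u * u))).
      { rewrite !Rabs_mult; replace (Rabs σ) with 1.
        - rewrite Rmult_1_l; apply Rmult_le_compat_l; [apply Rabs_pos | auto].
        - destruct (sg_cases b) as [->| ->]; unfold Rabs; destruct (Rcase_abs _); lra. }
      pose proof (Rle_abs (σ * (k * x))); lra. }
    pose proof (B k1 _ Hx1); pose proof (B k2 _ Hx2).
    replace (w * (σ * c t + s t * s eta - (Rabs k1 + Rabs k2) * Q / w * (u * u)))
      with (w * (σ * c t + s t * s eta) - Rabs k1 * (Q * (u * u)) - Rabs k2 * (Q * (u * u)))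
      by (field; lra).
    assert (E : σ * (w * (c t + σ * (s t * s eta))) = w * (σ * c t + s t * s eta)).
    { transitivity (w * (σ * c t + (σ * σ) * (s t * s eta))); [ring | rewrite sg_sq; ring]. }
    lra. }
  assert (Dt : forall u, 0 < u <= 1 -> u <= l1 ->
    d (e2 t) (e2 r) = r - t /\ d (e2 r) (e2 0) = r /\ d (e2 t) (e2 0) = t /\ d (e2 0) (e1 u) = u).
  { intros u Hu Hul; repeat split; try (rewrite He2; [|lra|lra]).
    - rewrite Rabs_left1; lra.
    - rewrite Rabs_right; lra.
    - rewrite Rabs_right; lra.
    - rewrite <- HO; apply (geo_0 M d e1 l1); auto; lra. }
  destruct H4 as [HU|HL].
  - assert (Hw : 0 < c t + c r).
    { assert (0 < c t) by (apply cs_pos; intros E; specialize (Hl2 E); lra).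
      assert (0 <= c r) by (apply cs_nonneg; intros E; specialize (Hl2 E); lra); lra. }
    apply (Hfin (c t + c r) (1 + c (r - t)) ((1 + c (r - t)) * c (r + t) - (c t + c r) * c r)); auto.
    intros u Hu Hul; destruct (Dt u Hu Hul) as [D1 [D2 [D3 D4]]].
    specialize (HU (e2 t) (e2 0) (e2 r) (e1 u)).
    rewrite D1, (dsym (e2 0) (e2 r)), D2, D3, D4, (dsym (e2 r) (e1 u)), (dsym (e2 t) (e1 u)) in HU.
    set (eta := r - d (e1 u) (e2 r)) in *.
    replace (d (e1 u) (e2 r)) with (r - eta) in HU by (unfold eta; ring).
    replace (t + (r - eta)) with ((r + t) - eta) in HU by ring.
    rewrite (cs_sub b (r + t) eta), (cs_sub b r eta) in HU.
    pose proof (cs_mul_half b r t) as I1; pose proof (sn_add_half b r t) as I2.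
    assert (I3 : (1 + c (r - t)) * s (r + t) = (c t + c r) * (s r + s t)).
    { pose proof (cs_double b (r + t)) as J1; pose proof (cs_double b (r - t)) as J2.
      pose proof (cs_sum b r t) as J3.
      assert (J4 : s r + s t = 2 * s ((r + t) / 2) * c ((r - t) / 2)).
      { replace (s r) with (s ((r + t) / 2 + (r - t) / 2)) by (f_equal; field).
        replace (s t) with (s ((r + t) / 2 - (r - t) / 2)) by (f_equal; field).
        rewrite sn_add, sn_sub; ring. }
      replace (s (r + t)) with (s ((r + t) / 2 + (r + t) / 2)) by (f_equal; field).
      rewrite J2, (Rplus_comm (c t)), J3, J4, sn_add; ring. }
    set (k := 1 + c (r - t)) in *; set (w := c t + c r) in *.
    assert (I1' : k * (1 + c (r + t)) = w * w) by (rewrite I1; unfold w; ring).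
    apply (Rplus_le_reg_r (σ * (w * (c r * c eta + σ * (s r * s eta))))).
    eapply Rle_trans; [|eapply Rle_trans; [exact HU|]]; right; [|ring].
    rewrite <- Rmult_plus_distr_l; f_equal.
    transitivity (w * w - w * c r + w * (σ * (s t * s eta)) - k * (1 - c u)
       - (k * c (r + t) - w * c r) * (1 - c eta) + w * (c r * c eta + σ * (s r * s eta))).
    { unfold w; ring. }
    rewrite <- I1'.
    transitivity (k * (c u + c (r + t) * c eta) + σ * (w * (s r + s t)) * s eta); [ring|].
    rewrite <- I3; ring.
  - assert (Hw : 0 < 1 + c r).
    { assert (0 <= c r) by (apply cs_nonneg; intros E; specialize (Hl2 E); lra); lra. }
    apply (Hfin (1 + c r) (c t + c (r - t)) ((c t + c (r - t)) * c r - (1 + c r) * c (r - t))); auto.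
    intros u Hu Hul; destruct (Dt u Hu Hul) as [D1 [D2 [D3 D4]]].
    specialize (HL (e2 0) (e2 t) (e2 r) (e1 u)).
    rewrite D1, (dsym (e2 0) (e2 r)), D2, (dsym (e2 0) (e2 t)), D3, D4, (dsym (e2 r) (e1 u)), (dsym (e2 t) (e1 u)) in HL.
    set (eta := r - d (e1 u) (e2 r)) in *.
    replace (d (e1 u) (e2 r)) with (r - eta) in HL by (unfold eta; ring).
    replace (t - (r - eta)) with (- ((r - t) - eta)) in HL by ring.
    rewrite cs_neg, (cs_sub b (r - t) eta), (cs_sub b r eta) in HL.
    pose proof (sn_add_half b t (r - t)) as I2; replace (t + (r - t)) with r in I2 by ring.
    set (k := c t + c (r - t)) in *; set (w := 1 + c r) in *.
    apply (Rplus_le_reg_r (σ * (w * (c (r - t) * c eta + σ * (s (r - t) * s eta))))).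
    eapply Rle_trans; [|eapply Rle_trans; [exact HL|]]; right; [|ring].
    rewrite <- Rmult_plus_distr_l; f_equal.
    transitivity (w * k - w * c (r - t) + σ * (w * (s t + s (r - t))) * s eta - k * (1 - c u)
       - (k * c r - w * c (r - t)) * (1 - c eta) + w * (c (r - t) * c eta)).
    { unfold k; ring. }
    rewrite <- I2; unfold w; ring.
Qed.

(** Up to [O(u)], the value [sn eta / sn u] is an upper bound at [r] and a lower bound at [t]. The
    lemma serves as the boundary condition at [u = 0] when mixed differences are summed over [u]. *)
Lemma psi_first_order (t r : R) : 0 < t < r -> r <= l2 -> exists C, 0 <= C /\
  forall u, 0 < u <= 1 -> u <= l1 -> cos_angle u r - C * u <= cos_angle u t.
Proof.
  intros Htr Hr; destruct (distance_first_order t r Htr Hr) as [C [HC H]].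
  assert (Hl2 : b = true -> r <= PI / 2)
    by (intros E; pose proof (geo_len e2 l2 He2 ltac:(lra) E); lra).
  pose proof PI_RGT_0 as HPI.
  assert (Hst : 0 < s t) by (apply sn_pos; [lra|]; intros E; specialize (Hl2 E); lra).
  assert (Hsr : 0 < s r) by (apply sn_pos; [lra|]; intros E; specialize (Hl2 E); lra).
  set (Q := cosh 1 * cosh 1).
  assert (HQ : 0 <= Q) by (unfold Q; pose proof (cosh_ge_1 1); nra).
  exists (2 * (C + Rabs (c t) * Q) / s t + 2 * (Rabs (c r) * (2 * Q)) / s r).
  assert (Hk : forall x y z, 0 <= x -> 0 <= y -> 0 < z -> 0 <= 2 * (x + y) / z).
  { intros; apply Rmult_le_pos; [lra | apply Rlt_le, Rinv_0_lt_compat; auto]. }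
  split.
  { pose proof (Hk C (Rabs (c t) * Q) (s t) HC ltac:(apply Rmult_le_pos; auto using Rabs_pos) Hst).
    pose proof (Hk 0 (Rabs (c r) * (2 * Q)) (s r) ltac:(lra)
       ltac:(apply Rmult_le_pos; [apply Rabs_pos | lra]) Hsr).
    rewrite Rplus_0_l in *; lra. }
  intros u Hu Hul; specialize (H u Hu Hul).
  pose proof (sn_half b u ltac:(lra)) as Hsu.
  set (y := d (e1 u) (e2 r)) in *; set (eta := r - y) in *.
  assert (Heta : Rabs eta <= u).
  { unfold eta, y; pose proof (dlip (e2 r) (e1 0) (e1 u)) as H1.
    rewrite (geo_0 M d e1 l1), HO, (dsym (e2 r) (e2 0)), (geo_0 M d e2 l2), (dsym (e2 r)) in H1; auto; lra. }
  assert (Hcu : Rabs (1 - c u) <= Q * (u * u)) by (apply cs_small; rewrite Rabs_right; lra).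
  assert (Hce : Rabs (1 - c eta) <= Q * (u * u)).
  { eapply Rle_trans; [apply (cs_small b _ 1); lra|].
    fold Q; apply Rmult_le_compat_l; [auto|].
    apply sq_le_of_abs; auto. }
  assert (Bd : forall k x B, Rabs x <= B -> σ * (k * x) <= Rabs k * B).
  { intros k x B Hx; eapply Rle_trans; [apply Rle_abs|].
    rewrite !Rabs_mult; replace (Rabs σ) with 1.
    - rewrite Rmult_1_l; apply Rmult_le_compat_l; [apply Rabs_pos | auto].
    - destruct (sg_cases b) as [->| ->]; unfold Rabs; destruct (Rcase_abs _); lra. }
  assert (H1 : s eta / s u - (C + Rabs (c t) * Q) * (u * u) / (s u * s t) <= cos_angle u t).
  { unfold cos_angle; apply (Rmult_le_reg_r (s u * s t)); [nra|].
    replace (σ * (c (d (e1 u) (e2 t)) - c u * c t) / (s u * s t) * (s u * s t))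
      with (σ * c (d (e1 u) (e2 t)) - σ * (c u * c t)) by (field; lra).
    replace ((s eta / s u - (C + Rabs (c t) * Q) * (u * u) / (s u * s t)) * (s u * s t))
      with (s t * s eta - C * (u * u) - Rabs (c t) * (Q * (u * u))) by (field; lra).
    assert (Hm : Rabs (- (1 - c u)) <= Q * (u * u)) by (rewrite Rabs_Ropp; auto).
    pose proof (Bd (c t) _ _ Hm); lra. }
  assert (H2 : cos_angle u r <= s eta / s u + Rabs (c r) * (2 * Q) * (u * u) / (s u * s r)).
  { unfold cos_angle; fold y; replace y with (r - eta) by (unfold eta; ring).
    apply (Rmult_le_reg_r (s u * s r)); [nra|]; rewrite cs_sub.
    replace (σ * (c r * c eta + σ * (s r * s eta) - c u * c r) / (s u * s r) * (s u * s r))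
      with (σ * (c r * (c eta - c u)) + (σ * σ) * (s r * s eta)) by (field; lra).
    replace ((s eta / s u + Rabs (c r) * (2 * Q) * (u * u) / (s u * s r)) * (s u * s r))
      with (s r * s eta + Rabs (c r) * (2 * Q * (u * u))) by (field; lra).
    rewrite sg_sq.
    assert (Hm : Rabs (c eta - c u) <= 2 * Q * (u * u)).
    { replace (c eta - c u) with ((1 - c u) + - (1 - c eta)) by ring.
      eapply Rle_trans; [apply Rabs_triang|]; rewrite Rabs_Ropp; lra. }
    pose proof (Bd (c r) _ _ Hm); lra. }
  assert (H3 : forall k z, 0 <= k -> 0 < z -> k * (u * u) / (s u * z) <= 2 * k / z * u).
  { intros k z Hk0 Hz; apply (Rmult_le_reg_r (s u * z)); [nra|].
    replace (k * (u * u) / (s u * z) * (s u * z)) with (k * u * u) by (field; lra).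
    replace (2 * k / z * u * (s u * z)) with (k * u * (2 * s u)) by (field; lra).
    apply Rmult_le_compat_l; [nra | lra]. }
  pose proof (H3 (C + Rabs (c t) * Q) (s t)) as P1.
  pose proof (H3 (Rabs (c r) * (2 * Q)) (s r)) as P2.
  pose proof (Rabs_pos (c t)); pose proof (Rabs_pos (c r)).
  specialize (P1 ltac:(nra) Hst); specialize (P2 ltac:(nra) Hsr).
  rewrite Rmult_plus_distr_r; lra.
Qed.

End TwoGeodesics.
End Space.

Lemma sn_mono (b : bool) (x y : R) : 0 <= x <= y -> y <= 1 -> sn b x <= sn b y.
Proof.
  intros H H1; pose proof PI2_1; unfold sn; destruct b.
  - apply sin_incr_1; lra.
  - destruct (Req_dec x y) as [->|]; [lra|]; apply Rlt_le, sinh_lt; lra.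
Qed.

Lemma sn_abs (b : bool) (x : R) : Rabs x <= 1 -> Rabs (sn b x) = sn b (Rabs x).
Proof.
  intros H; pose proof PI2_1; unfold Rabs at 2; destruct (Rcase_abs x) as [Hx|Hx].
  - rewrite Rabs_left1, sn_neg; auto.
    assert (0 <= sn b (- x)); [|rewrite sn_neg in *; lra].
    apply sn_nonneg; intros; [lra|]; rewrite Rabs_left in H; lra.
  - rewrite Rabs_right; auto; apply Rle_ge, sn_nonneg; intros; [lra|].
    rewrite Rabs_right in H; lra.
Qed.

Section Space.
Variables (b : bool) (M : Type) (d : M -> M -> R).
Notation σ := (sg b).
Notation c := (cs b).
Notation s := (sn b).
Hypothesis Hd : semimetric d.
Hypothesis Hdiam : b = true -> diam_le d (PI / 2).
Hypothesis H4 : upper4 b d \/ lower4 b d.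

Notation dsym := (d_sym M d Hd).
Notation dpos := (d_pos M d Hd).
Notation dle := (d_le b M d Hdiam).
Notation tri := (triangle_of_4point b M d Hd Hdiam H4).
Notation dlip := (dist_lip M d Hd tri).
Notation psi := (cos_angle b M d).

Lemma cs_dist_diff (x y j : R) : 0 <= x -> 0 <= y -> (b = true -> x <= PI / 2 /\ y <= PI / 2) ->
  Rabs (x - y) <= 2 * j -> j <= 1 -> Rabs (c x - c y) <= 2 * s ((x + y) / 2) * s j.
Proof.
  intros Hx Hy Hb Hj Hj1; pose proof PI_RGT_0.
  rewrite Rabs_minus_sym, cs_diff, Rabs_mult.
  replace (Rabs σ) with 1 by (destruct (sg_cases b) as [->| ->]; unfold Rabs; destruct (Rcase_abs _); lra).
  assert (0 <= s ((x + y) / 2)).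
  { apply sn_nonneg; [lra|]; intros E; specialize (Hb E); lra. }
  rewrite Rmult_1_l, !Rabs_mult, (Rabs_right 2), (Rabs_right (s ((x + y) / 2))) by lra.
  apply Rmult_le_compat_l; [lra|].
  assert (Hh : Rabs ((x - y) / 2) <= j).
  { unfold Rdiv; rewrite Rabs_mult, (Rabs_right (/ 2)); lra. }
  rewrite sn_abs by lra; apply sn_mono; auto; split; auto using Rabs_pos.
Qed.

Section TwoGeodesics.
Variables (e1 e2 : R -> M) (l1 l2 : R).
Hypothesis He1 : geo d e1 l1.
Hypothesis He2 : geo d e2 l2.

Definition cs_dist (u t : R) : R := c (d (e1 u) (e2 t)).

Lemma cd_psi (u t : R) : s u <> 0 -> s t <> 0 ->
  cs_dist u t = c u * c t + σ * (s u * s t * psi e1 e2 u t).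
Proof.
  intros Hu Ht; unfold cos_angle, cs_dist.
  transitivity (c u * c t + (σ * σ) * (c (d (e1 u) (e2 t)) - c u * c t)); [rewrite sg_sq; ring|].
  field; auto.
Qed.

(** Rectangles with centre [(sq, tq)] and half sides [i], [j] that shrink to a point with limiting
    aspect ratio [rho]; they stay off the axes, where [sn] vanishes. *)
Definition shrink (s0 t0 rho : R) (sq tq i j : nat -> R) : Prop :=
  Un_cv sq s0 /\ Un_cv tq t0 /\ Un_cv i 0 /\ Un_cv j 0 /\ Un_cv (fun n => i n / j n) rho /\
  forall n, 0 < i n <= 1 /\ 0 < j n <= 1 /\ 0 < sq n - i n /\ sq n + i n <= l1 /\
            0 < tq n - j n /\ tq n + j n <= l2.

Lemma shrink_sub (s0 t0 rho : R) (sq tq i j : nat -> R) (phi : nat -> nat) :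
  (forall n, (n <= phi n)%nat) -> shrink s0 t0 rho sq tq i j ->
  shrink s0 t0 rho (fun n => sq (phi n)) (fun n => tq (phi n)) (fun n => i (phi n)) (fun n => j (phi n)).
Proof.
  intros Hphi [H1 [H2 [H3 [H4' [H5 H6]]]]]; repeat split; try apply H6;
    try (apply (cv_sub _ _ _ Hphi); assumption).
  apply (cv_sub (fun n => i n / j n) _ _ Hphi); auto.
Qed.

Definition corner_mm (sq tq i j : nat -> R) (n : nat) := cs_dist (sq n - i n) (tq n - j n).
Definition corner_pp (sq tq i j : nat -> R) (n : nat) := cs_dist (sq n + i n) (tq n + j n).
Definition corner_pm (sq tq i j : nat -> R) (n : nat) := cs_dist (sq n + i n) (tq n - j n).
Definition corner_mp (sq tq i j : nat -> R) (n : nat) := cs_dist (sq n - i n) (tq n + j n).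
Definition corner_slope (sq tq i j : nat -> R) : nat -> R :=
  slope_s b tq i j (corner_mm sq tq i j) (corner_pp sq tq i j) (corner_pm sq tq i j) (corner_mp sq tq i j).

Lemma shrink_corners (s0 t0 rho : R) (sq tq i j : nat -> R) :
  0 < s0 <= l1 -> 0 < t0 <= l2 -> shrink s0 t0 rho sq tq i j ->
  Un_cv (fun n => d (e1 (sq n - i n)) (e2 (tq n - j n))) (d (e1 s0) (e2 t0)) /\
  Un_cv (fun n => d (e1 (sq n + i n)) (e2 (tq n + j n))) (d (e1 s0) (e2 t0)) /\
  Un_cv (fun n => d (e1 (sq n + i n)) (e2 (tq n - j n))) (d (e1 s0) (e2 t0)) /\
  Un_cv (fun n => d (e1 (sq n - i n)) (e2 (tq n + j n))) (d (e1 s0) (e2 t0)).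
Proof.
  intros Hs Ht [H1 [H2 [H3 [H4' [H5 H6]]]]].
  repeat split; apply (cv_hinge M d Hd tri e1 e2 l1 l2); auto; try lra;
    try (intros n; specialize (H6 n); lra); eapply cv_eq; try cv; ring.
Qed.

(** The distance is 1-Lipschitz in [t], so its cosine varies at a rate of at most [sn] of the
    distance. This is the regularity that keeps the slopes bounded and confines their limits. *)
Lemma slope_estimate (sq tq i j : nat -> R) (n : nat) :
  0 < i n <= 1 -> 0 < j n <= 1 -> 0 < sq n - i n -> sq n + i n <= l1 ->
  0 < tq n - j n -> tq n + j n <= l2 ->
  Rabs (corner_slope sq tq i j n
        - c (tq n) * ((corner_mm sq tq i j n + corner_pp sq tq i j n + corner_pm sq tq i j n + corner_mp sq tq i j n) / 4)
          / (c (i n) * c (j n)))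
  <= s (tq n) * ((s ((d (e1 (sq n + i n)) (e2 (tq n + j n)) + d (e1 (sq n + i n)) (e2 (tq n - j n))) / 2)
      + s ((d (e1 (sq n - i n)) (e2 (tq n + j n)) + d (e1 (sq n - i n)) (e2 (tq n - j n))) / 2)) / 2)
       / c (i n).
Proof.
  intros Hi Hj Hs1 Hs2 Ht1 Ht2.
  destruct (small_trig b _ Hi) as [A1 [A2 A3]]; destruct (small_trig b _ Hj) as [B1 [B2 B3]].
  assert (St : 0 < s (tq n)) by (apply (geo_sn_pos b M d Hdiam e2 l2 _ He2); lra).
  unfold corner_slope, slope_s, corner_mm, corner_pp, corner_pm, corner_mp.
  set (F := c (tq n) * _ / _); set (ft := (_ - _ - _) / 4).
  replace (F - s (tq n) * ft / (c (i n) * s (j n)) - F) with (- (s (tq n) * ft / (c (i n) * s (j n)))) by ring.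
  rewrite Rabs_Ropp.
  assert (Hyy : Rabs (tq n + j n - (tq n - j n)) = 2 * j n) by (rewrite Rabs_right; lra).
  assert (Hdd : forall x, Rabs (d x (e2 (tq n + j n)) - d x (e2 (tq n - j n))) <= 2 * j n).
  { intros x; eapply Rle_trans; [apply dlip|]; rewrite He2; lra. }
  assert (Hcc : forall x, Rabs (c (d x (e2 (tq n + j n))) - c (d x (e2 (tq n - j n))))
     <= 2 * s ((d x (e2 (tq n + j n)) + d x (e2 (tq n - j n))) / 2) * s (j n)).
  { intros x; apply cs_dist_diff; auto; try apply dpos; [|lra]; intros E; split; apply dle; auto. }
  pose proof (Hcc (e1 (sq n + i n))) as P1; pose proof (Hcc (e1 (sq n - i n))) as P2.
  set (S1 := s ((d (e1 (sq n + i n)) _ + _) / 2)) in *.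
  set (S2 := s ((d (e1 (sq n - i n)) _ + _) / 2)) in *.
  assert (Hft : Rabs ft <= (S1 + S2) / 2 * s (j n)).
  { replace ft with ((cs_dist (sq n + i n) (tq n + j n) - cs_dist (sq n + i n) (tq n - j n)) / 4
        + (cs_dist (sq n - i n) (tq n + j n) - cs_dist (sq n - i n) (tq n - j n)) / 4) by (unfold ft; field).
    unfold cs_dist; eapply Rle_trans; [apply Rabs_triang|]; unfold Rdiv; rewrite !Rabs_mult.
    rewrite (Rabs_right (/ 4)) by lra; lra. }
  unfold Rdiv at 1; rewrite !Rabs_mult, (Rabs_right (s (tq n))), (Rabs_right (/ _)).
  2:{ apply Rle_ge, Rlt_le, Rinv_0_lt_compat, Rmult_lt_0_compat; auto. }
  2:{ lra. }
  replace (s (tq n) * ((S1 + S2) / 2) / c (i n))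
    with (s (tq n) * ((S1 + S2) / 2 * s (j n)) * / (c (i n) * s (j n))) by (field; lra).
  apply Rmult_le_compat_r; [apply Rlt_le, Rinv_0_lt_compat, Rmult_lt_0_compat; auto|].
  apply Rmult_le_compat_l; lra.
Qed.

Lemma slope_limits (s0 t0 rho : R) (sq tq i j : nat -> R) :
  0 < s0 <= l1 -> 0 < t0 <= l2 -> shrink s0 t0 rho sq tq i j ->
  Un_cv (fun n => c (tq n) * ((corner_mm sq tq i j n + corner_pp sq tq i j n + corner_pm sq tq i j n + corner_mp sq tq i j n) / 4)
          / (c (i n) * c (j n))) (c t0 * cs_dist s0 t0) /\
  Un_cv (fun n => s (tq n) * ((s ((d (e1 (sq n + i n)) (e2 (tq n + j n)) + d (e1 (sq n + i n)) (e2 (tq n - j n))) / 2)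
      + s ((d (e1 (sq n - i n)) (e2 (tq n + j n)) + d (e1 (sq n - i n)) (e2 (tq n - j n))) / 2)) / 2)
       / c (i n)) (s t0 * s (d (e1 s0) (e2 t0))).
Proof.
  intros Hs Ht Hsh; destruct (shrink_corners s0 t0 rho sq tq i j Hs Ht Hsh) as [C1 [C2 [C3 C4]]].
  destruct Hsh as [H1 [H2 [H3 [H4' [H5 H6]]]]].
  split; eapply cv_eq.
  - unfold corner_mm, corner_pp, corner_pm, corner_mp, cs_dist; cv; rewrite ?cs_0; lra.
  - unfold cs_dist; rewrite ?cs_0; field.
  - cv; rewrite ?cs_0; lra.
  - rewrite cs_0; replace ((d (e1 s0) (e2 t0) + d (e1 s0) (e2 t0)) / 2) with (d (e1 s0) (e2 t0)) by field.
    field.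
Qed.

Lemma slope_bounded (s0 t0 rho : R) (sq tq i j : nat -> R) :
  0 < s0 <= l1 -> 0 < t0 <= l2 -> shrink s0 t0 rho sq tq i j ->
  exists B, forall n, Rabs (corner_slope sq tq i j n) <= B.
Proof.
  intros Hs Ht Hsh; destruct (slope_limits s0 t0 rho sq tq i j Hs Ht Hsh) as [L1 L2].
  assert (Hb : forall u l, Un_cv u l -> exists B, forall n, Rabs (u n) <= B).
  { intros u l Hu; destruct (maj_by_pos u (exist _ l Hu)) as [B [_ HB]]; exists B; auto. }
  destruct (Hb _ _ L1) as [B1 HB1]; destruct (Hb _ _ L2) as [B2 HB2].
  exists (B1 + B2); intros n; destruct Hsh as [H1 [H2 [H3 [H4' [H5 H6]]]]].
  destruct (H6 n) as [K1 [K2 [K3 [K4 [K5 K6]]]]].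
  pose proof (slope_estimate sq tq i j n K1 K2 K3 K4 K5 K6) as E.
  specialize (HB1 n); specialize (HB2 n); cbv beta in HB1, HB2.
  match type of E with Rabs (?x - ?y) <= ?z =>
    pose proof (Rabs_triang (x - y) y) as T; replace (x - y + y) with x in T by ring;
    pose proof (Rle_abs z); lra end.
Qed.

Lemma slope_limit_bound (s0 t0 rho X : R) (sq tq i j : nat -> R) :
  0 < s0 <= l1 -> 0 < t0 <= l2 -> shrink s0 t0 rho sq tq i j -> Un_cv (corner_slope sq tq i j) X ->
  Rabs (X - c t0 * cs_dist s0 t0) <= s t0 * s (d (e1 s0) (e2 t0)).
Proof.
  intros Hs Ht Hsh HX; destruct (slope_limits s0 t0 rho sq tq i j Hs Ht Hsh) as [L1 L2].
  destruct Hsh as [H1 [H2 [H3 [H4' [H5 H6]]]]].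
  eapply cv_abs_le; [| eapply CV_minus; [exact HX | exact L1] | exact L2].
  intros n; destruct (H6 n) as [K1 [K2 [K3 [K4 [K5 K6]]]]].
  apply (slope_estimate sq tq i j n K1 K2 K3 K4 K5 K6).
Qed.

End TwoGeodesics.
End Space.

Section Space.
Variables (b : bool) (M : Type) (d : M -> M -> R).
Notation σ := (sg b).
Notation c := (cs b).
Notation s := (sn b).
Hypothesis Hd : semimetric d.
Hypothesis Hdiam : b = true -> diam_le d (PI / 2).
Hypothesis H4 : upper4 b d \/ lower4 b d.

Notation dsym := (d_sym M d Hd).
Notation dpos := (d_pos M d Hd).
Notation dle := (d_le b M d Hdiam).
Notation tri := (triangle_of_4point b M d Hd Hdiam H4).
Notation psi := (cos_angle b M d).
Notation cd := (cs_dist b M d).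
Notation slope := (corner_slope b M d).

Lemma cos_angle_swap (e1 e2 : R -> M) (u t : R) : psi e1 e2 u t = psi e2 e1 t u.
Proof. unfold cos_angle; rewrite dsym, (Rmult_comm (c u)), (Rmult_comm (s u)); auto. Qed.

Lemma cs_dist_swap (e1 e2 : R -> M) (u t : R) : cd e1 e2 u t = cd e2 e1 t u.
Proof. unfold cs_dist; now rewrite dsym. Qed.

Lemma shrink_swap (l1 l2 s0 t0 rho : R) (sq tq i j : nat -> R) :
  0 < rho -> shrink l1 l2 s0 t0 rho sq tq i j -> shrink l2 l1 t0 s0 (/ rho) tq sq j i.
Proof.
  intros Hr [H1 [H2 [H3 [H4' [H5 H6]]]]]; repeat split; auto; try apply H6.
  apply cv_ext with (fun n => / (i n / j n)).
  - intros n; destruct (H6 n) as [K1 [K2 _]]; field; lra.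
  - apply cv_inv; auto; lra.
Qed.

Section TwoGeodesics.
Variables (e1 e2 : R -> M) (l1 l2 : R).
Hypothesis He1 : geo d e1 l1.
Hypothesis He2 : geo d e2 l2.
Notation pq := (corner_mm b M d e1 e2).
Notation qq := (corner_pp b M d e1 e2).
Notation uq := (corner_pm b M d e1 e2).
Notation vq := (corner_mp b M d e1 e2).
Notation sp1 := (fun u => geo_sn_pos b M d Hdiam e1 l1 u He1).
Notation sp2 := (fun u => geo_sn_pos b M d Hdiam e2 l2 u He2).

Lemma slope_t_swap (sq tq i j : nat -> R) (n : nat) :
  slope_t b sq i j (pq sq tq i j) (qq sq tq i j) (uq sq tq i j) (vq sq tq i j) n
  = slope e2 e1 tq sq j i n.
Proof.
  unfold slope_t, corner_slope, slope_s, corner_mm, corner_pp, corner_pm, corner_mp.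
  rewrite (cs_dist_swap e2 e1 (tq n - j n) (sq n - i n)), (cs_dist_swap e2 e1 (tq n + j n) (sq n + i n)).
  rewrite (cs_dist_swap e2 e1 (tq n + j n) (sq n - i n)), (cs_dist_swap e2 e1 (tq n - j n) (sq n + i n)).
  rewrite (Rmult_comm (c (j n))), (Rmult_comm (c (j n))).
  unfold Rdiv; ring.
Qed.

(** The parts [cs u * cs t] of the corner values combine to [sn (2 * i) * sn (2 * j)], which
    accounts for the subtracted 1; the parts with [psi] all carry the same product of four sines. *)
Lemma mixed_form_psi (sq tq i j : nat -> R) (n : nat) :
  0 < i n <= 1 -> 0 < j n <= 1 -> 0 < sq n - i n -> sq n + i n <= l1 ->
  0 < tq n - j n -> tq n + j n <= l2 ->
  σ * (mixed_form b sq tq i j (pq sq tq i j) (qq sq tq i j) (uq sq tq i j) (vq sq tq i j) n - 1)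
  = s (sq n + i n) * s (sq n - i n) * (s (tq n + j n) * s (tq n - j n))
    * mixed (psi e1 e2) (sq n - i n) (sq n + i n) (tq n - j n) (tq n + j n)
    / (s (2 * i n) * s (2 * j n)).
Proof.
  intros Hi Hj Hs1 Hs2 Ht1 Ht2.
  destruct (small_trig b _ Hi) as [A1 [A2 A3]]; destruct (small_trig b _ Hj) as [B1 [B2 B3]].
  pose proof (sp1 (sq n + i n) ltac:(lra)); pose proof (sp1 (sq n - i n) ltac:(lra)).
  pose proof (sp2 (tq n + j n) ltac:(lra)); pose proof (sp2 (tq n - j n) ltac:(lra)).
  unfold mixed_form, mixed, corner_mm, corner_pp, corner_pm, corner_mp.
  rewrite !cd_psi by lra.
  assert (E1 : s (2 * i n) = s (sq n + i n) * c (sq n - i n) - c (sq n + i n) * s (sq n - i n))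
    by (rewrite <- sn_sub; f_equal; ring).
  assert (E2 : s (2 * j n) = s (tq n + j n) * c (tq n - j n) - c (tq n + j n) * s (tq n - j n))
    by (rewrite <- sn_sub; f_equal; ring).
  apply (Rmult_eq_reg_r (s (2 * i n) * s (2 * j n))); [|nra].
  match goal with |- σ * (?x / ?y - 1) * ?y = ?z / ?y * ?y =>
    replace (σ * (x / y - 1) * y) with (σ * (x - y)) by (field; lra);
    replace (z / y * y) with ((σ * σ) * z) by (rewrite sg_sq; field; lra) end.
  rewrite E1, E2; ring.
Qed.

Lemma upper_corners_of_upper4 (u t i j : R) : upper4 b d ->
  0 < i -> 0 < j -> 0 < u - i -> u + i <= l1 -> 0 < t - j -> t + j <= l2 ->
  upper_corners b (c (2 * i)) (c (2 * j)) (cd e1 e2 (u - i) (t - j)) (cd e1 e2 (u + i) (t + j))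
     (cd e1 e2 (u + i) (t - j)) (cd e1 e2 (u - i) (t + j)).
Proof.
  intros HU Hi Hj H1 H2 H3 H5.
  exists (d (e1 (u - i)) (e2 (t - j))), (d (e1 (u + i)) (e2 (t + j))); repeat split; auto.
  specialize (HU (e1 (u - i)) (e2 (t - j)) (e1 (u + i)) (e2 (t + j))).
  rewrite (He1 (u - i) (u + i)), (He2 (t - j) (t + j)), Rabs_left1, Rabs_left1 in HU by lra.
  replace (- (u - i - (u + i))) with (2 * i) in HU by ring.
  replace (- (t - j - (t + j))) with (2 * j) in HU by ring.
  rewrite (dsym (e2 (t - j))) in HU; exact HU.
Qed.

(** The first vector runs from [e1] to [e2] and the second one back from [e2] to [e1], whereas in
    the upper condition both run from [e1] to [e2]. With this reversal both conditions bound the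
    mixed difference on the same side. *)
Lemma lower_corners_of_lower4 (u t i j : R) : lower4 b d ->
  0 < i -> 0 < j -> 0 < u - i -> u + i <= l1 -> 0 < t - j -> t + j <= l2 ->
  lower_corners b (c (2 * i)) (c (2 * j)) (cd e1 e2 (u - i) (t - j)) (cd e1 e2 (u + i) (t + j))
     (cd e1 e2 (u + i) (t - j)) (cd e1 e2 (u - i) (t + j)).
Proof.
  intros HL Hi Hj H1 H2 H3 H5.
  exists (d (e1 (u + i)) (e2 (t + j))), (d (e1 (u - i)) (e2 (t - j))); repeat split; auto.
  specialize (HL (e1 (u + i)) (e2 (t + j)) (e2 (t - j)) (e1 (u - i))).
  rewrite (He1 (u + i) (u - i)), (He2 (t + j) (t - j)), !Rabs_right in HL by lra.
  replace (u + i - (u - i)) with (2 * i) in HL by ring.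
  replace (t + j - (t - j)) with (2 * j) in HL by ring.
  rewrite (dsym (e2 (t - j)) (e1 (u - i))), (dsym (e2 (t + j)) (e1 (u - i))) in HL; exact HL.
Qed.

(** [K] is the limit density of a lower bound for the mixed difference, per area [4 * i * j]. The
    slopes converge only along a subsequence, hence [phi]; the ratio [rho] depends on the point and
    on which of the two conditions holds. *)
Lemma local_mixed (s0 t0 K : R) : 0 < s0 <= l1 -> 0 < t0 <= l2 -> e1 s0 <> e2 t0 ->
  0 < cd e1 e2 s0 t0 -> exists rho, 0 < rho /\
  forall sq tq i j k, shrink l1 l2 s0 t0 rho sq tq i j -> Un_cv k K ->
    (forall n, 4 * i n * j n * k n
       <= mixed (psi e1 e2) (sq n - i n) (sq n + i n) (tq n - j n) (tq n + j n)) ->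
    exists phi X, (forall n, (n <= phi n)%nat) /\
      Un_cv (fun n => slope e1 e2 sq tq i j (phi n)) X /\
      2 * (s s0 * s s0 * (s t0 * s t0) * K) + σ * ((X - c s0) * (X - c s0)) <= 0.
Proof.
  intros Hs0 Ht0 Hne HF.
  pose proof (sp1 s0 Hs0) as Ss0; pose proof (sp2 t0 Ht0) as St0.
  exists (match excluded_middle_informative (upper4 b d) with
          | left _ => s s0 / (cd e1 e2 s0 t0 * s t0) | right _ => s s0 / s t0 end).
  split.
  { destruct (excluded_middle_informative (upper4 b d)); apply Rdiv_lt_0_compat; auto.
    apply Rmult_lt_0_compat; auto. }
  intros sq tq i j k Hsh Hk Hmix.
  destruct (slope_bounded b M d Hd Hdiam H4 e1 e2 l1 l2 He1 He2 _ _ _ _ _ _ _ Hs0 Ht0 Hsh) as [B HB].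
  destruct (bolzano_weierstrass _ _ HB) as [f1 [X [Hf1 HX]]].
  assert (Hrho : 0 < match excluded_middle_informative (upper4 b d) with
          | left _ => s s0 / (cd e1 e2 s0 t0 * s t0) | right _ => s s0 / s t0 end).
  { destruct (excluded_middle_informative (upper4 b d)); apply Rdiv_lt_0_compat; auto.
    apply Rmult_lt_0_compat; auto. }
  (* The slope in the other variable, which the lower condition involves, is a slope of the
     exchanged pair of geodesics. *)
  destruct (slope_bounded b M d Hd Hdiam H4 e2 e1 l2 l1 He2 He1 _ _ _ _ _ _ _ Ht0 Hs0
    (shrink_swap _ _ _ _ _ _ _ _ _ Hrho Hsh)) as [B' HB'].
  destruct (bolzano_weierstrass (fun n => slope e2 e1 tq sq j i (f1 n)) B' (fun n => HB' (f1 n)))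
    as [f2 [Y [Hf2 HY]]].
  set (phi := fun n => f1 (f2 n)).
  assert (Hphi : forall n, (n <= phi n)%nat)
    by (intros n; unfold phi; specialize (Hf2 n); specialize (Hf1 (f2 n)); lia).
  exists phi, X; split; [auto|]; split; [exact (cv_sub _ _ _ Hf2 HX)|].
  set (sq' := fun n => sq (phi n)); set (tq' := fun n => tq (phi n)).
  set (i' := fun n => i (phi n)); set (j' := fun n => j (phi n)); set (k' := fun n => k (phi n)).
  assert (Hsh' : shrink l1 l2 s0 t0 (match excluded_middle_informative (upper4 b d) with
          | left _ => s s0 / (cd e1 e2 s0 t0 * s t0) | right _ => s s0 / s t0 end) sq' tq' i' j')
    by exact (shrink_sub _ _ _ _ _ _ _ _ _ _ Hphi Hsh).
  assert (Hk' : Un_cv k' K) by exact (cv_sub _ _ _ Hphi Hk).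
  assert (Hmix' : forall n, 4 * i' n * j' n * k' n
       <= mixed (psi e1 e2) (sq' n - i' n) (sq' n + i' n) (tq' n - j' n) (tq' n + j' n))
    by (intros n; apply (Hmix (phi n))).
  assert (HX' : Un_cv (slope_s b tq' i' j' (pq sq' tq' i' j') (qq sq' tq' i' j')
                   (uq sq' tq' i' j') (vq sq' tq' i' j')) X) by exact (cv_sub _ _ _ Hf2 HX).
  assert (HY' : Un_cv (fun n => slope e2 e1 tq' sq' j' i' n) Y) by exact HY.
  clearbody sq' tq' i' j' k'; clear Hsh Hk Hmix HB HB' HX HY Hf1 Hf2 Hphi phi f1 f2 sq tq i j k.
  destruct (shrink_corners b M d Hd Hdiam H4 e1 e2 l1 l2 He1 He2 _ _ _ _ _ _ _ Hs0 Ht0 Hsh')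
    as [C1 [C2 [C3 C4]]].
  destruct Hsh' as [K1 [K2 [K3 [K4 [K5 K6]]]]].
  set (l := fun n => s (sq' n + i' n) * s (sq' n - i' n) * (s (tq' n + j' n) * s (tq' n - j' n))
    * k' n / ((s (2 * i' n) / (2 * i' n)) * (s (2 * j' n) / (2 * j' n)))).
  assert (Hl : Un_cv l (s s0 * s s0 * (s t0 * s t0) * K)).
  { assert (R : forall x : nat -> R, (forall n, 0 < x n <= 1) -> Un_cv x 0 ->
        Un_cv (fun n => s (2 * x n) / (2 * x n)) 1).
    { intros x Hx Hx0; apply (cv_sn_ratio b (fun n => 2 * x n)).
      - intros n; specialize (Hx n); lra.
      - eapply cv_eq; [cv | ring]. }
    pose proof (R i' ltac:(apply K6) K3) as R1; pose proof (R j' ltac:(apply K6) K4) as R2.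
    eapply cv_eq; [unfold l; cv; lra|].
    rewrite !Rplus_0_r, !Rminus_0_r; field. }
  assert (Hlo : forall n, l n <= σ * (mixed_form b sq' tq' i' j' (pq sq' tq' i' j') (qq sq' tq' i' j')
                   (uq sq' tq' i' j') (vq sq' tq' i' j') n - 1)).
  { intros n; destruct (K6 n) as [G1 [G2 [G3 [G4 [G5 G6]]]]].
    rewrite mixed_form_psi; auto.
    destruct (small_trig b _ G1) as [A1 [A2 A3]]; destruct (small_trig b _ G2) as [B1 [B2 B3]].
    pose proof (sp1 (sq' n + i' n) ltac:(lra)); pose proof (sp1 (sq' n - i' n) ltac:(lra)).
    pose proof (sp2 (tq' n + j' n) ltac:(lra)); pose proof (sp2 (tq' n - j' n) ltac:(lra)).
    unfold l; set (Pi := _ * _ * (_ * _)).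
    assert (HPi : 0 < Pi) by (unfold Pi; repeat apply Rmult_lt_0_compat; auto).
    replace (Pi * k' n / (s (2 * i' n) / (2 * i' n) * (s (2 * j' n) / (2 * j' n))))
      with (Pi * (4 * i' n * j' n * k' n) / (s (2 * i' n) * s (2 * j' n))) by (field; lra).
    apply Rmult_le_compat_r; [apply Rlt_le, Rinv_0_lt_compat, Rmult_lt_0_compat; auto|].
    apply Rmult_le_compat_l; [lra | apply Hmix']. }
  assert (Hcd : forall x y, Un_cv (fun n => d (e1 (x n)) (e2 (y n))) (d (e1 s0) (e2 t0)) ->
     Un_cv (fun n => cd e1 e2 (x n) (y n)) (cd e1 e2 s0 t0)) by (intros; apply cv_cs; auto).
  destruct (excluded_middle_informative (upper4 b d)) as [HU|HU].
  - apply (local_upper b sq' tq' i' j' (pq sq' tq' i' j') (qq sq' tq' i' j')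
      (uq sq' tq' i' j') (vq sq' tq' i' j') l s0 t0 (cd e1 e2 s0 t0)); auto;
      try (intros n; apply K6); try (apply Hcd; assumption).
    + intros n; destruct (K6 n) as [G1 [G2 [G3 [G4 [G5 G6]]]]]; apply sp1; lra.
    + intros n; destruct (K6 n) as [G1 [G2 [G3 [G4 [G5 G6]]]]]; apply sp2; lra.
    + intros n; destruct (K6 n) as [G1 [G2 [G3 [G4 [G5 G6]]]]]; apply upper_corners_of_upper4; auto; lra.
  - assert (HL : lower4 b d) by tauto.
    apply (local_lower b sq' tq' i' j' (pq sq' tq' i' j') (qq sq' tq' i' j')
      (uq sq' tq' i' j') (vq sq' tq' i' j') l s0 t0 (cd e1 e2 s0 t0) X _) with (Y1 := Y); auto;
      try (intros n; apply K6); try (apply Hcd; assumption); try lra.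
    + intros n; destruct (K6 n) as [G1 [G2 [G3 [G4 [G5 G6]]]]]; apply sp1; lra.
    + intros n; destruct (K6 n) as [G1 [G2 [G3 [G4 [G5 G6]]]]]; apply sp2; lra.
    + intros n; destruct (K6 n) as [G1 [G2 [G3 [G4 [G5 G6]]]]]; apply lower_corners_of_lower4; auto; lra.
    + assert (Hp : 0 < d (e1 s0) (e2 t0)).
      { destruct (Rle_lt_or_eq_dec 0 (d (e1 s0) (e2 t0)) (dpos _ _)) as [?|E]; auto.
        symmetry in E; apply (d_eq M d Hd) in E; contradiction. }
      unfold cs_dist; rewrite <- sn_sq; pose proof PI_RGT_0.
      assert (0 < s (d (e1 s0) (e2 t0))); [|nra].
      apply sn_pos; auto; intros E; pose proof (dle (e1 s0) (e2 t0) E); lra.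
    + apply cv_ext with (fun n => slope e2 e1 tq' sq' j' i' n); [|exact HY'].
      intros n; symmetry; apply slope_t_swap.
Qed.

End TwoGeodesics.
End Space.

(** * From densities to mixed differences on rectangles *)

Section Space.
Variables (b : bool) (M : Type) (d : M -> M -> R).
Notation σ := (sg b).
Notation c := (cs b).
Notation s := (sn b).
Hypothesis Hd : semimetric d.
Hypothesis Hdiam : b = true -> diam_le d (PI / 2).
Hypothesis H4 : upper4 b d \/ lower4 b d.

Notation psi := (cos_angle b M d).
Notation cd := (cs_dist b M d).
Notation slope := (corner_slope b M d).

(** This contradicts [local_mixed] for any density larger than [K], so [K] bounds the density at the
    point. For [σ = 1] the left side is at most 0 and [K = 0] is allowed; for [σ = -1] it amounts to
    a bound on the slope. *)
Definition slope_control (e1 e2 : R -> M) (l1 l2 : R) (K s0 t0 : R) : Prop :=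
  forall rho sq tq i j X, 0 < rho -> shrink l1 l2 s0 t0 rho sq tq i j ->
    Un_cv (slope e1 e2 sq tq i j) X ->
    - σ * ((X - c s0) * (X - c s0)) <= 2 * (s s0 * s s0 * (s t0 * s t0) * K).

Section TwoGeodesics.
Variables (e1 e2 : R -> M) (l1 l2 : R).
Hypothesis He1 : geo d e1 l1.
Hypothesis He2 : geo d e2 l2.

(** [H] is an antiderivative, in the sense of an inequality, of the allowed density [K]. If the
    claim failed, [psi - H - eps * (u * t)] would have a positive mixed difference; localised at a
    point, this contradicts [local_mixed] with density [K + eps]. The point decides which of the two
    slopes is used. *)
Lemma mixed_bound (a a' b0 b0' : R) (H K : R -> R -> R) :
  0 < a < a' -> a' <= l1 -> 0 < b0 < b0' -> b0' <= l2 ->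
  (forall u t, a <= u <= a' -> b0 <= t <= b0' -> e1 u <> e2 t /\ 0 < cd e1 e2 u t) ->
  (forall u t i j, a <= u - i -> u + i <= a' -> b0 <= t - j -> t + j <= b0' -> 0 < i -> 0 < j ->
     4 * i * j * K u t <= mixed H (u - i) (u + i) (t - j) (t + j)) ->
  (forall sq tq s0 t0, Un_cv sq s0 -> Un_cv tq t0 -> a <= s0 <= a' -> b0 <= t0 <= b0' ->
     Un_cv (fun n => K (sq n) (tq n)) (K s0 t0)) ->
  (forall u t, a <= u <= a' -> b0 <= t <= b0' ->
     slope_control e1 e2 l1 l2 (K u t) u t \/ slope_control e2 e1 l2 l1 (K u t) t u) ->
  mixed (psi e1 e2) a a' b0 b0' <= mixed H a a' b0 b0'.
Proof.
  intros Ha Ha' Hb Hb' Hgen HH HK HS; apply Rnot_lt_le; intros Hlt.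
  set (ar := (a' - a) * (b0' - b0)).
  assert (Har : 0 < ar) by (unfold ar; nra).
  (* Half of the mean excess: the other half keeps the mixed difference of [chi] positive, while
     [eps] survives in the limit as a strict excess of density. *)
  set (eps := (mixed (psi e1 e2) a a' b0 b0' - mixed H a a' b0 b0') / (2 * ar)).
  assert (Heps : 0 < eps) by (unfold eps; apply Rdiv_lt_0_compat; lra).
  set (chi := fun u t => psi e1 e2 u t - H u t - eps * (u * t)).
  assert (Hchi : forall u u' t t', mixed chi u u' t t'
     = mixed (psi e1 e2) u u' t t' - mixed H u u' t t' - eps * ((u' - u) * (t' - t)))
    by (intros; unfold mixed, chi; ring).
  destruct (mixed_localise chi a a' b0 b0') as [s0 [t0 [Hs0 [Ht0 Hloc]]]]; try lra.
  { rewrite Hchi; fold ar; replace (eps * ar) with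
      ((mixed (psi e1 e2) a a' b0 b0' - mixed H a a' b0 b0') / 2) by (unfold eps; field; lra); lra. }
  assert (Hseq : forall rho, 0 < rho -> exists sq tq i j,
     shrink l1 l2 s0 t0 rho sq tq i j /\
     forall n, 4 * i n * j n * (K (sq n) (tq n) + eps)
       <= mixed (psi e1 e2) (sq n - i n) (sq n + i n) (tq n - j n) (tq n + j n)).
  { intros rho Hrho.
    assert (Hn : forall n, exists q : R * R * (R * R),
      let u := fst (fst q) in let t := snd (fst q) in let i := fst (snd q) in let j := snd (snd q) in
      let eta := / INR (S n) in
      a <= u - i /\ u + i <= a' /\ b0 <= t - j /\ t + j <= b0' /\
      0 < i < eta /\ 0 < j < eta /\ Rabs (u - s0) < eta /\ Rabs (t - t0) < eta /\
      Rabs (i / j - rho) < eta /\ 0 < mixed chi (u - i) (u + i) (t - j) (t + j)).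
    { intros n; destruct (Hloc rho (/ INR (S n)) Hrho (inv_nat_pos n)) as [u [t [i [j Hq]]]].
      exists ((u, t), (i, j)); exact Hq. }
    destruct (choice _ Hn) as [q Hq]; cbv zeta in Hq.
    exists (fun n => fst (fst (q n))), (fun n => snd (fst (q n))),
           (fun n => fst (snd (q n))), (fun n => snd (snd (q n))).
    assert (Hsq : forall x l, (forall n, Rabs (x n - l) < / INR (S n)) -> Un_cv x l).
    { intros x l Hx; apply cv_squeeze with (fun n => / INR (S n)); [|apply cv_inv_nat].
      intros n; apply Rlt_le, Hx. }
    assert (Hz : forall x, (forall n, 0 < x n < / INR (S n)) -> Un_cv x 0).
    { intros x Hx; apply Hsq; intros n; specialize (Hx n); rewrite Rminus_0_r, Rabs_right; lra. }
    split.
    - unfold shrink; split; [apply Hsq; apply Hq|]; split; [apply Hsq; apply Hq|].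
      split; [apply Hz; apply Hq|]; split; [apply Hz; apply Hq|].
      split; [apply Hsq; apply Hq|].
      intros n; specialize (Hq n).
      assert (Hn1 : / INR (S n) <= 1).
      { rewrite <- Rinv_1; apply Rinv_le_contravar; [lra|]; rewrite S_INR; pose proof (pos_INR n); lra. }
      repeat split; lra.
    - intros n; specialize (Hq n); rewrite Hchi in Hq.
      pose proof (HH (fst (fst (q n))) (snd (fst (q n))) (fst (snd (q n))) (snd (snd (q n)))).
      nra. }
  assert (HKs : forall sq tq rho i j, shrink l1 l2 s0 t0 rho sq tq i j ->
     Un_cv (fun n => K (sq n) (tq n) + eps) (K s0 t0 + eps)).
  { intros sq tq rho i j [H1 [H2 _]]; apply CV_plus; [|apply cv_const]; apply HK; auto. }
  destruct (Hgen s0 t0 Hs0 Ht0) as [Hne HF].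
  assert (Ss0 : 0 < s s0) by (apply (geo_sn_pos b M d Hdiam e1 l1 _ He1); lra).
  assert (St0 : 0 < s t0) by (apply (geo_sn_pos b M d Hdiam e2 l2 _ He2); lra).
  assert (HP : 0 < s s0 * s s0 * (s t0 * s t0) * eps)
    by (clearbody eps; repeat apply Rmult_lt_0_compat; auto).
  destruct (HS s0 t0 Hs0 Ht0) as [HC|HC].
  - destruct (local_mixed b M d Hd Hdiam H4 e1 e2 l1 l2 He1 He2 s0 t0 (K s0 t0 + eps))
      as [rho [Hrho HL]]; auto; try lra.
    destruct (Hseq rho Hrho) as [sq [tq [i [j [Hsh Hm]]]]].
    destruct (HL sq tq i j _ Hsh (HKs _ _ _ _ _ Hsh) Hm) as [phi [X [Hphi [HX HE]]]].
    pose proof (HC _ _ _ _ _ X Hrho (shrink_sub _ _ _ _ _ _ _ _ _ _ Hphi Hsh) HX).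
    lra.
  (* Exchanging the geodesics inverts the aspect ratio, so the rectangles are cut with ratio
     [/ rho]. *)
  - destruct (local_mixed b M d Hd Hdiam H4 e2 e1 l2 l1 He2 He1 t0 s0 (K s0 t0 + eps))
      as [rho [Hrho HL]]; auto; try lra.
    { rewrite <- cs_dist_swap; auto. }
    assert (Hrho' : 0 < / rho) by (apply Rinv_0_lt_compat; auto).
    destruct (Hseq (/ rho) Hrho') as [sq [tq [i [j [Hsh Hm]]]]].
    pose proof (shrink_swap _ _ _ _ _ _ _ _ _ Hrho' Hsh) as Hsh2; rewrite Rinv_inv in Hsh2.
    destruct (HL tq sq j i _ Hsh2 (HKs _ _ _ _ _ Hsh)) as [phi [X [Hphi [HX HE]]]].
    { intros n; specialize (Hm n).
      replace (mixed (psi e2 e1) (tq n - j n) (tq n + j n) (sq n - i n) (sq n + i n))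
        with (mixed (psi e1 e2) (sq n - i n) (sq n + i n) (tq n - j n) (tq n + j n)); [lra|].
      unfold mixed; rewrite !(cos_angle_swap b M d Hd e2 e1); ring. }
    pose proof (HC _ _ _ _ _ X Hrho (shrink_sub _ _ _ _ _ _ _ _ _ _ Hphi Hsh2) HX).
    lra.
Qed.

End TwoGeodesics.
End Space.

Section Space.
Variables (b : bool) (M : Type) (d : M -> M -> R).
Notation σ := (sg b).
Notation c := (cs b).
Notation s := (sn b).
Hypothesis Hd : semimetric d.
Hypothesis Hdiam : b = true -> diam_le d (PI / 2).
Hypothesis H4 : upper4 b d \/ lower4 b d.

Notation dsym := (d_sym M d Hd).
Notation dpos := (d_pos M d Hd).
Notation dle := (d_le b M d Hdiam).
Notation tri := (triangle_of_4point b M d Hd Hdiam H4).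
Notation psi := (cos_angle b M d).
Notation cd := (cs_dist b M d).
Notation slope := (corner_slope b M d).

Section TwoGeodesics.
Variables (e1 e2 : R -> M) (l1 l2 : R).
Hypothesis He1 : geo d e1 l1.
Hypothesis He2 : geo d e2 l2.
Hypothesis HO : e1 0 = e2 0.
Notation sp1 := (fun u => geo_sn_pos b M d Hdiam e1 l1 u He1).
Notation sp2 := (fun u => geo_sn_pos b M d Hdiam e2 l2 u He2).

(** Let [u'] tend to 0: by [psi_first_order] the edge at [u'] contributes at most [C * u'], so the
    bound on mixed differences becomes a bound on the increment of [psi] in [t] at [u]. *)
Lemma psi_limit_bound (u t t' B : R) : 0 < u <= l1 -> 0 < t' < t -> t <= l2 ->
  (forall u', 0 < u' < u -> mixed (psi e1 e2) u' u t' t <= B) ->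
  psi e1 e2 u t <= psi e1 e2 u t' + B.
Proof.
  intros Hu Ht Htl H.
  destruct (psi_first_order b M d Hd Hdiam H4 e1 e2 l1 l2 He1 He2 HO t' t Ht Htl) as [C [HC Hpsi]].
  apply Rnot_lt_le; intros Hlt.
  set (gap := psi e1 e2 u t - (psi e1 e2 u t' + B)).
  set (u' := Rmin (Rmin 1 (u / 2)) (gap / (2 * (C + 1)))).
  assert (Hg : 0 < gap) by (unfold gap; lra).
  assert (Hq : 0 < gap / (2 * (C + 1))) by (apply Rdiv_lt_0_compat; lra).
  assert (Hu' : 0 < u' /\ u' <= 1 /\ u' <= u / 2 /\ u' <= gap / (2 * (C + 1))).
  { unfold u'; split; [repeat apply Rmin_pos; lra|].
    pose proof (Rmin_l (Rmin 1 (u / 2)) (gap / (2 * (C + 1)))).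
    pose proof (Rmin_r (Rmin 1 (u / 2)) (gap / (2 * (C + 1)))).
    pose proof (Rmin_l 1 (u / 2)); pose proof (Rmin_r 1 (u / 2)); lra. }
  specialize (H u' ltac:(lra)); specialize (Hpsi u' ltac:(lra) ltac:(lra)).
  unfold mixed in H.
  assert (C * u' <= gap / 2).
  { apply Rle_trans with (C * (gap / (2 * (C + 1)))); [apply Rmult_le_compat_l; lra|].
    apply (Rmult_le_reg_r (2 * (C + 1))); [lra|].
    replace (C * (gap / (2 * (C + 1))) * (2 * (C + 1))) with (C * gap) by (field; lra).
    nra. }
  unfold gap in *; lra.
Qed.

Lemma mixed_zero (a a' b0 b0' : R) : mixed (fun _ _ => 0) a a' b0 b0' = 0.
Proof. unfold mixed; ring. Qed.

(** The density 0 is allowed here. The condition [u + t < PI / 2] keeps the distances below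
    [PI / 2], hence their cosines positive, as [local_mixed] requires. *)
Lemma mixed_nonpos_spherical (u' u t' t : R) : b = true -> 0 < u' < u -> u <= l1 ->
  0 < t' < t -> t <= l2 -> u + t < PI / 2 ->
  (forall x y, 0 < x <= l1 -> 0 < y <= l2 -> e1 x <> e2 y) ->
  mixed (psi e1 e2) u' u t' t <= 0.
Proof.
  intros E Hu Hul Ht Htl Hut Hne; rewrite <- (mixed_zero u' u t' t).
  apply (mixed_bound b M d Hd Hdiam H4 e1 e2 l1 l2 He1 He2 u' u t' t _ (fun _ _ => 0)); auto.
  - intros x y Hx Hy; split; [apply Hne; lra|].
    apply cs_pos; intros _; pose proof (hinge_bounds M d Hd tri e1 e2 l1 l2 x y He1 He2 HO ltac:(lra) ltac:(lra)).
    pose proof (dpos (e1 x) (e2 y)); pose proof PI_RGT_0; lra.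
  - intros; rewrite mixed_zero; lra.
  - intros; apply cv_const.
  - intros x y Hx Hy; left; intros rho sq tq i j X Hrho Hsh HX.
    rewrite E; simpl; pose proof (Rle_0_sqr (X - cos x)); unfold Rsqr in *; lra.
Qed.

(** With [r = d (e1 s0) (e2 t0)], the Lipschitz bound confines [X] to the interval from
    [cosh (r - t0)] to [cosh (r + t0)], and the triangle inequality puts [cosh s0] into it too. Its
    length is the first bound. The second one is quadratic in [s0] but one-sided; [slope_refined]
    provides the other side. *)
Lemma slope_crude (s0 t0 rho X : R) (sq tq i j : nat -> R) : b = false ->
  0 < s0 <= l1 -> 0 < t0 <= l2 -> shrink l1 l2 s0 t0 rho sq tq i j ->
  Un_cv (slope e1 e2 sq tq i j) X ->
  Rabs (X - c s0) <= 2 * (s t0 * s (d (e1 s0) (e2 t0))) /\ - (2 * (s s0 * s s0)) <= X - c s0.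
Proof.
  intros E Hs Ht Hsh HX.
  pose proof (slope_limit_bound b M d Hd Hdiam H4 e1 e2 l1 l2 He1 He2 _ _ _ _ _ _ _ _ Hs Ht Hsh HX) as HB.
  pose proof (hinge_bounds M d Hd tri e1 e2 l1 l2 s0 t0 He1 He2 HO ltac:(lra) ltac:(lra)) as Hr; unfold cs_dist in HB.
  set (r := d (e1 s0) (e2 t0)) in *.
  pose proof (cs_add b r t0) as F1; pose proof (cs_sub b r t0) as F2.
  assert (Hr2 : Rabs (r - t0) <= s0 /\ s0 <= r + t0).
  { unfold Rabs in *; destruct (Rcase_abs (s0 - t0)); destruct (Rcase_abs (r - t0)); lra. }
  assert (G1 : c (r - t0) <= c s0).
  { rewrite E; simpl; apply cosh_mono; lra. }
  assert (G2 : c s0 <= c (r + t0)) by (rewrite E; simpl; apply cosh_mono; rewrite Rabs_right; lra).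
  replace σ with (-1) in * by (rewrite E; auto).
  pose proof (Rle_abs (X - c t0 * c r)); pose proof (Rabs_lb (X - c t0 * c r)).
  split; [apply Rabs_le; lra|].
  assert (G3 : c s0 - c (r - t0) <= 2 * (s s0 * s s0)).
  { pose proof (cs_diff b (r - t0) s0) as F3.
    replace σ with (-1) in F3 by (rewrite E; auto).
    assert (A1 : 0 <= s ((r - t0 + s0) / 2) <= s s0).
    { pose proof (Rabs_lb (r - t0)); pose proof (Rle_abs (r - t0)).
      rewrite E; simpl; split.
      - destruct (Req_dec ((r - t0 + s0) / 2) 0) as [->|]; [rewrite sinh_0; lra|].
        rewrite <- sinh_0; apply Rlt_le, sinh_lt; lra.
      - destruct (Req_dec ((r - t0 + s0) / 2) s0) as [->|]; [lra|]; apply Rlt_le, sinh_lt; lra. }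
    assert (A2 : 0 <= - s ((r - t0 - s0) / 2) <= s s0).
    { pose proof (Rabs_lb (r - t0)); pose proof (Rle_abs (r - t0)).
      rewrite <- sn_neg, E; simpl; split.
      - destruct (Req_dec (- ((r - t0 - s0) / 2)) 0) as [->|]; [rewrite sinh_0; lra|].
        rewrite <- sinh_0; apply Rlt_le, sinh_lt; lra.
      - destruct (Req_dec (- ((r - t0 - s0) / 2)) s0) as [->|]; [lra|]; apply Rlt_le, sinh_lt; lra. }
    nra. }
  lra.
Qed.

End TwoGeodesics.

(** For [y <= x] the distance is at most [2 * x], so the crude slope bound is [4 * cosh B] times
    [sn x * sn y], and half its square gives the constant density. For [x < y] the geodesics are
    exchanged. *)
Lemma mixed_rough (e1 e2 : R -> M) (l1 l2 B u' u t' t : R) : b = false ->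
  geo d e1 l1 -> geo d e2 l2 -> e1 0 = e2 0 -> l1 <= B -> l2 <= B ->
  0 < u' < u -> u <= l1 -> 0 < t' < t -> t <= l2 ->
  (forall x y, 0 < x <= l1 -> 0 < y <= l2 -> e1 x <> e2 y) ->
  mixed (psi e1 e2) u' u t' t <= 8 * (cosh B * cosh B) * ((u - u') * (t - t')).
Proof.
  intros E He1 He2 HO HB1 HB2 Hu Hul Ht Htl Hne.
  set (K := 8 * (cosh B * cosh B)).
  replace (K * ((u - u') * (t - t'))) with (mixed (fun x y => K * (x * y)) u' u t' t)
    by (unfold mixed; ring).
  assert (Ctl : forall f1 f2 m1 m2 x y, geo d f1 m1 -> geo d f2 m2 -> f1 0 = f2 0 -> m1 <= B ->
     0 < x <= m1 -> 0 < y <= m2 -> y <= x -> slope_control b M d f1 f2 m1 m2 K x y).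
  { intros f1 f2 m1 m2 x y G1 G2 G0 HmB Hx Hy Hyx rho sq tq i j X Hrho Hsh HX.
    destruct (slope_crude f1 f2 m1 m2 G1 G2 G0 x y rho X sq tq i j E Hx Hy Hsh HX) as [HC _].
    pose proof (hinge_bounds M d Hd tri f1 f2 m1 m2 x y G1 G2 G0 ltac:(lra) ltac:(lra)) as [_ Hr].
    replace σ with (-1) by (rewrite E; auto).
    assert (Sx : 0 < s x) by (apply (geo_sn_pos b M d Hdiam f1 m1 _ G1); lra).
    assert (Sy : 0 < s y) by (apply (geo_sn_pos b M d Hdiam f2 m2 _ G2); lra).
    assert (S1 : s (d (f1 x) (f2 y)) <= 2 * s x * cosh B).
    { apply Rle_trans with (s (2 * x)).
      - rewrite E; simpl; destruct (Req_dec (d (f1 x) (f2 y)) (2 * x)) as [->|]; [lra|].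
        apply Rlt_le, sinh_lt; lra.
      - replace (s (2 * x)) with (2 * s x * c x)
          by (replace (2 * x) with (x + x) by ring; rewrite sn_add; ring).
        apply Rmult_le_compat_l; [lra|]; rewrite E; simpl; apply cosh_mono; rewrite Rabs_right; lra. }
    assert (S2 : 2 * (s y * s (d (f1 x) (f2 y))) <= 4 * cosh B * (s x * s y)) by nra.
    pose proof (sq_le_of_abs _ _ (Rle_trans _ _ _ HC S2)) as Q.
    unfold K; nra. }
  apply (mixed_bound b M d Hd Hdiam H4 e1 e2 l1 l2 He1 He2 u' u t' t _ (fun _ _ => K)); auto.
  - intros x y Hx Hy; split; [apply Hne; lra|].
    apply cs_pos; intros E'; rewrite E in E'; discriminate.
  - intros; unfold mixed; right; ring.
  - intros; apply cv_const.
  - intros x y Hx Hy; destruct (Rle_dec y x) as [H|H]; [left|right]; apply Ctl; auto; lra.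
Qed.

End Space.

Lemma sinh_ge (x : R) : 0 <= x -> x <= sinh x.
Proof.
  intros Hx; destruct (Req_dec x 0) as [->|H]; [rewrite sinh_0; lra|].
  destruct (MVT_cor2 sinh cosh 0 x) as [z [Hz _]]; [lra | intros; apply derivable_pt_lim_sinh|].
  rewrite sinh_0, !Rminus_0_r in Hz; rewrite Hz; pose proof (cosh_ge_1 z); nra.
Qed.

Section Space.
Variables (b : bool) (M : Type) (d : M -> M -> R).
Notation σ := (sg b).
Notation c := (cs b).
Notation s := (sn b).
Hypothesis Hd : semimetric d.
Hypothesis Hdiam : b = true -> diam_le d (PI / 2).
Hypothesis H4 : upper4 b d \/ lower4 b d.

Notation dsym := (d_sym M d Hd).
Notation dpos := (d_pos M d Hd).
Notation dle := (d_le b M d Hdiam).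
Notation tri := (triangle_of_4point b M d Hd Hdiam H4).
Notation psi := (cos_angle b M d).
Notation cd := (cs_dist b M d).
Notation slope := (corner_slope b M d).

Section Hyperbolic.
Hypothesis E : b = false.
Variables (e1 e2 : R -> M) (l1 l2 B : R).
Hypothesis He1 : geo d e1 l1.
Hypothesis He2 : geo d e2 l2.
Hypothesis HO : e1 0 = e2 0.
Hypothesis HB1 : l1 <= B.
Hypothesis HB2 : l2 <= B.
Hypothesis Hne : forall x y, 0 < x <= l1 -> 0 < y <= l2 -> e1 x <> e2 y.
Notation sp1 := (fun u => geo_sn_pos b M d Hdiam e1 l1 u He1).
Notation sp2 := (fun u => geo_sn_pos b M d Hdiam e2 l2 u He2).
Notation C8 := (8 * (cosh B * cosh B)).

Lemma sg_hyp : σ = -1.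
Proof. now rewrite E. Qed.

Lemma psi_rough (u t' t : R) : 0 < u <= l1 -> 0 < t' < t -> t <= l2 ->
  psi e1 e2 u t <= psi e1 e2 u t' + C8 * (u * (t - t')).
Proof.
  intros Hu Ht Htl.
  apply (psi_limit_bound b M d Hd Hdiam H4 e1 e2 l1 l2 He1 He2 HO); auto.
  intros u' Hu'; eapply Rle_trans.
  - apply (mixed_rough b M d Hd Hdiam H4 e1 e2 l1 l2 B); auto; lra.
  - pose proof (cosh_ge_1 B); apply Rmult_le_compat_l; [nra|]; apply Rmult_le_compat_r; lra.
Qed.

Lemma cv_psi (s0 t0 : R) (x y : nat -> R) : 0 < s0 <= l1 -> 0 < t0 <= l2 ->
  Un_cv x s0 -> Un_cv y t0 -> (forall n, 0 <= x n <= l1) -> (forall n, 0 <= y n <= l2) ->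
  Un_cv (fun n => psi e1 e2 (x n) (y n)) (psi e1 e2 s0 t0).
Proof.
  intros Hs Ht Hx Hy Hx1 Hy1.
  assert (Hdd : Un_cv (fun n => d (e1 (x n)) (e2 (y n))) (d (e1 s0) (e2 t0)))
    by (apply (cv_hinge M d Hd tri e1 e2 l1 l2); auto; lra).
  pose proof (sp1 s0 Hs); pose proof (sp2 t0 Ht).
  unfold cos_angle; eapply cv_eq; [cv | reflexivity]; nra.
Qed.

(** For smooth [psi], [X - cs s0] would be [sn s0 * sn t0 ^ 2] times the derivative of [psi] in [t],
    whose growth [psi_rough] limits. For difference quotients, [W] is the resulting lower bound for
    the increment of the cosine, and [V] the upper bound for the slope. *)
Lemma slope_refined (s0 t0 rho X : R) (sq tq i j : nat -> R) :
  0 < s0 <= l1 -> 0 < t0 <= l2 -> shrink l1 l2 s0 t0 rho sq tq i j ->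
  Un_cv (slope e1 e2 sq tq i j) X ->
  X - c s0 <= C8 * (s0 * s s0 * (s t0 * s t0)).
Proof.
  intros Hs Ht Hsh HX.
  pose proof (shrink_corners b M d Hd Hdiam H4 e1 e2 l1 l2 He1 He2 _ _ _ _ _ _ _ Hs Ht Hsh)
    as [K1 [K2 [K3 K4]]].
  destruct Hsh as [H1 [H2 [H3 [H4' [H5 H6]]]]].
  set (W := fun x t j => 2 * s j * (c x * s t - s x * c t * psi e1 e2 x (t + j))
                         - 2 * j * (C8 * (x * s x * s (t - j)))).
  assert (HW : forall x t j, 0 < x <= l1 -> 0 < j -> 0 < t - j -> t + j <= l2 ->
            W x t j <= cd e1 e2 x (t + j) - cd e1 e2 x (t - j)).
  { intros x t k Hx Hk Ht1 Ht2.
    pose proof (sp1 x Hx) as Sx; pose proof (sp2 (t + k) ltac:(lra)); pose proof (sp2 (t - k) ltac:(lra)) as St.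
    rewrite !cd_psi by lra; rewrite sg_hyp.
    pose proof (psi_rough x (t - k) (t + k) Hx ltac:(lra) Ht2) as Hr.
    replace (t + k - (t - k)) with (2 * k) in Hr by ring.
    apply (Rmult_le_compat_l (s x * s (t - k))) in Hr; [|nra].
    unfold W; revert Hr; set (p1 := psi e1 e2 x (t + k)); set (p2 := psi e1 e2 x (t - k)); intros Hr.
    assert (I1 : c (t + k) - c (t - k) = 2 * (s t * s k))
      by (rewrite cs_add, cs_sub, sg_hyp; ring).
    assert (I2 : s (t + k) = s (t - k) + 2 * (c t * s k)) by (rewrite sn_add, sn_sub; ring).
    rewrite I2; clear I2; replace (c (t + k)) with (c (t - k) + 2 * (s t * s k)) by lra.
    lra. }
  set (V := fun n =>
    c (tq n) * ((cd e1 e2 (sq n - i n) (tq n - j n) + cd e1 e2 (sq n + i n) (tq n + j n)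
                 + cd e1 e2 (sq n + i n) (tq n - j n) + cd e1 e2 (sq n - i n) (tq n + j n)) / 4)
          / (c (i n) * c (j n))
    - s (tq n) / c (i n) * ((c (sq n + i n) * s (tq n) - s (sq n + i n) * c (tq n) * psi e1 e2 (sq n + i n) (tq n + j n))
       + (c (sq n - i n) * s (tq n) - s (sq n - i n) * c (tq n) * psi e1 e2 (sq n - i n) (tq n + j n))) / 2
    + s (tq n) / c (i n) / (s (j n) / j n) * (C8 * ((sq n + i n) * s (sq n + i n) * s (tq n - j n)
         + (sq n - i n) * s (sq n - i n) * s (tq n - j n))) / 2).
  assert (HV : forall n, slope e1 e2 sq tq i j n <= V n).
  { intros n; destruct (H6 n) as [G1 [G2 [G3 [G4 [G5 G6]]]]].
    destruct (small_trig b _ G1) as [A1 [A2 A3]]; destruct (small_trig b _ G2) as [B1 [B2 B3]].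
    pose proof (HW (sq n + i n) (tq n) (j n) ltac:(lra) ltac:(lra) ltac:(lra) ltac:(lra)) as W1.
    pose proof (HW (sq n - i n) (tq n) (j n) ltac:(lra) ltac:(lra) ltac:(lra) ltac:(lra)) as W2.
    pose proof (sp2 (tq n) ltac:(lra)) as St.
    assert (EV : V n = c (tq n) * ((cd e1 e2 (sq n - i n) (tq n - j n) + cd e1 e2 (sq n + i n) (tq n + j n)
                 + cd e1 e2 (sq n + i n) (tq n - j n) + cd e1 e2 (sq n - i n) (tq n + j n)) / 4)
          / (c (i n) * c (j n))
       - s (tq n) / (c (i n) * s (j n)) * ((W (sq n + i n) (tq n) (j n) + W (sq n - i n) (tq n) (j n)) / 4))
      by (unfold V, W; field; repeat split; lra).
    rewrite EV; unfold corner_slope, slope_s, corner_mm, corner_pp, corner_pm, corner_mp; unfold Rminus at 1 6.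
    apply Rplus_le_compat_l, Ropp_le_contravar.
    match goal with |- _ <= s (tq n) * ?x / ?y =>
      replace (s (tq n) * x / y) with (s (tq n) / y * x) by (unfold Rdiv; ring) end.
    apply Rmult_le_compat_l; [|lra].
    apply Rlt_le, Rdiv_lt_0_compat; [lra | apply Rmult_lt_0_compat; auto]. }
  assert (Hsp : Un_cv (fun n => sq n + i n) s0) by (eapply cv_eq; [cv | ring]).
  assert (Hsm : Un_cv (fun n => sq n - i n) s0) by (eapply cv_eq; [cv | ring]).
  assert (Htp : Un_cv (fun n => tq n + j n) t0) by (eapply cv_eq; [cv | ring]).
  assert (Htm : Un_cv (fun n => tq n - j n) t0) by (eapply cv_eq; [cv | ring]).
  assert (Q1 : Un_cv (fun n => psi e1 e2 (sq n + i n) (tq n + j n)) (psi e1 e2 s0 t0))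
    by (apply cv_psi; auto; intros n; specialize (H6 n); lra).
  assert (Q2 : Un_cv (fun n => psi e1 e2 (sq n - i n) (tq n + j n)) (psi e1 e2 s0 t0))
    by (apply cv_psi; auto; intros n; specialize (H6 n); lra).
  assert (Hj1 : Un_cv (fun n => s (j n) / j n) 1)
    by (apply cv_sn_ratio; auto; intros n; specialize (H6 n); lra).
  pose proof (sp1 s0 Hs) as Ss; pose proof (sp2 t0 Ht) as St.
  assert (HVl : Un_cv V (c s0 + C8 * (s0 * s s0 * (s t0 * s t0)))).
  { eapply cv_eq; [unfold V, cs_dist; cv; rewrite ?cs_0; lra|].
    rewrite cs_0; fold (cd e1 e2 s0 t0); rewrite cd_psi, sg_hyp by lra.
    pose proof (pyth b t0) as P; rewrite sg_hyp in P.
    transitivity (c s0 * (c t0 * c t0 + -1 * (s t0 * s t0)) + C8 * (s0 * s s0 * (s t0 * s t0)));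
      [field | rewrite P; ring]. }
  pose proof (cv_le _ _ _ _ HV HX HVl); lra.
Qed.

(** Both bounds on [X - cs x] are now of order [x^2], so the constant density improves to
    [k * x^2 / y^2]. The function [- (k / 3) * x^3 / y] has this density as its mixed derivative. *)
Lemma psi_refined : exists C, 0 <= C /\ forall u t' t, 0 < u <= l1 -> 0 < t' < t -> t <= l2 ->
  2 * u <= t' -> psi e1 e2 u t <= psi e1 e2 u t' + C * (u * u * u / t').
Proof.
  pose proof (cosh_ge_1 B) as HcB.
  set (k1 := 2 * (cosh B * cosh B) + C8 * (cosh B * (sinh B * sinh B))).
  assert (Hk1 : 0 <= k1).
  { unfold k1; apply Rplus_le_le_0_compat; [nra|].
    apply Rmult_le_pos; [nra|]; apply Rmult_le_pos; [lra|]; apply Rle_0_sqr. }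
  assert (Hsinh : forall x, 0 < x <= B -> s x <= cosh B * x /\ x <= s x /\ s x <= sinh B).
  { intros x Hx; rewrite E; simpl; repeat split.
    - pose proof (sn_small false x B) as Hx2; simpl in Hx2.
      rewrite (Rabs_right x) in Hx2 by lra; specialize (Hx2 ltac:(lra)).
      pose proof (Rle_abs (sinh x)); lra.
    - apply sinh_ge; lra.
    - destruct (Req_dec x B) as [->|]; [lra|]; apply Rlt_le, sinh_lt; lra. }
  set (k := k1 * k1 / 2); exists (k / 3).
  assert (Hk : 0 <= k) by (unfold k; nra).
  split; [lra|].
  intros u t' t Hu Ht Htl Hut.
  apply (psi_limit_bound b M d Hd Hdiam H4 e1 e2 l1 l2 He1 He2 HO); auto.
  intros u' Hu'.
  eapply Rle_trans; [apply (mixed_bound b M d Hd Hdiam H4 e1 e2 l1 l2 He1 He2 u' u t' t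
     (fun x y => - (k / 3) * (x * x * x) / y) (fun x y => k * (x * x) / (y * y))); try lra|].
  - intros x y Hx Hy; split; [apply Hne; lra|].
    apply cs_pos; intros E'; rewrite E in E'; discriminate.
  - intros x y i j Hx1 Hx2 Hy1 Hy2 Hi Hj; unfold mixed.
    assert (HJ : 0 < (y - j) * (y + j)) by (apply Rmult_lt_0_compat; lra).
    match goal with |- _ <= ?r => replace r with
      (4 * i * j * (k * (x * x + i * i / 3) / ((y - j) * (y + j)))) by (field; lra) end.
    apply Rmult_le_compat_l; [nra|].
    apply Rmult_le_compat; [apply Rmult_le_pos; [lra | nra] | | |].
    + apply Rlt_le, Rinv_0_lt_compat; nra.
    + apply Rmult_le_compat_l; [lra|]; nra.
    + apply Rinv_le_contravar; nra.
  - intros sq tq s0 t0 H1 H2 H3 H5; eapply cv_eq; [cv; nra | reflexivity].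
  - intros x y Hx Hy; left; intros rho sq tq i j X Hrho Hsh HX.
    pose proof (slope_refined x y rho X sq tq i j ltac:(lra) ltac:(lra) Hsh HX) as R1.
    destruct (slope_crude b M d Hd Hdiam H4 e1 e2 l1 l2 He1 He2 HO x y rho X sq tq i j E
       ltac:(lra) ltac:(lra) Hsh HX) as [_ R2].
    destruct (Hsinh x ltac:(lra)) as [Sx1 [Sx2 _]]; destruct (Hsinh y ltac:(lra)) as [Sy1 [Sy2 Sy3]].
    rewrite sg_hyp.
    assert (Q : Rabs (X - c x) <= k1 * (x * x)).
    { assert (P0 : 0 <= C8 * (cosh B * (sinh B * sinh B)) * (x * x)).
      { apply Rmult_le_pos; [|nra]; apply Rmult_le_pos; [nra|]; apply Rmult_le_pos; [lra|]; apply Rle_0_sqr. }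
      apply Rabs_le; unfold k1; split.
      - assert (s x * s x <= (cosh B * x) * (cosh B * x)) by (apply Rmult_le_compat; lra).
        replace ((cosh B * x) * (cosh B * x)) with (cosh B * cosh B * (x * x)) in H by ring. lra.
      - assert (x * s x * (s y * s y) <= x * (cosh B * x) * (sinh B * sinh B)).
        { apply Rmult_le_compat; [nra | nra | |apply Rmult_le_compat; lra].
          apply Rmult_le_compat_l; lra. }
        assert (C8 * (x * s x * (s y * s y)) <= C8 * (x * (cosh B * x) * (sinh B * sinh B)))
          by (apply Rmult_le_compat_l; [nra | auto]).
        assert (0 <= 2 * (cosh B * cosh B) * (x * x)) by (apply Rmult_le_pos; nra).
        replace (C8 * (x * (cosh B * x) * (sinh B * sinh B)))
          with (C8 * (cosh B * (sinh B * sinh B)) * (x * x)) in H0 by ring.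
        lra. }
    apply sq_le_of_abs in Q.
    assert (Z : 2 * (x * x * (y * y) * (k * (x * x) / (y * y)))
                <= 2 * (s x * s x * (s y * s y) * (k * (x * x) / (y * y)))).
    { apply Rmult_le_compat_l; [lra|]; apply Rmult_le_compat_r.
      - apply Rmult_le_pos; [apply Rmult_le_pos; nra | apply Rlt_le, Rinv_0_lt_compat; nra].
      - apply Rmult_le_compat; nra. }
    replace (2 * (x * x * (y * y) * (k * (x * x) / (y * y)))) with (k1 * (x * x) * (k1 * (x * x))) in Z
      by (unfold k; field; lra).
    lra.
  - unfold mixed.
    match goal with |- ?l <= _ => replace l with (k / 3 * ((u * u * u - u' * u' * u') * (/ t' - / t))) by (field; lra) end.
    assert (0 < / t) by (apply Rinv_0_lt_compat; lra).
    assert (/ t < / t') by (apply Rinv_lt_contravar; nra).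
    unfold Rdiv at 2; apply Rmult_le_compat_l; [lra|].
    assert (0 < u' * u' * u') by (repeat apply Rmult_lt_0_compat; lra).
    assert (u' * u' * u' <= u * u * u) by (apply Rmult_le_compat; [nra | lra | nra | lra]).
    apply Rmult_le_compat; lra.
Qed.

End Hyperbolic.

(** Later [t'] tends to 0 with [u] fixed, so the error must be independent of [t']; being quadratic
    in [u], it becomes cubic for [h] through the factor [sn u]. *)
Lemma psi_second_order (e1 e2 : R -> M) (l1 r : R) :
  geo d e1 l1 -> geo d e2 r -> e1 0 = e2 0 -> 0 < l1 -> 0 < r -> (b = true -> r < PI / 2) ->
  exists C d0, 0 <= C /\ 0 < d0 /\ forall u t', 0 < u < d0 -> 0 < t' < u ->
    u <= l1 /\ psi e1 e2 u r <= psi e1 e2 u t' + C * (u * u).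
Proof.
  intros He1 He2 HO Hl1 Hr Hrb.
  destruct (classic (forall x y, 0 < x <= l1 -> 0 < y <= r -> e1 x <> e2 y)) as [Hne|Hco].
  - destruct (Bool.bool_dec b true) as [E|E].
    + set (d0 := Rmin (Rmin l1 r) (PI / 2 - r)); specialize (Hrb E).
      exists 0, d0; split; [lra|]; split; [unfold d0; repeat apply Rmin_pos; lra|].
      intros u t' Hu Ht'.
      assert (Hd0 : d0 <= l1 /\ d0 <= r /\ d0 <= PI / 2 - r).
      { pose proof (Rmin_l (Rmin l1 r) (PI / 2 - r)); pose proof (Rmin_r (Rmin l1 r) (PI / 2 - r)).
        pose proof (Rmin_l l1 r); pose proof (Rmin_r l1 r); unfold d0; lra. }
      split; [lra|]; rewrite Rmult_0_l.
      apply (psi_limit_bound b M d Hd Hdiam H4 e1 e2 l1 r He1 He2 HO); try lra.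
      intros u' Hu'; apply (mixed_nonpos_spherical b M d Hd Hdiam H4 e1 e2 l1 r); auto; lra.
    + apply Bool.not_true_is_false in E.
      set (B := Rmax l1 r).
      assert (HB : l1 <= B /\ r <= B) by (split; [apply Rmax_l | apply Rmax_r]).
      destruct (psi_refined E e1 e2 l1 r B He1 He2 HO ltac:(lra) ltac:(lra) Hne) as [C [HC HP]].
      set (d0 := Rmin l1 (r / 2)).
      assert (Hd0 : d0 <= l1 /\ d0 <= r / 2) by (split; [apply Rmin_l | apply Rmin_r]).
      pose proof (cosh_ge_1 B) as HcB.
      exists (C / 2 + 16 * (cosh B * cosh B)), d0; split; [nra|]; split; [unfold d0; apply Rmin_pos; lra|].
      intros u t' Hu Ht'; split; [lra|].
      (* The range of [t] is split at [2 * u]: the refined bound on the outer part and the rough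
         bound on the inner part both cost a multiple of [u^2]. *)
      pose proof (HP u (2 * u) r ltac:(lra) ltac:(lra) ltac:(lra) ltac:(lra)) as P1.
      pose proof (psi_rough E e1 e2 l1 r B He1 He2 HO ltac:(lra) ltac:(lra) Hne u t' (2 * u)
         ltac:(lra) ltac:(lra) ltac:(lra)) as P2.
      replace (C * (u * u * u / (2 * u))) with (C / 2 * (u * u)) in P1 by (field; lra).
      assert (8 * (cosh B * cosh B) * (u * (2 * u - t')) <= 16 * (cosh B * cosh B) * (u * u)).
      { replace (16 * (cosh B * cosh B) * (u * u)) with (8 * (cosh B * cosh B) * (u * (2 * u))) by ring.
        apply Rmult_le_compat_l; [nra|]; apply Rmult_le_compat_l; lra. }
      lra.
  (* Geodesics that meet do so at equal distance from the origin, hence coincide up to there by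
     uniqueness, and [psi] is 1. *)
  - assert (Hx : exists x, 0 < x <= l1 /\ x <= r /\ e1 x = e2 x).
    { apply NNPP; intros Hno; apply Hco; intros x y Hx Hy Exy; apply Hno; exists x.
      pose proof (geo_0 M d e1 l1 x He1 ltac:(lra)) as D1; pose proof (geo_0 M d e2 r y He2 ltac:(lra)) as D2.
      rewrite Exy, HO in D1; assert (x = y) by lra; subst y; repeat split; auto; lra. }
    destruct Hx as [x [Hx [Hxr Exx]]].
    assert (Hsub : forall e l, x <= l -> geo d e l -> geo d e x)
      by (intros e l Hl He u v Hu Hv; apply He; lra).
    pose proof (geo_unique b M d Hd Hdiam H4 e1 e2 x (Hsub e1 l1 ltac:(lra) He1) (Hsub e2 r ltac:(lra) He2) HO Exx) as Hsame.
    exists 0, x; split; [lra|]; split; [lra|].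
    intros u t' Hu Ht'; split; [lra|].
    assert (H1 : forall t, 0 < t <= r -> psi e1 e2 u t = 1).
    { intros t Ht; unfold cos_angle; rewrite Hsame, He2 by lra.
      rewrite (c_abs b), cs_sub.
      pose proof (geo_sn_pos b M d Hdiam e1 l1 u He1 ltac:(lra)).
      pose proof (geo_sn_pos b M d Hdiam e2 r t He2 ltac:(lra)).
      replace (σ * (c u * c t + σ * (s u * s t) - c u * c t)) with ((σ * σ) * (s u * s t)) by ring.
      rewrite sg_sq; field; lra. }
    rewrite !H1; lra.
Qed.

End Space.

(** * The maximum principle and the comparison inequality *)

(** The retraction onto [[0, l]]: composed with it, a function that is continuous on the interval
    becomes continuous on the whole line. *)
Definition clamp (l x : R) : R := Rmax 0 (Rmin x l).

Lemma clamp_in (l x : R) : 0 <= l -> 0 <= clamp l x <= l.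
Proof.
  intros H; unfold clamp, Rmax, Rmin; destruct (Rle_dec x l); destruct (Rle_dec 0 _); lra.
Qed.

Lemma clamp_id (l x : R) : 0 <= x <= l -> clamp l x = x.
Proof.
  intros H; unfold clamp, Rmax, Rmin; destruct (Rle_dec x l); destruct (Rle_dec 0 _); lra.
Qed.

Lemma clamp_lip (l x y : R) : 0 <= l -> Rabs (clamp l x - clamp l y) <= Rabs (x - y).
Proof.
  intros H; unfold clamp, Rmax, Rmin, Rabs.
  destruct (Rle_dec x l); destruct (Rle_dec y l);
    repeat (destruct (Rle_dec 0 _)); repeat (destruct (Rcase_abs _)); lra.
Qed.

Lemma lip_continuity (f : R -> R) (L : R) :
  (forall x y, Rabs (f x - f y) <= L * Rabs (x - y)) -> continuity f.
Proof.
  intros H x e He; exists (e / (Rabs L + 1)); pose proof (Rabs_pos L); split.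
  - apply Rdiv_lt_0_compat; lra.
  - intros y [_ Hy]; simpl in *; unfold Rdist in *.
    eapply Rle_lt_trans; [apply H|].
    pose proof (Rle_abs L); pose proof (Rabs_pos (y - x)).
    apply Rle_lt_trans with (Rabs L * Rabs (y - x)); [apply Rmult_le_compat_r; lra|].
    apply (Rmult_lt_compat_r (Rabs L + 1)) in Hy; [|lra].
    replace (e / (Rabs L + 1) * (Rabs L + 1)) with e in Hy by (field; lra); nra.
Qed.

(** A positive strict supersolution of [f'' + K f = 0]. In the spherical case the frequency [3 / 2]
    exceeds 1, while the argument stays within [3 pi / 8] for [l <= pi / 2]; in the hyperbolic case
    a constant serves. *)
Definition barrier (b : bool) (l x : R) : R := if b then cos (3 / 2 * (x - l / 2)) else 1.
Definition barrier_ratio (b : bool) (x : R) : R := if b then cos (3 / 2 * x) else 1.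

Lemma barrier_pos (b : bool) (l x : R) : 0 <= x <= l -> (b = true -> l <= PI / 2) -> 0 < barrier b l x.
Proof.
  intros Hx Hl; unfold barrier; destruct b; [|lra].
  specialize (Hl eq_refl); pose proof PI_RGT_0; apply cos_gt_0; lra.
Qed.

Lemma barrier_sum (b : bool) (l x u : R) :
  barrier b l (x + u) + barrier b l (x - u) = 2 * barrier_ratio b u * barrier b l x.
Proof.
  unfold barrier, barrier_ratio; destruct b; [|ring].
  replace (3 / 2 * (x + u - l / 2)) with (3 / 2 * (x - l / 2) + 3 / 2 * u) by ring.
  replace (3 / 2 * (x - u - l / 2)) with (3 / 2 * (x - l / 2) - 3 / 2 * u) by ring.
  rewrite cos_plus, cos_minus; ring.
Qed.

Lemma barrier_gap (b : bool) (u : R) : 0 < u <= 1 / 2 -> u * u / 8 <= cs b u - barrier_ratio b u.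
Proof.
  intros Hu; unfold cs, barrier_ratio; destruct b.
  - pose proof (cs_diff true (3 / 2 * u) u) as H; simpl in H.
    replace ((3 / 2 * u + u) / 2) with (5 / 4 * u) in H by field.
    replace ((3 / 2 * u - u) / 2) with (u / 4) in H by field.
    pose proof (sn_half true (5 / 4 * u) ltac:(lra)) as H1.
    pose proof (sn_half true (u / 4) ltac:(lra)) as H2; simpl in *.
    rewrite H; nra.
  - pose proof (cs_double' false u) as H; simpl in H.
    pose proof (sinh_ge (u / 2) ltac:(lra)); nra.
Qed.

Section MaxPrinciple.
Variables (b : bool) (h : R -> R) (l L : R).
Notation σ := (sg b).
Notation c := (cs b).
Notation s := (sn b).
Hypothesis Hl : 0 < l.
Hypothesis Hlb : b = true -> l <= PI / 2.
Hypothesis Hlip : forall x y, 0 <= x <= l -> 0 <= y <= l -> Rabs (h x - h y) <= L * Rabs (x - y).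
Hypothesis Hloc : forall x, 0 < x < l -> exists C d0, 0 <= C /\ 0 < d0 /\
  forall u, 0 < u < d0 -> σ * (h (x + u) + h (x - u)) <= σ * (2 * c u * h x) + C * (u * u * u).

(** [D] is [σ] times the difference between [h] and the solution with the same end values. At a
    minimum [m] of [D / barrier] with negative value, a negative multiple of [barrier] touches [D]
    from below, and comparing second differences at [m] bounds a positive multiple of [u^2] by
    [C * u^3]. Only the point [m] is tested, so [C] and [d0] may depend on the point. *)
Lemma trig_concave (x : R) : 0 <= x <= l ->
  σ * (s (l - x) * h 0 + s x * h l) <= σ * (s l * h x).
Proof.
  pose proof PI_RGT_0 as HPI.
  assert (Sl : 0 < s l) by (apply sn_pos; auto; intros E; specialize (Hlb E); lra).
  set (D := fun x => σ * (h x - (s (l - x) * h 0 + s x * h l) / s l)).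
  assert (HD0 : D 0 = 0) by (unfold D; rewrite Rminus_0_r, sn_0; field; lra).
  assert (HDl : D l = 0) by (unfold D; rewrite Rminus_diag, sn_0; field; lra).
  assert (Hcl : forall y, barrier b l y <> 0 ->
      continuity_pt (fun x => D (clamp l x) / barrier b l x) y).
  { intros y Hy.
    assert (C1 : continuity (clamp l)).
    { apply (lip_continuity _ 1); intros u v; rewrite Rmult_1_l; apply clamp_lip; lra. }
    assert (C2 : continuity (fun x => h (clamp l x))).
    { apply (lip_continuity _ (Rabs L)); intros u v.
      eapply Rle_trans; [apply Hlip; apply clamp_in; lra|].
      pose proof (clamp_lip l u v ltac:(lra)); pose proof (Rle_abs L); pose proof (Rabs_pos L).
      pose proof (Rabs_pos (clamp l u - clamp l v)).
      apply Rle_trans with (Rabs L * Rabs (clamp l u - clamp l v));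
        [apply Rmult_le_compat_r; lra | apply Rmult_le_compat_l; lra]. }
    apply continuity_pt_div; auto.
    - apply (continuity_scal (fun x => h (clamp l x)
         - (s (l - clamp l x) * h 0 + s (clamp l x) * h l) / s l) σ).
      apply continuity_minus; auto.
      apply (continuity_div (fun x => s (l - clamp l x) * h 0 + s (clamp l x) * h l) (fun _ => s l)).
      + apply continuity_plus.
        * apply continuity_mult; [|apply continuity_const; intros ? ?; auto].
          apply (continuity_comp (fun x => l - clamp l x) s); [|apply cont_sn].
          apply (continuity_minus (fun _ => l) (clamp l)); auto.
          apply continuity_const; intros ? ?; auto.
        * apply continuity_mult; [|apply continuity_const; intros ? ?; auto].
          apply (continuity_comp (clamp l) s); auto; apply cont_sn.
      + apply continuity_const; intros ? ?; auto.
      + intros _; lra.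
    - unfold barrier; destruct b.
      + apply (continuity_comp (fun x => 3 / 2 * (x - l / 2)) cos); [|apply continuity_cos].
        apply (lip_continuity _ (3 / 2)); intros u v.
        replace (3 / 2 * (u - l / 2) - 3 / 2 * (v - l / 2)) with (3 / 2 * (u - v)) by ring.
        rewrite Rabs_mult, (Rabs_right (3 / 2)); lra.
      + apply continuity_const; intros ? ?; auto. }
  destruct (continuity_ab_min (fun x => D (clamp l x) / barrier b l x) 0 l) as [m [Hm Hml]]; [lra| |].
  { intros y Hy; apply Hcl; pose proof (barrier_pos b l y Hy Hlb); lra. }
  assert (Hmin : forall y, 0 <= y <= l -> D m / barrier b l m * barrier b l y <= D y).
  { intros y Hy; specialize (Hm y Hy); rewrite !clamp_id in Hm by auto.
    pose proof (barrier_pos b l y Hy Hlb) as Hb.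
    apply (Rmult_le_compat_r (barrier b l y)) in Hm; [|lra].
    replace (D y / barrier b l y * barrier b l y) with (D y) in Hm by (field; lra); auto. }
  assert (Hpos : 0 <= D m).
  { apply Rnot_lt_le; intros Hneg.
    assert (Hmi : 0 < m < l).
    { split; apply Rnot_le_lt; intros Hle.
      - replace m with 0 in Hneg by lra; lra.
      - replace m with l in Hneg by lra; lra. }
    pose proof (barrier_pos b l m Hml Hlb) as Hbm.
    set (k := - (D m / barrier b l m)).
    assert (Hk : 0 < k).
    { unfold k; replace (- (D m / barrier b l m)) with ((- D m) / barrier b l m) by (field; lra).
      apply Rdiv_lt_0_compat; lra. }
    destruct (Hloc m Hmi) as [C [d0 [HC [Hd0 Hd]]]].
    (* The gap [u^2 / 8] from [barrier_gap], times [2 * (k * barrier b l m)], is [w * u^2]. *)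
    set (w := k * barrier b l m / 4).
    assert (Hw : 0 < w) by (unfold w; nra).
    set (u := Rmin (Rmin (d0 / 2) (1 / 2)) (Rmin (Rmin (m / 2) ((l - m) / 2)) (w / (C + 1) / 2))).
    assert (Hwq : 0 < w / (C + 1)) by (apply Rdiv_lt_0_compat; lra).
    assert (Hu : 0 < u /\ u <= d0 / 2 /\ u <= 1 / 2 /\ u <= m / 2 /\ u <= (l - m) / 2 /\ u <= w / (C + 1) / 2).
    { split; [unfold u; repeat apply Rmin_pos; lra|].
      pose proof (Rmin_l (Rmin (d0 / 2) (1 / 2)) (Rmin (Rmin (m / 2) ((l - m) / 2)) (w / (C + 1) / 2))).
      pose proof (Rmin_r (Rmin (d0 / 2) (1 / 2)) (Rmin (Rmin (m / 2) ((l - m) / 2)) (w / (C + 1) / 2))).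
      pose proof (Rmin_l (d0 / 2) (1 / 2)); pose proof (Rmin_r (d0 / 2) (1 / 2)).
      pose proof (Rmin_l (Rmin (m / 2) ((l - m) / 2)) (w / (C + 1) / 2)).
      pose proof (Rmin_r (Rmin (m / 2) ((l - m) / 2)) (w / (C + 1) / 2)).
      pose proof (Rmin_l (m / 2) ((l - m) / 2)); pose proof (Rmin_r (m / 2) ((l - m) / 2)).
      fold u in H, H0; lra. }
    specialize (Hd u ltac:(lra)).
    pose proof (Hmin (m + u) ltac:(lra)) as M1; pose proof (Hmin (m - u) ltac:(lra)) as M2.
    assert (HDD : D (m + u) + D (m - u) <= 2 * c u * D m + C * (u * u * u)).
    { unfold D.
      assert (E : s (l - (m + u)) + s (l - (m - u)) = 2 * c u * s (l - m)).
      { replace (l - (m + u)) with ((l - m) - u) by ring; replace (l - (m - u)) with ((l - m) + u) by ring.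
        rewrite sn_sub, sn_add; ring. }
      assert (E2 : s (m + u) + s (m - u) = 2 * c u * s m) by (rewrite sn_sub, sn_add; ring).
      replace (σ * (h (m + u) - (s (l - (m + u)) * h 0 + s (m + u) * h l) / s l)
             + σ * (h (m - u) - (s (l - (m - u)) * h 0 + s (m - u) * h l) / s l))
        with (σ * (h (m + u) + h (m - u))
           - σ * (((s (l - (m + u)) + s (l - (m - u))) * h 0 + (s (m + u) + s (m - u)) * h l) / s l))
        by (field; lra).
      rewrite E, E2.
      replace (2 * c u * (σ * (h m - (s (l - m) * h 0 + s m * h l) / s l)))
        with (σ * (2 * c u * h m) - σ * ((2 * c u * s (l - m) * h 0 + 2 * c u * s m * h l) / s l))
        by (field; lra).
      lra. }
    pose proof (barrier_sum b l m u) as HB; pose proof (barrier_gap b u ltac:(lra)) as HG.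
    assert (HDm : D m = - k * barrier b l m) by (unfold k; field; lra).
    assert (M3 : - k * (2 * barrier_ratio b u * barrier b l m) <= 2 * c u * D m + C * (u * u * u)).
    { rewrite <- HB; replace (D m / barrier b l m) with (- k) in M1, M2 by (unfold k; ring); lra. }
    rewrite HDm in M3.
    assert (M4 : 2 * (k * barrier b l m) * (u * u / 8) <= C * (u * u * u)).
    { apply Rle_trans with (2 * (k * barrier b l m) * (c u - barrier_ratio b u)); [|lra].
      apply Rmult_le_compat_l; [nra | auto]. }
    assert (M5 : w * (u * u) <= C * u * (u * u)) by (unfold w; lra).
    apply Rmult_le_reg_r in M5; [|nra].
    assert (C * u < w); [|lra].
    apply Rle_lt_trans with ((C + 1) * (w / (C + 1) / 2)); [apply Rmult_le_compat; lra|].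
    replace ((C + 1) * (w / (C + 1) / 2)) with (w / 2) by (field; lra); lra. }
  intros Hx; specialize (Hmin x Hx).
  pose proof (barrier_pos b l m Hml Hlb); pose proof (barrier_pos b l x Hx Hlb).
  assert (HDx : 0 <= D x).
  { eapply Rle_trans; [|exact Hmin]; apply Rmult_le_pos; [|lra].
    apply Rmult_le_pos; [auto | apply Rlt_le, Rinv_0_lt_compat; auto]. }
  unfold D in HDx; apply (Rmult_le_compat_r (s l)) in HDx; [|lra].
  replace (σ * (h x - (s (l - x) * h 0 + s x * h l) / s l) * s l)
    with (σ * (s l * h x) - σ * (s (l - x) * h 0 + s x * h l)) in HDx by (field; lra).
  lra.
Qed.

End MaxPrinciple.

Section Space.
Variables (b : bool) (M : Type) (d : M -> M -> R).
Notation σ := (sg b).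
Notation c := (cs b).
Notation s := (sn b).
Hypothesis Hd : semimetric d.
Hypothesis Hdiam : b = true -> diam_le d (PI / 2).
Hypothesis H4 : upper4 b d \/ lower4 b d.
Hypothesis Hgeo : forall A B, exists e, geo d e (d A B) /\ e 0 = A /\ e (d A B) = B.

Notation dsym := (d_sym M d Hd).
Notation dpos := (d_pos M d Hd).
Notation dle := (d_le b M d Hdiam).
Notation tri := (triangle_of_4point b M d Hd Hdiam H4).
Notation psi := (cos_angle b M d).

Lemma cs_sum_opposite (u x y : R) : 0 <= u -> 0 <= x -> 0 <= y -> 2 * u <= x + y ->
  (b = true -> x <= PI / 2 /\ y <= PI / 2) -> σ * (c x + c y) <= σ * (2 * c u).
Proof.
  intros Hu Hx Hy Hxy Hb; pose proof PI_RGT_0.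
  assert (H1 : σ * c ((x + y) / 2) <= σ * c u).
  { apply cs_anti_le; [lra|]; intros E; specialize (Hb E); lra. }
  assert (H2 : 0 <= c ((x + y) / 2)).
  { apply cs_nonneg; intros E; specialize (Hb E); lra. }
  pose proof (sg_cs_le_1 b ((x - y) / 2)) as H3.
  rewrite cs_sum.
  assert (σ * (c ((x + y) / 2) * c ((x - y) / 2)) <= σ * c ((x + y) / 2)); [|lra].
  apply (Rmult_le_compat_l (c ((x + y) / 2))) in H3; lra.
Qed.

(* Adjacent model angles add up to at least [pi] as [t] tends to [0]. *)
Lemma opposite_psi (e1 e1' e2 : R -> M) (l1 l1' l2 u : R) :
  geo d e1 l1 -> geo d e1' l1' -> geo d e2 l2 -> e1 0 = e2 0 -> e1' 0 = e2 0 ->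
  0 < u <= l1 -> u <= l1' -> u <= l2 -> d (e1 u) (e1' u) = 2 * u -> forall a,
  (forall t, 0 < t < u -> a <= psi e1 e2 u t + psi e1' e2 u t) -> a <= 0.
Proof.
  intros He1 He1' He2 H0 H0' Hu Hu' Hu2 Hopp a Ha; pose proof PI_RGT_0 as HPI.
  assert (Su : 0 < s u) by (apply (geo_sn_pos b M d Hdiam e1 l1 _ He1); lra).
  set (tn := fun n => u / 2 * / INR (S n)).
  assert (Htn : forall n, 0 < tn n < u).
  { intros n; unfold tn; pose proof (inv_nat_pos n).
    assert (/ INR (S n) <= 1); [|split; nra].
    rewrite <- Rinv_1; apply Rinv_le_contravar; [lra|]; rewrite S_INR; pose proof (pos_INR n); lra. }
  assert (Ht0 : Un_cv tn 0) by (eapply cv_eq; [unfold tn; eapply CV_mult; [apply cv_const | apply cv_inv_nat] | ring]).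
  apply (cv_le (fun _ => a) (fun n => 2 * c u / s u * (s (tn n / 2) / c (tn n / 2)))).
  2: apply cv_const.
  2:{ eapply cv_eq; [cv|]; replace (0 / 2) with 0 by field; rewrite ?cs_0, ?sn_0; lra. }
  intros n; specialize (Htn n); specialize (Ha (tn n) Htn); set (t := tn n) in *.
  eapply Rle_trans; [exact Ha|].
  assert (St : 0 < s t) by (apply (geo_sn_pos b M d Hdiam e2 l2 _ He2); lra).
  assert (St2 : 0 < s (t / 2)) by (apply (geo_sn_pos b M d Hdiam e2 l2 _ He2); lra).
  assert (Ct2 : 0 < c (t / 2)).
  { apply cs_pos; intros E; pose proof (geo_len b M d Hdiam e2 l2 He2 ltac:(lra) E); lra. }
  assert (Es : s t = 2 * s (t / 2) * c (t / 2))
    by (replace t with (t / 2 + t / 2) at 1 by field; rewrite sn_add; ring).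
  assert (Ec : c t = 1 - σ * (2 * (s (t / 2) * s (t / 2)))) by (pose proof (cs_double' b t); lra).
  assert (Hsum : σ * (c (d (e1 u) (e2 t)) + c (d (e1' u) (e2 t))) <= σ * (2 * c u)).
  { apply cs_sum_opposite; try apply dpos; try lra.
    - pose proof (tri (e1 u) (e2 t) (e1' u)); rewrite (dsym (e2 t) (e1' u)) in H; lra.
    - intros E; split; apply dle; auto. }
  unfold cos_angle.
  replace (σ * (c (d (e1 u) (e2 t)) - c u * c t) / (s u * s t)
         + σ * (c (d (e1' u) (e2 t)) - c u * c t) / (s u * s t))
    with ((σ * (c (d (e1 u) (e2 t)) + c (d (e1' u) (e2 t))) - σ * (2 * c u) * c t) / (s u * s t))
    by (field; lra).
  apply Rle_trans with ((σ * (2 * c u) - σ * (2 * c u) * c t) / (s u * s t)).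
  - apply Rmult_le_compat_r; [apply Rlt_le, Rinv_0_lt_compat; nra | lra].
  - right; rewrite Es, Ec.
    replace (σ * (2 * c u) - σ * (2 * c u) * (1 - σ * (2 * (s (t / 2) * s (t / 2)))))
      with ((σ * σ) * (4 * c u * (s (t / 2) * s (t / 2)))) by ring.
    rewrite sg_sq; field; lra.
Qed.

Section OneGeodesic.
Variables (e : R -> M) (l : R) (P : M).
Hypothesis He : geo d e l.
Definition hP (x : R) : R := c (d P (e x)).

Lemma geo_forward (x : R) : 0 <= x <= l -> geo d (fun u => e (x + u)) (l - x).
Proof. intros Hx u v Hu Hv; rewrite He by lra; f_equal; ring. Qed.

Lemma geo_backward (x : R) : 0 <= x <= l -> geo d (fun u => e (x - u)) x.
Proof.
  intros Hx u v Hu Hv; rewrite He by lra; rewrite <- Rabs_Ropp; f_equal; ring.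
Qed.

Lemma psi_sum_small (x r : R) (e2 : R -> M) : 0 < x < l -> 0 < r -> (b = true -> r < PI / 2) ->
  geo d e2 r -> e2 0 = e x -> exists C d0, 0 <= C /\ 0 < d0 /\ forall u, 0 < u < d0 ->
    u <= l - x /\ u <= x /\
    psi (fun u => e (x + u)) e2 u r + psi (fun u => e (x - u)) e2 u r <= C * (u * u).
Proof.
  intros Hx Hr Hrb He2 E0.
  assert (E1 : (fun u => e (x + u)) 0 = e2 0) by (rewrite Rplus_0_r; auto).
  assert (E2 : (fun u => e (x - u)) 0 = e2 0) by (rewrite Rminus_0_r; auto).
  destruct (psi_second_order b M d Hd Hdiam H4 _ e2 (l - x) r (geo_forward x ltac:(lra)) He2 E1)
    as [C1 [d1 [HC1 [Hd1 H1]]]]; auto; try lra.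
  destruct (psi_second_order b M d Hd Hdiam H4 _ e2 x r (geo_backward x ltac:(lra)) He2 E2)
    as [C2 [d2 [HC2 [Hd2 H2]]]]; auto; try lra.
  set (d0 := Rmin (Rmin d1 d2) r).
  assert (Hd0 : d0 <= d1 /\ d0 <= d2 /\ d0 <= r).
  { pose proof (Rmin_l (Rmin d1 d2) r); pose proof (Rmin_r (Rmin d1 d2) r).
    pose proof (Rmin_l d1 d2); pose proof (Rmin_r d1 d2); unfold d0; lra. }
  exists (C1 + C2), d0; split; [lra|]; split; [unfold d0; repeat apply Rmin_pos; lra|].
  intros u Hu.
  destruct (H1 u (u / 2) ltac:(lra) ltac:(lra)) as [U1 _].
  destruct (H2 u (u / 2) ltac:(lra) ltac:(lra)) as [U2 _].
  split; [auto|]; split; [auto|].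
  set (f1 := fun u => e (x + u)) in *; set (f2 := fun u => e (x - u)) in *.
  assert (psi f1 e2 u r + psi f2 e2 u r - (C1 + C2) * (u * u) <= 0); [|lra].
  apply (opposite_psi f1 f2 e2 (l - x) x r u); auto; try lra.
  - apply geo_forward; lra.
  - apply geo_backward; lra.
  - unfold f1, f2; rewrite He, Rabs_right; lra.
  - intros t Ht; destruct (H1 u t ltac:(lra) Ht) as [_ P1]; destruct (H2 u t ltac:(lra) Ht) as [_ P2].
    lra.
Qed.

Lemma psi_to_h (f e2 : R -> M) (m r u : R) : geo d f m -> geo d e2 r -> 0 < u <= m -> 0 < r ->
  e2 r = P -> σ * (c (d P (f u)) - c u * c r) = s u * s r * psi f e2 u r.
Proof.
  intros Hf He2 Hu Hr EP; rewrite <- EP, (dsym (e2 r) (f u)); unfold cos_angle.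
  assert (0 < s u) by (apply (geo_sn_pos b M d Hdiam f m _ Hf); lra).
  assert (0 < s r) by (apply (geo_sn_pos b M d Hdiam e2 r _ He2); lra).
  field; lra.
Qed.

(** The factor [sn u * sn r] turns the quadratic error of [psi_sum_small] into a cubic one. If [P]
    is the point [e x] itself, [h] is the cosine of the parameter measured from [x], and equality
    holds. *)
Lemma h_concave_at (x : R) : 0 < x < l -> (b = true -> d P (e x) < PI / 2) ->
  exists C d0, 0 <= C /\ 0 < d0 /\ forall u, 0 < u < d0 ->
    σ * (hP (x + u) + hP (x - u)) <= σ * (2 * c u * hP x) + C * (u * u * u).
Proof.
  intros Hx Hb; unfold hP.
  destruct (Rle_lt_or_eq_dec 0 (d P (e x)) (dpos _ _)) as [Hr|Hr].
  - destruct (Hgeo (e x) P) as [e2 [He2 [E0 EP]]]; rewrite (dsym (e x) P) in *.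
    set (r := d P (e x)) in *.
    destruct (psi_sum_small x r e2 Hx Hr Hb He2 E0) as [C [d0 [HC [Hd0 H]]]].
    assert (Sr : 0 < s r) by (apply (geo_sn_pos b M d Hdiam e2 r _ He2); lra).
    pose proof (cosh_ge_1 1) as Hc1.
    exists (C * s r * cosh 1), (Rmin d0 1).
    split; [apply Rmult_le_pos; [nra | lra]|]; split; [apply Rmin_pos; lra|].
    intros u Hu; pose proof (Rmin_l d0 1); pose proof (Rmin_r d0 1).
    destruct (H u ltac:(lra)) as [U1 [U2 HS]].
    pose proof (psi_to_h _ e2 _ r u (geo_forward x ltac:(lra)) He2 ltac:(lra) Hr EP) as P1.
    pose proof (psi_to_h _ e2 _ r u (geo_backward x ltac:(lra)) He2 ltac:(lra) Hr EP) as P2.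
    cbv beta in P1, P2.
    assert (Su : 0 < s u) by (apply (geo_sn_pos b M d Hdiam _ _ _ (geo_backward x ltac:(lra))); lra).
    assert (Su2 : s u <= cosh 1 * u).
    { pose proof (sn_small b u 1) as Q; rewrite (Rabs_right u) in Q by lra.
      specialize (Q ltac:(lra)); pose proof (Rle_abs (s u)); lra. }
    apply (Rmult_le_compat_l (s u * s r)) in HS; [|nra].
    assert (s u * s r * (C * (u * u)) <= C * s r * cosh 1 * (u * u * u)); [|lra].
    replace (s u * s r * (C * (u * u))) with (C * s r * (u * u) * s u) by ring.
    replace (C * s r * cosh 1 * (u * u * u)) with (C * s r * (u * u) * (cosh 1 * u)) by ring.
    apply Rmult_le_compat_l; [|lra]; apply Rmult_le_pos; nra.
  - exists 0, (Rmin x (l - x)); split; [lra|]; split; [apply Rmin_pos; lra|].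
    intros u Hu; pose proof (Rmin_l x (l - x)); pose proof (Rmin_r x (l - x)).
    symmetry in Hr; apply (d_eq M d Hd) in Hr; subst P.
    rewrite (d_refl M d Hd), cs_0, !He, Rabs_left1, Rabs_right by lra.
    replace (- (x - (x + u))) with u by ring; replace (x - (x - u)) with u by ring; lra.
Qed.

(** [psi_second_order] requires [r < pi / 2]. It is used at [pi / 4] on the geodesic towards [P] and
    continued to [pi / 2] by [psi_first_order], which leaves an error linear in [u] for [psi] and
    quadratic for [h]. *)
Lemma h_zero_at (x : R) : b = true -> 0 < x < l -> d P (e x) = PI / 2 ->
  exists C d0, 0 <= C /\ 0 < d0 /\ forall u, 0 < u < d0 ->
    u <= l - x /\ u <= x /\ hP (x + u) + hP (x - u) <= C * (u * u).
Proof.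
  intros E Hx Hr; pose proof PI_RGT_0 as HPI.
  destruct (Hgeo (e x) P) as [e2 [He2 [E0 EP]]]; rewrite (dsym (e x) P) in *; rewrite Hr in *.
  assert (He4 : geo d e2 (PI / 4)) by (intros u v Hu Hv; apply He2; lra).
  destruct (psi_sum_small x (PI / 4) e2 Hx ltac:(lra) ltac:(intros; lra) He4 E0) as [C [d0 [HC [Hd0 H]]]].
  assert (E1 : (fun u => e (x + u)) 0 = e2 0) by (rewrite Rplus_0_r; auto).
  assert (E2 : (fun u => e (x - u)) 0 = e2 0) by (rewrite Rminus_0_r; auto).
  destruct (psi_first_order b M d Hd Hdiam H4 _ e2 (l - x) (PI / 2) (geo_forward x ltac:(lra)) He2 E1
     (PI / 4) (PI / 2) ltac:(lra) ltac:(lra)) as [C1 [HC1 F1]].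
  destruct (psi_first_order b M d Hd Hdiam H4 _ e2 x (PI / 2) (geo_backward x ltac:(lra)) He2 E2
     (PI / 4) (PI / 2) ltac:(lra) ltac:(lra)) as [C2 [HC2 F2]].
  pose proof (cosh_ge_1 1) as Hc1.
  exists (cosh 1 * (C1 + C2 + C)), (Rmin d0 1).
  split; [apply Rmult_le_pos; lra|]; split; [apply Rmin_pos; lra|].
  intros u Hu; pose proof (Rmin_l d0 1); pose proof (Rmin_r d0 1).
  destruct (H u ltac:(lra)) as [U1 [U2 HS]]; split; [auto|]; split; [auto|].
  specialize (F1 u ltac:(lra) ltac:(lra)); specialize (F2 u ltac:(lra) ltac:(lra)).
  pose proof (psi_to_h _ e2 _ (PI / 2) u (geo_forward x ltac:(lra)) He2 ltac:(lra) ltac:(lra) EP) as P1.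
  pose proof (psi_to_h _ e2 _ (PI / 2) u (geo_backward x ltac:(lra)) He2 ltac:(lra) ltac:(lra) EP) as P2.
  cbv beta in P1, P2; unfold hP.
  assert (Su : 0 < s u) by (apply (geo_sn_pos b M d Hdiam _ _ _ (geo_backward x ltac:(lra))); lra).
  assert (Su2 : s u <= cosh 1 * u).
  { pose proof (sn_small b u 1) as Q; rewrite (Rabs_right u) in Q by lra.
    specialize (Q ltac:(lra)); pose proof (Rle_abs (s u)); lra. }
  assert (G1 : σ = 1) by (rewrite E; auto).
  assert (G2 : c (PI / 2) = 0) by (rewrite E; simpl; apply cos_PI2).
  assert (G3 : s (PI / 2) = 1) by (rewrite E; simpl; apply sin_PI2).
  rewrite G1, G2, G3 in *.
  set (p1 := psi (fun v => e (x + v)) e2 u (PI / 2)) in *.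
  set (p2 := psi (fun v => e (x - v)) e2 u (PI / 2)) in *.
  assert (Q : p1 + p2 <= (C1 + C2 + C) * u).
  { assert (C * (u * u) <= C * u) by (apply Rmult_le_compat_l; nra); lra. }
  assert (s u * (p1 + p2) <= cosh 1 * (C1 + C2 + C) * (u * u)); [|lra].
  apply Rle_trans with (s u * ((C1 + C2 + C) * u)); [apply Rmult_le_compat_l; lra|].
  replace (cosh 1 * (C1 + C2 + C) * (u * u)) with (cosh 1 * u * ((C1 + C2 + C) * u)) by ring.
  apply Rmult_le_compat_r; [|lra]; apply Rmult_le_pos; lra.
Qed.

Lemma h_lip : 0 <= l -> exists L, 0 <= L /\ forall x y, 0 <= x <= l -> 0 <= y <= l ->
  Rabs (hP x - hP y) <= L * Rabs (x - y).
Proof.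
  intros Hl; set (B := d P (e 0) + l); pose proof (dpos P (e 0)).
  exists (cosh B); split; [pose proof (cosh_ge_1 B); lra|].
  assert (HB : forall x, 0 <= x <= l -> Rabs (d P (e x)) <= B).
  { intros x Hx; pose proof (tri P (e 0) (e x)); pose proof (geo_0 M d e l x He Hx).
    pose proof (dpos P (e x)); rewrite Rabs_right; unfold B; lra. }
  intros x y Hx Hy; eapply Rle_trans; [apply cs_lipschitz; apply HB; auto|].
  apply Rmult_le_compat_l; [pose proof (cosh_ge_1 B); lra|].
  eapply Rle_trans; [apply (dist_lip M d Hd tri)|]; rewrite He; lra.
Qed.

Lemma h_nonneg (x : R) : 0 <= hP x.
Proof. apply (c_nonneg b M d Hd Hdiam). Qed.

Lemma h_zero_dist (x : R) : b = true -> hP x <= 0 -> d P (e x) = PI / 2.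
Proof.
  intros E H; pose proof (dle P (e x) E); pose proof (dpos P (e x)); pose proof PI_RGT_0.
  apply Rle_antisym; auto; apply Rnot_lt_le; intros Hlt.
  assert (0 < hP x); [|lra].
  apply cs_pos; intros; lra.
Qed.

(* At the last zero before y the function would leave 0 with positive slope. *)
Lemma h_zero_right (x0 y : R) : b = true -> 0 < x0 < y -> y <= l -> hP x0 = 0 -> hP y <= 0.
Proof.
  intros E Hx Hy H0; apply Rnot_lt_le; intros Hpos.
  destruct (h_lip ltac:(lra)) as [L [HL Hlip]].
  pose proof (geo_len b M d Hdiam e l He ltac:(lra) E) as Hlb.
  set (Z := fun x => x0 <= x <= y /\ hP x = 0).
  destruct (completeness Z) as [x1 [Hub Hleast]].
  { exists y; intros x [Hx' _]; lra. }
  { exists x0; split; auto; lra. }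
  assert (Hx1 : x0 <= x1 <= y).
  { split; [apply Hub; split; auto; lra | apply Hleast; intros x [Hx' _]; lra]. }
  assert (Hz : hP x1 = 0).
  { apply Rle_antisym; [|apply h_nonneg]; apply Rnot_lt_le; intros Hlt.
    assert (Hq : 0 < hP x1 / (L + 1)) by (apply Rdiv_lt_0_compat; lra).
    assert (x1 <= x1 - hP x1 / (L + 1)); [|lra].
    apply Hleast; intros x Hxz; assert (x <= x1) by (apply Hub; auto); destruct Hxz as [Hx' Hx0].
    apply Rnot_lt_le; intros Hlt2.
    pose proof (Hlip x1 x ltac:(lra) ltac:(lra)) as H1; rewrite Hx0, Rminus_0_r, !Rabs_right in H1 by lra.
    assert (L * (x1 - x) <= L * (hP x1 / (L + 1))) by (apply Rmult_le_compat_l; lra).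
    assert (L * (hP x1 / (L + 1)) < hP x1); [|lra].
    apply (Rmult_lt_reg_r (L + 1)); [lra|].
    replace (L * (hP x1 / (L + 1)) * (L + 1)) with (L * hP x1) by (field; lra); lra. }
  assert (Hx1y : x1 < y) by (destruct (Req_dec x1 y) as [->|]; lra).
  assert (Hpos' : forall x, x1 < x <= y -> 0 < hP x).
  { intros x Hxx; destruct (Rle_lt_or_eq_dec 0 (hP x) (h_nonneg x)); auto.
    assert (x <= x1) by (apply Hub; split; auto; lra); lra. }
  destruct (h_zero_at x1 E ltac:(lra)) as [C [d0 [HC [Hd0 HH]]]]; [apply h_zero_dist; auto; lra|].
  (* On the interval from [x1] to [y] the function lies above the sine arch that starts from 0 at
     [x1] and ends at [hP y]. This linear growth contradicts the quadratic bound of [h_zero_at],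
     because [hP (x1 - u)] is nonnegative. *)
  pose proof (trig_concave b (fun u => hP (x1 + u)) (y - x1) L ltac:(lra) ltac:(intros; lra)) as HT.
  lapply HT; [clear HT; intros HT|].
  2:{ intros u v Hu Hv; eapply Rle_trans; [apply Hlip; lra|].
      replace (x1 + u - (x1 + v)) with (u - v) by ring; lra. }
  lapply HT; [clear HT; intros HT|].
  2:{ intros u Hu; destruct (h_concave_at (x1 + u) ltac:(lra)) as [C' [d' [HC' [Hd' H']]]].
      - intros _; pose proof (Hpos' (x1 + u) ltac:(lra)) as HP0.
        destruct (Rlt_le_dec (d P (e (x1 + u))) (PI / 2)); auto.
        exfalso; pose proof (dle P (e (x1 + u)) E).
        unfold hP in HP0; replace (d P (e (x1 + u))) with (PI / 2) in HP0 by lra.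
        rewrite E in HP0; simpl in HP0; rewrite cos_PI2 in HP0; lra.
      - exists C', d'; repeat split; auto; intros v Hv; specialize (H' v Hv).
        rewrite !Rplus_assoc in H'.
        replace (x1 + (u - v)) with (x1 + u - v) by ring; rewrite <- !Rplus_assoc in *; auto. }
  set (hy := hP y) in *.
  set (u := Rmin (Rmin (d0 / 2) (y - x1)) (Rmin 1 (hy / (4 * (C + 1))))).
  assert (Hq : 0 < hy / (4 * (C + 1))) by (apply Rdiv_lt_0_compat; lra).
  assert (Hu : 0 < u /\ u <= d0 / 2 /\ u <= y - x1 /\ u <= 1 /\ u <= hy / (4 * (C + 1))).
  { split; [unfold u; repeat apply Rmin_pos; lra|].
    pose proof (Rmin_l (Rmin (d0 / 2) (y - x1)) (Rmin 1 (hy / (4 * (C + 1))))).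
    pose proof (Rmin_r (Rmin (d0 / 2) (y - x1)) (Rmin 1 (hy / (4 * (C + 1))))).
    pose proof (Rmin_l (d0 / 2) (y - x1)); pose proof (Rmin_r (d0 / 2) (y - x1)).
    pose proof (Rmin_l 1 (hy / (4 * (C + 1)))); pose proof (Rmin_r 1 (hy / (4 * (C + 1)))).
    fold u in H, H1; lra. }
  specialize (HT u ltac:(lra)); cbv beta in HT.
  replace (x1 + (y - x1)) with y in HT by ring; fold hy in HT.
  rewrite Rplus_0_r, Hz, Rmult_0_r, Rplus_0_l in HT.
  replace σ with 1 in HT by (rewrite E; auto).
  destruct (HH u ltac:(lra)) as [_ [_ HC2]]; pose proof (h_nonneg (x1 - u)).
  pose proof (sn_half b u ltac:(lra)) as Hs.
  assert (Hs1 : 0 <= s (y - x1) <= 1).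
  { split; [apply sn_nonneg; [lra|]; intros; lra|].
    rewrite E; simpl; pose proof (SIN_bound (y - x1)); lra. }
  pose proof (h_nonneg (x1 + u)).
  assert (K1 : u / 2 * hy <= C * (u * u)) by nra.
  assert (K2 : hy <= 2 * C * u) by (apply (Rmult_le_reg_l (u / 2)); [lra|]; lra).
  assert (K3 : 2 * C * u <= 2 * C * (hy / (4 * (C + 1)))) by (apply Rmult_le_compat_l; lra).
  assert (K4 : 2 * C * (hy / (4 * (C + 1))) < hy); [|lra].
  apply (Rmult_lt_reg_r (4 * (C + 1))); [lra|].
  replace (2 * C * (hy / (4 * (C + 1))) * (4 * (C + 1))) with (2 * C * hy) by (field; lra); nra.
Qed.

End OneGeodesic.

(** The local estimate is missing only where the distance is [pi / 2]. Such an interior point makes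
    [h] vanish to its right by [h_zero_right] and to its left by reversing the geodesic, so that
    both sides are 0. *)
Lemma cat_inequality (e : R -> M) (l : R) (P : M) (x : R) : geo d e l -> 0 <= x <= l ->
  σ * (s (l - x) * c (d P (e 0)) + s x * c (d P (e l))) <= σ * (s l * c (d P (e x))).
Proof.
  intros He Hx.
  destruct (Req_dec l 0) as [->|Hl0].
  { replace x with 0 by lra; rewrite Rminus_0_r, sn_0; lra. }
  fold (hP e P 0) (hP e P l) (hP e P x).
  destruct (h_lip e l P He ltac:(lra)) as [L [HL Hlip]].
  pose proof (geo_len b M d Hdiam e l He ltac:(lra)) as Hlb.
  destruct (classic (exists x0, b = true /\ 0 < x0 < l /\ hP e P x0 = 0)) as [[x0 [E [Hx0 Hz]]]|Hno].
  - assert (Hall : forall y, 0 <= y <= l -> hP e P y = 0).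
    { intros y Hy; apply Rle_antisym; [|apply h_nonneg].
      destruct (Rtotal_order y x0) as [Hlt|[->|Hgt]]; [|lra|].
      - assert (He' : geo d (fun u => e (l - u)) l).
        { intros u v Hu Hv; rewrite He by lra; rewrite <- Rabs_Ropp; f_equal; ring. }
        pose proof (h_zero_right _ l P He' (l - x0) (l - y) E ltac:(lra) ltac:(lra)) as HZ.
        unfold hP in *; replace (l - (l - x0)) with x0 in HZ by ring.
        replace (l - (l - y)) with y in HZ by ring; auto.
      - apply (h_zero_right e l P He x0 y); auto; lra. }
    rewrite !Hall by lra; lra.
  - apply (trig_concave b (hP e P) l L); auto; [lra|].
    intros y Hy; apply (h_concave_at e l P He y Hy); intros E.
    destruct (Rlt_le_dec (d P (e y)) (PI / 2)) as [?|Hge]; auto.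
    exfalso; apply Hno; exists y; repeat split; auto; try lra.
    unfold hP; replace (d P (e y)) with (PI / 2) by (pose proof (dle P (e y) E); lra).
    rewrite E; simpl; apply cos_PI2.
Qed.

End Space.

(** * Curves and upper angles *)

Lemma sn_ratio_near_0 (b : bool) (eta : R) : 0 < eta -> exists del, 0 < del /\
  forall w, 0 <= w < del -> (1 - eta) * w <= sn b w <= (1 + eta) * w.
Proof.
  intros He; pose proof (derivable_sn b 0) as HD; rewrite cs_0 in HD.
  destruct (HD eta He) as [[del Hdel] H]; exists del; split; auto.
  intros w Hw; destruct (Req_dec w 0) as [->|Hw0]; [rewrite sn_0; lra|].
  specialize (H w Hw0); simpl in H; rewrite Rabs_right in H by lra; specialize (H ltac:(lra)).
  rewrite Rplus_0_l, sn_0, Rminus_0_r in H.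
  assert (E : sn b w = sn b w / w * w) by (field; auto).
  apply Rabs_def2 in H; rewrite E; split; apply Rmult_le_compat_r; lra.
Qed.

(** The cosine of the Euclidean angle between sides [s] and [t] opposite to [z]; [cpsi] is its
    analogue in the model plane. Upper angles are defined by the former, comparison uses the
    latter. *)
Definition eucl (s t z : R) : R := (s * s + t * t - z * z) / (2 * s * t).

Definition cpsi (b : bool) (s t z : R) : R := sg b * (cs b z - cs b s * cs b t) / (sn b s * sn b t).

Lemma one_minus_cpsi (b : bool) (s t z : R) : 0 < sn b s -> 0 < sn b t ->
  1 - cpsi b s t z
  = 2 * sn b ((z + Rabs (s - t)) / 2) * sn b ((z - Rabs (s - t)) / 2) / (sn b s * sn b t).
Proof.
  intros Hs Ht; pose proof (cs_diff b z (Rabs (s - t))) as E.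
  rewrite c_abs, cs_sub in E; unfold cpsi.
  apply (Rmult_eq_reg_r (sn b s * sn b t)); [|nra].
  unfold Rdiv; rewrite Rmult_minus_distr_r, !Rmult_assoc, Rinv_l, !Rmult_1_r by nra.
  destruct (sg_cases b) as [G|G]; rewrite G in *; lra.
Qed.

(** [1 - eucl] is [2 * u * v / (s * t)], and [1 - cpsi] is the same with [sn] applied to each
    length. As [sn x / x] tends to 1 and the triangle inequality gives [u * v <= s * t], the
    difference is small uniformly in the ratio of [s] and [t]. *)
Lemma eucl_cpsi_close (b : bool) (eps : R) : 0 < eps -> exists del, 0 < del /\
  forall s t z, 0 < s < del -> 0 < t < del -> Rabs (s - t) <= z <= s + t ->
  Rabs (eucl s t z - cpsi b s t z) <= eps.
Proof.
  intros He; set (eta := Rmin (1 / 2) (eps / 32)).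
  assert (Heta : 0 < eta <= 1 / 2 /\ eta <= eps / 32).
  { pose proof (Rmin_l (1 / 2) (eps / 32)); pose proof (Rmin_r (1 / 2) (eps / 32)).
    repeat split; auto; unfold eta; apply Rmin_pos; lra. }
  destruct (sn_ratio_near_0 b eta ltac:(lra)) as [del [Hdel H]]; exists del; split; auto.
  intros s t z Hs Ht Hz; set (D := Rabs (s - t)) in *.
  assert (HD : 0 <= D /\ D * D = (s - t) * (s - t) /\ s + t + D < 2 * del).
  { unfold D, Rabs; destruct (Rcase_abs _); repeat split; lra. }
  set (u := (z + D) / 2); set (v := (z - D) / 2).
  assert (Euv : u * v = (z * z - D * D) / 4) by (unfold u, v; field).
  pose proof (H s ltac:(lra)) as Ss; pose proof (H t ltac:(lra)) as St.
  pose proof (H u ltac:(unfold u; lra)) as Su; pose proof (H v ltac:(unfold v; lra)) as Sv.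
  assert (Ps : 0 < sn b s) by nra; assert (Pt : 0 < sn b t) by nra.
  pose proof (one_minus_cpsi b s t z Ps Pt) as E; fold D u v in E.
  assert (E0 : 1 - eucl s t z = 2 * (u * v) / (s * t)).
  { rewrite Euv; destruct HD as [_ [HD _]]; rewrite HD; unfold eucl; field; lra. }
  assert (Hu0 : 0 <= u) by (unfold u; lra); assert (Hv0 : 0 <= v) by (unfold v; lra).
  assert (Huv : u * v <= s * t).
  { rewrite Euv; destruct HD as [HD0 [HD _]].
    assert (z * z <= (s + t) * (s + t)) by (apply Rmult_le_compat; lra); lra. }
  assert (Hst : 0 < s * t) by nra; assert (Huv0 : 0 <= u * v) by nra.
  assert (B1 : (1 - eta) * (1 - eta) * (s * t) <= sn b s * sn b t <= (1 + eta) * (1 + eta) * (s * t)).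
  { split; [replace ((1 - eta) * (1 - eta) * (s * t)) with ((1 - eta) * s * ((1 - eta) * t)) by ring
           | replace ((1 + eta) * (1 + eta) * (s * t)) with ((1 + eta) * s * ((1 + eta) * t)) by ring];
      apply Rmult_le_compat; nra. }
  assert (B2 : (1 - eta) * (1 - eta) * (u * v) <= sn b u * sn b v <= (1 + eta) * (1 + eta) * (u * v)).
  { split; [replace ((1 - eta) * (1 - eta) * (u * v)) with ((1 - eta) * u * ((1 - eta) * v)) by ring
           | replace ((1 + eta) * (1 + eta) * (u * v)) with ((1 + eta) * u * ((1 + eta) * v)) by ring];
      apply Rmult_le_compat; nra. }
  set (A := 1 - eucl s t z) in *; set (B := 1 - cpsi b s t z) in *.
  assert (HAB : Rabs (B - A) <= 32 * eta).
  { assert (PP : 0 < sn b s * sn b t) by nra.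
    assert (EA : A * (s * t) = 2 * (u * v)) by (rewrite E0; field; lra).
    assert (EB : B * (sn b s * sn b t) = 2 * sn b u * sn b v) by (rewrite E; field; lra).
    assert (HA0 : 0 <= A) by (apply (Rmult_le_reg_r (s * t)); lra).
    assert (H14 : 1 / 4 <= (1 - eta) * (1 - eta)) by nra.
    apply Rabs_le; split.
    - assert (A - 32 * eta <= B); [|lra].
      destruct (Rle_lt_dec (A - 32 * eta) 0) as [Hn|Hp].
      + assert (0 <= B); [|lra]; apply (Rmult_le_reg_r (sn b s * sn b t)); [auto|].
        rewrite Rmult_0_l, EB; nra.
      + apply (Rmult_le_reg_r (sn b s * sn b t)); [auto|]; rewrite EB.
        apply Rle_trans with ((A - 32 * eta) * ((1 + eta) * (1 + eta) * (s * t))).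
        { apply Rmult_le_compat_l; lra. }
        replace ((A - 32 * eta) * ((1 + eta) * (1 + eta) * (s * t)))
          with ((1 + eta) * (1 + eta) * (A * (s * t)) - 32 * eta * (s * t) * ((1 + eta) * (1 + eta))) by ring.
        rewrite EA; assert (0 <= eta * (s * t)) by nra.
        assert (eta * (s * t) * 1 <= eta * (s * t) * ((1 + eta) * (1 + eta)))
          by (apply Rmult_le_compat_l; nra).
        assert (eta * (u * v) <= eta * (s * t)) by nra; nra.
    - assert (B <= A + 32 * eta); [|lra].
      apply (Rmult_le_reg_r (sn b s * sn b t)); [auto|]; rewrite EB.
      apply Rle_trans with ((A + 32 * eta) * ((1 - eta) * (1 - eta) * (s * t))).
      2:{ apply Rmult_le_compat_l; lra. }
      replace ((A + 32 * eta) * ((1 - eta) * (1 - eta) * (s * t)))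
        with ((1 - eta) * (1 - eta) * (A * (s * t)) + 32 * eta * (s * t) * ((1 - eta) * (1 - eta))) by ring.
      rewrite EA; assert (0 <= eta * (s * t)) by nra.
      assert (eta * (s * t) * (1 / 4) <= eta * (s * t) * ((1 - eta) * (1 - eta)))
        by (apply Rmult_le_compat_l; nra).
      assert (eta * (u * v) <= eta * (s * t)) by nra; nra. }
  replace (eucl s t z - cpsi b s t z) with (B - A) by (unfold A, B; ring); lra.
Qed.

Lemma eucl_bounds (s t z : R) : 0 < s -> 0 < t -> Rabs (s - t) <= z <= s + t -> -1 <= eucl s t z <= 1.
Proof.
  intros Hs Ht Hz; assert (Hst : 0 < 2 * s * t) by nra; unfold eucl.
  pose proof (Rabs_pos (s - t)); assert (E : Rabs (s - t) * Rabs (s - t) = (s - t) * (s - t)).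
  { unfold Rabs; destruct (Rcase_abs _); ring. }
  split; apply (Rmult_le_reg_r (2 * s * t)); auto;
    replace ((s * s + t * t - z * z) / (2 * s * t) * (2 * s * t)) with (s * s + t * t - z * z)
      by (field; lra).
  - assert (z * z <= (s + t) * (s + t)) by (apply Rmult_le_compat; lra); lra.
  - assert (Rabs (s - t) * Rabs (s - t) <= z * z) by (apply Rmult_le_compat; lra); lra.
Qed.

Lemma acos_le_of_cos_le (x th : R) : -1 <= x <= 1 -> 0 <= th <= PI -> cos th <= x -> acos x <= th.
Proof.
  intros Hx Ht H; pose proof (acos_bound x); apply Rnot_lt_le; intros Hlt.
  pose proof (cos_decreasing_1 th (acos x) ltac:(lra) ltac:(lra) ltac:(lra) ltac:(lra) Hlt) as H1.
  rewrite cos_acos in H1; lra.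
Qed.

Lemma cos_le_of_acos_le (x th : R) : -1 <= x <= 1 -> 0 <= th <= PI -> acos x <= th -> cos th <= x.
Proof.
  intros Hx Ht H; pose proof (acos_bound x); rewrite <- (cos_acos x) at 1 by auto.
  destruct (Req_dec (acos x) th) as [->|]; [lra|].
  apply Rlt_le, cos_decreasing_1; lra.
Qed.

Lemma acos_antitone (x y : R) : -1 <= x -> x <= y -> y <= 1 -> acos y <= acos x.
Proof.
  intros; apply acos_le_of_cos_le; [lra | apply acos_bound | rewrite cos_acos; lra].
Qed.

Section Curves.
Variables (M : Type) (rho : M -> M -> R).
Hypothesis Hd : semimetric rho.
Hypothesis Htri : triangle_ineq rho.

Notation dsym := (d_sym M rho Hd).
Notation dpos := (d_pos M rho Hd).
Notation drefl := (d_refl M rho Hd).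

Definition seg (e : R -> M) (l : R) (X : M) : Prop := exists u, 0 <= u <= l /\ X = e u.

Lemma geo_reverse (e : R -> M) (l : R) : geo rho e l -> geo rho (fun u => e (l - u)) l.
Proof. intros He u v Hu Hv; rewrite He by lra; rewrite <- Rabs_Ropp; f_equal; ring. Qed.

Lemma geo_sub (e : R -> M) (l l' : R) : l' <= l -> geo rho e l -> geo rho e l'.
Proof. intros H He u v Hu Hv; apply He; lra. Qed.

Lemma shortest_additive (g : R -> M) (A B : M) (t t' : R) : shortest rho g A B ->
  0 <= t -> t <= t' -> t' <= 1 -> rho A (g t') = rho A (g t) + rho (g t) (g t').
Proof.
  intros [_ [E0 [E1 [Hub _]]]] H0 H1 H2; subst A B.
  assert (H : rho (g 0) (g t) + rho (g t) (g t') + rho (g t') (g 1) <= rho (g 0) (g 1)).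
  { apply Hub; exists 3%nat,
      (fun i => match i with O => 0 | 1%nat => t | 2%nat => t' | _ => 1 end).
    repeat split; auto.
    - intros [|[|[|i]]] Hi; lra || lia.
    - simpl; ring. }
  pose proof (Htri (g 0) (g t) (g t')); pose proof (Htri (g 0) (g t') (g 1)); lra.
Qed.

(** The curve is isometric with respect to [phi], the distance from [A], which takes all values by
    continuity. As the curve may pause, [phi] need not be injective; a preimage is chosen for each
    value, and no point of the image is lost because equal values mean equal points. *)
Lemma geo_of_shortest (g : R -> M) (A B : M) : shortest rho g A B ->
  exists e, geo rho e (rho A B) /\ e 0 = A /\ e (rho A B) = B /\
    (forall X, image g X <-> seg e (rho A B) X).
Proof.
  intros Hg; pose proof Hg as [Hc [E0 [E1 _]]]; set (L := rho A B).
  set (phi := fun t => rho A (g t)).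
  assert (Hadd : forall t t', 0 <= t <= 1 -> 0 <= t' <= 1 -> rho (g t) (g t') = Rabs (phi t - phi t')).
  { intros t t' Ht Ht'; unfold phi; destruct (Rle_lt_dec t t').
    - rewrite (shortest_additive g A B t t' Hg) by lra; pose proof (dpos (g t) (g t')).
      rewrite Rabs_left1; lra.
    - rewrite (shortest_additive g A B t' t Hg), (dsym (g t) (g t')) by lra.
      pose proof (dpos (g t') (g t)); rewrite Rabs_right; lra. }
  assert (P0 : phi 0 = 0) by (unfold phi; rewrite E0; apply drefl).
  assert (P1 : phi 1 = L) by (unfold phi, L; rewrite E1; auto).
  assert (HL : forall t, 0 <= t <= 1 -> 0 <= phi t <= L).
  { intros t Ht; rewrite <- P1; unfold phi.
    rewrite (shortest_additive g A B t 1 Hg) by lra.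
    pose proof (dpos (g t) (g 1)); pose proof (dpos A (g t)); lra. }
  assert (Hcont : continuity (fun t => phi (clamp 1 t))).
  { intros x eps Heps; destruct (Hc (clamp 1 x) (clamp_in 1 x ltac:(lra)) eps Heps) as [del [Hdel H]].
    exists del; split; auto; intros y [_ Hy]; simpl in *; unfold Rdist in *.
    rewrite <- Hadd by (apply clamp_in; lra).
    apply H; [apply clamp_in; lra|].
    eapply Rle_lt_trans; [apply clamp_lip; lra | auto]. }
  assert (Hsurj : forall u, 0 <= u <= L -> exists t, 0 <= t <= 1 /\ phi t = u).
  { intros u Hu.
    destruct (IVT_cor (fun t => phi (clamp 1 t) - u) 0 1) as [t [Ht E]].
    - apply continuity_minus; [auto|]; apply continuity_const; intros ? ?; auto.
    - lra.
    - rewrite !clamp_id, P0, P1 by lra; nra.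
    - exists t; split; auto; rewrite clamp_id in E by auto; lra. }
  set (tt := fun u => epsilon (inhabits 0) (fun t => 0 <= t <= 1 /\ phi t = u)).
  assert (Htt : forall u, 0 <= u <= L -> 0 <= tt u <= 1 /\ phi (tt u) = u).
  { intros u Hu; apply (epsilon_spec (inhabits 0) (fun t => 0 <= t <= 1 /\ phi t = u)); auto. }
  assert (Hsame : forall t, 0 <= t <= 1 -> g t = g (tt (phi t))).
  { intros t Ht; destruct (Htt (phi t) (HL t Ht)) as [H1 H2].
    apply (d_eq M rho Hd); rewrite Hadd, H2, Rminus_diag, Rabs_R0; auto. }
  pose proof (dpos A B) as HL0; fold L in HL0.
  exists (fun u => g (tt u)); split; [|split; [|split]].
  - intros u v Hu Hv; destruct (Htt u Hu) as [H1 H2]; destruct (Htt v Hv) as [H3 H4].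
    rewrite Hadd, H2, H4; auto.
  - pose proof (Hsame 0 ltac:(lra)) as H; rewrite P0 in H; congruence.
  - pose proof (Hsame 1 ltac:(lra)) as H; rewrite P1 in H; fold L; congruence.
  - intros X; split.
    + intros [t [Ht ->]]; exists (phi t); split; [apply HL; auto | apply Hsame; auto].
    + intros [u [Hu ->]]; exists (tt u); split; [apply Htt; auto | auto].
Qed.

Lemma shortest_of_geo (e : R -> M) (A B : M) : geo rho e (rho A B) -> e 0 = A -> e (rho A B) = B ->
  shortest rho (fun t => e (rho A B * t)) A B.
Proof.
  intros He E0 E1; set (L := rho A B) in *; pose proof (dpos A B) as HL; fold L in HL.
  assert (HLt : forall t, 0 <= t <= 1 -> 0 <= L * t <= L) by (intros; nra).
  split; [|split; [|split]].
  - intros t Ht eps Heps; exists (eps / (L + 1)); split; [apply Rdiv_lt_0_compat; lra|].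
    intros s Hs Hst; rewrite He by auto.
    replace (L * s - L * t) with (L * (s - t)) by ring; rewrite Rabs_mult, (Rabs_right L) by lra.
    apply Rle_lt_trans with (L * (eps / (L + 1))); [apply Rmult_le_compat_l; lra|].
    apply (Rmult_lt_reg_r (L + 1)); [lra|].
    replace (L * (eps / (L + 1)) * (L + 1)) with (L * eps) by (field; lra); nra.
  - rewrite Rmult_0_r; auto.
  - rewrite Rmult_1_r; auto.
  - assert (Hsum : forall x, partition_sums rho (fun t => e (L * t)) x -> x = L).
    { intros x [n [t [T0 [T1 [Hm ->]]]]].
      assert (Hmono : forall i j, (i <= j <= n)%nat -> t i <= t j).
      { intros i j [Hij Hjn]; induction Hij as [|j Hij IH]; [lra|].
        apply Rle_trans with (t j); [apply IH; lia | apply Hm; lia]. }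
      assert (Ht : forall i, (i <= n)%nat -> 0 <= t i <= 1).
      { intros i Hi; rewrite <- T0, <- T1; split; apply Hmono; lia. }
      assert (Hp : forall m, (m <= n)%nat -> poly_sum rho (fun t => e (L * t)) t m = L * t m).
      { induction m as [|m IH]; intros Hmn; simpl; [rewrite T0; ring|].
        rewrite IH by lia; rewrite He by (apply HLt, Ht; lia).
        pose proof (Hm m ltac:(lia)); rewrite Rabs_left1; [ring | nra]. }
      rewrite Hp, T1; [ring | auto]. }
    split.
    + intros x Hx; rewrite (Hsum x Hx); unfold L; lra.
    + intros B' HB'; apply HB'; exists 1%nat, (fun i => match i with O => 0 | _ => 1 end).
      repeat split; auto; [intros [|i] Hi; lra || lia|].
      simpl; rewrite Rmult_0_r, Rmult_1_r, E0, E1; fold L; ring.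
Qed.

Lemma image_of_geo (e : R -> M) (L : R) (X : M) : 0 < L ->
  image (fun t => e (L * t)) X <-> seg e L X.
Proof.
  intros HL; split.
  - intros [t [[H0 H1] ->]]; exists (L * t); split; [nra | auto].
  - intros [u [Hu ->]]; exists (u / L); split.
    + split; apply (Rmult_le_reg_r L); auto; unfold Rdiv; rewrite Rmult_assoc, Rinv_l; lra.
    + f_equal; field; lra.
Qed.

End Curves.

Lemma cpsi_bounds (b : bool) (s t z : R) : 0 < s -> 0 < t -> Rabs (s - t) <= z <= s + t ->
  (b = true -> s + t <= PI) -> -1 <= cpsi b s t z <= 1.
Proof.
  intros Hs Ht Hz Hb; pose proof (Rabs_pos (s - t)).
  assert (Ss : 0 < sn b s) by (apply sn_pos; [auto | intros E; specialize (Hb E); lra]).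
  assert (St : 0 < sn b t) by (apply sn_pos; [auto | intros E; specialize (Hb E); lra]).
  assert (P : 0 < sn b s * sn b t) by nra.
  assert (H1 : sg b * cs b (s + t) <= sg b * cs b z) by (apply cs_anti_le; auto; lra).
  assert (H2 : sg b * cs b z <= sg b * cs b (s - t)).
  { rewrite <- (c_abs b (s - t)); apply cs_anti_le; [lra | intros E; specialize (Hb E); lra]. }
  rewrite cs_add in H1; rewrite cs_sub in H2; pose proof (sg_sq b) as G.
  assert (G2 : sg b * (sg b * (sn b s * sn b t)) = sn b s * sn b t) by (rewrite <- Rmult_assoc, G; ring).
  unfold cpsi; split; apply (Rmult_le_reg_r (sn b s * sn b t)); auto;
    unfold Rdiv; rewrite (Rmult_assoc (sg b * _)), Rinv_l by lra; lra.
Qed.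

Section CosAngle.
Variables (b : bool) (M : Type) (d : M -> M -> R).

(* [cosang e1 e2 q]: [q] is the lower limit of the cosine of the model angle, that is the cosine of the
   upper angle between [e1] and [e2]. *)
Definition cosang_lower (e1 e2 : R -> M) (q : R) : Prop := forall eps, 0 < eps ->
  exists del, 0 < del /\ forall s t, 0 < s < del -> 0 < t < del ->
    q - eps <= cpsi b s t (d (e1 s) (e2 t)).

Definition cosang (e1 e2 : R -> M) (q : R) : Prop :=
  -1 <= q <= 1 /\ cosang_lower e1 e2 q /\ forall q', cosang_lower e1 e2 q' -> q' <= q.

Hypothesis Hd : semimetric d.
Hypothesis Htri : triangle_ineq d.

Lemma cosang_exists (e1 e2 : R -> M) (l1 l2 : R) : geo d e1 l1 -> geo d e2 l2 -> e1 0 = e2 0 ->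
  0 < l1 -> 0 < l2 -> exists q, cosang e1 e2 q.
Proof.
  intros He1 He2 E H1 H2; pose proof PI_RGT_0.
  set (dd := Rmin (Rmin l1 l2) (PI / 2)).
  assert (Hdd : 0 < dd /\ dd <= l1 /\ dd <= l2 /\ dd <= PI / 2).
  { unfold dd; pose proof (Rmin_l (Rmin l1 l2) (PI / 2)); pose proof (Rmin_r (Rmin l1 l2) (PI / 2)).
    pose proof (Rmin_l l1 l2); pose proof (Rmin_r l1 l2); repeat split; try lra.
    repeat apply Rmin_pos; lra. }
  assert (HB : forall s t, 0 < s < dd -> 0 < t < dd -> -1 <= cpsi b s t (d (e1 s) (e2 t)) <= 1).
  { intros s t Hs Ht; apply cpsi_bounds; [lra | lra | | intros; lra].
    apply (hinge_bounds M d Hd Htri e1 e2 l1 l2); auto; lra. }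
  assert (Hle1 : forall q, cosang_lower e1 e2 q -> q <= 1).
  { intros q Hq; apply Rnot_lt_le; intros Hlt.
    destruct (Hq ((q - 1) / 2) ltac:(lra)) as [del [Hdel H']].
    pose proof (Rmin_l del dd); pose proof (Rmin_r del dd); pose proof (Rmin_pos del dd Hdel ltac:(lra)).
    set (u := Rmin del dd / 2); assert (Hu : 0 < u < del /\ u < dd) by (unfold u; lra).
    specialize (H' u u ltac:(lra) ltac:(lra)); specialize (HB u u ltac:(lra) ltac:(lra)); lra. }
  destruct (completeness (fun q => -1 <= q /\ cosang_lower e1 e2 q)) as [q [Hub Hl]].
  - exists 1; intros q [_ Hq]; auto.
  - exists (-1); split; [lra|]; intros eps Heps; exists dd; split; [lra|].
    intros s t Hs Ht; specialize (HB s t Hs Ht); lra.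
  - assert (Hm1 : -1 <= q).
    { apply Hub; split; [lra|]; intros eps Heps; exists dd; split; [lra|].
      intros s t Hs Ht; specialize (HB s t Hs Ht); lra. }
    assert (Hlow : cosang_lower e1 e2 q).
    { intros eps Heps.
      destruct (classic (exists q', q - eps / 2 < q' /\ cosang_lower e1 e2 q')) as [[q' [Hq' L]]|Hno].
      - destruct (L (eps / 2) ltac:(lra)) as [del [Hdel H']]; exists del; split; auto.
        intros s t Hs Ht; specialize (H' s t Hs Ht); lra.
      - exfalso; assert (q <= q - eps / 2); [|lra].
        apply Hl; intros q' [_ Hq']; apply Rnot_lt_le; intros Hlt; apply Hno; exists q'; auto. }
    exists q; split; [split; auto|]; split; auto.
    intros q' Hq'; destruct (Rle_lt_dec (-1) q'); [apply Hub; auto | lra].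
Qed.

(* Shortcut from [e u] to a point [g v] of the other side, with [v] a large multiple of [u]. *)
Lemma first_variation (e g : R -> M) (l z q eps : R) : geo d e l -> geo d g z -> e 0 = g 0 ->
  0 < l -> 0 < z -> cosang_lower e g q -> 0 < eps -> -1 <= q <= 1 ->
  exists del, 0 < del /\ forall u, 0 < u < del -> d (e u) (g z) <= z - u * (q - eps).
Proof.
  intros He Hg E Hl Hz Hq Heps Hq1.
  destruct (Hq (eps / 3) ltac:(lra)) as [d1 [Hd1 H1]].
  destruct (eucl_cpsi_close b (eps / 3) ltac:(lra)) as [d2 [Hd2 H2]].
  (* With [v = N * u] one has [u / v <= eps / 3], so the second order term of the Euclidean law of
     cosines, at most of size [u^2 / v], costs no more than [u * (eps / 3)]. *)
  set (N := 1 + 3 / eps); assert (HN : 1 < N) by (unfold N; assert (0 < 3 / eps) by (apply Rdiv_lt_0_compat; lra); lra).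
  set (m := Rmin (Rmin d1 d2) (Rmin l z)).
  assert (Hm : 0 < m /\ m <= d1 /\ m <= d2 /\ m <= l /\ m <= z).
  { unfold m; pose proof (Rmin_l (Rmin d1 d2) (Rmin l z)); pose proof (Rmin_r (Rmin d1 d2) (Rmin l z)).
    pose proof (Rmin_l d1 d2); pose proof (Rmin_r d1 d2); pose proof (Rmin_l l z); pose proof (Rmin_r l z).
    repeat split; try lra; repeat apply Rmin_pos; lra. }
  exists (m / N); split; [apply Rdiv_lt_0_compat; lra|].
  intros u Hu; set (v := N * u).
  assert (Hv : u < v < m).
  { assert (v < N * (m / N)) by (apply Rmult_lt_compat_l; lra).
    replace (N * (m / N)) with m in H by (field; lra); split; auto; unfold v; nra. }
  specialize (H1 u v ltac:(lra) ltac:(lra)).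
  assert (HB : Rabs (u - v) <= d (e u) (g v) <= u + v) by (apply (hinge_bounds M d Hd Htri e g l z); auto; lra).
  specialize (H2 u v (d (e u) (g v)) ltac:(lra) ltac:(lra) HB).
  set (w := d (e u) (g v)) in *.
  pose proof (eucl_bounds u v w ltac:(lra) ltac:(lra) HB) as EB.
  apply Rabs_le_inv in H2; set (x := eucl u v w) in *.
  assert (Hw : w * w = u * u + v * v - 2 * u * v * x) by (unfold x, eucl; field; lra).
  assert (Hw0 : 0 <= w) by apply Hd.
  assert (Hxq : q - 2 * (eps / 3) <= x) by lra.
  assert (Hww : w <= v - u * x + u * (eps / 3)).
  { assert (Hub : u <= v * (eps / 3)).
    { unfold v, N; replace ((1 + 3 / eps) * u * (eps / 3)) with (u * (eps / 3) + u) by (field; lra); nra. }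
    apply Rnot_lt_le; intros Hlt.
    assert (Hux : u * x <= u * 1) by (apply Rmult_le_compat_l; lra).
    assert (Hue : 0 < u * (eps / 3)) by (apply Rmult_lt_0_compat; lra).
    assert (Hsq : (v - u * x + u * (eps / 3)) * (v - u * x + u * (eps / 3)) < w * w).
    { apply Rmult_le_0_lt_compat; lra. }
    rewrite Hw in Hsq; pose proof (Rle_0_sqr (u * x - u * (eps / 3))) as Hs0; unfold Rsqr in Hs0.
    assert (0 <= u * (v * (eps / 3) - u)) by (apply Rmult_le_pos; lra).
    assert (0 <= u * (v * (eps / 3))) by (apply Rmult_le_pos; nra).
    lra. }
  pose proof (Htri (e u) (g v) (g z)) as HT; fold w in HT; rewrite Hg, Rabs_left1 in HT by lra.
  assert (u * (q - 2 * (eps / 3)) <= u * x) by (apply Rmult_le_compat_l; lra).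
  nra.
Qed.

Lemma cosang_lower_sym (e1 e2 : R -> M) (q : R) : cosang_lower e1 e2 q -> cosang_lower e2 e1 q.
Proof.
  intros H eps He; destruct (H eps He) as [del [Hdel H']]; exists del; split; auto.
  intros s t Hs Ht; specialize (H' t s Ht Hs); rewrite (d_sym M d Hd (e2 s) (e1 t)).
  unfold cpsi in *; rewrite (Rmult_comm (cs b s)), (Rmult_comm (sn b s)); auto.
Qed.

End CosAngle.

(** * Rescaling the metric *)

Section Scaling.
Variables (M : Type) (rho : M -> M -> R) (k : R).
Hypothesis Hk : 0 < k.
Hypothesis Hrho : semimetric rho.
Definition scaled (P Q : M) : R := k * rho P Q.
Notation d := scaled.

Lemma scaled_semimetric : semimetric d.
Proof.
  destruct Hrho as [H1 [H2 H3]]; unfold scaled; split; [|split].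
  - intros P Q; rewrite H1; auto.
  - intros P Q; specialize (H2 P Q); nra.
  - intros P Q; rewrite <- H3; split; intros H; [|rewrite H; ring].
    apply (Rmult_eq_reg_l k); lra.
Qed.

Lemma scaled_triangle : triangle_ineq rho <-> triangle_ineq d.
Proof.
  split; intros H P Q S; specialize (H P Q S); unfold scaled in *.
  - rewrite <- Rmult_plus_distr_l; apply Rmult_le_compat_l; lra.
  - rewrite <- Rmult_plus_distr_l in H; apply (Rmult_le_reg_l k); lra.
Qed.

Lemma scaled_cauchy_complete : cauchy_complete rho <-> cauchy_complete d.
Proof.
  unfold cauchy_complete, is_cauchy, is_limit, scaled; split; intros H x Hx.
  - destruct (H x) as [L HL].
    + intros eps He; destruct (Hx (k * eps)) as [N HN]; [nra|]; exists N; intros m n Hm Hn.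
      specialize (HN m n Hm Hn); apply (Rmult_lt_reg_l k); lra.
    + exists L; intros eps He; destruct (HL (eps / k)) as [N HN]; [apply Rdiv_lt_0_compat; lra|].
      exists N; intros n Hn; specialize (HN n Hn); apply (Rmult_lt_compat_l k) in HN; [|lra].
      replace (k * (eps / k)) with eps in HN by (field; lra); lra.
  - destruct (H x) as [L HL].
    + intros eps He; destruct (Hx (eps / k)) as [N HN]; [apply Rdiv_lt_0_compat; lra|].
      exists N; intros m n Hm Hn; specialize (HN m n Hm Hn); apply (Rmult_lt_compat_l k) in HN; [|lra].
      replace (k * (eps / k)) with eps in HN by (field; lra); lra.
    + exists L; intros eps He; destruct (HL (k * eps)) as [N HN]; [nra|]; exists N; intros n Hn.
      specialize (HN n Hn); apply (Rmult_lt_reg_l k); lra.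
Qed.

Lemma scaled_weakly_convex : weakly_convex rho -> weakly_convex d.
Proof.
  unfold weakly_convex, scaled; intros H A B; destruct (H A B) as [lam [Hl HC]].
  exists lam; split; auto; intros eps He.
  destruct (HC (eps / k)) as [C [H1 H2]]; [apply Rdiv_lt_0_compat; lra|]; exists C.
  assert (Hs : forall x y, Rabs (x - y) < eps / k -> Rabs (k * x - k * y) < eps).
  { intros x y Hxy; rewrite <- Rmult_minus_distr_l, Rabs_mult, (Rabs_right k) by lra.
    apply (Rmult_lt_compat_l k) in Hxy; auto; replace (k * (eps / k)) with eps in Hxy by (field; lra); auto. }
  split; [apply Hs in H1 | apply Hs in H2];
    [rewrite <- Rmult_assoc, (Rmult_comm lam), Rmult_assoc
    |rewrite <- Rmult_assoc, (Rmult_comm (1 - lam)), Rmult_assoc]; auto.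
Qed.

Lemma scaled_geo (e : R -> M) (l : R) : geo rho e l <-> geo d (fun u => e (u / k)) (k * l).
Proof.
  unfold scaled; split; intros H u v Hu Hv.
  - assert (Hdiv : forall x, 0 <= x <= k * l -> 0 <= x / k <= l).
    { intros x Hx; split; apply (Rmult_le_reg_l k); auto;
        replace (k * (x / k)) with x by (field; lra); lra. }
    rewrite H by (apply Hdiv; auto); rewrite <- (Rabs_right k) at 1 by lra.
    rewrite <- Rabs_mult; f_equal; field; lra.
  - specialize (H (k * u) (k * v) ltac:(nra) ltac:(nra)); cbv beta in H.
    replace (k * u / k) with u in H by (field; lra); replace (k * v / k) with v in H by (field; lra).
    rewrite <- Rmult_minus_distr_l, Rabs_mult, (Rabs_right k) in H by lra.
    apply (Rmult_eq_reg_l k); lra.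
Qed.

Lemma scaled_seg (e : R -> M) (l : R) (X : M) :
  seg M (fun u => e (u / k)) (k * l) X <-> seg M e l X.
Proof.
  split; intros [u [Hu ->]].
  - exists (u / k); split; auto; split; apply (Rmult_le_reg_l k); auto;
      replace (k * (u / k)) with u by (field; lra); lra.
  - exists (k * u); split; [nra|]; f_equal; field; lra.
Qed.

Hypothesis Htri : triangle_ineq rho.

Lemma scaled_geo_of_shortest (g : R -> M) (A B : M) : shortest rho g A B ->
  exists e, geo d e (d A B) /\ e 0 = A /\ e (d A B) = B /\
    (forall X, image g X <-> seg M e (d A B) X).
Proof.
  intros Hg; destruct (geo_of_shortest M rho Hrho Htri g A B Hg) as [e [He [E0 [E1 HI]]]].
  assert (EL : d A B = k * rho A B) by reflexivity; rewrite EL.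
  exists (fun u => e (u / k)); split; [|split; [|split]].
  - apply -> scaled_geo; auto.
  - unfold Rdiv; rewrite Rmult_0_l; auto.
  - replace (k * rho A B / k) with (rho A B) by (field; lra); auto.
  - intros X; rewrite HI; symmetry; apply scaled_seg.
Qed.

Lemma shortest_of_scaled_geo (e : R -> M) (A B : M) : A <> B -> geo d e (d A B) -> e 0 = A ->
  e (d A B) = B -> exists g, shortest rho g A B /\ (forall X, image g X <-> seg M e (d A B) X).
Proof.
  intros HAB He E0 E1; set (e' := fun u => e (k * u)).
  assert (HL : 0 < rho A B).
  { destruct Hrho as [_ [H2 H3]]; destruct (H2 A B) as [|E]; auto.
    exfalso; apply HAB, H3; auto. }
  assert (He' : geo rho e' (rho A B)).
  { apply (proj2 (scaled_geo e' (rho A B))); intros u v Hu Hv; unfold e'.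
    replace (k * (u / k)) with u by (field; lra); replace (k * (v / k)) with v by (field; lra).
    apply He; auto. }
  assert (E0' : e' 0 = A) by (unfold e'; rewrite Rmult_0_r; auto).
  exists (fun t => e' (rho A B * t)); split.
  - apply (shortest_of_geo M rho Hrho); auto.
  - intros X; rewrite image_of_geo by auto; unfold scaled; rewrite <- scaled_seg.
    unfold e'; split; intros [u [Hu ->]]; exists u; split; auto; f_equal; field; lra.
Qed.

Variable b : bool.

(** Euclidean comparison angles are invariant under scaling, so those of [rho] are computed from
    [d]; only the radius [del] changes. *)
Lemma near_angles_iff (e1 e2 : R -> M) (l1 l2 : R) (S1 S2 : M -> Prop) (O : M) (del v : R) :
  geo d e1 l1 -> geo d e2 l2 -> e1 0 = O -> e2 0 = O ->
  (forall X, S1 X <-> seg M e1 l1 X) -> (forall X, S2 X <-> seg M e2 l2 X) ->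
  near_angles rho O S1 S2 del v <->
  exists s t, 0 < s <= l1 /\ 0 < t <= l2 /\ s < k * del /\ t < k * del /\
    v = acos (eucl s t (d (e1 s) (e2 t))).
Proof.
  intros He1 He2 E1 E2 HS1 HS2.
  assert (Haux : forall p r z s t, k * p = s -> k * r = t -> 0 < s -> 0 < t ->
    (p * p + r * r - z * z) / (2 * p * r) = eucl s t (k * z)).
  { intros p r z s t <- <- Hs Ht; unfold eucl.
    assert (p <> 0) by (intros ->; lra); assert (r <> 0) by (intros ->; lra); field; lra. }
  assert (Hang : forall s t, 0 < s <= l1 -> 0 < t <= l2 ->
    comp_angle rho 0 (e1 s) O (e2 t) = acos (eucl s t (d (e1 s) (e2 t)))).
  { intros s t Hs Ht.
    pose proof (geo_0 M d e1 l1 s He1 ltac:(lra)) as D1; pose proof (geo_0 M d e2 l2 t He2 ltac:(lra)) as D2.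
    rewrite E1 in D1; rewrite E2 in D2; unfold comp_angle, model_angle, scaled in *.
    destruct (Rlt_dec 0 0); [lra|].
    f_equal; apply Haux; auto; lra. }
  assert (Hpos : forall (e : R -> M) l s, geo d e l -> e 0 = O -> 0 <= s <= l ->
    (e s <> O <-> 0 < s) /\ (rho O (e s) < del <-> s < k * del)).
  { intros e l s He E Hs; pose proof (geo_0 M d e l s He Hs) as D; rewrite E in D.
    unfold scaled in D; split; split; intros H.
    - destruct Hs as [[Hs|Hs] _]; auto; subst s; contradiction.
    - intros Z; rewrite Z, (d_refl M rho Hrho) in D; lra.
    - apply (Rmult_lt_compat_l k) in H; lra.
    - apply (Rmult_lt_reg_l k); lra. }
  split.
  - intros [X [Y [H1 [H2 [NX [NY [DX [DY ->]]]]]]]].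
    apply HS1 in H1; apply HS2 in H2; destruct H1 as [s [Hs ->]]; destruct H2 as [t [Ht ->]].
    apply (Hpos e1 l1) in NX; auto; apply (Hpos e2 l2) in NY; auto.
    apply (Hpos e1 l1) in DX; auto; apply (Hpos e2 l2) in DY; auto.
    exists s, t; repeat split; auto; try lra; apply Hang; lra.
  - intros [s [t [Hs [Ht [Ds [Dt ->]]]]]].
    exists (e1 s), (e2 t); repeat split.
    + apply HS1; exists s; split; auto; lra.
    + apply HS2; exists t; split; auto; lra.
    + apply (Hpos e1 l1); auto; lra.
    + apply (Hpos e2 l2); auto; lra.
    + apply (Hpos e1 l1); auto; lra.
    + apply (Hpos e2 l2); auto; lra.
    + symmetry; apply Hang; auto.
Qed.

(** As [acos] is decreasing, the upper limit of angles is [acos] of the lower limit of cosines; near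
    the vertex [eucl_cpsi_close] exchanges the Euclidean cosine for that of the model plane. *)
Lemma upper_angle_cosang (e1 e2 : R -> M) (l1 l2 q : R) (S1 S2 : M -> Prop) (O : M) :
  geo d e1 l1 -> geo d e2 l2 -> e1 0 = O -> e2 0 = O -> 0 < l1 -> 0 < l2 ->
  (forall X, S1 X <-> seg M e1 l1 X) -> (forall X, S2 X <-> seg M e2 l2 X) ->
  cosang b M d e1 e2 q -> upper_angle rho O S1 S2 (acos q).
Proof.
  intros He1 He2 E1 E2 Hl1 Hl2 HS1 HS2 [Hq1 [Hlow Hmax]].
  pose proof (proj1 scaled_triangle Htri) as Htri'; pose proof scaled_semimetric as Hd.
  assert (HB : forall s t, 0 <= s <= l1 -> 0 <= t <= l2 -> Rabs (s - t) <= d (e1 s) (e2 t) <= s + t).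
  { intros s t Hs Ht; apply (hinge_bounds M d Hd Htri' e1 e2 l1 l2); auto; congruence. }
  assert (Hlub : forall del, 0 < del -> exists m, is_lub (near_angles rho O S1 S2 del) m).
  { intros del Hdel.
    destruct (completeness (near_angles rho O S1 S2 del)) as [m Hm]; [| |exists m; auto].
    - exists PI; intros v Hv; apply (near_angles_iff e1 e2 l1 l2) in Hv; auto.
      destruct Hv as [s [t [_ [_ [_ [_ ->]]]]]]; apply acos_bound.
    - set (u := Rmin (Rmin l1 l2) (k * del / 2)).
      assert (Hkd : 0 < k * del) by nra.
      assert (Hu : 0 < u /\ u <= l1 /\ u <= l2 /\ u <= k * del / 2).
      { unfold u; pose proof (Rmin_l (Rmin l1 l2) (k * del / 2)).
        pose proof (Rmin_r (Rmin l1 l2) (k * del / 2)); pose proof (Rmin_l l1 l2).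
        pose proof (Rmin_r l1 l2); repeat split; try lra; repeat apply Rmin_pos; lra. }
      exists (acos (eucl u u (d (e1 u) (e2 u)))).
      apply (near_angles_iff e1 e2 l1 l2); auto; exists u, u; repeat split; lra. }
  split.
  - intros th [del [Hdel [Hub _]]].
    assert (Hkd : 0 < k * del) by nra.
    set (m := Rmin (Rmin l1 l2) (k * del)).
    assert (Hm : 0 < m /\ m <= l1 /\ m <= l2 /\ m <= k * del).
    { unfold m; pose proof (Rmin_l (Rmin l1 l2) (k * del)).
      pose proof (Rmin_r (Rmin l1 l2) (k * del)); pose proof (Rmin_l l1 l2).
      pose proof (Rmin_r l1 l2); repeat split; try lra; repeat apply Rmin_pos; lra. }
    assert (Hin : forall s t, 0 < s < m -> 0 < t < m -> acos (eucl s t (d (e1 s) (e2 t))) <= th).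
    { intros s t Hs Ht; apply Hub, (near_angles_iff e1 e2 l1 l2); auto; exists s, t; repeat split; lra. }
    destruct (Rle_lt_dec th PI) as [HP|HP]; [|pose proof (acos_bound q); lra].
    assert (H0 : 0 <= th).
    { specialize (Hin (m / 2) (m / 2) ltac:(lra) ltac:(lra)).
      pose proof (acos_bound (eucl (m / 2) (m / 2) (d (e1 (m / 2)) (e2 (m / 2))))); lra. }
    apply acos_le_of_cos_le; auto.
    apply Hmax; intros eps Heps; destruct (eucl_cpsi_close b eps Heps) as [d1 [Hd1 HE]].
    exists (Rmin m d1); split; [apply Rmin_pos; lra|]; intros s t Hs Ht.
    pose proof (Rmin_l m d1); pose proof (Rmin_r m d1).
    specialize (HB s t ltac:(lra) ltac:(lra)).
    specialize (HE s t _ ltac:(lra) ltac:(lra) HB); apply Rabs_le_inv in HE.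
    specialize (Hin s t ltac:(lra) ltac:(lra)).
    apply cos_le_of_acos_le in Hin; [lra | apply eucl_bounds; auto; lra | auto].
  - intros bd Hbd; apply Rnot_lt_le; intros Hlt.
    set (th := (acos q + bd) / 2).
    destruct (Hlub 1 ltac:(lra)) as [m1 Hm1].
    assert (Hm1P : m1 <= PI).
    { apply Hm1; intros v Hv; apply (near_angles_iff e1 e2 l1 l2) in Hv; auto.
      destruct Hv as [s [t [_ [_ [_ [_ ->]]]]]]; apply acos_bound. }
    assert (HbP : bd <= PI) by (apply Rle_trans with m1; [apply Hbd; exists 1; split; auto; lra | auto]).
    pose proof (acos_bound q) as HA.
    assert (Hc : cos th < q).
    { rewrite <- (cos_acos q) by auto; apply cos_decreasing_1; unfold th; lra. }
    set (eps := (q - cos th) / 2); assert (Heps : 0 < eps) by (unfold eps; lra).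
    destruct (Hlow eps Heps) as [d1 [Hd1 HL]]; destruct (eucl_cpsi_close b eps Heps) as [d2 [Hd2 HE]].
    set (del := Rmin d1 d2 / k); pose proof (Rmin_l d1 d2); pose proof (Rmin_r d1 d2).
    assert (Hdel : 0 < del) by (apply Rdiv_lt_0_compat; auto; apply Rmin_pos; lra).
    assert (Ekd : k * del = Rmin d1 d2) by (unfold del; field; lra).
    destruct (Hlub del Hdel) as [m Hm].
    assert (Hbm : bd <= m) by (apply Hbd; exists del; auto).
    assert (m <= th); [|unfold th in *; lra].
    apply Hm; intros v Hv; apply (near_angles_iff e1 e2 l1 l2) in Hv; auto.
    destruct Hv as [s [t [Hs [Ht [Ds [Dt ->]]]]]]; rewrite Ekd in *.
    specialize (HB s t ltac:(lra) ltac:(lra)).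
    specialize (HE s t _ ltac:(lra) ltac:(lra) HB); apply Rabs_le_inv in HE.
    specialize (HL s t ltac:(lra) ltac:(lra)).
    apply acos_le_of_cos_le; [apply eucl_bounds; auto; lra | unfold th; lra | unfold eps in *; lra].
Qed.

Lemma upper_angle_unique (O : M) (S1 S2 : M -> Prop) (th th' : R) :
  upper_angle rho O S1 S2 th -> upper_angle rho O S1 S2 th' -> th = th'.
Proof. intros [H1 H2] [H3 H4]; apply Rle_antisym; auto. Qed.

End Scaling.

(** * Angle comparison from the angle sum *)

Lemma cpsi_opposite (b : bool) (s t : R) : 0 < sn b s -> 0 < sn b t -> cpsi b s t (s + t) = -1.
Proof.
  intros Hs Ht; unfold cpsi; rewrite cs_add.
  replace (sg b * (cs b s * cs b t - sg b * (sn b s * sn b t) - cs b s * cs b t))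
    with (- (sg b * sg b) * (sn b s * sn b t)) by ring.
  rewrite sg_sq; field; lra.
Qed.

Lemma cpsi_same (b : bool) (s t : R) : 0 < sn b s -> 0 < sn b t -> cpsi b s t (Rabs (s - t)) = 1.
Proof.
  intros Hs Ht; unfold cpsi; rewrite c_abs, cs_sub.
  replace (sg b * (cs b s * cs b t + sg b * (sn b s * sn b t) - cs b s * cs b t))
    with ((sg b * sg b) * (sn b s * sn b t)) by ring.
  rewrite sg_sq; field; lra.
Qed.

Lemma negative_near_0 (F : R -> R) (D : R) : derivable_pt_lim F 0 D -> F 0 <= 0 ->
  (F 0 = 0 -> D < 0) -> exists del, 0 < del /\ forall u, 0 < u < del -> F u < 0.
Proof.
  intros HD H0 Hneg; destruct (Req_dec (F 0) 0) as [E|E].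
  - destruct (HD (- D / 2)) as [[del Hdel] H]; [specialize (Hneg E); lra|].
    exists del; split; auto; intros u Hu; simpl in H.
    specialize (H u ltac:(lra) ltac:(rewrite Rabs_right; lra)); rewrite Rplus_0_l, E, Rminus_0_r in H.
    specialize (Hneg E).
    apply Rabs_def2 in H; apply (Rmult_lt_reg_r (/ u)); [apply Rinv_0_lt_compat; lra|].
    rewrite Rmult_0_l; fold (F u / u); lra.
  - assert (HC : continuity_pt F 0) by (apply derivable_continuous_pt; exists D; auto).
    destruct (HC (- F 0) ltac:(lra)) as [del [Hdel H]]; exists del; split; auto.
    intros u Hu; simpl in H; unfold Rdist in H.
    assert (Hu' : Rabs (F u - F 0) < - F 0).
    { apply H; split; [split; [exact I | lra]|]; rewrite Rminus_0_r, Rabs_right; lra. }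
    apply Rabs_def2 in Hu'; lra.
Qed.

(* Squared and multiplied by [sn s ^ 2], both sides are the Gram determinant of the triangle. *)
Lemma law_of_sines (b : bool) (s t z : R) : 0 < sn b s -> 0 < sn b t -> 0 < sn b z ->
  -1 <= cpsi b s t z <= 1 -> -1 <= cpsi b s z t <= 1 ->
  sin (acos (cpsi b s z t)) * sn b z = sin (acos (cpsi b s t z)) * sn b t.
Proof.
  intros Hs Ht Hz H1 H2.
  pose proof (acos_bound (cpsi b s z t)); pose proof (acos_bound (cpsi b s t z)).
  assert (P1 : 0 <= sin (acos (cpsi b s z t))) by (apply sin_ge_0; lra).
  assert (P2 : 0 <= sin (acos (cpsi b s t z))) by (apply sin_ge_0; lra).
  assert (Hsq : forall x, -1 <= x <= 1 -> sin (acos x) * sin (acos x) = 1 - x * x).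
  { intros x Hx; pose proof (sin2_cos2 (acos x)) as E; unfold Rsqr in E.
    rewrite cos_acos in E by auto; lra. }
  apply Rsqr_inj; [apply Rmult_le_pos; lra | apply Rmult_le_pos; lra|]; unfold Rsqr.
  replace (sin (acos (cpsi b s z t)) * sn b z * (sin (acos (cpsi b s z t)) * sn b z))
    with (sin (acos (cpsi b s z t)) * sin (acos (cpsi b s z t)) * (sn b z * sn b z)) by ring.
  replace (sin (acos (cpsi b s t z)) * sn b t * (sin (acos (cpsi b s t z)) * sn b t))
    with (sin (acos (cpsi b s t z)) * sin (acos (cpsi b s t z)) * (sn b t * sn b t)) by ring.
  rewrite !Hsq by auto; unfold cpsi.
  apply (Rmult_eq_reg_r (sn b s * sn b s)); [|nra].
  replace ((1 - sg b * (cs b t - cs b s * cs b z) / (sn b s * sn b z) *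
    (sg b * (cs b t - cs b s * cs b z) / (sn b s * sn b z))) * (sn b z * sn b z) * (sn b s * sn b s))
    with ((sn b s * sn b s) * (sn b z * sn b z) - (sg b * sg b) * (cs b t - cs b s * cs b z) * (cs b t - cs b s * cs b z))
    by (field; lra).
  replace ((1 - sg b * (cs b z - cs b s * cs b t) / (sn b s * sn b t) *
    (sg b * (cs b z - cs b s * cs b t) / (sn b s * sn b t))) * (sn b t * sn b t) * (sn b s * sn b s))
    with ((sn b s * sn b s) * (sn b t * sn b t) - (sg b * sg b) * (cs b z - cs b s * cs b t) * (cs b z - cs b s * cs b t))
    by (field; lra).
  rewrite !sn_sq.
  replace (sg b * (1 - cs b s * cs b s) * (sg b * (1 - cs b z * cs b z)))
    with ((sg b * sg b) * ((1 - cs b s * cs b s) * (1 - cs b z * cs b z))) by ring.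
  replace (sg b * (1 - cs b s * cs b s) * (sg b * (1 - cs b t * cs b t)))
    with ((sg b * sg b) * ((1 - cs b s * cs b s) * (1 - cs b t * cs b t))) by ring.
  rewrite sg_sq; ring.
Qed.

(** A fixed deficit of the angle gives a gain of the cosine proportional to [sin phi], uniformly as
    [phi] approaches 0 or [pi]. This factor is the one that the law of sines carries over to the
    angle at [O]. *)
Lemma cos_gap (xi phi eps : R) : 0 <= xi -> phi <= PI -> 0 < eps <= PI -> xi <= phi - eps ->
  sin (eps / 2) * sin phi <= cos xi - cos phi.
Proof.
  intros Hxi Hphi He Hle.
  assert (H1 : cos (phi - eps) <= cos xi) by (apply cos_decr_1; lra).
  assert (E : cos (phi - eps) - cos phi = 2 * sin (phi - eps / 2) * sin (eps / 2)).
  { replace (phi - eps) with (phi - eps / 2 - eps / 2) by field.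
    replace (cos phi) with (cos (phi - eps / 2 + eps / 2)) by (f_equal; field).
    rewrite cos_minus, cos_plus; ring. }
  assert (S0 : 0 < sin (eps / 2)) by (apply sin_gt_0; lra).
  assert (Hs : sin phi <= 2 * sin (phi - eps / 2)).
  { destruct (Rle_lt_dec (phi - eps / 2) (PI / 2)) as [Hc|Hc].
    - assert (A1 : sin (phi / 2) <= sin (phi - eps / 2)) by (apply sin_incr_1; lra).
      replace phi with (2 * (phi / 2)) at 1 by field; rewrite sin_2a.
      pose proof (COS_bound (phi / 2)); assert (0 <= sin (phi / 2)) by (apply sin_ge_0; lra).
      nra.
    - assert (A1 : sin phi <= sin (phi - eps / 2)) by (apply sin_decr_1; lra).
      assert (0 <= sin phi) by (apply sin_ge_0; lra); lra. }
  nra.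
Qed.

(* When the angle at [X], with cosine [q1], falls short of its model value, moving [X] towards [O]
   decreases the model angle at [O] at a definite logarithmic rate; [h] is the sine of half that
   angle. *)
Lemma descent_step (b : bool) (s t z q1 h th kp kp' c0 C : R) :
  0 < s -> 0 < sn b s -> 0 < sn b t -> 0 < sn b z ->
  -1 <= cpsi b s t z <= 1 -> -1 <= cpsi b s z t <= 1 ->
  0 <= h -> 2 * (h * h) = 1 - cpsi b s t z -> 0 < h -> h <= th -> 0 <= c0 -> c0 * c0 <= 1 - h * h ->
  0 < kp -> sn b s <= C * s -> 2 * kp * C < kp' * c0 -> 0 <= kp' ->
  kp' * sin (acos (cpsi b s z t)) <= q1 - cpsi b s z t ->
  exists eps del, 0 < eps /\ 0 < del /\ forall u, 0 < u < del -> u < s /\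
    0 <= th + kp * (ln (s - u) - ln s) /\
    (1 - 2 * ((th + kp * (ln (s - u) - ln s)) * (th + kp * (ln (s - u) - ln s)))) * (sn b (s - u) * sn b t)
    <= sg b * (cs b (z - u * (q1 - eps)) - cs b (s - u) * cs b t).
Proof.
  intros Hs Ss St Sz B1 B2 Hh0 Hh Hh1 Hth Hc0 Hc0' Hkp HC Hk Hkp' Hq.
  set (psi := cpsi b s t z) in *; set (px := cpsi b s z t) in *.
  assert (Epsi : psi * (sn b s * sn b t) = sg b * (cs b z - cs b s * cs b t)) by (unfold psi, cpsi; field; lra).
  assert (Epx : px * sn b z = sn b s * cs b t - cs b s * sn b t * psi).
  { apply (Rmult_eq_reg_r (sn b s)); [|lra].
    replace ((sn b s * cs b t - cs b s * sn b t * psi) * sn b s)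
      with (sn b s * sn b s * cs b t - cs b s * (psi * (sn b s * sn b t))) by ring.
    rewrite Epsi, sn_sq; unfold px, cpsi; field; lra. }
  (* The law of sines converts the gain at [X] into the sine of the angle at [O], which is at least
     [2 * h * c0]. Thus the gain is proportional to [h], like the decrease of the squared potential
     that it has to pay for. *)
  assert (Hgap : 4 * h * kp / s * (sn b s * sn b t) < sn b z * (q1 - px)).
  { pose proof (law_of_sines b s t z Ss St Sz B1 B2) as LS; fold psi px in LS.
    assert (Hsin : 2 * h * c0 <= sin (acos psi)).
    { pose proof (acos_bound psi); apply Rnot_lt_le; intros Hlt.
      assert (P : 0 <= sin (acos psi)) by (apply sin_ge_0; lra).
      assert (Q : sin (acos psi) * sin (acos psi) < 2 * h * c0 * (2 * h * c0)).
      { apply Rmult_le_0_lt_compat; lra. }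
      pose proof (sin2_cos2 (acos psi)) as E; unfold Rsqr in E; rewrite cos_acos in E by auto.
      assert (E2 : psi = 1 - 2 * (h * h)) by lra; rewrite E2 in E at 3 4.
      assert (h * h * (c0 * c0) <= h * h * (1 - h * h)) by (apply Rmult_le_compat_l; nra).
      nra. }
    apply Rlt_le_trans with (kp' * (2 * h * c0) * sn b t).
    - apply Rle_lt_trans with (4 * h * kp * C * sn b t).
      + replace (4 * h * kp / s * (sn b s * sn b t)) with (4 * h * kp * sn b t * (sn b s / s)) by (field; lra).
        replace (4 * h * kp * C * sn b t) with (4 * h * kp * sn b t * C) by ring.
        apply Rmult_le_compat_l; [repeat apply Rmult_le_pos; lra|].
        apply (Rmult_le_reg_r s); auto; replace (sn b s / s * s) with (sn b s) by (field; lra); auto.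
      + replace (4 * h * kp * C * sn b t) with (2 * h * sn b t * (2 * kp * C)) by ring.
        replace (kp' * (2 * h * c0) * sn b t) with (2 * h * sn b t * (kp' * c0)) by ring.
        apply Rmult_lt_compat_l; auto; nra.
    - apply Rle_trans with (kp' * sin (acos px) * sn b z).
      + rewrite Rmult_assoc, (Rmult_assoc kp' (sin _)), LS.
        apply Rmult_le_compat_l; auto; apply Rmult_le_compat_r; lra.
      + rewrite (Rmult_comm (sn b z)); apply Rmult_le_compat_r; lra. }
  (* Half of the slack in [Hgap], divided by [sn z]: the error conceded to the first variation. *)
  set (eps := (sn b z * (q1 - px) - 4 * h * kp / s * (sn b s * sn b t)) / (2 * sn b z)).
  assert (Heps : 0 < eps) by (apply Rdiv_lt_0_compat; lra).
  set (w := q1 - eps).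
  assert (Ew : 4 * h * kp / s * (sn b s * sn b t) + sn b z * (px - w) < 0).
  { replace (sn b z * (px - w)) with (- (sn b z * (q1 - px)) + sn b z * eps) by (unfold w; ring).
    replace (sn b z * eps) with ((sn b z * (q1 - px) - 4 * h * kp / s * (sn b s * sn b t)) / 2)
      by (unfold eps; field; lra); lra. }
  set (L := fun u => th + kp * (ln (s - u) - ln s)).
  (* The inequality to be proved follows from [F u < 0]. One has [F 0 <= 0]; equality forces
     [th = h], and then [Ew] makes the derivative at 0 negative. *)
  set (F := fun u => (1 - 2 * (L u * L u)) * (sn b (s - u) * sn b t)
                     - sg b * (cs b (z - u * w) - cs b (s - u) * cs b t)).
  assert (EL0 : L 0 = th) by (unfold L; rewrite Rminus_0_r; ring).
  assert (Dlin : forall m, derivable_pt_lim (fun u => m - u) 0 (-1)).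
  { intros m; replace (-1) with (0 - 1) by ring; apply (derivable_pt_lim_minus (fun _ => m) (fun u => u));
      [apply derivable_pt_lim_const | apply derivable_pt_lim_id]. }
  assert (DL : derivable_pt_lim L 0 (- kp / s)).
  { unfold L; replace (- kp / s) with (0 + kp * (/ s * (-1) - 0)) by (field; lra).
    apply (derivable_pt_lim_plus (fun _ => th)); [apply derivable_pt_lim_const|].
    apply (derivable_pt_lim_scal (fun u => ln (s - u) - ln s)).
    apply (derivable_pt_lim_minus (fun u => ln (s - u)) (fun _ => ln s)); [|apply derivable_pt_lim_const].
    apply (derivable_pt_lim_comp (fun u => s - u) ln); [apply Dlin|].
    rewrite Rminus_0_r; apply derivable_pt_lim_ln; auto. }
  assert (Dsn : derivable_pt_lim (fun u => sn b (s - u)) 0 (cs b s * (-1))).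
  { apply (derivable_pt_lim_comp (fun u => s - u) (sn b)); [apply Dlin|].
    rewrite Rminus_0_r; apply derivable_sn. }
  assert (Dcs : derivable_pt_lim (fun u => cs b (s - u)) 0 (- sg b * sn b s * (-1))).
  { apply (derivable_pt_lim_comp (fun u => s - u) (cs b)); [apply Dlin|].
    rewrite Rminus_0_r; apply derivable_cs. }
  assert (Dcz : derivable_pt_lim (fun u => cs b (z - u * w)) 0 (- sg b * sn b z * (0 - w))).
  { apply (derivable_pt_lim_comp (fun u => z - u * w) (cs b)).
    - apply (derivable_pt_lim_minus (fun _ => z) (fun u => u * w)); [apply derivable_pt_lim_const|].
      apply (derivable_pt_lim_ext (fun u => w * u)); [intros; ring|].
      pose proof (derivable_pt_lim_scal id w 0 1 (derivable_pt_lim_id 0)) as Dw.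
      rewrite Rmult_1_r in Dw; exact Dw.
    - replace (z - 0 * w) with z by ring; apply derivable_cs. }
  destruct (negative_near_0 F (4 * th * kp / s * (sn b s * sn b t) - (1 - 2 * (th * th)) * (cs b s * sn b t)
     - w * sn b z + sn b s * cs b t)) as [d1 [Hd1 HF]].
  - unfold F.
    replace (4 * th * kp / s * (sn b s * sn b t) - (1 - 2 * (th * th)) * (cs b s * sn b t) - w * sn b z + sn b s * cs b t)
    with (((0 - 2 * (- kp / s * L 0 + L 0 * (- kp / s))) * (sn b (s - 0) * sn b t)
           + (1 - 2 * (L 0 * L 0)) * (sn b t * (cs b s * (-1))))
          - sg b * (- sg b * sn b z * (0 - w) - cs b t * (- sg b * sn b s * (-1)))).
    2:{ rewrite EL0, Rminus_0_r.
        transitivity (4 * th * kp / s * (sn b s * sn b t) - (1 - 2 * (th * th)) * (cs b s * sn b t)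
           - (sg b * sg b) * (w * sn b z) + (sg b * sg b) * (sn b s * cs b t)); [field; lra | rewrite sg_sq; ring]. }
    apply (derivable_pt_lim_minus (fun u => (1 - 2 * (L u * L u)) * (sn b (s - u) * sn b t))).
    + apply (derivable_pt_lim_mult (fun u => 1 - 2 * (L u * L u)) (fun u => sn b (s - u) * sn b t)).
      * apply (derivable_pt_lim_minus (fun _ => 1)); [apply derivable_pt_lim_const|].
        apply (derivable_pt_lim_scal (fun u => L u * L u)); apply (derivable_pt_lim_mult L L); auto.
      * apply (derivable_pt_lim_ext (fun u => sn b t * sn b (s - u))); [intros; ring|].
        apply (derivable_pt_lim_scal (fun u => sn b (s - u))); auto.
    + apply (derivable_pt_lim_scal (fun u => cs b (z - u * w) - cs b (s - u) * cs b t)).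
      apply (derivable_pt_lim_minus (fun u => cs b (z - u * w))); auto.
      apply (derivable_pt_lim_ext (fun u => cs b t * cs b (s - u))); [intros; ring|].
      apply (derivable_pt_lim_scal (fun u => cs b (s - u))); auto.
  - unfold F; rewrite EL0, !Rminus_0_r, Rmult_0_l, Rminus_0_r, <- Epsi.
    assert (h * h <= th * th) by (apply Rmult_le_compat; lra).
    assert (0 < sn b s * sn b t) by nra.
    assert ((1 - 2 * (th * th)) * (sn b s * sn b t) <= psi * (sn b s * sn b t)) by (apply Rmult_le_compat_r; lra).
    lra.
  - unfold F; rewrite EL0, !Rminus_0_r, Rmult_0_l, Rminus_0_r, <- Epsi; intros E0.
    assert (0 < sn b s * sn b t) by nra.
    assert (E1 : 1 - 2 * (th * th) = psi) by (apply (Rmult_eq_reg_r (sn b s * sn b t)); lra).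
    assert (E2 : th = h) by (apply Rsqr_inj; [lra | lra | unfold Rsqr; lra]).
    rewrite E1, E2; replace (4 * h * kp / s * (sn b s * sn b t) - psi * (cs b s * sn b t) - w * sn b z + sn b s * cs b t)
      with (4 * h * kp / s * (sn b s * sn b t) + (sn b s * cs b t - cs b s * sn b t * psi - sn b z * w)) by ring.
    rewrite <- Epx; lra.
  - destruct (negative_near_0 (fun u => - L u) (- (- kp / s))) as [d2 [Hd2 HL]].
    + apply (derivable_pt_lim_opp L); auto.
    + rewrite EL0; lra.
    + rewrite EL0; lra.
    + exists eps, (Rmin (Rmin d1 d2) s); split; auto; split; [repeat apply Rmin_pos; auto|].
      intros u Hu; pose proof (Rmin_l (Rmin d1 d2) s); pose proof (Rmin_r (Rmin d1 d2) s).
      pose proof (Rmin_l d1 d2); pose proof (Rmin_r d1 d2).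
      specialize (HF u ltac:(lra)); specialize (HL u ltac:(lra)); split; [lra|].
      unfold L in HL; split; [lra|]; unfold F, L, w in HF; lra.
Qed.

Lemma acos_m1 : acos (-1) = PI.
Proof. replace (-1) with (- (1)) by ring; rewrite acos_opp, acos_1; ring. Qed.

Definition angle_sum (b : bool) {M : Type} (d : M -> M -> R) : Prop :=
  forall A B C e1 e2 e3, A <> B -> B <> C -> C <> A ->
  geo d e1 (d A B) -> e1 0 = A -> e1 (d A B) = B ->
  geo d e2 (d B C) -> e2 0 = B -> e2 (d B C) = C ->
  geo d e3 (d C A) -> e3 0 = C -> e3 (d C A) = A ->
  forall qA qB qC,
  cosang b M d e1 (fun u => e3 (d C A - u)) qA ->
  cosang b M d (fun u => e1 (d A B - u)) e2 qB ->
  cosang b M d (fun u => e2 (d B C - u)) e3 qC ->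
  acos qA + acos qB + acos qC <=
    acos (cpsi b (d A B) (d A C) (d B C)) + acos (cpsi b (d B A) (d B C) (d A C))
    + acos (cpsi b (d C A) (d C B) (d A B)).

Definition concave_distance (b : bool) {M : Type} (d : M -> M -> R) : Prop :=
  forall e l P x, geo d e l -> 0 <= x <= l ->
  sg b * (sn b (l - x) * cs b (d P (e 0)) + sn b x * cs b (d P (e l)))
  <= sg b * (sn b l * cs b (d P (e x))).

Section Space.
Variables (b : bool) (M : Type) (d : M -> M -> R).
Notation σ := (sg b).
Notation c := (cs b).
Notation s := (sn b).
Hypothesis Hd : semimetric d.
Hypothesis Hdiam : b = true -> diam_le d (PI / 2).
Hypothesis Htri : triangle_ineq d.

Notation dsym := (d_sym M d Hd).
Notation dpos := (d_pos M d Hd).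
Notation dle := (d_le b M d Hdiam).

Lemma hinge_cpsi_bounds (e1 e2 : R -> M) (l1 l2 : R) : geo d e1 l1 -> geo d e2 l2 -> e1 0 = e2 0 ->
  0 < l1 -> 0 < l2 -> -1 <= cpsi b l1 l2 (d (e1 l1) (e2 l2)) <= 1.
Proof.
  intros He1 He2 E H1 H2; apply cpsi_bounds; auto.
  - apply (hinge_bounds M d Hd Htri e1 e2 l1 l2); auto; lra.
  - intros Eb; pose proof (geo_len b M d Hdiam e1 l1 He1 ltac:(lra) Eb).
    pose proof (geo_len b M d Hdiam e2 l2 He2 ltac:(lra) Eb); lra.
Qed.

Lemma cpsi_swap (x y z : R) : cpsi b x y z = cpsi b y x z.
Proof. unfold cpsi; rewrite (Rmult_comm (c x)), (Rmult_comm (s x)); auto. Qed.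

Lemma cosang_sym (e1 e2 : R -> M) (q : R) : cosang b M d e1 e2 q -> cosang b M d e2 e1 q.
Proof.
  intros [H1 [H2 H3]]; split; auto; split; [apply cosang_lower_sym; auto|].
  intros q' Hq'; apply H3, cosang_lower_sym; auto.
Qed.

Lemma cosang_ext (e1 e2 f1 f2 : R -> M) (q : R) : (forall u, f1 u = e1 u) -> (forall u, f2 u = e2 u) ->
  cosang b M d e1 e2 q -> cosang b M d f1 f2 q.
Proof.
  intros E1 E2 [H1 [H2 H3]]; split; auto; split.
  - intros eps He; destruct (H2 eps He) as [del [Hdel H]]; exists del; split; auto.
    intros x y Hx Hy; rewrite E1, E2; auto.
  - intros q' Hq'; apply H3; intros eps He; destruct (Hq' eps He) as [del [Hdel H]].
    exists del; split; auto; intros x y Hx Hy; rewrite <- E1, <- E2; auto.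
Qed.

Lemma cpsi_antitone (e : R -> M) (l x : R) (P : M) : concave_distance b d -> geo d e l ->
  0 < x <= l -> 0 < d P (e 0) ->
  cpsi b l (d P (e 0)) (d P (e l)) <= cpsi b x (d P (e 0)) (d P (e x)).
Proof.
  intros Hstar He Hx Hr; specialize (Hstar e l P x He ltac:(lra)).
  pose proof (geo_sn_pos b M d Hdiam e l l He ltac:(lra)) as Sl; pose proof (geo_sn_pos b M d Hdiam e l x He ltac:(lra)) as Sx.
  set (r := d P (e 0)) in *.
  assert (Sr : 0 < s r).
  { pose proof PI_RGT_0; apply sn_pos; [auto|]; intros E; pose proof (dle P (e 0) E); unfold r; lra. }
  rewrite sn_sub in Hstar; unfold cpsi.
  apply (Rmult_le_reg_r (s l * s x * s r)); [repeat apply Rmult_lt_0_compat; auto|].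
  replace (σ * (c (d P (e l)) - c l * c r) / (s l * s r) * (s l * s x * s r))
    with (σ * (c (d P (e l)) - c l * c r) * s x) by (field; lra).
  replace (σ * (c (d P (e x)) - c x * c r) / (s x * s r) * (s l * s x * s r))
    with (σ * (c (d P (e x)) - c x * c r) * s l) by (field; lra).
  lra.
Qed.

(** [cpsi_antitone] shortens first one side and then the other, so the value at [(l1, l2)] is a
    lower bound for all shorter hinges. *)
Lemma cpsi_le_cosang (e1 e2 : R -> M) (l1 l2 q : R) : concave_distance b d ->
  geo d e1 l1 -> geo d e2 l2 -> e1 0 = e2 0 -> 0 < l1 -> 0 < l2 ->
  cosang b M d e1 e2 q -> cpsi b l1 l2 (d (e1 l1) (e2 l2)) <= q.
Proof.
  intros Hstar He1 He2 E H1 H2 [_ [_ Hq]]; apply Hq; intros eps Heps.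
  exists (Rmin l1 l2); split; [apply Rmin_pos; auto|]; intros x y Hx Hy.
  pose proof (Rmin_l l1 l2); pose proof (Rmin_r l1 l2).
  pose proof (geo_0 M d e1 l1 x He1 ltac:(lra)) as D1; pose proof (geo_0 M d e2 l2 l2 He2 ltac:(lra)) as D2.
  pose proof (cpsi_antitone e1 l1 x (e2 l2) Hstar He1 ltac:(lra)) as A1.
  pose proof (cpsi_antitone e2 l2 y (e1 x) Hstar He2 ltac:(lra)) as A2.
  rewrite E, (dsym (e2 l2) (e2 0)), D2 in A1; specialize (A1 H2).
  rewrite <- E, (dsym (e1 x) (e1 0)), D1 in A2; specialize (A2 ltac:(lra)).
  rewrite (cpsi_swap l2), (cpsi_swap y) in A2.
  rewrite (dsym (e2 l2) (e1 l1)), (dsym (e2 l2) (e1 x)) in A1; lra.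
Qed.

Lemma angle_sum_of_concave : concave_distance b d -> angle_sum b d.
Proof.
  intros Hstar A B C e1 e2 e3 NAB NBC NCA G1 E10 E11 G2 E20 E21 G3 E30 E31 qA qB qC QA QB QC.
  assert (Hpos : forall X Y, X <> Y -> 0 < d X Y).
  { intros X Y HXY; destruct (dpos X Y) as [|E]; auto; exfalso; apply HXY, (d_eq M d Hd); auto. }
  pose proof (Hpos A B NAB); pose proof (Hpos B C NBC); pose proof (Hpos C A NCA).
  pose proof (geo_reverse M d e1 _ G1) as R1; pose proof (geo_reverse M d e2 _ G2) as R2.
  pose proof (geo_reverse M d e3 _ G3) as R3.
  assert (Haux : forall f1 f2 l1 l2 q X Y O, geo d f1 l1 -> geo d f2 l2 -> f1 0 = O -> f2 0 = O ->
    f1 l1 = X -> f2 l2 = Y -> 0 < l1 -> 0 < l2 -> cosang b M d f1 f2 q -> 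
    acos q <= acos (cpsi b l1 l2 (d X Y))).
  { intros f1 f2 l1 l2 q X Y O F1 F2 E1 E2 <- <- L1 L2 Q.
    apply acos_antitone; [| |apply Q].
    - apply hinge_cpsi_bounds; auto; congruence.
    - apply cpsi_le_cosang; auto; congruence. }
  assert (SA : acos qA <= acos (cpsi b (d A B) (d C A) (d B C))).
  { apply (Haux e1 _ _ _ qA B C A G1 R3); auto; rewrite ?Rminus_0_r, ?Rminus_diag; auto. }
  assert (SB : acos qB <= acos (cpsi b (d A B) (d B C) (d A C))).
  { apply (Haux _ e2 _ _ qB A C B R1 G2); auto; rewrite ?Rminus_0_r, ?Rminus_diag; auto. }
  assert (SC : acos qC <= acos (cpsi b (d B C) (d C A) (d B A))).
  { apply (Haux _ e3 _ _ qC B A C R2 G3); auto; rewrite ?Rminus_0_r, ?Rminus_diag; auto. }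
  rewrite (cpsi_swap (d B C)), (dsym B A) in SC.
  rewrite (dsym B A), (dsym C B); rewrite (dsym A C) in *; lra.
Qed.

End Space.

(** * Degenerate hinges *)

Section Hinges.
Variables (b : bool) (M : Type) (d : M -> M -> R).
Notation σ := (sg b).
Notation c := (cs b).
Notation s := (sn b).
Hypothesis Hd : semimetric d.
Hypothesis Hdiam : b = true -> diam_le d (PI / 2).
Hypothesis Htri : triangle_ineq d.
Hypothesis Hgeo : forall A B, exists e, geo d e (d A B) /\ e 0 = A /\ e (d A B) = B.
Hypothesis Hsum : angle_sum b d.

Notation dsym := (d_sym M d Hd).
Notation dpos := (d_pos M d Hd).
Notation dle := (d_le b M d Hdiam).
Notation sn_pos' := (geo_sn_pos b M d Hdiam).

Lemma hinge_sum (e1 e2 g : R -> M) (l1 l2 z q q1 q2 : R) :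
  geo d e1 l1 -> geo d e2 l2 -> e1 0 = e2 0 -> 0 < l1 -> 0 < l2 ->
  geo d g z -> g 0 = e1 l1 -> g z = e2 l2 -> 0 < z ->
  cosang b M d e1 e2 q -> cosang b M d (fun u => e1 (l1 - u)) g q1 ->
  cosang b M d (fun u => g (z - u)) (fun u => e2 (l2 - u)) q2 ->
  acos q + acos q1 + acos q2 <=
    acos (cpsi b l1 l2 z) + acos (cpsi b l1 z l2) + acos (cpsi b l2 z l1).
Proof.
  intros He1 He2 E H1 H2 Hg G0 G1 Hz Q Q1 Q2.
  pose proof (geo_0 M d e1 l1 l1 He1 ltac:(lra)) as D1; pose proof (geo_0 M d e2 l2 l2 He2 ltac:(lra)) as D2.
  pose proof (geo_0 M d g z z Hg ltac:(lra)) as D3; rewrite G0, G1 in D3.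
  rewrite <- E in D2; set (A := e1 0) in *; set (B := e1 l1) in *; set (C := e2 l2) in *.
  assert (Hne : forall X Y, 0 < d X Y -> X <> Y).
  { intros X Y H ->; rewrite (d_refl M d Hd) in H; lra. }
  rewrite (dsym A C) in D2.
  pose proof (Hsum A B C e1 g (fun u => e2 (l2 - u))) as S.
  rewrite D1, D2, D3, (dsym B A), D1, (dsym C B), D3, (dsym A C), D2 in S.
  apply S with (qA := q) (qB := q1) (qC := q2); auto; try (apply Hne; lra).
  - apply geo_reverse; auto.
  - rewrite Rminus_0_r; auto.
  - rewrite Rminus_diag; auto.
  - eapply cosang_ext; [| |exact Q]; auto; intros u; cbv beta; f_equal; ring.
Qed.

Lemma cosang_straight (e : R -> M) (l x q : R) : geo d e l -> 0 < x < l ->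
  cosang b M d (fun u => e (x + u)) (fun u => e (x - u)) q -> q = -1.
Proof.
  intros He Hx [Hq [Hlow _]]; apply Rle_antisym; [|lra].
  apply Rnot_lt_le; intros Hlt; destruct (Hlow ((q + 1) / 2) ltac:(lra)) as [del [Hdel H]].
  set (m := Rmin del (Rmin x (l - x))).
  assert (Hm : 0 < m /\ m <= del /\ m <= x /\ m <= l - x).
  { unfold m; pose proof (Rmin_l del (Rmin x (l - x))); pose proof (Rmin_r del (Rmin x (l - x))).
    pose proof (Rmin_l x (l - x)); pose proof (Rmin_r x (l - x)); repeat split; try lra.
    repeat apply Rmin_pos; lra. }
  specialize (H (m / 2) (m / 2) ltac:(lra) ltac:(lra)); rewrite He, Rabs_right in H by lra.
  replace (x + m / 2 - (x - m / 2)) with (m / 2 + m / 2) in H by ring.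
  pose proof (sn_pos' e l (m / 2) He ltac:(lra)); rewrite cpsi_opposite in H by auto; lra.
Qed.

(** The triangle of the common origin, the common end and the midpoint of [e2] has model angles 0, 0
    and [pi], while its angle at the midpoint is [pi] by [cosang_straight]; the angle sum leaves
    nothing for the origin. *)
Lemma digon_trivial (e1 e2 : R -> M) (l q : R) : geo d e1 l -> geo d e2 l -> e1 0 = e2 0 ->
  0 < l -> e1 l = e2 l -> cosang b M d e1 e2 q -> q = 1.
Proof.
  intros He1 He2 E Hl El Q; set (m := l / 2).
  set (g := fun u => e2 (l - u)).
  assert (Hg : geo d g m) by (apply (geo_sub M d _ l); [unfold m; lra | apply geo_reverse; auto]).
  assert (He2' : geo d e2 m) by (apply (geo_sub M d _ l); [unfold m; lra | auto]).
  destruct (cosang_exists b M d Hd Htri (fun u => e1 (l - u)) g l m) as [q1 Q1]; auto;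
    try (unfold m; lra).
  { apply geo_reverse; auto. }
  { unfold g; rewrite !Rminus_0_r; auto. }
  destruct (cosang_exists b M d Hd Htri (fun u => g (m - u)) (fun u => e2 (m - u)) m m) as [q2 Q2];
    try (unfold m; lra).
  { apply geo_reverse; auto. }
  { apply geo_reverse; auto. }
  { unfold g, m; f_equal; field. }
  assert (Z2 : q2 = -1).
  { apply (cosang_straight e2 l m); auto; [unfold m; lra|].
    eapply cosang_ext; [| |exact Q2]; auto; intros u; unfold g, m; f_equal; field. }
  pose proof (sn_pos' e1 l l He1 ltac:(lra)) as Sl; pose proof (sn_pos' e2 m m He2' ltac:(unfold m; lra)) as Sm.
  pose proof (hinge_sum e1 e2 g l m m q q1 q2 He1 He2' E Hl ltac:(unfold m; lra) Hg) as S.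
  assert (P1 : cpsi b l m m = 1).
  { rewrite <- (cpsi_same b l m) by auto; f_equal; unfold m; rewrite Rabs_right; lra. }
  assert (P2 : cpsi b m m l = -1).
  { rewrite <- (cpsi_opposite b m m) by auto; f_equal; unfold m; field. }
  rewrite P1, P2, acos_1, acos_m1 in S.
  assert (S' : acos q <= 0).
  { pose proof (acos_bound q1).
    lapply S; [clear S; intros S | unfold g; rewrite Rminus_0_r; auto].
    lapply S; [clear S; intros S | unfold g, m; f_equal; field].
    specialize (S ltac:(unfold m; lra) Q Q1 Q2); rewrite Z2, acos_m1 in S; lra. }
  pose proof (acos_bound q); rewrite <- (cos_acos q) by apply Q.
  replace (acos q) with 0 by lra; apply cos_0.
Qed.

(* Otherwise the positive angle at [O] would leave the angle at [e2 l2] smaller than [pi], hence a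
   shortcut from [O] to [e1 l1]. *)
Lemma collinear_trivial (e1 e2 : R -> M) (l1 l2 q : R) : geo d e1 l1 -> geo d e2 l2 -> e1 0 = e2 0 ->
  0 < l2 < l1 -> d (e1 l1) (e2 l2) = l1 - l2 -> cosang b M d e1 e2 q -> q = 1.
Proof.
  intros He1 He2 E Hl Ez Q; set (z := l1 - l2) in *.
  destruct (Hgeo (e1 l1) (e2 l2)) as [g [Hg [G0 G1]]]; rewrite Ez in *.
  assert (Hz : 0 < z) by (unfold z; lra).
  pose proof (geo_reverse M d g z Hg) as Hgr; pose proof (geo_reverse M d e2 l2 He2) as He2r.
  destruct (cosang_exists b M d Hd Htri (fun u => e1 (l1 - u)) g l1 z) as [q1 Q1]; auto; try lra.
  { apply geo_reverse; auto. }
  { rewrite !Rminus_0_r; auto. }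
  destruct (cosang_exists b M d Hd Htri (fun u => g (z - u)) (fun u => e2 (l2 - u)) z l2) as [q2 Q2];
    auto; try lra.
  { rewrite !Rminus_0_r; auto. }
  pose proof (hinge_sum e1 e2 g l1 l2 z q q1 q2 He1 He2 E ltac:(lra) ltac:(lra) Hg G0 G1 Hz Q Q1 Q2) as S.
  pose proof (sn_pos' e1 l1 l1 He1 ltac:(lra)) as S1; pose proof (sn_pos' e2 l2 l2 He2 ltac:(lra)) as S2.
  pose proof (sn_pos' g z z Hg ltac:(lra)) as Sz.
  assert (P1 : cpsi b l1 l2 z = 1).
  { rewrite <- (cpsi_same b l1 l2) by auto; f_equal; rewrite Rabs_right; unfold z; lra. }
  assert (P2 : cpsi b l1 z l2 = 1).
  { rewrite <- (cpsi_same b l1 z) by auto; f_equal; rewrite Rabs_right; unfold z; lra. }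
  assert (P3 : cpsi b l2 z l1 = -1).
  { rewrite <- (cpsi_opposite b l2 z) by auto; f_equal; unfold z; lra. }
  rewrite P1, P2, P3, acos_1, acos_m1 in S.
  pose proof (acos_bound q1); pose proof (acos_bound q) as HA; pose proof (proj1 Q2) as B2.
  assert (Hq2 : q2 <= -1).
  { apply Rnot_lt_le; intros Hlt.
    destruct (first_variation b M d Hd Htri (fun u => e2 (l2 - u)) (fun u => g (z - u)) l2 z q2 ((q2 + 1) / 2))
      as [del [Hdel HV]]; auto; try lra.
    { rewrite !Rminus_0_r; auto. }
    { apply cosang_lower_sym; auto; apply Q2. }
    pose proof (Rmin_l del l2); pose proof (Rmin_r del l2); pose proof (Rmin_pos del l2 Hdel ltac:(lra)).
    set (u := Rmin del l2 / 2); assert (Hu : 0 < u < del /\ u < l2) by (unfold u; lra).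
    specialize (HV u ltac:(lra)); cbv beta in HV; rewrite Rminus_diag, G0 in HV.
    pose proof (geo_0 M d e1 l1 l1 He1 ltac:(lra)) as D1.
    pose proof (geo_0 M d e2 l2 (l2 - u) He2 ltac:(lra)) as D2.
    pose proof (Htri (e1 0) (e2 (l2 - u)) (e1 l1)) as HT; rewrite D1, E, D2 in HT.
    assert (0 < u * (q2 - (q2 + 1) / 2 + 1)) by (apply Rmult_lt_0_compat; lra).
    unfold z in HV; lra. }
  replace q2 with (-1) in S by lra; rewrite acos_m1 in S.
  rewrite <- (cos_acos q) by apply Q; replace (acos q) with 0 by lra; apply cos_0.
Qed.

End Hinges.

Lemma sqrt_half_sq (x : R) : x <= 1 -> 2 * (sqrt ((1 - x) / 2) * sqrt ((1 - x) / 2)) = 1 - x.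
Proof. intros H; rewrite sqrt_sqrt; lra. Qed.

Lemma cv_ln (u : nat -> R) (l : R) : 0 < l -> Un_cv u l -> Un_cv (fun n => ln (u n)) (ln l).
Proof.
  intros Hl Hu eps He.
  destruct (ln_continue l Hl eps He) as [del [Hdel H]].
  destruct (cv_ev_gt u l 0 Hu Hl) as [N1 HN1]; destruct (Hu del Hdel) as [N2 HN2].
  exists (max N1 N2); intros n Hn; specialize (HN1 n ltac:(lia)); specialize (HN2 n ltac:(lia)).
  destruct (Req_dec (u n) l) as [->|Hne]; [unfold Rdist; rewrite Rminus_diag, Rabs_R0; lra|].
  apply (H (u n)); split; [split; [apply HN1 | auto] | apply HN2].
Qed.

(** * The descent on hinges *)

Section AngleComparison.
Variables (b : bool) (M : Type) (d : M -> M -> R).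
Notation σ := (sg b).
Notation c := (cs b).
Notation s := (sn b).
Hypothesis Hd : semimetric d.
Hypothesis Hdiam : b = true -> diam_le d (PI / 2).
Hypothesis Htri : triangle_ineq d.

Notation dsym := (d_sym M d Hd).
Notation dpos := (d_pos M d Hd).
Notation dle := (d_le b M d Hdiam).
Notation sn_pos' := (geo_sn_pos b M d Hdiam).

Lemma cpsi_lt_1 (x y z : R) : 0 < s x -> 0 < s y -> Rabs (x - y) < z -> (b = true -> z <= PI / 2) ->
  cpsi b x y z < 1.
Proof.
  intros Sx Sy Hz Hb; pose proof (one_minus_cpsi b x y z Sx Sy) as E; pose proof (Rabs_pos (x - y)).
  pose proof PI_RGT_0.
  assert (0 < s ((z + Rabs (x - y)) / 2)) by (apply sn_pos; [lra | intros Eb; specialize (Hb Eb); lra]).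
  assert (0 < s ((z - Rabs (x - y)) / 2)) by (apply sn_pos; [lra | intros Eb; specialize (Hb Eb); lra]).
  assert (0 < 1 - cpsi b x y z); [|lra].
  rewrite E; apply Rdiv_lt_0_compat; repeat apply Rmult_lt_0_compat; lra.
Qed.

(** The first variation bounds the third side of the shortened hinge, and [descent_step] shows that
    this bound keeps the model angle below the lowered potential. *)
Lemma shortcut_step (e1 e2 g : R -> M) (x y z q1 ep th th0 kp C : R) :
  geo d e1 x -> geo d e2 y -> e1 0 = e2 0 -> 0 < x -> 0 < y ->
  geo d g z -> g 0 = e1 x -> g z = e2 y -> Rabs (x - y) < z ->
  cosang b M d (fun u => e1 (x - u)) g q1 -> 0 < ep <= PI -> acos q1 <= acos (cpsi b x z y) - ep ->
  0 <= th <= th0 -> th0 * th0 <= 1 -> 1 - cpsi b x y z <= 2 * (th * th) ->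
  0 < kp -> s x <= C * x -> 2 * kp * C < sin (ep / 2) * sqrt (1 - th0 * th0) ->
  exists u, 0 < u < x /\ 0 <= th + kp * (ln (x - u) - ln x) /\
    (1 - 2 * ((th + kp * (ln (x - u) - ln x)) * (th + kp * (ln (x - u) - ln x)))) * (s (x - u) * s y)
    <= σ * (c (d (e1 (x - u)) (e2 y)) - c (x - u) * c y).
Proof.
  intros He1 He2 E Hx Hy Hg G0 G1 Hz Q1 Hep Hq1 Hth Hth0 HT Hkp HC Hk.
  pose proof (Rabs_pos (x - y)) as Hz0; pose proof PI_RGT_0 as HPI.
  pose proof (geo_reverse M d e1 x He1) as He1r.
  pose proof (sn_pos' e1 x x He1 ltac:(lra)) as Sx; pose proof (sn_pos' e2 y y He2 ltac:(lra)) as Sy.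
  pose proof (sn_pos' g z z Hg ltac:(lra)) as Sz.
  pose proof (geo_0 M d g z z Hg ltac:(lra)) as Dz; rewrite G0, G1 in Dz.
  assert (Bz : b = true -> z <= PI / 2) by (intros Eb; rewrite <- Dz; apply dle; auto).
  assert (B1 : -1 <= cpsi b x y z <= 1).
  { rewrite <- Dz; apply (hinge_cpsi_bounds b M d Hd Hdiam Htri); auto. }
  assert (B2 : -1 <= cpsi b x z y <= 1).
  { pose proof (hinge_cpsi_bounds b M d Hd Hdiam Htri (fun u => e1 (x - u)) g x z He1r Hg) as B.
    cbv beta in B; rewrite Rminus_0_r, Rminus_diag, G0, G1, E, (geo_0 M d e2 y y He2) in B by lra; apply B; auto; lra. }
  pose proof (cpsi_lt_1 x y z Sx Sy Hz Bz) as Hlt1.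
  set (h := sqrt ((1 - cpsi b x y z) / 2)).
  assert (Hh : 2 * (h * h) = 1 - cpsi b x y z) by (apply sqrt_half_sq; lra).
  assert (Hh0 : 0 < h) by (apply sqrt_lt_R0; lra).
  assert (Hhth : h <= th) by (apply Rsqr_incr_0; unfold Rsqr; lra).
  assert (Hgap : sin (ep / 2) * sin (acos (cpsi b x z y)) <= q1 - cpsi b x z y).
  { pose proof (acos_bound q1); pose proof (acos_bound (cpsi b x z y)).
    rewrite <- (cos_acos q1) by apply Q1; rewrite <- (cos_acos (cpsi b x z y)) at 2 by auto.
    apply cos_gap; lra. }
  assert (Hthh : th * th <= th0 * th0) by (apply Rmult_le_compat; lra).
  destruct (descent_step b x y z q1 h th kp (sin (ep / 2)) (sqrt (1 - th0 * th0)) C)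
    as [eps [d1 [Heps [Hd1 H1]]]]; auto; try lra.
  { apply sqrt_pos. }
  { rewrite sqrt_sqrt by lra; assert (h * h <= th * th) by (apply Rmult_le_compat; lra); lra. }
  { apply sin_ge_0; lra. }
  destruct (first_variation b M d Hd Htri (fun u => e1 (x - u)) g x z q1 eps) as [d2 [Hd2 H2]]; auto; try lra.
  { rewrite Rminus_0_r; auto. }
  { apply Q1. }
  { apply Q1. }
  (* In the spherical case [u * (1 + eps) <= 1] keeps the bound for the third side below
     [PI / 2 + 1], hence below [PI], where the cosine is decreasing. *)
  set (m := Rmin (Rmin d1 d2) (/ (1 + eps))).
  assert (Hi : 0 < / (1 + eps)) by (apply Rinv_0_lt_compat; lra).
  assert (Hm : 0 < m /\ m <= d1 /\ m <= d2 /\ m <= / (1 + eps)).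
  { unfold m; pose proof (Rmin_l (Rmin d1 d2) (/ (1 + eps))); pose proof (Rmin_r (Rmin d1 d2) (/ (1 + eps))).
    pose proof (Rmin_l d1 d2); pose proof (Rmin_r d1 d2); repeat split; try lra.
    repeat apply Rmin_pos; lra. }
  exists (m / 2); set (u := m / 2) in *; assert (Hu : 0 < u < m) by (unfold u; lra).
  specialize (H1 u ltac:(lra)); specialize (H2 u ltac:(lra)); cbv beta in H2; rewrite G1 in H2.
  destruct H1 as [H1 [H3 H4]]; split; [lra|]; split; [auto|].
  eapply Rle_trans; [exact H4|]; rewrite !Rmult_minus_distr_l; apply Rplus_le_compat_r.
  apply cs_anti_le; [split; [apply dpos | lra]|].
  intros Eb; specialize (Bz Eb); pose proof PI2_1.
  assert (u * (1 + eps) <= 1).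
  { apply Rle_trans with (/ (1 + eps) * (1 + eps)); [apply Rmult_le_compat_r; lra | rewrite Rinv_l; lra]. }
  pose proof (proj1 Q1); assert (u * (- q1) <= u * 1) by (apply Rmult_le_compat_l; lra).
  lra.
Qed.

Hypothesis Hgeo : forall A B, exists e, geo d e (d A B) /\ e 0 = A /\ e (d A B) = B.
Hypothesis Hsum : angle_sum b d.

Section Hinge.
Variables (e1 e2 : R -> M) (l1 l2 q : R).
Hypothesis He1 : geo d e1 l1.
Hypothesis He2 : geo d e2 l2.
Hypothesis E0 : e1 0 = e2 0.
Hypothesis Hl1 : 0 < l1.
Hypothesis Hl2 : 0 < l2.
Hypothesis HQ : cosang b M d e1 e2 q.
Notation p0 := (cpsi b l1 l2 (d (e1 l1) (e2 l2))).
Notation th0 := (sqrt ((1 - p0) / 2)).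
Variable kp : R.

(* The bound for the sine of half the model angle that survives the descent; it becomes negative near
   the origin. *)
Definition potential (x y : R) : R := th0 + kp * (ln x + ln y - ln l1 - ln l2).

(** [1 - 2 * h^2] is the cosine of the angle whose half has sine [h]: the model angle of the hinge
    is at most the one encoded by the potential. The sines are cleared from the denominator, which
    eases the passage to limits. *)
Definition below_potential (x y : R) : Prop := 0 < x <= l1 /\ 0 < y <= l2 /\ 0 <= potential x y /\
  (1 - 2 * (potential x y * potential x y)) * (s x * s y) <= σ * (c (d (e1 x) (e2 y)) - c x * c y).

(** The potential tends to minus infinity as [x * y] tends to 0, so its nonnegativity keeps [x * y]
    above [m0] and makes the set compact. A minimiser replaces the infinite iteration of the
    descent. *)
Lemma below_potential_minimum : 0 < kp -> p0 <= 1 ->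
  exists x y, below_potential x y /\ forall x' y', below_potential x' y' -> x * y <= x' * y'.
Proof.
  intros Hkp Hp0.
  set (E := fun v => exists x y, below_potential x y /\ v = - (x * y)).
  set (m0 := exp (ln l1 + ln l2 - th0 / kp)).
  assert (Hm0 : forall x y, below_potential x y -> m0 <= x * y).
  { intros x y [Hx [Hy [Hp _]]]; unfold m0, potential in *.
    rewrite <- (exp_ln (x * y)) by nra; rewrite ln_mult by lra.
    assert (ln l1 + ln l2 - th0 / kp <= ln x + ln y) as [H|H].
    { apply (Rmult_le_reg_l kp); auto.
      replace (kp * (ln l1 + ln l2 - th0 / kp)) with (kp * (ln l1 + ln l2) - th0) by (field; lra); lra. }
    - apply Rlt_le, exp_increasing; auto.
    - rewrite H; lra. }
  assert (Hm0p : 0 < m0) by apply exp_pos.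
  assert (Hend : below_potential l1 l2).
  { split; [lra|]; split; [lra|].
    assert (EP : potential l1 l2 = th0) by (unfold potential; ring).
    rewrite EP; split; [apply sqrt_pos|].
    rewrite sqrt_half_sq by auto; pose proof (sn_pos' e1 l1 l1 He1 ltac:(lra)).
    pose proof (sn_pos' e2 l2 l2 He2 ltac:(lra)); right; unfold cpsi; field; lra. }
  destruct (completeness E) as [mm [Hub Hleast]].
  { exists 0; intros v [x [y [H ->]]]; specialize (Hm0 x y H); lra. }
  { exists (- (l1 * l2)), l1, l2; auto. }
  assert (Hseq : forall n : nat, exists p : R * R, below_potential (fst p) (snd p) /\
            mm - / INR (S n) < - (fst p * snd p)).
  { intros n; destruct (classic (exists p : R * R, below_potential (fst p) (snd p) /\
            mm - / INR (S n) < - (fst p * snd p))) as [?|Hno]; auto; exfalso.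
    pose proof (inv_nat_pos n); assert (mm <= mm - / INR (S n)); [|lra].
    apply Hleast; intros v [x [y [H' ->]]]; apply Rnot_lt_le; intros Hlt.
    apply Hno; exists (x, y); auto. }
  set (pn := fun n => epsilon (inhabits (0, 0)) (fun p : R * R => below_potential (fst p) (snd p) /\
            mm - / INR (S n) < - (fst p * snd p))).
  assert (Hpn : forall n, below_potential (fst (pn n)) (snd (pn n)) /\
            mm - / INR (S n) < - (fst (pn n) * snd (pn n))).
  { intros n; apply (epsilon_spec (inhabits (0, 0)) (fun p : R * R => below_potential (fst p) (snd p) /\
            mm - / INR (S n) < - (fst p * snd p))); auto. }
  destruct (bolzano_weierstrass (fun n => fst (pn n)) l1) as [f1 [x [Hf1 Hx]]].
  { intros n; destruct (proj1 (Hpn n)) as [Hx _]; rewrite Rabs_right; lra. }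
  destruct (bolzano_weierstrass (fun n => snd (pn (f1 n))) l2) as [f2 [y [Hf2 Hy]]].
  { intros n; destruct (proj1 (Hpn (f1 n))) as [_ [Hy _]]; rewrite Rabs_right; lra. }
  set (xn := fun n => fst (pn (f1 (f2 n)))); set (yn := fun n => snd (pn (f1 (f2 n)))).
  assert (Cx : Un_cv xn x) by (apply (cv_sub _ _ f2 Hf2 Hx)).
  assert (Cy : Un_cv yn y) by exact Hy.
  assert (Hn : forall n, below_potential (xn n) (yn n)) by (intros n; apply Hpn).
  assert (Hxn : forall n, m0 / l2 <= xn n <= l1).
  { intros n; pose proof (Hm0 _ _ (Hn n)) as H; destruct (Hn n) as [Hx' [Hy' _]]; split; [|lra].
    apply (Rmult_le_reg_r l2); auto; replace (m0 / l2 * l2) with m0 by (field; lra); nra. }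
  assert (Hyn : forall n, m0 / l1 <= yn n <= l2).
  { intros n; pose proof (Hm0 _ _ (Hn n)) as H; destruct (Hn n) as [Hx' [Hy' _]]; split; [|lra].
    apply (Rmult_le_reg_r l1); auto; replace (m0 / l1 * l1) with m0 by (field; lra); nra. }
  assert (P1 : 0 < m0 / l2) by (apply Rdiv_lt_0_compat; auto).
  assert (P2 : 0 < m0 / l1) by (apply Rdiv_lt_0_compat; auto).
  assert (Bx : m0 / l2 <= x <= l1).
  { split; [apply (cv_le (fun _ => m0 / l2) xn) | apply (cv_le xn (fun _ => l1))]; auto;
      try apply cv_const; intros n; apply Hxn. }
  assert (By : m0 / l1 <= y <= l2).
  { split; [apply (cv_le (fun _ => m0 / l1) yn) | apply (cv_le yn (fun _ => l2))]; auto;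
      try apply cv_const; intros n; apply Hyn. }
  assert (Cd : Un_cv (fun n => d (e1 (xn n)) (e2 (yn n))) (d (e1 x) (e2 y))).
  { apply (cv_hinge M d Hd Htri e1 e2 l1 l2); auto; try lra; intros n; [specialize (Hxn n) | specialize (Hyn n)]; lra. }
  assert (Cp : Un_cv (fun n => potential (xn n) (yn n)) (potential x y)).
  { pose proof (cv_ln xn x ltac:(lra) Cx); pose proof (cv_ln yn y ltac:(lra) Cy).
    unfold potential; apply CV_plus; [apply cv_const|]; apply CV_mult; [apply cv_const|].
    apply CV_minus; [|apply cv_const]; apply CV_minus; [|apply cv_const]; apply CV_plus; auto. }
  exists x, y; split.
  - split; [lra|]; split; [lra|]; split.
    + apply (cv_le (fun _ => 0) (fun n => potential (xn n) (yn n))); auto; [|apply cv_const].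
      intros n; apply Hn.
    + apply (cv_le (fun n => (1 - 2 * (potential (xn n) (yn n) * potential (xn n) (yn n))) * (s (xn n) * s (yn n)))
        (fun n => σ * (c (d (e1 (xn n)) (e2 (yn n))) - c (xn n) * c (yn n)))).
      * intros n; apply Hn.
      * set (pt := fun n => potential (xn n) (yn n)) in *.
        change (Un_cv (fun n => (1 - 2 * (pt n * pt n)) * (s (xn n) * s (yn n)))
          ((1 - 2 * (potential x y * potential x y)) * (s x * s y))).
        cv.
      * set (dt := fun n => d (e1 (xn n)) (e2 (yn n))) in *.
        change (Un_cv (fun n => σ * (c (dt n) - c (xn n) * c (yn n))) (σ * (c (d (e1 x) (e2 y)) - c x * c y))).
        cv.
  - intros x' y' H'.
    assert (- (x' * y') <= mm) by (apply Hub; exists x', y'; auto).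
    assert (mm <= - (x * y)); [|lra].
    apply (cv_le (fun n => mm - / INR (S n)) (fun n => - (xn n * yn n))).
    + intros n; pose proof (proj2 (Hpn (f1 (f2 n)))) as H1; fold (xn n) (yn n) in H1.
      assert (/ INR (S (f1 (f2 n))) <= / INR (S n)); [|lra].
      apply Rinv_le_contravar; [apply lt_0_INR; lia | apply le_INR].
      specialize (Hf2 n); specialize (Hf1 (f2 n)); lia.
    + eapply cv_eq; [apply CV_minus; [apply cv_const | apply cv_inv_nat] | ring].
    + cv.
Qed.

(** The potential is at most [th0], so the model angle at the origin is at most [acos p0], and
    [acos q] exceeds it by [2 * ep]. By the angle sum, the other two angles fall short of their
    model values by [2 * ep] in total, hence one of them by [ep], and the hinge is shortened at that
    vertex. *)
Lemma below_potential_step (ep : R) (x y : R) : q < p0 -> p0 <= 1 -> 0 < ep ->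
  acos p0 + 2 * ep <= acos q -> 0 < kp -> 2 * kp * cosh (l1 + l2) < sin (ep / 2) * sqrt (1 - th0 * th0) ->
  below_potential x y -> exists x' y', below_potential x' y' /\ x' * y' < x * y.
Proof.
  intros Hq Hp0 Hep Hac Hkp Hkap [Hx [Hy [Hpot HT]]].
  pose proof (proj1 HQ) as Bq; pose proof (acos_bound q); pose proof (acos_bound p0).
  set (th := potential x y) in *; set (z := d (e1 x) (e2 y)) in *.
  assert (Hlnx : ln x <= ln l1) by (destruct (proj2 Hx) as [|<-]; [apply Rlt_le, ln_increasing; lra | lra]).
  assert (Hlny : ln y <= ln l2) by (destruct (proj2 Hy) as [|<-]; [apply Rlt_le, ln_increasing; lra | lra]).
  assert (Hth : 0 <= th <= th0).
  { split; auto; unfold th, potential; assert (0 <= kp * (ln l1 + ln l2 - ln x - ln y)); [apply Rmult_le_pos; lra | lra]. }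
  assert (Eth0 : 2 * (th0 * th0) = 1 - p0) by (apply sqrt_half_sq; auto).
  assert (Hthh : th * th <= th0 * th0) by (apply Rmult_le_compat; lra).
  assert (G1 : geo d e1 x) by (apply (geo_sub M d e1 l1); auto; lra).
  assert (G2 : geo d e2 y) by (apply (geo_sub M d e2 l2); auto; lra).
  pose proof (sn_pos' e1 x x G1 ltac:(lra)) as Sx; pose proof (sn_pos' e2 y y G2 ltac:(lra)) as Sy.
  assert (HT' : 1 - cpsi b x y z <= 2 * (th * th)).
  { assert (1 - 2 * (th * th) <= cpsi b x y z); [|lra].
    apply (Rmult_le_reg_r (s x * s y)); [nra|]; unfold cpsi.
    replace (σ * (c z - c x * c y) / (s x * s y) * (s x * s y)) with (σ * (c z - c x * c y)) by (field; lra); auto. }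
  assert (Hq1 : q <> 1) by lra.
  pose proof (hinge_bounds M d Hd Htri e1 e2 x y x y G1 G2 E0 ltac:(lra) ltac:(lra)) as Hz; fold z in Hz.
  (* A degenerate hinge would have upper angle 0, contrary to [q < p0 <= 1]. *)
  assert (Hz' : Rabs (x - y) < z).
  { destruct (proj1 Hz) as [|Ez]; auto; exfalso; apply Hq1.
    destruct (Rtotal_order x y) as [Hlt|[Heq|Hgt]].
    - apply (collinear_trivial b M d Hd Hdiam Htri Hgeo Hsum e2 e1 y x q); auto; try lra.
      + rewrite dsym; fold z; rewrite <- Ez, Rabs_left1; lra.
      + apply cosang_sym; auto.
    - subst y; rewrite Rminus_diag, Rabs_R0 in Ez.
      apply (digon_trivial b M d Hd Hdiam Htri Hsum e1 e2 x q); auto; try lra.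
      apply (d_eq M d Hd); auto.
    - apply (collinear_trivial b M d Hd Hdiam Htri Hgeo Hsum e1 e2 x y q); auto; try lra.
      fold z; rewrite <- Ez, Rabs_right; lra. }
  assert (Hz0 : 0 < z) by (pose proof (Rabs_pos (x - y)); lra).
  destruct (Hgeo (e1 x) (e2 y)) as [g [Hg [g0 g1]]]; fold z in Hg, g1.
  pose proof (geo_reverse M d g z Hg) as Hgr.
  pose proof (geo_reverse M d e1 x G1) as R1; pose proof (geo_reverse M d e2 y G2) as R2.
  destruct (cosang_exists b M d Hd Htri (fun u => e1 (x - u)) g x z) as [q1 Q1]; auto; try lra.
  { rewrite Rminus_0_r; auto. }
  destruct (cosang_exists b M d Hd Htri (fun u => g (z - u)) (fun u => e2 (y - u)) z y) as [q2 Q2]; auto; try lra.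
  { rewrite !Rminus_0_r; auto. }
  pose proof (hinge_sum b M d Hd Hsum e1 e2 g x y z q q1 q2 G1 G2 E0 ltac:(lra) ltac:(lra) Hg g0 g1 Hz0 HQ Q1 Q2) as S.
  assert (Hf : acos (cpsi b x y z) <= acos p0).
  { apply acos_antitone; [apply (hinge_cpsi_bounds b M d Hd Hdiam Htri); auto | lra |].
    apply (hinge_cpsi_bounds b M d Hd Hdiam Htri); auto; lra. }
  assert (HC : forall v, 0 < v <= l1 + l2 -> s v <= cosh (l1 + l2) * v).
  { intros v Hv; pose proof (sn_small b v (l1 + l2)) as Q; rewrite (Rabs_right v) in Q by lra.
    specialize (Q ltac:(lra)); pose proof (Rle_abs (s v)); lra. }
  pose proof (acos_bound q1); pose proof (acos_bound q2).
  destruct (Rle_lt_dec (acos q1) (acos (cpsi b x z y) - ep)) as [D1|D1].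
  - destruct (shortcut_step e1 e2 g x y z q1 ep th th0 kp (cosh (l1 + l2))) as [u [Hu [HP Hstep]]]; auto; try lra.
    { apply HC; lra. }
    assert (EP : potential (x - u) y = th + kp * (ln (x - u) - ln x)) by (unfold th, potential; ring).
    exists (x - u), y; split; [|nra].
    split; [lra|]; split; [lra|]; rewrite EP; auto.
  - destruct (shortcut_step e2 e1 (fun u => g (z - u)) y x z q2 ep th th0 kp (cosh (l1 + l2)))
      as [u [Hu [HP Hstep]]]; auto; try lra.
    { rewrite Rminus_0_r; auto. }
    { rewrite Rminus_diag; auto. }
    { rewrite Rabs_minus_sym; auto. }
    { apply cosang_sym; auto. }
    { rewrite cpsi_swap; auto. }
    { apply HC; lra. }
    assert (EP : potential x (y - u) = th + kp * (ln (y - u) - ln y)) by (unfold th, potential; ring).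
    exists x, (y - u); split; [|nra].
    split; [lra|]; split; [lra|]; rewrite EP; split; auto.
    rewrite (dsym (e1 x) (e2 (y - u))), (Rmult_comm (s x)), (Rmult_comm (c x)); auto.
Qed.

End Hinge.

Lemma cosang_ge_cpsi (e1 e2 : R -> M) (l1 l2 q : R) : geo d e1 l1 -> geo d e2 l2 -> e1 0 = e2 0 ->
  0 < l1 -> 0 < l2 -> cosang b M d e1 e2 q -> cpsi b l1 l2 (d (e1 l1) (e2 l2)) <= q.
Proof.
  intros He1 He2 E H1 H2 Q; apply Rnot_lt_le; intros Hlt.
  set (p0 := cpsi b l1 l2 (d (e1 l1) (e2 l2))) in *.
  pose proof (hinge_cpsi_bounds b M d Hd Hdiam Htri e1 e2 l1 l2 He1 He2 E H1 H2) as B; fold p0 in B.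
  pose proof (proj1 Q) as Bq; pose proof (acos_bound q); pose proof (acos_bound p0).
  assert (Hac : acos p0 < acos q).
  { apply Rnot_le_lt; intros Hle; apply cos_le_of_acos_le in Hle; auto; rewrite cos_acos in Hle; lra. }
  set (ep := (acos q - acos p0) / 2); assert (Hep : 0 < ep) by (unfold ep; lra).
  set (th0 := sqrt ((1 - p0) / 2)).
  assert (Eth0 : 2 * (th0 * th0) = 1 - p0) by (apply sqrt_half_sq; lra).
  assert (Hs : 0 < sin (ep / 2)) by (apply sin_gt_0; unfold ep; lra).
  assert (Hr : 0 < sqrt (1 - th0 * th0)) by (apply sqrt_lt_R0; lra).
  set (K := sin (ep / 2) * sqrt (1 - th0 * th0)); assert (HK : 0 < K) by (apply Rmult_lt_0_compat; auto).
  pose proof (cosh_ge_1 (l1 + l2)) as Hc.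
  (* Half of the rate below which [below_potential_step] works. *)
  set (kp := K / (4 * cosh (l1 + l2))).
  assert (Hkp : 0 < kp) by (apply Rdiv_lt_0_compat; lra).
  assert (Ekp : 2 * kp * cosh (l1 + l2) = K / 2) by (unfold kp; field; lra).
  destruct (below_potential_minimum e1 e2 l1 l2 He1 He2 H1 H2 kp Hkp ltac:(fold p0; lra)) as [x [y [Hxy Hmin]]].
  destruct (below_potential_step e1 e2 l1 l2 q He1 He2 E H1 H2 Q kp ep x y) as [x' [y' [Hxy' Hlt']]]; auto;
    fold p0; try lra.
  - unfold ep; lra.
  - fold th0 K; lra.
  - specialize (Hmin x' y' Hxy'); lra.
Qed.

(** If [q1 + q2] were positive, a small step along [g] would decrease the sum of the distances to
    [e (x - m)] and [e (x + m)] below [2 * m], against the triangle inequality. *)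
Lemma cosang_adjacent (e g : R -> M) (l x r q1 q2 : R) : geo d e l -> 0 < x < l -> geo d g r -> 0 < r ->
  g 0 = e x -> cosang b M d (fun u => e (x - u)) g q1 -> cosang b M d (fun u => e (x + u)) g q2 ->
  q1 + q2 <= 0.
Proof.
  intros He Hx Hg Hr G0 Q1 Q2; apply Rnot_lt_le; intros Hlt.
  set (m := Rmin x (l - x)).
  assert (Hm : 0 < m /\ m <= x /\ m <= l - x).
  { unfold m; pose proof (Rmin_l x (l - x)); pose proof (Rmin_r x (l - x)); repeat split; auto.
    apply Rmin_pos; lra. }
  assert (F1 : geo d (fun u => e (x - u)) m) by (apply (geo_sub M d _ x); [lra | apply (geo_backward M d e l); auto; lra]).
  assert (F2 : geo d (fun u => e (x + u)) m) by (apply (geo_sub M d _ (l - x)); [lra | apply (geo_forward M d e l); auto; lra]).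
  destruct (first_variation b M d Hd Htri g (fun u => e (x - u)) r m q1 ((q1 + q2) / 4)) as [d1 [Hd1 H1]]; auto; try lra.
  { rewrite Rminus_0_r; auto. }
  { apply cosang_lower_sym; auto; apply Q1. }
  { apply Q1. }
  destruct (first_variation b M d Hd Htri g (fun u => e (x + u)) r m q2 ((q1 + q2) / 4)) as [d2 [Hd2 H2]]; auto; try lra.
  { rewrite Rplus_0_r; auto. }
  { apply cosang_lower_sym; auto; apply Q2. }
  { apply Q2. }
  pose proof (Rmin_l d1 d2); pose proof (Rmin_r d1 d2); pose proof (Rmin_pos d1 d2 Hd1 Hd2).
  set (u := Rmin d1 d2 / 2); assert (Hu : 0 < u < d1 /\ u < d2) by (unfold u; lra).
  specialize (H1 u ltac:(lra)); specialize (H2 u ltac:(lra)); cbv beta in H1, H2.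
  pose proof (Htri (e (x - m)) (g u) (e (x + m))) as HT; rewrite (dsym (e (x - m)) (g u)) in HT.
  rewrite He, Rabs_left1 in HT by lra; nra.
Qed.

(** At [e x] the cosines of the two model angles towards [P] add up to at most 0, by
    [cosang_ge_cpsi] and [cosang_adjacent]. Cleared of denominators and with [sn l] expanded, this
    is the inequality. *)
Lemma concave_of_angle_sum : concave_distance b d.
Proof.
  intros e l P x He Hx.
  destruct (Req_dec x 0) as [->|Hx0]; [rewrite Rminus_0_r, sn_0; lra|].
  destruct (Req_dec x l) as [->|Hxl]; [rewrite Rminus_diag, sn_0; lra|].
  destruct (Rle_lt_or_eq_dec 0 (d P (e x)) (dpos _ _)) as [Hr|Hr].
  - destruct (Hgeo (e x) P) as [g [Hg [G0 G1]]]; rewrite (dsym (e x) P) in *.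
    set (r := d P (e x)) in *.
    pose proof (geo_backward M d e l He x Hx) as Fb; pose proof (geo_forward M d e l He x Hx) as Ff.
    destruct (cosang_exists b M d Hd Htri (fun u => e (x - u)) g x r) as [q1 Q1]; auto; try lra.
    { rewrite Rminus_0_r; auto. }
    destruct (cosang_exists b M d Hd Htri (fun u => e (x + u)) g (l - x) r) as [q2 Q2]; auto; try lra.
    { rewrite Rplus_0_r; auto. }
    pose proof (cosang_adjacent e g l x r q1 q2 He ltac:(lra) Hg Hr G0 Q1 Q2) as Hadj.
    pose proof (cosang_ge_cpsi (fun u => e (x - u)) g x r q1 Fb Hg) as P1.
    pose proof (cosang_ge_cpsi (fun u => e (x + u)) g (l - x) r q2 Ff Hg) as P2.
    cbv beta in P1, P2; rewrite Rminus_0_r, Rminus_diag, G1 in P1; rewrite Rplus_0_r, G1 in P2.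
    replace (x + (l - x)) with l in P2 by ring.
    specialize (P1 (eq_sym G0) ltac:(lra) Hr Q1); specialize (P2 (eq_sym G0) ltac:(lra) Hr Q2).
    pose proof (sn_pos' e l x He ltac:(lra)) as Sx; pose proof (sn_pos' e l (l - x) He ltac:(lra)) as Slx.
    pose proof (sn_pos' g r r Hg ltac:(lra)) as Sr.
    rewrite (dsym (e 0) P) in P1; rewrite (dsym (e l) P) in P2.
    set (h0 := d P (e 0)) in *; set (hl := d P (e l)) in *.
    assert (Hsum2 : cpsi b x r h0 + cpsi b (l - x) r hl <= 0) by lra.
    apply (Rmult_le_compat_r (s x * s (l - x) * s r)) in Hsum2; [|repeat apply Rmult_le_pos; lra].
    unfold cpsi in Hsum2.
    replace ((σ * (c h0 - c x * c r) / (s x * s r) + σ * (c hl - c (l - x) * c r) / (s (l - x) * s r))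
      * (s x * s (l - x) * s r))
      with (σ * (c h0 - c x * c r) * s (l - x) + σ * (c hl - c (l - x) * c r) * s x) in Hsum2 by (field; lra).
    assert (El : s l = s x * c (l - x) + c x * s (l - x)) by (rewrite <- sn_add; f_equal; ring).
    rewrite El; lra.
  - symmetry in Hr; apply (d_eq M d Hd) in Hr; subst P.
    rewrite (d_refl M d Hd), cs_0, !He, !c_abs, Rminus_0_r by lra.
    assert (El : s l = s x * c (l - x) + c x * s (l - x)) by (rewrite <- sn_add; f_equal; ring).
    replace (x - l) with (- (l - x)) by ring; rewrite cs_neg, El; lra.
Qed.

End AngleComparison.

(** * The lower cosq condition from the comparison inequality *)

(* The point [N] of the geodesic [A B] is the end point [A]. *)
Lemma lower4_endpoint (b : bool) (x y f k I w : R) :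
  0 <= cs b ((y + f) / 2) -> 0 <= cs b y + cs b f -> 0 < sn b y -> 0 <= sn b x -> 0 <= k ->
  0 <= sg b * (1 - k * cs b (y - f)) -> sg b * cs b (x + f) <= sg b * cs b w ->
  sg b * (sn b y * I) <= sg b * ((1 + k) * sn b (y - x) + k * (sn b x * (cs b y + cs b f))) ->
  sg b * (I * (cs b y + cs b f)) <= sg b * ((1 + k) * (cs b w + cs b (x - y))).
Proof.
  intros Hmu HJ Hy Hx Hk Hkc Hw HI.
  apply Rle_trans with (sg b * ((1 + k) * (cs b (x + f) + cs b (x - y)))).
  2:{ assert ((1 + k) * (sg b * cs b (x + f)) <= (1 + k) * (sg b * cs b w)) by (apply Rmult_le_compat_l; lra); lra. }
  apply (mul_cancel b (sn b y)); auto.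
  set (mu := (y + f) / 2) in *; set (nu := (y - f) / 2).
  assert (EJ : cs b y + cs b f = 2 * cs b mu * cs b nu) by apply cs_sum.
  assert (EN : cs b (x + f) + cs b (x - y) = 2 * cs b mu * cs b (x - nu)).
  { rewrite cs_sum; replace ((x + f + (x - y)) / 2) with (x - nu) by (unfold nu; field).
    replace ((x + f - (x - y)) / 2) with mu by (unfold mu; field); ring. }
  assert (E2 : cs b (y - f) = 2 * (cs b nu * cs b nu) - 1).
  { pose proof (cs_double b (y - f)); unfold nu; lra. }
  assert (Emu : cs b mu = cs b y * cs b nu + sg b * (sn b y * sn b nu)).
  { replace mu with (y - nu) by (unfold mu, nu; field); apply cs_sub. }
  apply (Rmult_le_compat_r (cs b y + cs b f)) in HI; auto.
  replace (sg b * (sn b y * (I * (cs b y + cs b f)))) with (sg b * (sn b y * I) * (cs b y + cs b f)) by ring.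
  eapply Rle_trans; [exact HI|].
  (* The difference of the two bounds factors, and each factor has a known sign, the last one after
     multiplication by [sg b]. *)
  assert (ED : sn b y * ((1 + k) * (cs b (x + f) + cs b (x - y)))
    - ((1 + k) * sn b (y - x) + k * (sn b x * (cs b y + cs b f))) * (cs b y + cs b f)
    = 2 * (cs b mu * cs b mu) * sn b x * (1 - k * cs b (y - f))).
  { rewrite EN, EJ, E2, sn_sub, cs_sub.
    replace (cs b mu * cs b mu) with (cs b mu * (cs b y * cs b nu + sg b * (sn b y * sn b nu)))
      by (rewrite <- Emu; auto).
    replace (k * (sn b x * (2 * cs b mu * cs b nu)) * (2 * cs b mu * cs b nu))
      with (4 * k * sn b x * cs b mu * (cs b nu * cs b nu) * (cs b y * cs b nu + sg b * (sn b y * sn b nu)))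
      by (rewrite <- Emu; ring).
    replace ((1 + k) * (sn b y * cs b x - cs b y * sn b x)
       + k * (sn b x * (2 * cs b mu * cs b nu)))
      with ((1 + k) * (sn b y * cs b x - cs b y * sn b x)
       + k * (sn b x * (2 * (cs b y * cs b nu + sg b * (sn b y * sn b nu)) * cs b nu)))
      by (rewrite <- Emu; ring).
    ring. }
  assert (0 <= 2 * (cs b mu * cs b mu) * sn b x * (sg b * (1 - k * cs b (y - f)))).
  { apply Rmult_le_pos; auto; nra. }
  replace (2 * (cs b mu * cs b mu) * sn b x * (sg b * (1 - k * cs b (y - f))))
    with (sg b * (2 * (cs b mu * cs b mu) * sn b x * (1 - k * cs b (y - f)))) in H by ring.
  rewrite <- ED in H; lra.
Qed.

(* Extremal value of the linear form with coefficients [X1], [X2] on the circle or hyperbola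
   [(cs t, sn t)]. *)
Lemma optimum_square (b : bool) (X1 X2 t : R) : X1 * sn b t = sg b * (X2 * cs b t) ->
  (cs b t * X1 + sn b t * X2) * (cs b t * X1 + sn b t * X2) = X1 * X1 + sg b * (X2 * X2).
Proof.
  intros H; pose proof (pyth b t) as P; pose proof (sg_sq b) as G.
  assert (E : (cs b t * X1 + sn b t * X2) * (cs b t * X1 + sn b t * X2)
     + sg b * ((X1 * sn b t - sg b * (X2 * cs b t)) * (X1 * sn b t - sg b * (X2 * cs b t)))
     = X1 * X1 * (cs b t * cs b t + sg b * (sn b t * sn b t))
       + sg b * (X2 * X2) * (cs b t * cs b t * (sg b * sg b) + sg b * (sn b t * sn b t))
       + (1 - sg b * sg b) * (X2 * X2 * (sn b t * sn b t) + 2 * X1 * X2 * cs b t * sn b t)) by ring.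
  rewrite H, G, !Rmult_1_r, !P in E; lra.
Qed.

Section Space.
Variables (b : bool) (M : Type) (d : M -> M -> R).
Notation σ := (sg b).
Notation c := (cs b).
Notation s := (sn b).
Hypothesis Hd : semimetric d.
Hypothesis Hdiam : b = true -> diam_le d (PI / 2).
Hypothesis Htri : triangle_ineq d.
Hypothesis Hgeo : forall A B, exists e, geo d e (d A B) /\ e 0 = A /\ e (d A B) = B.
Hypothesis Hstar : concave_distance b d.

Notation dsym := (d_sym M d Hd).
Notation dpos := (d_pos M d Hd).
Notation dle := (d_le b M d Hdiam).
Notation cpos := (c_nonneg b M d Hd Hdiam).

Lemma cs_triangle (P N Q : M) : σ * c (d P N + d N Q) <= σ * c (d P Q).
Proof.
  apply cs_anti_le; [split; [apply dpos | apply Htri]|].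
  intros E; pose proof (dle P N E); pose proof (dle N Q E); lra.
Qed.

(* AM-GM: [2 g h s1 s2 <= g ^ 2 s1 ^ 2 + h ^ 2 s2 ^ 2], with [s1], [s2] the sines of the two sides. *)
Lemma cs_triangle_weighted (P N Q : M) (g h : R) : 0 <= g -> 0 <= h ->
  σ * ((g * c (d P N) + h * c (d N Q)) * (g * c (d P N) + h * c (d N Q)) - g * g - h * h)
  <= σ * (2 * g * h * c (d P Q)).
Proof.
  intros Hg Hh; pose proof (cs_triangle P N Q) as H; rewrite cs_add in H.
  set (n1 := d P N) in *; set (n2 := d N Q) in *; pose proof (sg_sq b) as G.
  pose proof (Rle_0_sqr (g * s n1 - h * s n2)) as Hs; unfold Rsqr in Hs.
  apply (Rmult_le_compat_l (2 * g * h)) in H; [|nra].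
  assert (E1 : s n1 * s n1 = σ * (1 - c n1 * c n1)) by apply sn_sq.
  assert (E2 : s n2 * s n2 = σ * (1 - c n2 * c n2)) by apply sn_sq.
  assert (Hs' : 2 * g * h * (s n1 * s n2) <= g * g * (σ * (1 - c n1 * c n1)) + h * h * (σ * (1 - c n2 * c n2))).
  { rewrite <- E1, <- E2; lra. }
  replace (2 * g * h * (σ * (c n1 * c n2 - σ * (s n1 * s n2))))
    with (σ * (2 * g * h * (c n1 * c n2)) - (σ * σ) * (2 * g * h * (s n1 * s n2))) in H by ring.
  rewrite G in H; lra.
Qed.

Lemma sg_square_le (x y : R) : 0 <= x -> 0 <= y -> σ * x <= σ * y -> σ * (x * x) <= σ * (y * y).
Proof. intros Hx Hy H; destruct (sg_cases b) as [E|E]; rewrite E in *; nra. Qed.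

(** At the point with parameter [a / 2 - t] of the geodesic [A B], the concavity bound is a linear
    form in [cs t] and [sn t]. The two hypotheses say that its critical point lies within the
    geodesic. The weights of [cs_triangle_weighted] are [g = sn y] and [h = sn x]. *)
Lemma lower4_interior (A P B Q : M) :
  let x := d A P in let y := d B Q in let k := c (d A B) in
  let I := c x + c (d P B) in let J := c y + c (d A Q) in
  0 < s x -> 0 < s y -> 0 < d A B ->
  σ * ((1 + k) * s (y - x)) <= σ * (s y * I - k * (s x * J)) ->
  σ * ((1 + k) * s (x - y)) <= σ * (s x * J - k * (s y * I)) ->
  σ * (I * J) <= σ * ((1 + k) * (c (d P Q) + c (x - y))).
Proof.
  intros x y k I J Sx Sy Ha H1 H2.
  set (a := d A B) in *; set (h := s x) in *; set (g := s y) in *.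
  pose proof PI_RGT_0 as HPI; pose proof (sg_sq b) as G.
  assert (Ba : b = true -> a <= PI / 2) by (intros E; apply dle; auto).
  assert (SA : 0 < s (a / 2)) by (apply sn_pos; [lra | intros E; specialize (Ba E); lra]).
  assert (CA : 0 < c (a / 2)) by (apply cs_pos; intros E; specialize (Ba E); lra).
  assert (Ek1 : 1 + k = 2 * (c (a / 2) * c (a / 2))) by apply cs_double.
  assert (Ek2 : 1 - k = σ * (2 * (s (a / 2) * s (a / 2)))) by apply cs_double'.
  assert (Esa : s a = 2 * s (a / 2) * c (a / 2)).
  { replace a with (a / 2 + a / 2) at 1 by field; rewrite sn_add; ring. }
  set (E' := s (y - x)).
  assert (Exy : s (x - y) = - E') by (unfold E'; rewrite <- sn_neg; f_equal; ring).
  assert (EE : E' = g * c x - c y * h) by (unfold E'; rewrite sn_sub; auto).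
  rewrite Exy in H2; fold E' in H1.
  set (W := g * I + h * J); set (V := g * I - h * J); set (V' := 2 * E' - V).
  assert (HV1 : σ * (V' * (c (a / 2) * c (a / 2))) <= W * (s (a / 2) * s (a / 2))).
  { assert (X : σ * (V' * (1 + k)) <= σ * (W * (1 - k))) by (unfold V', V, W; lra).
    rewrite Ek1, Ek2 in X.
    replace (σ * (W * (σ * (2 * (s (a / 2) * s (a / 2)))))) with ((σ * σ) * (2 * (W * (s (a / 2) * s (a / 2))))) in X by ring.
    rewrite G in X; lra. }
  assert (HV2 : - (σ * (V' * (c (a / 2) * c (a / 2)))) <= W * (s (a / 2) * s (a / 2))).
  { assert (X : - (σ * (V' * (1 + k))) <= σ * (W * (1 - k))) by (unfold V', V, W; lra).
    rewrite Ek1, Ek2 in X.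
    replace (σ * (W * (σ * (2 * (s (a / 2) * s (a / 2)))))) with ((σ * σ) * (2 * (W * (s (a / 2) * s (a / 2))))) in X by ring.
    rewrite G in X; lra. }
  (* A zero is a critical point of the linear form; [HV1] and [HV2] give the opposite signs at the
     two ends. *)
  destruct (IVT_cor (fun t => W * s (a / 2) * s t - σ * V' * c (a / 2) * c t) (- (a / 2)) (a / 2))
    as [t [Ht Et]].
  { apply continuity_minus; apply continuity_scal; [apply cont_sn | apply cont_cs]. }
  { lra. }
  { rewrite sn_neg, cs_neg.
    assert (0 <= W * s (a / 2) * s (a / 2) - σ * V' * c (a / 2) * c (a / 2)) by lra.
    assert (W * s (a / 2) * - s (a / 2) - σ * V' * c (a / 2) * c (a / 2) <= 0) by lra.
    nra. }
  destruct (Hgeo A B) as [e [He [E0 E1]]]; fold a in He, E1.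
  set (u := a / 2 - t); set (N := e u).
  pose proof (Hstar e a P u He ltac:(unfold u; lra)) as SP.
  pose proof (Hstar e a Q u He ltac:(unfold u; lra)) as SQ.
  rewrite E0, E1 in SP, SQ; fold N in SP, SQ.
  replace (a - u) with (a / 2 + t) in SP, SQ by (unfold u; field); unfold u in SP, SQ.
  rewrite (dsym P A) in SP; fold x in SP.
  rewrite (dsym Q A), (dsym Q B) in SQ; fold y in SQ.
  rewrite (dsym Q N) in SQ.
  pose proof (cs_triangle_weighted P N Q g h ltac:(lra) ltac:(lra)) as HT.
  set (n1 := c (d P N)) in *; set (n2 := c (d N Q)) in *.
  set (C1 := g * c x + h * c (d A Q)); set (C2 := g * c (d P B) + h * c y).
  assert (Ssum : 0 <= s (a / 2 + t) /\ 0 <= s (a / 2 - t)).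
  { split; apply sn_nonneg; try lra; intros E; specialize (Ba E); lra. }
  assert (Ncos : 0 <= c x /\ 0 <= c y /\ 0 <= c (d P B) /\ 0 <= c (d A Q) /\ 0 <= n1 /\ 0 <= n2).
  { repeat split; apply cpos. }
  assert (Sa : 0 < s a) by (rewrite Esa; nra).
  set (Y := (s (a / 2 + t) * C1 + s (a / 2 - t) * C2) / s a).
  assert (HY0 : 0 <= Y).
  { unfold Y, C1, C2; apply Rmult_le_pos; [|apply Rlt_le, Rinv_0_lt_compat; auto].
    apply Rplus_le_le_0_compat; apply Rmult_le_pos; try apply Ssum; apply Rplus_le_le_0_compat;
      apply Rmult_le_pos; lra. }
  assert (HY : σ * Y <= σ * (g * n1 + h * n2)).
  { apply (mul_cancel b (s a)); auto.
    replace (s a * Y) with (s (a / 2 + t) * C1 + s (a / 2 - t) * C2) by (unfold Y; field; lra).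
    apply (Rmult_le_compat_l g) in SP; [|lra]; apply (Rmult_le_compat_l h) in SQ; [|lra].
    unfold C1, C2; lra. }
  apply sg_square_le in HY; auto.
  2:{ apply Rplus_le_le_0_compat; apply Rmult_le_pos; lra. }
  assert (EY : 4 * (Y * Y) * ((s (a / 2) * s (a / 2)) * (c (a / 2) * c (a / 2)))
     = W * W * (s (a / 2) * s (a / 2)) + σ * (V' * V' * (c (a / 2) * c (a / 2)))).
  { pose proof (optimum_square b (W * s (a / 2)) (V' * c (a / 2)) t ltac:(lra)) as O.
    assert (EYY : 2 * Y * (s (a / 2) * c (a / 2)) = c t * (W * s (a / 2)) + s t * (V' * c (a / 2))).
    { unfold Y; rewrite Esa, sn_add, sn_sub.
      replace (2 * (((s (a / 2) * c t + c (a / 2) * s t) * C1 + (s (a / 2) * c t - c (a / 2) * s t) * C2) /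
          (2 * s (a / 2) * c (a / 2))) * (s (a / 2) * c (a / 2)))
        with (c t * (s (a / 2) * (C1 + C2)) + s t * (c (a / 2) * (C1 - C2))) by (field; lra).
      replace (C1 + C2) with W by (unfold W, C1, C2, I, J; ring).
      replace (C1 - C2) with V'; [ring|].
      unfold V', V, C1, C2, I, J; rewrite EE; ring. }
    rewrite <- EYY in O; lra. }
  assert (Hfin : σ * (W * W - V * V) <= σ * (2 * ((1 + k) * (Y * Y - E' * E')))).
  { apply (mul_cancel b (s (a / 2) * s (a / 2))); [nra|].
    replace (s (a / 2) * s (a / 2) * (2 * ((1 + k) * (Y * Y - E' * E'))))
      with (4 * (Y * Y) * ((s (a / 2) * s (a / 2)) * (c (a / 2) * c (a / 2)))
            - 4 * (c (a / 2) * c (a / 2)) * (s (a / 2) * s (a / 2)) * (E' * E')) by (rewrite Ek1; ring).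
    rewrite EY.
    assert (ES : s (a / 2) * s (a / 2) = σ * (1 - c (a / 2) * c (a / 2))) by apply sn_sq.
    set (C := c (a / 2) * c (a / 2)) in *; rewrite ES.
    (* The slack of the inequality [Hfin], once multiplied by the squared sine, is exactly this
       square. *)
    pose proof (Rle_0_sqr (V - 2 * C * E')) as Hsq; unfold Rsqr in Hsq; unfold V'.
    assert (σ * (W * W * (σ * (1 - C)) + σ * ((2 * E' - V) * (2 * E' - V) * C) - 4 * C * (σ * (1 - C)) * (E' * E'))
      - σ * (σ * (1 - C) * (W * W - V * V)) = (σ * σ) * ((V - 2 * C * E') * (V - 2 * C * E'))) by ring.
    rewrite G in H; lra. }
  assert (Egh : g * g + h * h - 2 * g * h * c (x - y) = E' * E').
  { rewrite EE, cs_sub; fold g h.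
    assert (Q1 : g * g = σ * (1 - c y * c y)) by apply sn_sq.
    assert (Q2 : h * h = σ * (1 - c x * c x)) by apply sn_sq.
    assert (Q3 : g * g - h * h * (c y * c y) - g * g * (c x * c x) + h * h - 2 * (σ * ((h * h) * (g * g))) = 0).
    { rewrite Q1, Q2.
      replace (2 * (σ * (σ * (1 - c x * c x) * (σ * (1 - c y * c y)))))
        with ((σ * σ) * (2 * σ * ((1 - c x * c x) * (1 - c y * c y)))) by ring.
      rewrite G; ring. }
    lra. }
  assert (EWV : W * W - V * V = 4 * (g * h) * (I * J)) by (unfold W, V; ring).
  rewrite EWV in Hfin.
  apply (mul_cancel b (4 * (g * h))); [nra|].
  eapply Rle_trans; [exact Hfin|].
  assert (Hk0 : 0 <= 1 + k) by (rewrite Ek1; nra).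
  assert (HX : σ * (Y * Y - g * g - h * h) <= σ * (2 * g * h * c (d P Q))) by lra.
  apply (Rmult_le_compat_l (1 + k)) in HX; auto.
  rewrite <- Egh; lra.
Qed.

(** Two comparisons decide whether the best point of the geodesic [A B] is an end or lies inside.
    The end [B] is reduced to the end [A] by exchanging the two vectors. *)
Lemma lower4_of_concave : lower4 b d.
Proof.
  intros A P B Q; pose proof PI_RGT_0 as HPI.
  assert (Hsn : forall X Y, 0 < d X Y -> 0 < s (d X Y)).
  { intros X Y H; apply sn_pos; auto; intros E; pose proof (dle X Y E); lra. }
  assert (Hend : forall A P B Q, 0 < d A P -> 0 < d B Q ->
    σ * (s (d B Q) * (c (d A P) + c (d P B)))
      <= σ * ((1 + c (d A B)) * s (d B Q - d A P) + c (d A B) * (s (d A P) * (c (d B Q) + c (d A Q)))) ->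
    σ * ((c (d A P) + c (d P B)) * (c (d B Q) + c (d A Q)))
      <= σ * ((1 + c (d A B)) * (c (d P Q) + c (d A P - d B Q)))).
  { intros A' P' B' Q' Hx Hy H.
    apply lower4_endpoint; auto.
    - apply cs_nonneg; intros E; pose proof (dle B' Q' E); pose proof (dle A' Q' E).
      pose proof (dpos B' Q'); pose proof (dpos A' Q'); lra.
    - pose proof (cpos B' Q'); pose proof (cpos A' Q'); lra.
    - apply Rlt_le; auto.
    - apply cpos.
    - set (v := d B' Q' - d A' Q').
      assert (Hv : 0 <= c v).
      { apply cs_nonneg; intros E; unfold v; pose proof (dle B' Q' E); pose proof (dle A' Q' E).
        pose proof (dpos B' Q'); pose proof (dpos A' Q'); lra. }
      pose proof (cpos A' B'); pose proof (sg_cs_le_1 b v); pose proof (sg_cs_le_1 b (d A' B')).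
      destruct (sg_cases b) as [E|E]; rewrite E in *; nra.
    - rewrite (dsym A' P'); apply cs_triangle. }
  destruct (dpos A P) as [Hx|Hx].
  2:{ assert (A = P) by (apply (d_eq M d Hd); auto); subst P.
      rewrite (d_refl M d Hd), cs_0, Rminus_0_l, cs_neg; right; ring. }
  destruct (dpos B Q) as [Hy|Hy].
  2:{ assert (B = Q) by (apply (d_eq M d Hd); auto); subst Q.
      rewrite (d_refl M d Hd), cs_0, Rminus_0_r; right; ring. }
  destruct (dpos A B) as [Ha|Ha].
  2:{ assert (A = B) by (apply (d_eq M d Hd); auto); subst B.
      apply Hend; auto; rewrite (d_refl M d Hd), cs_0, sn_sub, (dsym P A); right; ring. }
  destruct (Rle_lt_dec (σ * (s (d B Q) * (c (d A P) + c (d P B))))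
    (σ * ((1 + c (d A B)) * s (d B Q - d A P) + c (d A B) * (s (d A P) * (c (d B Q) + c (d A Q))))))
    as [H1|H1]; [apply Hend; auto|].
  destruct (Rle_lt_dec (σ * (s (d A P) * (c (d B Q) + c (d A Q))))
    (σ * ((1 + c (d A B)) * s (d A P - d B Q) + c (d A B) * (s (d B Q) * (c (d A P) + c (d P B))))))
    as [H2|H2].
  - pose proof (Hend B Q A P Hy Hx) as H.
    rewrite (dsym Q A), (dsym B P), (dsym B A), (dsym Q P) in H; specialize (H H2).
    replace (d B Q - d A P) with (- (d A P - d B Q)) in H by ring; rewrite cs_neg in H; lra.
  - apply lower4_interior; auto; lra.
Qed.

End Space.

(** * The equivalence *)

Definition is_pos (K : R) : bool := if Rlt_dec 0 K then true else false.

Lemma seg_reverse (M : Type) (e : R -> M) (l : R) (X : M) :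
  seg M (fun u => e (l - u)) l X <-> seg M e l X.
Proof.
  split; intros [u [Hu ->]]; exists (l - u); split; try lra; auto; f_equal; ring.
Qed.

Section Main.
Variables (M : Type) (rho : M -> M -> R) (K : R).
Hypothesis HK : K <> 0.
Hypothesis Hrho : semimetric rho.
Hypothesis Hdiam : 0 < K -> diam_le rho (PI / (2 * sqrt K)).
Notation k := (kap K).
Notation b := (is_pos K).
Notation d := (scaled M rho (kap K)).

Lemma kap_pos : 0 < k.
Proof. apply sqrt_lt_R0, Rabs_pos_lt; auto. Qed.

Lemma kap_eq : 0 < K -> k = sqrt K.
Proof. intros H; unfold kap; rewrite Rabs_right; auto; lra. Qed.

Lemma is_pos_true : b = true -> 0 < K.
Proof. unfold is_pos; destruct (Rlt_dec 0 K); auto; discriminate. Qed.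

Lemma scaled_diam : b = true -> diam_le d (PI / 2).
Proof.
  intros E P Q; pose proof (is_pos_true E) as HK0; pose proof (Hdiam HK0 P Q) as H; pose proof kap_pos as Hk.
  unfold scaled; rewrite <- (kap_eq HK0) in H; apply (Rmult_le_compat_l k) in H; [|lra].
  replace (k * (PI / (2 * k))) with (PI / 2) in H by (field; lra); auto.
Qed.

Notation Hd := (scaled_semimetric M rho k kap_pos Hrho).

Lemma comp_angle_scaled (B A C : M) :
  comp_angle rho K B A C = acos (cpsi b (d A B) (d A C) (d B C)).
Proof.
  unfold comp_angle, model_angle, is_pos, scaled, cpsi, sg, cs, sn.
  destruct (Rlt_dec 0 K); [f_equal; unfold Rdiv; ring|].
  destruct (Rlt_dec K 0); [f_equal; unfold Rdiv; ring | lra].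
Qed.

Lemma scaled_pos (A B : M) : A <> B -> 0 < d A B.
Proof.
  intros H; destruct (d_pos M d Hd A B) as [|E]; auto.
  exfalso; apply H, (d_eq M d Hd); auto.
Qed.

Lemma sn_scaled_pos (A B : M) : A <> B -> 0 < sn b (d A B).
Proof.
  intros H; pose proof PI_RGT_0; apply sn_pos; [apply scaled_pos; auto|].
  intros E; pose proof (scaled_diam E A B); lra.
Qed.

(** One formula for both signs of [K]; with the expansions of [cs (x + y)] and [cs (x - y)] the
    bounds 1 and -1 become [upper4] and [lower4]. *)
Lemma cosq_scaled (A P B Q : M) : A <> P -> B <> Q ->
  cosq rho K A P B Q
  = sg b * ((1 + cs b (d A B)) * (cs b (d P Q) + cs b (d A P) * cs b (d B Q))
            - (cs b (d A P) + cs b (d P B)) * (cs b (d B Q) + cs b (d A Q)))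
    / ((1 + cs b (d A B)) * (sn b (d A P) * sn b (d B Q))).
Proof.
  intros HAP HBQ; pose proof (sn_scaled_pos A P HAP) as S1; pose proof (sn_scaled_pos B Q HBQ) as S2.
  pose proof (c_nonneg b M d Hd scaled_diam A B) as HC.
  unfold cosq, is_pos, scaled, sg, cs, sn in *; destruct (Rlt_dec 0 K); field; lra.
Qed.

Lemma cosq_admissible_of_diam (A P B Q : M) : A <> P -> B <> Q -> cosq_admissible rho K A P B Q.
Proof.
  intros H1 H2; split; auto; split; auto; intros H; pose proof PI_RGT_0.
  assert (Hs : 0 < sqrt K) by (apply sqrt_lt_R0; auto).
  assert (PI / (2 * sqrt K) < PI / sqrt K).
  { apply (Rmult_lt_reg_r (2 * sqrt K)); [lra|].
    replace (PI / (2 * sqrt K) * (2 * sqrt K)) with PI by (field; lra).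
    replace (PI / sqrt K * (2 * sqrt K)) with (2 * PI) by (field; lra); lra. }
  pose proof (Hdiam H A P); pose proof (Hdiam H B Q); pose proof (Hdiam H A B); lra.
Qed.

Lemma upper4_of_cosq : upper_cosq_cond rho K -> upper4 b d.
Proof.
  intros H A P B Q.
  destruct (classic (A = P)) as [->|HAP].
  { rewrite (d_refl M d Hd), cs_0, Rplus_0_l; right; ring. }
  destruct (classic (B = Q)) as [->|HBQ].
  { rewrite (d_refl M d Hd), cs_0, Rplus_0_r; right; ring. }
  specialize (H A P B Q (cosq_admissible_of_diam A P B Q HAP HBQ)); rewrite cosq_scaled in H; auto.
  pose proof (sn_scaled_pos A P HAP) as S1; pose proof (sn_scaled_pos B Q HBQ) as S2.
  pose proof (c_nonneg b M d Hd scaled_diam A B) as HC; pose proof (sg_sq b) as G.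
  set (D := (1 + cs b (d A B)) * (sn b (d A P) * sn b (d B Q))) in *.
  assert (HD : 0 < D) by (unfold D; apply Rmult_lt_0_compat; nra).
  apply (Rmult_le_compat_r D) in H; [|lra].
  match type of H with ?n / D * D <= _ => replace (n / D * D) with n in H by (field; lra) end.
  assert (ED : sg b * (sg b * D) = D) by (rewrite <- Rmult_assoc, G; ring).
  rewrite cs_add; unfold D in *; lra.
Qed.

Lemma lower4_of_cosq : lower_cosq_cond rho K -> lower4 b d.
Proof.
  intros H A P B Q.
  destruct (classic (A = P)) as [->|HAP].
  { rewrite (d_refl M d Hd), cs_0, Rminus_0_l, cs_neg; right; ring. }
  destruct (classic (B = Q)) as [->|HBQ].
  { rewrite (d_refl M d Hd), cs_0, Rminus_0_r; right; ring. }
  specialize (H A P B Q (cosq_admissible_of_diam A P B Q HAP HBQ)); rewrite cosq_scaled in H; auto.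
  pose proof (sn_scaled_pos A P HAP) as S1; pose proof (sn_scaled_pos B Q HBQ) as S2.
  pose proof (c_nonneg b M d Hd scaled_diam A B) as HC; pose proof (sg_sq b) as G.
  set (D := (1 + cs b (d A B)) * (sn b (d A P) * sn b (d B Q))) in *.
  assert (HD : 0 < D) by (unfold D; apply Rmult_lt_0_compat; nra).
  apply (Rmult_le_compat_r D) in H; [|lra].
  match type of H with _ <= ?n / D * D => replace (n / D * D) with n in H by (field; lra) end.
  assert (ED : sg b * (sg b * D) = D) by (rewrite <- Rmult_assoc, G; ring).
  rewrite cs_sub; unfold D in *; lra.
Qed.

Lemma cosq_of_lower4 : lower4 b d -> lower_cosq_cond rho K.
Proof.
  intros H A P B Q [HAP [HBQ _]]; specialize (H A P B Q); rewrite cosq_scaled; auto.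
  pose proof (sn_scaled_pos A P HAP) as S1; pose proof (sn_scaled_pos B Q HBQ) as S2.
  pose proof (c_nonneg b M d Hd scaled_diam A B) as HC; pose proof (sg_sq b) as G.
  set (D := (1 + cs b (d A B)) * (sn b (d A P) * sn b (d B Q))) in *.
  assert (HD : 0 < D) by (unfold D; apply Rmult_lt_0_compat; nra).
  apply (Rmult_le_reg_r D); auto.
  match goal with |- _ <= ?n / D * D => replace (n / D * D) with n by (field; lra) end.
  assert (ED : sg b * (sg b * D) = D) by (rewrite <- Rmult_assoc, G; ring).
  rewrite cs_sub in H; unfold D in *; lra.
Qed.

Lemma conditions_of_RK_domain : RK_domain rho K -> weakly_convex rho /\ one_sided_cosq_cond rho K.
Proof.
  intros [Htri [Hsh [_ Hang]]]; pose proof kap_pos as Hk.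
  pose proof (proj1 (scaled_triangle M rho k Hk) Htri) as Htri'.
  assert (Hgeo : forall A B, exists e, geo d e (d A B) /\ e 0 = A /\ e (d A B) = B).
  { intros A B; destruct (Hsh A B) as [g Hg].
    destruct (scaled_geo_of_shortest M rho k Hk Hrho Htri g A B Hg) as [e [H1 [H2 [H3 _]]]].
    exists e; auto. }
  split.
  - intros A B; exists (1 / 2); split; [lra|]; intros eps Heps.
    destruct (Hsh A B) as [g Hg]; destruct (geo_of_shortest M rho Hrho Htri g A B Hg) as [e [He [E0 [E1 _]]]].
    set (L := rho A B) in *; assert (H0 : 0 <= L) by apply Hrho.
    pose proof (He 0 (1 / 2 * L) ltac:(lra) ltac:(lra)) as D0; rewrite E0, Rabs_left1 in D0 by lra.
    pose proof (He L (1 / 2 * L) ltac:(lra) ltac:(lra)) as D1; rewrite E1, Rabs_right in D1 by lra.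
    exists (e (1 / 2 * L)); rewrite D0, D1.
    split; match goal with |- Rabs ?x < _ => replace x with 0 by field end; rewrite Rabs_R0; auto.
  - right; apply cosq_of_lower4, (lower4_of_concave b M d Hd scaled_diam Htri' Hgeo).
    apply (concave_of_angle_sum b M d Hd scaled_diam Htri' Hgeo).
    intros A B C e1 e2 e3 NAB NBC NCA G1 E10 E11 G2 E20 E21 G3 E30 E31 qA qB qC QA QB QC.
    destruct (shortest_of_scaled_geo M rho k Hk Hrho e1 A B NAB G1 E10 E11) as [g1 [S1 I1]].
    destruct (shortest_of_scaled_geo M rho k Hk Hrho e2 B C NBC G2 E20 E21) as [g2 [S2 I2]].
    destruct (shortest_of_scaled_geo M rho k Hk Hrho e3 C A NCA G3 E30 E31) as [g3 [S3 I3]].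
    pose proof (geo_reverse M d e1 _ G1) as R1; pose proof (geo_reverse M d e2 _ G2) as R2.
    pose proof (geo_reverse M d e3 _ G3) as R3.
    pose proof (scaled_pos A B NAB); pose proof (scaled_pos B C NBC); pose proof (scaled_pos C A NCA).
    rewrite <- !comp_angle_scaled.
    apply (Hang A B C g1 g2 g3); [repeat split; auto; try apply S1; try apply S2; apply S3 | | | ].
    + apply (upper_angle_cosang M rho k Hk Hrho Htri b e1 (fun u => e3 (d C A - u)) (d A B) (d C A)); auto.
      * rewrite Rminus_0_r; auto.
      * intros X; rewrite seg_reverse; auto.
    + apply (upper_angle_cosang M rho k Hk Hrho Htri b (fun u => e1 (d A B - u)) e2 (d A B) (d B C)); auto.
      * rewrite Rminus_0_r; auto.
      * intros X; rewrite seg_reverse; auto.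
    + apply (upper_angle_cosang M rho k Hk Hrho Htri b (fun u => e2 (d B C - u)) e3 (d B C) (d C A)); auto.
      * rewrite Rminus_0_r; auto.
      * intros X; rewrite seg_reverse; auto.
Qed.

Lemma RK_domain_of_conditions : weakly_convex rho -> cauchy_complete rho -> one_sided_cosq_cond rho K -> RK_domain rho K.
Proof.
  intros Hwc Hcc Hcosq; pose proof kap_pos as Hk.
  assert (H4 : upper4 b d \/ lower4 b d).
  { destruct Hcosq; [left; apply upper4_of_cosq | right; apply lower4_of_cosq]; auto. }
  pose proof (triangle_of_4point b M d Hd scaled_diam H4) as Htri'.
  pose proof (proj2 (scaled_triangle M rho k Hk) Htri') as Htri.
  assert (Hgeo : forall A B, exists e, geo d e (d A B) /\ e 0 = A /\ e (d A B) = B).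
  { apply (geo_exists b M d Hd scaled_diam H4).
    - apply scaled_cauchy_complete; auto.
    - apply scaled_weakly_convex; auto. }
  assert (Hstar : concave_distance b d).
  { intros e l P x; apply (cat_inequality b M d Hd scaled_diam H4 Hgeo). }
  pose proof (angle_sum_of_concave b M d Hd scaled_diam Htri' Hstar) as Hsum.
  split; [auto|]; split; [|split].
  - intros A B; destruct (classic (A = B)) as [->|HAB].
    + exists (fun t => (fun _ => B) (rho B B * t)); apply (shortest_of_geo M rho Hrho (fun _ => B)); auto.
      intros u v Hu Hv; rewrite (d_refl M rho Hrho) in *; replace (u - v) with 0 by lra; rewrite Rabs_R0; auto.
    + destruct (Hgeo A B) as [e [He [E0 E1]]].
      destruct (shortest_of_scaled_geo M rho k Hk Hrho e A B HAB He E0 E1) as [g [Hg _]]; exists g; auto.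
  (* The perimeter is at most three times [PI / (2 * sqrt K)], and the required bound is four times
     this number. *)
  - intros HK0 A B C g1 g2 g3 _; pose proof (Hdiam HK0 A B); pose proof (Hdiam HK0 B C); pose proof (Hdiam HK0 C A).
    assert (Hs : 0 < sqrt K) by (apply sqrt_lt_R0; auto); pose proof PI_RGT_0.
    assert (0 < PI / (2 * sqrt K)) by (apply Rdiv_lt_0_compat; lra).
    replace (2 * PI / sqrt K) with (4 * (PI / (2 * sqrt K))) by (field; lra); lra.
  - intros A B C g1 g2 g3 [NAB [NBC [NCA [S1 [S2 S3]]]]] thA thB thC TA TB TC.
    destruct (scaled_geo_of_shortest M rho k Hk Hrho Htri g1 A B S1) as [e1 [G1 [E10 [E11 I1]]]].
    destruct (scaled_geo_of_shortest M rho k Hk Hrho Htri g2 B C S2) as [e2 [G2 [E20 [E21 I2]]]].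
    destruct (scaled_geo_of_shortest M rho k Hk Hrho Htri g3 C A S3) as [e3 [G3 [E30 [E31 I3]]]].
    pose proof (geo_reverse M d e1 _ G1) as R1; pose proof (geo_reverse M d e2 _ G2) as R2.
    pose proof (geo_reverse M d e3 _ G3) as R3.
    pose proof (scaled_pos A B NAB); pose proof (scaled_pos B C NBC); pose proof (scaled_pos C A NCA).
    destruct (cosang_exists b M d Hd Htri' e1 (fun u => e3 (d C A - u)) (d A B) (d C A)) as [qA QA]; auto.
    { rewrite Rminus_0_r; congruence. }
    destruct (cosang_exists b M d Hd Htri' (fun u => e1 (d A B - u)) e2 (d A B) (d B C)) as [qB QB]; auto.
    { rewrite Rminus_0_r; congruence. }
    destruct (cosang_exists b M d Hd Htri' (fun u => e2 (d B C - u)) e3 (d B C) (d C A)) as [qC QC]; auto.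
    { rewrite Rminus_0_r; congruence. }
    assert (UA : upper_angle rho A (image g1) (image g3) (acos qA)).
    { apply (upper_angle_cosang M rho k Hk Hrho Htri b e1 (fun u => e3 (d C A - u)) (d A B) (d C A)); auto.
      - rewrite Rminus_0_r; auto.
      - intros X; rewrite seg_reverse; auto. }
    assert (UB : upper_angle rho B (image g1) (image g2) (acos qB)).
    { apply (upper_angle_cosang M rho k Hk Hrho Htri b (fun u => e1 (d A B - u)) e2 (d A B) (d B C)); auto.
      - rewrite Rminus_0_r; auto.
      - intros X; rewrite seg_reverse; auto. }
    assert (UC : upper_angle rho C (image g2) (image g3) (acos qC)).
    { apply (upper_angle_cosang M rho k Hk Hrho Htri b (fun u => e2 (d B C - u)) e3 (d B C) (d C A)); auto.
      - rewrite Rminus_0_r; auto.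
      - intros X; rewrite seg_reverse; auto. }
    (* The given upper angles are arbitrary numbers satisfying the definition; uniqueness identifies
       them with [acos] of the lower limits. *)
    rewrite (upper_angle_unique M rho A _ _ _ _ TA UA), (upper_angle_unique M rho B _ _ _ _ TB UB),
      (upper_angle_unique M rho C _ _ _ _ TC UC), !comp_angle_scaled.
    apply (Hsum A B C e1 e2 e3); auto.
Qed.

End Main.

Theorem theorem3 (M : Type) (rho : M -> M -> R) (K : R) :
  K <> 0 ->
  semimetric rho ->
  (0 < K -> diam_le rho (PI / (2 * sqrt K))) ->
  (complete_RK_domain rho K <->
     weakly_convex rho /\ cauchy_complete rho /\ one_sided_cosq_cond rho K).
Proof.
  intros HK Hrho Hdiam; split.
  - intros [HRK Hcc]; destruct (conditions_of_RK_domain M rho K HK Hrho Hdiam HRK); auto.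
  - intros [Hwc [Hcc Hcosq]]; split; auto; apply RK_domain_of_conditions; auto.
Qed.
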